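(* Let $S$ be the set of positive integers $s$ such that $s\equiv 1,5\pmod{12}$ and every prime divisor $p$ of $s$ satisfies either $p\equiv 5\pmod 8$, or $p\equiv 1\pmod 8$ and $4\mid \mathrm{ord}_p(2)$. For positive integers $n,m$ as in the cases listed below, the size of an optimal $2$-D $(n\times m,3,2,1)$-OOC is $$\Phi(n\times m,3,2,1)=\begin{cases} \lfloor 7m/32\rfloor, & n=1,\ m\equiv 0\pmod 8 \text{ and } m\neq 64;\\ \lfloor (7m+4)/32\rfloor, & n=1 \text{ and } m\equiv 4\pmod 8;\\ 13, & (n,m)=(1,64);\\ 3m/4, & n=2,\ m\equiv 0\pmod 4 \text{ and } m>4;\\ 2, & (n,m)=(2,4);\\ n(8nm+3m-8)/48, & n\equiv 0\pmod 3,\ n\neq 6,9, \text{ and } m\equiv 8\pmod{16};\\ n(32nm+11m-32)/192, & n\equiv 0\pmod 3,\ n\neq 6,9, \text{ and } m\equiv 32\pmod{64};\\ 6, & (n,m)=(3,4);\\ n(8nm+3m+4)/48, & n\equiv 0\pmod 3,\ n\neq 6,9,\ m>4,\ m\equiv 4,20\pmod{48}, \text{ and } m/4\in S. \end{cases}$$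
   Context: Let $I_n=\{0,1,\ldots,n-1\}$ and let $Z_m$ be the additive group of integers modulo $m$. For $B\subseteq I_n\times Z_m$ and an integer $s$, put $B+s=\{(i,x+s \bmod m):(i,x)\in B\}$. A $2$-D $(n\times m,k,\lambda_a,\lambda_c)$ optical orthogonal code ($2$-D $(n\times m,k,\lambda_a,\lambda_c)$-OOC) is a (possibly empty) set $\mathcal{B}$ of $k$-subsets of $I_n\times Z_m$ (codewords) such that: (1) $|B\cap(B+s)|\le\lambda_a$ for every $B\in\mathcal{B}$ and every integer $s\not\equiv 0\pmod m$; (2) $|A\cap(B+s)|\le\lambda_c$ for all $A,B\in\mathcal{B}$ with $A\ne B$ and every integer $s$. (Equivalently, codewords are $n\times m$ $(0,1)$-matrices of weight $k$, a matrix being identified with the set of positions of its ones.) The size of the code is its number of codewords; $\Phi(n\times m,k,\lambda_a,\lambda_c)$ denotes the largest size among all $2$-D $(n\times m,k,\lambda_a,\lambda_c)$-OOCs, and a code attaining this size is called optimal. For an integer $a$ coprime to $p$, $\mathrm{ord}_p(a)$ is the multiplicative order of $a$ modulo $p$, i.e. the smallest positive integer $l$ with $a^l\equiv 1\pmod p$. *)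

(* Defs.v *)
From mathcomp Require Import all_boot all_order all_algebra.
From mathcomp Require Import cyclic boolp.

Set Implicit Arguments.
Unset Strict Implicit.
Unset Printing Implicit Defensive.

(* Residues are 'I_m rather than 'Z_m, which has the wrong cardinality when    *)
(* m = 1.                                                                      *)
Lemma absz_mod_ord m (x : 'I_m) (s : int) : `|(x%:Z + s)%R %% m|%Z < m.
Proof.
have m_gt0 : 0 < m by case: m x => [[]|].
have m_neq0 : (m%:Z != 0)%R by rewrite eqz_nat -lt0n.
by rewrite -ltz_nat gez0_abs ?modz_ge0 // ltz_pmod.
Qed.

Definition addmod m (x : 'I_m) (s : int) : 'I_m := Ordinal (absz_mod_ord x s).

Definition translate n m (B : {set 'I_n * 'I_m}) (s : int) :
    {set 'I_n * 'I_m} :=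
  [set (p.1, addmod p.2 s) | p in B].

Definition is_ooc n m (k la lc : nat) (C : {set {set 'I_n * 'I_m}}) : Prop :=
  [/\ forall B, B \in C -> #|B| = k,
      forall B (s : int), B \in C -> ~~ (m %| s)%Z ->
        #|B :&: translate B s| <= la
    & forall A B (s : int), A \in C -> B \in C -> A != B ->
        #|A :&: translate B s| <= lc].

Definition Phi n m (k la lc : nat) : nat :=
  \max_(C : {set {set 'I_n * 'I_m}} | `[< is_ooc k la lc C >]) #|C|.

Lemma ord_mod_exists p a :
  exists l, (0 < l) && (coprime a p ==> (a ^ l == 1 %[mod p])).
Proof.
have [cop|_] := boolP (coprime a p); last by exists 1.
case: p cop => [|p] cop.
  by exists 1; move: cop; rewrite /coprime gcdn0 => /eqP ->.
by exists (totient p.+1); rewrite totient_gt0 Euler_exp_totient //= eqxx.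
Qed.

(* When a and p are not coprime, this takes the junk value 1. *)
Definition ord_mod p a : nat := ex_minn (ord_mod_exists p a).

Definition in_S (s : nat) : Prop :=
  [/\ 0 < s,
      s = 1 %[mod 12] \/ s = 5 %[mod 12]
    & forall p, prime p -> p %| s ->
        p = 5 %[mod 8] \/ (p = 1 %[mod 8] /\ 4 %| ord_mod p 2)].

(* Main.v *)
(* A codeword is a triangle up to translation, and conditions (1) and (2) say
   that no translation fixes a codeword and that distinct codewords have
   disjoint sets of directed differences (row, row, shift). A codeword of the
   form {x, x + d, x + 2d} in one row covers only four differences instead of six.

   Upper bounds: give each difference a weight depending on its two rows being
   equal or not and on its shift modulo a small power of 2, so that every
   triangle weighs at least W; then W times the number of codewords is at most
   the total weight. For (1,64), (2,4) and (3,4) a code attaining this bound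
   consists of triangles of weight exactly W, and then a second weight, taken
   modulo 8 or 4, has inconsistent totals.

   Lower bounds: codes are packings of differences. One and two rows are filled
   directly, with Skolem-type sequences. For 3t rows, the rows are indexed by a
   level l modulo 3 and x modulo t. Each pair x < y on a level l is joined to
   the two rows z on the level l + 1 with s_l(z) = x + y and x + y + 1 modulo t,
   where s_l permutes the residues. What remains splits into groups of three
   rows (t odd) or six rows (t even), which have to be filled with a few
   differences left out. There m = 2^a u with u odd, and by the Chinese
   remainder theorem the shifts are pairs (a, c); the blocks with c = 0 and
   those with c a small multiple of +-y, for each nonzero pair +-y modulo u,
   come from tables that depend only on 2^a. When 2^a = 4 one needs moreover a
   list Y such that Y and 2Y together represent every nonzero pair +-y once. It
   exists if all cycles of multiplication by 2 on these pairs have even length,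
   which is what membership in S gives. *)

From Stdlib Require Import ZArith List Lia Bool Znumtheory FinFun Permutation.
From Stdlib Require Import ClassicalEpsilon FunctionalExtensionality PropExtensionality.

Module Packing.
Import ListNotations.
Local Open Scope Z_scope.

(** * Packings of differences *)

Global Arguments Z.mul : simpl never.
Global Arguments Z.add : simpl never.
Global Arguments Z.sub : simpl never.
Global Arguments Z.opp : simpl never.
Global Arguments Z.modulo : simpl never.
Global Arguments Z.div : simpl never.

(** Outside the small cases, the values for two rows and for 3t rows equal the weight bounds
    exactly, so nothing may be wasted: every difference is used, and only blocks of minimal weight
    occur. For 3t rows and m = 4u with u odd, a nonzero multiple of 4 inside a row can then come
    only from a block {0, d, 2d} with d again a multiple of 4. This is what forces the doubling list
    and, with it, S. A pair x < y on a level cannot be joined to a single row z: the labels from x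
    and from y to z would be two permutations of the shifts whose difference is again a permutation,
    and a cyclic group of even order has none, since its elements sum to the element of order 2.
    Hence the two sums x + y and x + y + 1. At a fixed z of sum e, the reflections e - x and e - 1 -
    x string the row indices into a path. A 2-colouring of this path, constant along the first
    reflection and alternating along the second, decides which labels go with which sum. *)

Record point := Pt { prow : Z; pa : Z; pc : Z }.
Definition block : Type := point * point * point.
Definition key : Type := Z * Z * Z * Z.

Definition diff (m u : Z) (p q : point) : key :=
  (prow p, prow q, (pa q - pa p) mod m, (pc q - pc p) mod u).

Definition keys (m u : Z) (b : block) : list key :=
  let '(p, q, r) := b in
  [diff m u p q; diff m u q p; diff m u q r; diff m u r q; diff m u p r; diff m u r p].

Definition distinct (m u : Z) (p q : point) : Prop :=
  prow p <> prow q \/ (pa q - pa p) mod m <> 0 \/ (pc q - pc p) mod u <> 0.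

(** The last clause rules out, in particular, a coset of the subgroup of order 3 in one row: these
    are the only three points that a nonzero translation permutes. Blocks {x, x + d, x + 2d} are
    otherwise allowed, although they repeat keys. *)
Definition valid (m u : Z) (b : block) : Prop :=
  let '(p, q, r) := b in
  distinct m u p q /\ distinct m u q r /\ distinct m u p r /\
  (prow p <> prow q \/ prow p <> prow r \/
   (3 * (pa q - pa p)) mod m <> 0 \/ (3 * (pc q - pc p)) mod u <> 0).

Definition region : Type := key -> Prop.

Definition apart (K1 K2 : region) : Prop := forall k, K1 k -> K2 k -> False.

Definition disjoint_keys (m u : Z) (b b' : block) : Prop :=
  forall k, In k (keys m u b) -> In k (keys m u b') -> False.

(** Regions are arbitrary predicates, so packings of disjoint regions add up without any count of
    keys. Disjointness is asked between different blocks only, since one block may repeat a key. *)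
Definition packs (m u : Z) (K : region) (N : nat) : Prop :=
  exists L : list block,
    length L = N /\
    (forall b, In b L -> valid m u b /\ forall k, In k (keys m u b) -> K k) /\
    ForallOrdPairs (disjoint_keys m u) L.

Lemma packs_sub m u (K K' : region) N :
  packs m u K N -> (forall k, K k -> K' k) -> packs m u K' N.
Proof.
intros (L & HL & HK & HP) Hs; exists L; split; [exact HL|split; [|exact HP]].
intros b Hb; destruct (HK b Hb) as [Hv Hk]; split; auto.
Qed.

Lemma packs0 m u K : packs m u K 0.
Proof. exists []; repeat split; try constructor; intros; simpl in *; tauto. Qed.

Lemma ForallOrdPairs_app A (R : A -> A -> Prop) (l1 l2 : list A) :
  ForallOrdPairs R l1 -> ForallOrdPairs R l2 ->
  (forall a b, In a l1 -> In b l2 -> R a b) -> ForallOrdPairs R (l1 ++ l2).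
Proof.
induction 1 as [|a l1 Ha H1 IH]; simpl; intros H2 H; [exact H2|].
constructor.
- rewrite Forall_forall in *; intros b Hb; apply in_app_or in Hb as [Hb|Hb]; auto.
- apply IH; auto.
Qed.

Lemma packs_union m u (K1 K2 K : region) N1 N2 N :
  packs m u K1 N1 -> packs m u K2 N2 -> apart K1 K2 ->
  (forall k, K1 k \/ K2 k -> K k) -> N = (N1 + N2)%nat -> packs m u K N.
Proof.
intros (L1 & HL1 & HK1 & HP1) (L2 & HL2 & HK2 & HP2) Ha Hs ->.
exists (L1 ++ L2); split; [rewrite length_app; congruence|split].
- intros b Hb; apply in_app_or in Hb as [Hb|Hb].
  + destruct (HK1 b Hb); split; auto.
  + destruct (HK2 b Hb); split; auto.
- apply ForallOrdPairs_app; auto.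
  intros a b Ha1 Hb2 k Hka Hkb.
  destruct (HK1 a Ha1) as [_ H1], (HK2 b Hb2) as [_ H2]; eapply Ha; eauto.
Qed.

Lemma packs_range m u (K : Z -> region) c lo (n : nat) :
  (forall i, lo <= i < lo + Z.of_nat n -> packs m u (K i) c) ->
  (forall i j, lo <= i < lo + Z.of_nat n -> lo <= j < lo + Z.of_nat n ->
     i < j -> apart (K i) (K j)) ->
  packs m u (fun k => exists i, lo <= i < lo + Z.of_nat n /\ K i k) (n * c).
Proof.
induction n as [|n IH]; intros H1 H2; [apply packs0|].
apply packs_union with (N1 := (n * c)%nat) (N2 := c)
  (K1 := fun k => exists i, lo <= i < lo + Z.of_nat n /\ K i k)
  (K2 := K (lo + Z.of_nat n)).
- apply IH; intros; [apply H1|apply H2]; lia.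
- apply H1; lia.
- intros k (i & Hi & Hk) Hk2; apply (H2 i (lo + Z.of_nat n)) with k; auto; lia.
- intros k [(i & Hi & Hk)|Hk]; [exists i|exists (lo + Z.of_nat n)]; split; auto; lia.
- lia.
Qed.

Lemma packs_one m u b : valid m u b -> packs m u (fun k => In k (keys m u b)) 1.
Proof.
intros Hv; exists [b]; split; [reflexivity|split].
- intros b' [<-|[]]; auto.
- repeat constructor.
Qed.

Lemma packs_blocks m u (f : Z -> block) (K : region) lo (n : nat) :
  (forall i, lo <= i < lo + Z.of_nat n ->
     valid m u (f i) /\ forall k, In k (keys m u (f i)) -> K k) ->
  (forall i j, lo <= i < lo + Z.of_nat n -> lo <= j < lo + Z.of_nat n ->
     i < j -> disjoint_keys m u (f i) (f j)) ->
  packs m u K n.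
Proof.
intros H1 H2.
replace n with (n * 1)%nat by lia.
eapply packs_sub.
- apply (packs_range m u (fun i k => In k (keys m u (f i))) 1 lo n).
  + intros i Hi; apply packs_one, H1, Hi.
  + intros i j Hi Hj Hij k; apply H2; auto.
- intros k (i & Hi & Hk); exact (proj2 (H1 i Hi) k Hk).
Qed.

(** Congruences are handled throughout as divisibilities of linear expressions: a bound on the
    expression leaves finitely many multiples, and linear arithmetic decides each of them. *)
Lemma divide_small m x : (m | x) -> - m < x < m -> x = 0.
Proof. intros [z ->] H; destruct (Z.eq_dec z 0); [lia|nia]. Qed.

Lemma divide_small2 m x : (m | x) -> - (2 * m) < x < 2 * m -> x = 0 \/ x = m \/ x = - m.
Proof.
intros [z ->] H; assert (-2 < z < 2) by nia.
assert (z = -1 \/ z = 0 \/ z = 1) by lia; nia.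
Qed.

Lemma mod_eq_divide m a b : 0 < m -> a mod m = b mod m -> (m | a - b).
Proof.
intros Hm H; exists (a / m - b / m).
pose proof (Z.div_mod a m); pose proof (Z.div_mod b m); nia.
Qed.

Lemma divide_mod_eq m a b : 0 < m -> (m | a - b) -> a mod m = b mod m.
Proof.
intros Hm [z Hz]; replace a with (b + z * m) by lia; apply Z.mod_add; lia.
Qed.

Lemma mod_ne0 m a : 0 < m -> ~ (m | a) -> a mod m <> 0.
Proof. intros Hm H E; apply H, Z.mod_divide; lia. Qed.

(** * Constructions of packings *)

Lemma divide_twice u x : u mod 2 = 1 -> (u | 2 * x) -> (u | x).
Proof.
intros Hu Hd; replace x with (u * x - (u / 2) * (2 * x)).
- apply Z.divide_sub_r; [apply Z.divide_factor_l|apply Z.divide_mul_r, Hd].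
- pose proof (Z.div_mod u 2); nia.
Qed.

Lemma divide_thrice u x : u mod 3 <> 0 -> (u | 3 * x) -> (u | x).
Proof.
intros Hu Hd; pose proof (Z.div_mod u 3); pose proof (Z.mod_pos_bound u 3).
assert (E : u mod 3 = 1 \/ u mod 3 = 2) by lia; destruct E as [E|E].
- replace x with (u * x - (u / 3) * (3 * x)) by nia.
  apply Z.divide_sub_r; [apply Z.divide_factor_l|apply Z.divide_mul_r, Hd].
- replace x with (2 * u * x - (2 * (u / 3) + 1) * (3 * x)) by nia.
  apply Z.divide_sub_r; [|apply Z.divide_mul_r, Hd].
  replace (2 * u * x) with (u * (2 * x)) by ring; apply Z.divide_factor_l.
Qed.

Lemma packs_list A m u (K : A -> region) c (I : list A) :
  NoDup I -> (forall i, In i I -> packs m u (K i) c) ->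
  (forall i j, In i I -> In j I -> i <> j -> apart (K i) (K j)) ->
  packs m u (fun k => exists i, In i I /\ K i k) (length I * c).
Proof.
intros HI; induction HI as [|i I Hi HI IH]; intros H1 H2; [apply packs0|].
apply packs_union with (N1 := c) (N2 := (length I * c)%nat) (K1 := K i)
  (K2 := fun k => exists j, In j I /\ K j k).
- apply H1; left; reflexivity.
- apply IH; intros; [apply H1|apply H2]; simpl; auto.
- intros k Hk (j & Hj & Hk'); apply (H2 i j) with k; simpl; auto; congruence.
- intros k [Hk|(j & Hj & Hk)]; [exists i|exists j]; simpl; auto.
- reflexivity.
Qed.

(** * Chinese remaindering and renaming of rows *)

Section Crt.
Variables (m u : Z) (Hm : 0 < m) (Hu : 0 < u) (Hg : Z.gcd m u = 1).

Lemma crt_coefs : exists P Q, (u | P) /\ (m | P - 1) /\ (m | Q) /\ (u | Q - 1).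
Proof.
destruct (Z.gcd_bezout m u 1 Hg) as (a & b & E).
exists (b * u), (a * m); repeat split.
- apply Z.divide_factor_r.
- exists (- a); lia.
- apply Z.divide_factor_r.
- exists (- b); lia.
Qed.

Definition crt_region (K : region) : region := fun k =>
  let '(p, q, a, c) := k in K (p, q, a mod m, a mod u) /\ 0 <= a < m * u /\ c = 0.

(** The idempotents [P] and [Q] of the Chinese remainder theorem carry (a, c) to a P + c Q. The map
    [back] recovers the old key, so blocks sharing a new key would already share an old one. *)
Lemma packs_crt K N : packs m u K N -> packs (m * u) 1 (crt_region K) N.
Proof.
destruct crt_coefs as (P & Q & HP1 & HP2 & HQ1 & HQ2).
set (g := fun p => Pt (prow p) (pa p * P + pc p * Q) 0).
set (G := fun b : block => let '(p, q, r) := b in ((g p, g q, g r) : block)).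
assert (Ea : forall a c, (a * P + c * Q) mod (m * u) mod m = a mod m).
{ intros a c; rewrite <- Zmod_div_mod; try nia; [|exists u; ring].
  apply divide_mod_eq; auto.
  replace (a * P + c * Q - a) with (a * (P - 1) + c * Q) by ring.
  apply Z.divide_add_r; apply Z.divide_mul_r; auto. }
assert (Ec : forall a c, (a * P + c * Q) mod (m * u) mod u = c mod u).
{ intros a c; rewrite <- Zmod_div_mod; try nia; [|exists m; ring].
  apply divide_mod_eq; auto.
  replace (a * P + c * Q - c) with (a * P + c * (Q - 1)) by ring.
  apply Z.divide_add_r; apply Z.divide_mul_r; auto. }
set (back := fun k : key => let '(p, q, a, c) := k in (p, q, a mod m, a mod u)).
assert (Ed : forall p q, back (diff (m * u) 1 (g p) (g q)) = diff m u p q).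
{ intros p q; unfold back, diff, g; simpl.
  replace (pa q * P + pc q * Q - (pa p * P + pc p * Q))
    with ((pa q - pa p) * P + (pc q - pc p) * Q) by ring.
  rewrite Ea, Ec; reflexivity. }
assert (Ek : forall b k, In k (keys (m * u) 1 (G b)) -> In (back k) (keys m u b)).
{ intros [[p q] r] k; simpl; rewrite <- !Ed.
  intros H; repeat destruct H as [H|H]; try tauto; subst k; tauto. }
assert (E0 : forall x y, (u | x) -> (m | y) -> (x * P + y * Q) mod (m * u) = 0 ->
   x mod m = 0 /\ y mod u = 0).
{ intros x y Hx Hy H; rewrite <- (Ea x y), <- (Ec x y), H; split; apply Z.mod_0_l; lia. }
assert (Edist : forall p q, distinct m u p q -> distinct (m * u) 1 (g p) (g q)).
{ intros p q [H|H]; [left; exact H|right; left].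
  unfold g; simpl; intros H0.
  replace (pa q * P + pc q * Q - (pa p * P + pc p * Q))
    with ((pa q - pa p) * P + (pc q - pc p) * Q) in H0 by ring.
  rewrite <- (Ea _ (pc q - pc p)), <- (Ec (pa q - pa p)), H0 in H.
  rewrite !Z.mod_0_l in H by lia; lia. }
intros (L & HL & HK & HD); exists (map G L); split; [rewrite length_map; exact HL|split].
- intros b' Hb'; apply in_map_iff in Hb' as (b & <- & Hb); destruct (HK b Hb) as [Hv Hk].
  split.
  + destruct b as [[p q] r]; simpl in Hv |- *.
    destruct Hv as (V1 & V2 & V3 & V4); repeat split; auto.
    destruct V4 as [V4|[V4|V4]]; [left; exact V4|right; left; exact V4|].
    right; right; left; intros H0.
    replace (3 * (pa q * P + pc q * Q - (pa p * P + pc p * Q)))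
      with (3 * (pa q - pa p) * P + 3 * (pc q - pc p) * Q) in H0 by ring.
    rewrite <- (Ea _ (3 * (pc q - pc p))), <- (Ec (3 * (pa q - pa p))), H0 in V4.
    rewrite !Z.mod_0_l in V4 by lia; lia.
  + intros k Hk'; pose proof (Hk _ (Ek _ _ Hk')) as H1.
    destruct k as [[[p q] a] c]; split; [exact H1|].
    destruct b as [[p0 q0] r0]; simpl in Hk'.
    repeat destruct Hk' as [Hk'|Hk']; try tauto; injection Hk' as <- <- <- <-;
    (split; [apply Z.mod_pos_bound; nia|apply Z.mod_1_r]).
- clear HK HL; induction HD as [|b L Hb HD IH]; simpl; constructor; auto.
  rewrite Forall_forall in *; intros b' Hb'; apply in_map_iff in Hb' as (b0 & <- & Hb0).
  intros k H1 H2; apply (Hb b0 Hb0 (back k)); apply Ek; auto.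
Qed.
End Crt.

Definition row_region (f : Z -> Z) (K : region) : region := fun k =>
  let '(p, q, a, c) := k in exists p' q', p = f p' /\ q = f q' /\ K (p', q', a, c).

Definition rows_in (K : region) (n : Z) : Prop :=
  forall p q a c, K (p, q, a, c) -> 0 <= p < n /\ 0 <= q < n.

Lemma packs_rows m u (K : region) N n f :
  rows_in K n -> (forall p q, 0 <= p < n -> 0 <= q < n -> f p = f q -> p = q) ->
  packs m u K N -> packs m u (row_region f K) N.
Proof.
intros Hn Hf (L & HL & HK & HD).
set (g := fun p => Pt (f (prow p)) (pa p) (pc p)).
set (G := fun b : block => let '(p, q, r) := b in ((g p, g q, g r) : block)).
set (fk := fun k : key => let '(p, q, a, c) := k in ((f p, f q, a, c) : key)).
assert (Ek : forall b, keys m u (G b) = map fk (keys m u b)) by (intros [[p q] r]; reflexivity).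
assert (Hr : forall b, In b L -> let '(p, q, r) := b in
   0 <= prow p < n /\ 0 <= prow q < n /\ 0 <= prow r < n).
{ intros [[p q] r] Hb; destruct (HK _ Hb) as [_ H].
  assert (H1 := H (diff m u p q)); assert (H2 := H (diff m u q r)); simpl in H1, H2.
  apply Hn in H1; [|tauto]; apply Hn in H2; [|tauto]; tauto. }
exists (map G L); split; [rewrite length_map; exact HL|split].
- intros b' Hb'; apply in_map_iff in Hb' as (b & <- & Hb); destruct (HK b Hb) as [Hv Hk]; split.
  + specialize (Hr b Hb).
    destruct b as [[p q] r]; simpl in Hv |- *; unfold distinct in *; simpl.
    destruct Hr as (R1 & R2 & R3).
    destruct Hv as (V1 & V2 & V3 & V4).
    repeat split.
    * destruct V1 as [V|V]; [left; contradict V; auto|tauto].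
    * destruct V2 as [V|V]; [left; contradict V; auto|tauto].
    * destruct V3 as [V|V]; [left; contradict V; auto|tauto].
    * destruct V4 as [V|[V|V]]; [left; contradict V; auto|right; left; contradict V; auto|tauto].
  + intros k Hk'; rewrite Ek in Hk'; apply in_map_iff in Hk' as ([[[p q] a] c] & <- & Hk').
    exists p, q; repeat split; auto.
- assert (Hin : forall b k, In b L -> In k (keys m u b) -> K k) by (intros b k Hb; apply HK; auto).
  clear HL HK Hr; induction HD as [|b L Hb HD IH]; simpl; constructor.
  + rewrite Forall_forall in *; intros b' Hb'; apply in_map_iff in Hb' as (b0 & <- & Hb0).
    intros k H1 H2; rewrite Ek in H1, H2.
    apply in_map_iff in H1 as ([[[p q] a] c] & <- & H1).
    apply in_map_iff in H2 as ([[[p' q'] a'] c'] & E & H2).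
    simpl in E; injection E as E1 E2 -> ->.
    pose proof (Hn _ _ _ _ (Hin b _ (or_introl eq_refl) H1)).
    pose proof (Hn _ _ _ _ (Hin b0 _ (or_intror Hb0) H2)).
    apply Hf in E1; try tauto; apply Hf in E2; try tauto; subst; exact (Hb b0 Hb0 _ H1 H2).
  + apply IH; intros b0 k Hb0; apply Hin; right; exact Hb0.
Qed.

(* A table lists blocks whose second coordinates are multiples of an
   indeterminate [y]; [coefs m b] lists the keys with those coefficients left
   unreduced. *)
Definition coefs (m : Z) (b : block) : list key :=
  let d p q := (prow p, prow q, (pa q - pa p) mod m, pc q - pc p) in
  let '(p, q, r) := b in [d p q; d q p; d q r; d r q; d p r; d r p].

Definition scale_pt (y : Z) (p : point) : point := Pt (prow p) (pa p) (y * pc p).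
Definition scale (y : Z) (b : block) : block :=
  let '(p, q, r) := b in (scale_pt y p, scale_pt y q, scale_pt y r).

Lemma keys_scale m u y b :
  keys m u (scale y b) =
  map (fun k => let '(p, q, a, c) := k in (p, q, a, (y * c) mod u)) (coefs m b).
Proof.
destruct b as [[p q] r]; unfold scale, keys, coefs, diff; simpl.
rewrite <- !Z.mul_sub_distr_l; reflexivity.
Qed.

Definition same_place (k k' : key) : bool :=
  let '(p, q, a, _) := k in let '(p', q', a', _) := k' in
  (p =? p') && (q =? q') && (a =? a').

Definition coef (k : key) : Z := let '(_, _, _, c) := k in c.

Definition mixed_rows (b : block) : bool :=
  let '(p, q, r) := b in negb (prow p =? prow q) || negb (prow p =? prow r).

(* [y c = y' c'] modulo [u] is excluded when [c - c'] is a unit (for the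
   window and the zero tables, [y = y']). *)
Definition table_ok (m : Z) (unit : Z -> bool) (T : list block) : bool :=
  forallb (fun b => mixed_rows b &&
     let '(p, q, r) := b in
     let d p q := negb (prow p =? prow q) || negb ((pa q - pa p) mod m =? 0)
                  || unit (pc q - pc p) in
     d p q && d q r && d p r) T &&
  (fix go (T : list block) : bool := match T with
   | [] => true
   | b :: T' => forallb (fun b' =>
        forallb (fun k => forallb (fun k' =>
           negb (same_place k k') || unit (coef k - coef k')) (coefs m b'))
          (coefs m b)) T' && go T'
   end) T.

Definition table_region (u y : Z) (Q : key -> bool) : region := fun k =>
  let '(p, q, a, c') := k in exists c, Q (p, q, a, c) = true /\ c' = (y * c) mod u.

(** The check compares coefficients formally and never mentions u or y. One evaluation therefore
    serves all u and y for which no coefficient accepted by [unit] kills y modulo u. *)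
Lemma table_packs m u unit y T Q :
  0 < m -> 0 < u -> table_ok m unit T = true ->
  (forall c, unit c = true -> (y * c) mod u <> 0) ->
  forallb (fun b => forallb Q (coefs m b)) T = true ->
  packs m u (table_region u y Q) (length T).
Proof.
intros Hm Hu Hok Hun HQ.
apply andb_true_iff in Hok as [Hv Hd].
exists (map (scale y) T); split; [apply length_map|split].
- intros b' Hb'; apply in_map_iff in Hb' as (b & <- & Hb).
  rewrite forallb_forall in Hv, HQ; specialize (Hv b Hb); specialize (HQ b Hb); split.
  + destruct b as [[p q] r]; unfold scale, valid, scale_pt, distinct; simpl.
    rewrite !andb_true_iff, !orb_true_iff, !negb_true_iff in Hv.
    unfold mixed_rows in Hv; rewrite !orb_true_iff, !negb_true_iff, !Z.eqb_neq in Hv.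
    destruct Hv as (V4 & (V1 & V2) & V3).
    rewrite <- !Z.mul_sub_distr_l.
    repeat split.
    * destruct V1 as [V|V]; [tauto|right; right; apply Hun; exact V].
    * destruct V2 as [V|V]; [tauto|right; right; apply Hun; exact V].
    * destruct V3 as [V|V]; [tauto|right; right; apply Hun; exact V].
    * tauto.
  + intros k Hk; rewrite keys_scale in Hk; apply in_map_iff in Hk as ([[[p q] a] c] & <- & Hk).
    rewrite forallb_forall in HQ; exists c; split; auto.
- clear Hv HQ; induction T as [|b T IH]; simpl; constructor.
  + apply andb_true_iff in Hd as [Hd _].
    rewrite Forall_forall; intros b' Hb'; apply in_map_iff in Hb' as (b0 & <- & Hb0).
    rewrite forallb_forall in Hd; specialize (Hd b0 Hb0).
    intros k H1 H2; rewrite keys_scale in H1, H2.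
    apply in_map_iff in H1 as ([[[p q] a] c] & <- & H1).
    apply in_map_iff in H2 as ([[[p' q'] a'] c'] & E & H2).
    injection E as -> -> -> E.
    rewrite forallb_forall in Hd; specialize (Hd _ H1).
    rewrite forallb_forall in Hd; specialize (Hd _ H2).
    unfold same_place in Hd; rewrite !Z.eqb_refl in Hd; simpl in Hd.
    apply Hun in Hd; apply Hd.
    apply Z.mod_divide; [lia|].
    replace (y * (c - c')) with (y * c - y * c') by ring; apply mod_eq_divide; auto.
  + apply andb_true_iff in Hd as [_ Hd]; auto.
Qed.

(** * One row *)

Lemma divide_small3 m x : (m | x) -> - (3 * m) < x < 3 * m ->
  x = 0 \/ x = m \/ x = - m \/ x = 2 * m \/ x = - (2 * m).
Proof. intros [z ->] H; assert (-3 < z < 3) by nia.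
assert (z = -2 \/ z = -1 \/ z = 0 \/ z = 1 \/ z = 2) by lia; nia. Qed.

Lemma divide_small5 m x : (m | x) -> - (5 * m) < x < 5 * m ->
  x = 0 \/ x = m \/ x = - m \/ x = 2 * m \/ x = - (2 * m) \/ x = 3 * m \/ x = - (3 * m)
  \/ x = 4 * m \/ x = - (4 * m).
Proof. intros [z ->] H; assert (-5 < z < 5) by nia.
assert (z = -2 \/ z = -1 \/ z = 0 \/ z = 1 \/ z = 2 \/ z = 3 \/ z = -3 \/ z = 4 \/ z = -4) by lia; nia. Qed.

Ltac small_divide H :=
  first [ apply divide_small in H; [lia|lia]
        | apply divide_small2 in H; [lia|lia]
        | apply divide_small3 in H; [lia|lia]
        | apply divide_small5 in H; [lia|lia] ].

Definition zrange (lo hi : Z) : list Z :=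
  map (fun i => lo + Z.of_nat i) (seq 0 (Z.to_nat (hi - lo))).

Lemma in_zrange lo hi x : In x (zrange lo hi) <-> lo <= x < hi.
Proof.
unfold zrange; rewrite in_map_iff; split.
- intros (i & <- & Hi); apply in_seq in Hi; lia.
- intros H; exists (Z.to_nat (x - lo)); split; [lia|apply in_seq; lia].
Qed.

Lemma length_zrange lo hi : length (zrange lo hi) = Z.to_nat (hi - lo).
Proof. unfold zrange; rewrite length_map, length_seq; reflexivity. Qed.

Lemma pairwise_map_seq A (R : A -> A -> Prop) f a n :
  (forall i j, (a <= i < j)%nat -> (j < a + n)%nat -> R (f i) (f j)) ->
  ForallOrdPairs R (map f (seq a n)).
Proof.
revert a; induction n as [|n IH]; intros a H; simpl; constructor.
- rewrite Forall_forall; intros x Hx; apply in_map_iff in Hx as (j & <- & Hj).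
  apply in_seq in Hj; apply H; lia.
- apply IH; intros; apply H; lia.
Qed.

Lemma pairwise_zrange A (R : A -> A -> Prop) f lo hi :
  (forall i j, lo <= i < j -> j < hi -> R (f i) (f j)) ->
  ForallOrdPairs R (map f (zrange lo hi)).
Proof. intros H; unfold zrange; rewrite map_map; apply pairwise_map_seq; intros; apply H; lia. Qed.

Lemma pairwise_impl A (R S : A -> A -> Prop) l :
  (forall a b, In a l -> In b l -> R a b -> S a b) -> ForallOrdPairs R l -> ForallOrdPairs S l.
Proof.
intros H HR; induction HR as [|a l Ha HR IH]; constructor.
- rewrite Forall_forall in *; intros; apply H; simpl; auto.
- apply IH; intros; apply H; simpl; auto.
Qed.

Lemma pairwise_map_inv A B (R : B -> B -> Prop) (f : A -> B) l :
  ForallOrdPairs R (map f l) -> ForallOrdPairs (fun a b => R (f a) (f b)) l.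
Proof.
induction l as [|a l IH]; simpl; intros H; inversion H; subst; constructor; auto.
rewrite Forall_map in *; assumption.
Qed.

Lemma pairwise_app_inv A (R : A -> A -> Prop) l1 l2 : ForallOrdPairs R (l1 ++ l2) ->
  ForallOrdPairs R l1 /\ ForallOrdPairs R l2 /\ (forall a b, In a l1 -> In b l2 -> R a b).
Proof.
induction l1 as [|a l1 IH]; simpl; intros H.
- repeat split; [constructor|exact H|intros; tauto].
- inversion H as [|? ? Ha H']; subst; destruct (IH H') as (H1 & H2 & H3).
  rewrite Forall_forall in Ha; repeat split.
  + constructor; [rewrite Forall_forall; intros; apply Ha, in_or_app; auto|exact H1].
  + exact H2.
  + intros x y [->|Hx] Hy; [apply Ha, in_or_app; auto|auto].
Qed.

Lemma pairwise_and A (R S : A -> A -> Prop) l :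
  ForallOrdPairs R l -> ForallOrdPairs S l -> ForallOrdPairs (fun a b => R a b /\ S a b) l.
Proof.
intros HR HS; induction HR as [|a l Ha HR IH]; inversion HS; subst; constructor; auto.
rewrite Forall_forall in *; auto.
Qed.

Lemma packs_family A m u (I : list A) (f : A -> block) (K : region) (R : A -> A -> Prop) :
  ForallOrdPairs R I ->
  (forall i, In i I -> valid m u (f i) /\ forall k, In k (keys m u (f i)) -> K k) ->
  (forall i j, In i I -> In j I -> R i j -> disjoint_keys m u (f i) (f j)) ->
  packs m u K (length I).
Proof.
intros HR HK HD; exists (map f I); split; [apply length_map|split].
- intros b Hb; apply in_map_iff in Hb as (i & <- & Hi); auto.
- induction HR as [|a l Ha HR IH]; simpl; constructor.
  + rewrite Forall_forall in *; intros b Hb; apply in_map_iff in Hb as (i & <- & Hi).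
    apply HD; simpl; auto.
  + apply IH; intros; [apply HK|apply HD]; simpl; auto.
Qed.

(** Shifts inside a row matter up to sign only, because a block covers d together with - d. *)
Definition sep (N x y : Z) : Prop := ~ (N | x - y) /\ ~ (N | x + y).

Lemma sep_sym N x y : sep N x y -> sep N y x.
Proof.
intros [H1 H2]; split; intros H; [apply H1|apply H2; rewrite Z.add_comm; exact H].
replace (x - y) with (- (y - x)) by lia; apply Z.divide_opp_r, H.
Qed.

Definition zero2 (m u : Z) (d : Z * Z) : Prop := (m | fst d) /\ (u | snd d).

Definition sep2 (m u : Z) (d d' : Z * Z) : Prop :=
  ~ zero2 m u (fst d - fst d', snd d - snd d') /\ ~ zero2 m u (fst d + fst d', snd d + snd d').

Definition block1 (r : Z) (d d' : Z * Z) : block :=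
  (Pt r 0 0, Pt r (fst d) (snd d), Pt r (fst d') (snd d')).

Definition orbits1 (d d' : Z * Z) : list (Z * Z) := [d; d'; (fst d' - fst d, snd d' - snd d)].

Definition pure_region (m u r : Z) (D : Z * Z -> Prop) : region := fun k =>
  exists d, (D d \/ D (- fst d, - snd d)) /\ k = (r, r, fst d mod m, snd d mod u).

Lemma divide_neg N x y : (N | x) -> y = - x -> (N | y).
Proof. intros H ->; apply Z.divide_opp_r; exact H. Qed.

Section OneRow.
Variables (m u r : Z) (Hm : 0 < m) (Hu : 0 < u).

Lemma distinct_nonzero a c a' c' :
  ~ zero2 m u (a' - a, c' - c) -> distinct m u (Pt r a c) (Pt r a' c').
Proof.
intros H; right; destruct (Z.eq_dec ((a' - a) mod m) 0) as [E|E]; [|left; exact E].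
right; intros E'; apply H; split; apply Z.mod_divide; auto; lia.
Qed.

Lemma valid_block1 d d' :
  ~ zero2 m u d -> ~ zero2 m u d' -> ~ zero2 m u (fst d' - fst d, snd d' - snd d) ->
  ~ zero2 m u (3 * fst d, 3 * snd d) -> valid m u (block1 r d d').
Proof.
destruct d as [a c], d' as [a' c']; simpl; intros H1 H2 H3 H4.
split; [|split; [|split]].
- apply distinct_nonzero; rewrite !Z.sub_0_r; exact H1.
- apply distinct_nonzero; exact H3.
- apply distinct_nonzero; rewrite !Z.sub_0_r; exact H2.
- right; right; destruct (Z.eq_dec ((3 * (a - 0)) mod m) 0) as [E|E]; [|left; exact E].
  right; intros E'; apply H4; simpl in E'; rewrite !Z.sub_0_r in *.
  split; apply Z.mod_divide; auto; lia.
Qed.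

Lemma keys_block1 d d' k : In k (keys m u (block1 r d d')) ->
  pure_region m u r (fun e => In e (orbits1 d d')) k.
Proof.
destruct d as [a c], d' as [a' c']; unfold block1, keys, diff; simpl.
intros H; repeat (destruct H as [H|H]); try contradiction; subst k.
- exists (a, c); simpl; rewrite !Z.sub_0_r; tauto.
- exists (- a, - c); simpl; rewrite !Z.opp_involutive; tauto.
- exists (a' - a, c' - c); simpl; tauto.
- exists (a - a', c - c'); simpl; split; [|reflexivity].
  right; right; right; left; f_equal; lia.
- exists (a', c'); simpl; rewrite !Z.sub_0_r; tauto.
- exists (- a', - c'); simpl; rewrite !Z.opp_involutive; tauto.
Qed.

Lemma pure_apart D D' : (forall d d', D d -> D' d' -> sep2 m u d d') ->
  apart (pure_region m u r D) (pure_region m u r D').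
Proof.
intros H k ([a c] & Hd & ->) ([a' c'] & Hd' & E); simpl in *.
injection E as Ea Ec; apply mod_eq_divide in Ea; auto; apply mod_eq_divide in Ec; auto.
destruct Hd as [Hd|Hd], Hd' as [Hd'|Hd']; destruct (H _ _ Hd Hd') as [S1 S2]; simpl in *.
- apply S1; split; assumption.
- apply S2; split; simpl; rewrite Z.add_opp_r; assumption.
- apply S2; split; simpl; [apply (divide_neg _ _ _ Ea)|apply (divide_neg _ _ _ Ec)]; lia.
- apply S1; split; simpl; [apply (divide_neg _ _ _ Ea)|apply (divide_neg _ _ _ Ec)]; lia.
Qed.

Lemma packs_one_row A (I : list A) (f g : A -> Z * Z) (R : A -> A -> Prop) (D : Z * Z -> Prop) :
  ForallOrdPairs R I ->
  (forall i, In i I -> valid m u (block1 r (f i) (g i)) /\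
     forall d, In d (orbits1 (f i) (g i)) -> D d) ->
  (forall i j d d', In i I -> In j I -> R i j -> In d (orbits1 (f i) (g i)) ->
     In d' (orbits1 (f j) (g j)) -> sep2 m u d d') ->
  packs m u (pure_region m u r D) (length I).
Proof.
intros HR HV HD; apply packs_family with (f := fun i => block1 r (f i) (g i)) (R := R); auto.
- intros i Hi; destruct (HV i Hi) as [V Hk]; split; [exact V|].
  intros k Hk'; apply keys_block1 in Hk' as (d & Hd & ->); exists d; split; [|reflexivity].
  destruct Hd as [Hd|Hd]; [left|right]; auto.
- intros i j Hi Hj Hij k Hk Hk'; apply keys_block1 in Hk, Hk'.
  revert k Hk Hk'; apply pure_apart; intros d d' Hd Hd'; exact (HD i j d d' Hi Hj Hij Hd Hd').
Qed.
End OneRow.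

Ltac orbs H := simpl in H; repeat (destruct H as [H|H]); try contradiction; subst.

(** * Block shapes for one row and shifts modulo 8M *)

Section Cyclic8.
Variable M : Z.
Hypothesis HM : 0 < M.

Lemma cyclic8_mod4 x : (8 * M | x) -> (4 | x).
Proof. apply Z.divide_trans; exists (2 * M); lia. Qed.

Ltac mod4 D := solve [apply cyclic8_mod4 in D; destruct D; lia].

Lemma cyclic8_mod8 x : (8 * M | x) -> (8 | x).
Proof. apply Z.divide_trans; exists M; lia. Qed.

Lemma cyclic8_4 x y : (8 * M | x) -> x = 4 * y -> (2 * M | y).
Proof. intros [z Hz] E; exists z; lia. Qed.

Lemma sep2_1 m x y : sep m x y <-> sep2 m 1 (x, 0) (y, 0).
Proof.
unfold sep, sep2, zero2; simpl; split; intros [H1 H2]; split; intros H.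
- apply H1, H. 
- apply H2, H.
- apply H1; split; [exact H|exists 0; lia].
- apply H2; split; [exact H|exists 0; lia].
Qed.

(** Three shapes of blocks occur, those of minimal weight for the weights 2, 1, 3, 1 of the shifts
    modulo 4: {0, 1 + 4x, 1 + 4y} for the pairs of [P]; {0, d, 2d} with d = 1 + 4e; and {0, 4y, 8y}
    for [Y]. Every odd shift is some 1 + 4e up to sign, with e modulo 2M, whereas 2d depends on e
    modulo M only. So the second shape is wanted once per class modulo M, and [Q] must leave one of
    e, e + M free. In the class [c0] it need not: there 4 + 16 c0 = 4M modulo 8M, and {0, 2 + 8 c0,
    4M} replaces the block, provided that [E] avoids M. *)
Lemma cyclic8 (P : list (Z * Z)) (Y : list Z) c0 N :
  let Q := map fst P ++ map snd P in
  let E := map (fun p => fst p - snd p) P ++ Y ++ map (Z.mul 2) Y in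
  ForallOrdPairs (fun x y => ~ (2 * M | x - y)) Q ->
  ForallOrdPairs (sep (2 * M)) E ->
  (forall c, 0 <= c < M ->
     (exists e, (M | e - c) /\ forall x, In x Q -> ~ (2 * M | x - e)) \/
     (c = c0 /\ (2 * M | 1 + 4 * c0 - M) /\ forall y, In y E -> ~ (2 * M | y - M))) ->
  (forall y, In y Y -> ~ (2 * M | 2 * y)) ->
  N = (length P + Z.to_nat M + length Y)%nat ->
  packs (8 * M) 1 (pure_region (8 * M) 1 0 (fun _ => True)) N.
Proof.
intros Q E HQ HE Hc HY2 ->.
set (K1 := fun d : Z * Z => (exists y, In y Q /\ fst d = 1 + 4 * y) \/
   (exists p, In p P /\ fst d = 4 * (snd p - fst p))).
set (K2 := fun d : Z * Z => 
  (exists c e, 0 <= c < M /\ (M | e - c) /\ fst d = 1 + 4 * e /\ forall y, In y Q -> ~ (2 * M | y - e)) \/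
  (exists c, 0 <= c < M /\ (8 * M | fst d - (2 + 8 * c))) \/
  ((8 * M | fst d - 4 * M) /\ forall y, In y E -> ~ (2 * M | y - M))).
set (K3 := fun d : Z * Z => exists y, (In y (Y ++ map (Z.mul 2) Y)) /\ fst d = 4 * y).
unfold E in HE.
apply pairwise_app_inv in HE as (HE1 & HE2 & HE12).
pose proof (pairwise_app_inv _ _ _ _ HE2) as (HEY & HE2Y & HEYY).
apply pairwise_app_inv in HQ as (HQ1 & HQ2 & HQ12).
apply packs_union with (K1 := pure_region (8 * M) 1 0 K1)
  (K2 := fun k => pure_region (8 * M) 1 0 K2 k \/ pure_region (8 * M) 1 0 K3 k)
  (N1 := length P) (N2 := (Z.to_nat M + length Y)%nat).
- apply packs_one_row with (f := fun p => (1 + 4 * fst p, 0)) (g := fun p => (1 + 4 * snd p, 0))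
    (R := fun p q => ~ (2 * M | fst p - fst q) /\ ~ (2 * M | snd p - snd q) /\
       sep (2 * M) (fst p - snd p) (fst q - snd q)); try lia.
  + exact (pairwise_and _ _ _ _ (pairwise_map_inv _ _ _ _ _ HQ1)
      (pairwise_and _ _ _ _ (pairwise_map_inv _ _ _ _ _ HQ2) (pairwise_map_inv _ _ _ _ _ HE1))).
  + intros [x y] Hp; split.
    * assert (Hx : In x (map fst P)) by (apply in_map_iff; exists (x, y); auto).
      assert (Hy : In y (map snd P)) by (apply in_map_iff; exists (x, y); auto).
      apply valid_block1; try lia; intros [D _]; simpl in D; try (mod4 D).
      apply (HQ12 x y Hx Hy), (cyclic8_4 (4 * (x - y))); [|lia].
      apply (divide_neg _ _ _ D); lia.
    * intros d Hd; orbs Hd.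
      -- left; exists x; split; [apply in_or_app; left; apply in_map_iff; exists (x, y)|]; auto.
      -- left; exists y; split; [apply in_or_app; right; apply in_map_iff; exists (x, y)|]; auto.
      -- right; exists (x, y); simpl; split; [auto|lia].
  + intros [x y] [x' y'] d d' Hp Hp' (R1 & R2 & R3) Hd Hd'; simpl in R1, R2, R3, Hd, Hd'.
    assert (Hx : In x (map fst P)) by (apply in_map_iff; exists (x, y); auto).
    assert (Hy : In y (map snd P)) by (apply in_map_iff; exists (x, y); auto).
    assert (Hx' : In x' (map fst P)) by (apply in_map_iff; exists (x', y'); auto).
    assert (Hy' : In y' (map snd P)) by (apply in_map_iff; exists (x', y'); auto).
    destruct R3 as [R3 R4].
    orbs Hd; orbs Hd'; split; intros [D _]; simpl in D; try (mod4 D).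
    * apply R1, (cyclic8_4 _ _ D); lia.
    * apply (HQ12 x y' Hx Hy'), (cyclic8_4 _ _ D); lia.
    * apply (divide_neg _ _ (4 * (x' - y))) in D; [|lia].
      apply (HQ12 x' y Hx' Hy), (cyclic8_4 _ _ D); lia.
    * apply R2, (cyclic8_4 _ _ D); lia.
    * apply R3; apply (divide_neg _ _ (4 * ((x - y) - (x' - y')))) in D; [|lia].
      apply (cyclic8_4 _ _ D); lia.
    * apply R4; apply (divide_neg _ _ (4 * ((x - y) + (x' - y')))) in D; [|lia].
      apply (cyclic8_4 _ _ D); lia.
- apply packs_union with (K1 := pure_region (8 * M) 1 0 K2) (K2 := pure_region (8 * M) 1 0 K3)
    (N1 := Z.to_nat M) (N2 := length Y); auto.
  + set (Kc := fun c (d : Z * Z) =>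
      (exists e, (M | e - c) /\ fst d = 1 + 4 * e /\ forall y, In y Q -> ~ (2 * M | y - e)) \/
      (8 * M | fst d - (2 + 8 * c)) \/
      (c = c0 /\ (8 * M | fst d - 4 * M) /\ forall y, In y E -> ~ (2 * M | y - M))).
    replace (Z.to_nat M) with (Z.to_nat M * 1)%nat by lia.
    eapply packs_sub;
      [apply (packs_range (8 * M) 1 (fun c => pure_region (8 * M) 1 0 (Kc c)) 1 0 (Z.to_nat M))|].
    * intros c Hcr; destruct (Hc c ltac:(lia)) as [(e & He & HeQ)|(-> & Hc0 & HcE)].
      -- eapply packs_sub; [apply packs_one, (valid_block1 _ _ 0) with (d := (1 + 4 * e, 0)) (d' := (2 + 8 * e, 0))|];
           try lia; try (intros [D _]; simpl in D; mod4 D).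
         intros k Hk; apply keys_block1 in Hk as (d & Hd & ->); exists d; split; [|reflexivity].
         assert (H8 : (8 * M | 8 * e - 8 * c)) by (destruct He as [z Hz]; exists z; nia).
         assert (Hin : forall d, In d (orbits1 (1 + 4 * e, 0) (2 + 8 * e, 0)) -> Kc c d).
         { intros d' Hd'; orbs Hd'.
           - left; exists e; auto.
           - right; left; simpl; replace (2 + 8 * e - (2 + 8 * c)) with (8 * e - 8 * c) by lia; auto.
           - left; exists e; simpl; repeat split; auto; lia. }
         destruct Hd; auto.
      -- assert (H16 : (8 * M | 4 + 16 * c0 - 4 * M)) by (destruct Hc0 as [z Hz]; exists z; nia).
         eapply packs_sub; [apply packs_one, (valid_block1 _ _ 0) with (d := (2 + 8 * c0, 0)) (d' := (4 + 16 * c0, 0))|];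
           try lia; try (intros [D _]; simpl in D; mod4 D).
         { intros [D _]; simpl in D; pose proof (Z.divide_sub_r _ _ _ D H16) as D'.
           replace (4 + 16 * c0 - (4 + 16 * c0 - 4 * M)) with (4 * M) in D' by lia; small_divide D'. }
         intros k Hk; apply keys_block1 in Hk as (d & Hd & ->); exists d; split; [|reflexivity].
         assert (Hin : forall d, In d (orbits1 (2 + 8 * c0, 0) (4 + 16 * c0, 0)) -> Kc c0 d).
         { intros d' Hd'; orbs Hd'.
           - right; left; simpl; exists 0; lia.
           - right; right; auto.
           - right; left; simpl; exists 0; lia. }
         destruct Hd; auto.
    * intros c c' Hcr Hcr' Hlt; apply pure_apart; try lia.
      intros d d' Hd Hd'; split; intros [D _]; simpl in D;
      destruct Hd as [(e & He & Ee & Hf)|[Hd|(Ec & Hd & Hf)]], Hd' as [(e' & He' & Ee' & Hf')|[Hd'|(Ec' & Hd' & Hf')]];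
      try (apply cyclic8_mod8 in D; try apply cyclic8_mod8 in Hd; try apply cyclic8_mod8 in Hd';
           destruct D, Hd, Hd'; lia);
      try (apply cyclic8_mod8 in D; try apply cyclic8_mod8 in Hd;
           destruct D, Hd; lia);
      try (apply cyclic8_mod8 in D; try apply cyclic8_mod8 in Hd';
           destruct D, Hd'; lia);
      try (apply cyclic8_mod8 in D; destruct D; lia); try lia.
      -- assert (D' : (M | c - c')).
         { rewrite Ee, Ee' in D; apply (fun H => cyclic8_4 _ _ H (eq_sym (Z.mul_sub_distr_l 4 e e'))) in D || idtac.
           assert (D2 : (2 * M | e - e')) by (apply (cyclic8_4 _ _ D); lia).
           destruct D2 as [z2 D2], He as [z3 He], He' as [z4 He']; exists (2 * z2 - z3 + z4); nia. }
         small_divide D'.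
      -- assert (D' : (M | c - c')).
         { destruct D as [z2 D2], Hd as [z3 He], Hd' as [z4 He']; exists (z2 - z3 + z4); nia. }
         small_divide D'.
    * intros k (c & Hcr & d & Hd & ->); exists d; split; [|reflexivity].
      assert (Hin : forall d, Kc c d -> K2 d).
      { intros d' [(e & He & Ee & Hf)|[Hd'|(Ec & Hd' & Hf)]].
        - left; exists c, e; repeat split; auto; lia.
        - right; left; exists c; split; [lia|auto].
        - right; right; auto. }
      destruct Hd; auto.
  + apply packs_one_row with (f := fun y => (4 * y, 0)) (g := fun y => (8 * y, 0))
      (R := fun y y' => sep (2 * M) y y' /\ sep (2 * M) (2 * y) (2 * y')); try lia.
    * exact (pairwise_and _ _ _ _ HEY (pairwise_map_inv _ _ _ _ _ HE2Y)).
    * intros y Hy; assert (Hy2 : In (2 * y) (map (Z.mul 2) Y)) by (apply in_map; exact Hy).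
      destruct (HEYY y (2 * y) Hy Hy2) as [S1 S2]; split.
      -- apply valid_block1; try lia; intros [D _]; simpl in D.
         ++ apply S1, (cyclic8_4 (-(4 * y))); [apply Z.divide_opp_r, D|lia].
         ++ apply (HY2 y Hy), (cyclic8_4 _ _ D); lia.
         ++ apply S1, (cyclic8_4 (-(4 * y))); [apply (divide_neg _ _ _ D)|]; lia.
         ++ apply S2, (cyclic8_4 _ _ D); lia.
      -- intros d Hd; orbs Hd.
         ++ exists y; split; [apply in_or_app; left; exact Hy|reflexivity].
         ++ exists (2 * y); split; [apply in_or_app; right; exact Hy2|simpl; lia].
         ++ exists y; split; [apply in_or_app; left; exact Hy|simpl; lia].
    * intros y y' d d' Hy Hy' [[R1 R2] [R3 R4]] Hd Hd'.
      assert (Hy2 : In (2 * y) (map (Z.mul 2) Y)) by (apply in_map; exact Hy).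
      assert (Hy2' : In (2 * y') (map (Z.mul 2) Y)) by (apply in_map; exact Hy').
      destruct (HEYY y (2 * y') Hy Hy2') as [S1 S2], (HEYY y' (2 * y) Hy' Hy2) as [S3 S4].
      assert (Hs : forall x x', (x = y \/ x = 2 * y) -> (x' = y' \/ x' = 2 * y') ->
        sep (2 * M) x x').
      { intros x x' [->| ->] [->| ->]; try (split; assumption).
        apply sep_sym; split; assumption. }
      assert (He : forall d, In d (orbits1 (4 * y, 0) (8 * y, 0)) -> exists x, fst d = 4 * x /\ (x = y \/ x = 2 * y)).
      { intros e He; orbs He; [exists y|exists (2 * y)|exists y]; simpl; split; auto; lia. }
      assert (He' : forall d, In d (orbits1 (4 * y', 0) (8 * y', 0)) -> exists x, fst d = 4 * x /\ (x = y' \/ x = 2 * y')).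
      { intros e He'; orbs He'; [exists y'|exists (2 * y')|exists y']; simpl; split; auto; lia. }
      destruct (He d Hd) as (x & Ex & Hx), (He' d' Hd') as (x' & Ex' & Hx').
      destruct (Hs x x' Hx Hx') as [T1 T2]; split; intros [D _]; simpl in D; rewrite Ex, Ex' in D.
      -- apply T1, (cyclic8_4 _ _ D); lia.
      -- apply T2, (cyclic8_4 _ _ D); lia.
  + apply pure_apart; try lia.
    intros d d' Hd (x & Hx & Ex); split; intros [D _]; simpl in D; rewrite Ex in D;
    destruct Hd as [(c & e & Hcr & He & Ee & Hf)|[(c & Hcr & Hd)|(Hd & Hf)]]; try (mod4 D);
    try (rewrite Ee in D; mod4 D);
    try (apply cyclic8_mod4 in D; apply cyclic8_mod4 in Hd; destruct D, Hd; lia).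
    * apply (Hf x); [apply in_or_app; right; exact Hx|].
      pose proof (Z.divide_sub_r _ _ _ Hd D) as D'; apply (cyclic8_4 _ _ D'); lia.
    * apply (Hf x); [apply in_or_app; right; exact Hx|].
      pose proof (Z.divide_sub_r _ _ _ D Hd) as D'.
      replace (x - M) with (x + M - 2 * M) by lia; apply Z.divide_sub_r; [|exists 1; lia].
      apply (cyclic8_4 _ _ D'); lia.
- intros k H1 [H2|H2]; revert k H1 H2; apply pure_apart; try lia; intros d d' Hd Hd'.
  + split; intros [D _]; simpl in D;
    destruct Hd as [(y & Hy & Ey)|(p & Hp & Ep)], Hd' as [(c & e & Hcr & He & Ee & Hf)|[(c & Hcr & Hd')|(Hd' & Hf)]];
    try (rewrite Ey in D); try (rewrite Ep in D); try (rewrite Ee in D); try (mod4 D);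
    try (apply cyclic8_mod4 in D; apply cyclic8_mod4 in Hd'; destruct D, Hd'; lia).
    * apply (Hf y Hy), (cyclic8_4 _ _ D); lia.
    * apply (Hf (fst p - snd p)); [apply in_or_app; left; apply in_map_iff; exists p; auto|].
      pose proof (Z.divide_add_r _ _ _ Hd' D) as D'.
      apply (divide_neg _ (snd p - fst p - M + 2 * M)).
      { apply Z.divide_add_r; [|exists 1; lia]; apply (cyclic8_4 _ _ D'); lia. }
      lia.
    * apply (Hf (fst p - snd p)); [apply in_or_app; left; apply in_map_iff; exists p; auto|].
      pose proof (Z.divide_sub_r _ _ _ Hd' D) as D'.
      apply (cyclic8_4 _ _ D'); lia.
  + split; intros [D _]; simpl in D;
    destruct Hd as [(y & Hy & Ey)|(p & Hp & Ep)], Hd' as (x & Hx & Ex);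
    try (rewrite Ey in D); try (rewrite Ep in D); rewrite Ex in D; try (mod4 D);
    (destruct (HE12 (fst p - snd p) x) as [S1 S2];
     [apply in_map_iff; exists p; auto|exact Hx|]).
    * apply S2; pose proof (cyclic8_4 _ (snd p - fst p - x) D ltac:(lia)) as D'.
      apply (divide_neg _ _ _ D'); lia.
    * apply S1; pose proof (cyclic8_4 _ (snd p - fst p + x) D ltac:(lia)) as D'.
      apply (divide_neg _ _ _ D'); lia.
- intros k [H|[H|H]]; destruct H as (d & _ & ->); exists d; auto.
- lia.
Qed.
End Cyclic8.

(** * Block shapes for one row and shifts in Z_4 x Z_v *)

Ltac mod4' D := solve [destruct D; lia].

Section Cyclic4.
Variable v : Z.
Hypothesis Hv : 0 < v.
Hypothesis Hodd : v mod 2 = 1.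

(** The shifts of odd first component are (1, t) up to sign, and (2, 2t) determines t up to sign
    since v is odd. The block {0, (1, t), (2, 2t)} is thus wanted once for each pair +-t, and it
    suffices that [Q] never contains both t and - t. The value t = 0 stays free because [Q] avoids
    0. *)
Lemma cyclic4 (P : list (Z * Z)) (Y : list Z) N :
  let Q := map fst P ++ map snd P in
  let E := map (fun p => fst p - snd p) P ++ Y ++ map (Z.mul 2) Y in
  ForallOrdPairs (sep v) Q -> (forall x, In x Q -> ~ (v | x)) ->
  ForallOrdPairs (sep v) E ->
  (forall y, In y Y -> ~ (v | y)) ->
  N = (length P + Z.to_nat ((v + 1) / 2) + length Y)%nat ->
  packs 4 v (pure_region 4 v 0 (fun _ => True)) N.
Proof.
intros Q E HQ HQ0 HE HY0 ->.
set (K1 := fun d : Z * Z => (exists y, In y Q /\ d = (1, y)) \/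
   (exists p, In p P /\ d = (0, snd p - fst p))).
set (K2 := fun d : Z * Z => 
  (exists t, d = (1, t) /\ forall x, In x Q -> ~ (v | x - t)) \/ exists t, d = (2, 2 * t)).
set (K3 := fun d : Z * Z => exists y, (In y (Y ++ map (Z.mul 2) Y)) /\ d = (0, y)).
unfold E in HE.
apply pairwise_app_inv in HE as (HE1 & HE2 & HE12).
pose proof (pairwise_app_inv _ _ _ _ HE2) as (HEY & HE2Y & HEYY).
pose proof (pairwise_app_inv _ _ _ _ HQ) as (HQ1 & HQ2 & HQ12).
apply packs_union with (K1 := pure_region 4 v 0 K1)
  (K2 := fun k => pure_region 4 v 0 K2 k \/ pure_region 4 v 0 K3 k)
  (N1 := length P) (N2 := (Z.to_nat ((v + 1) / 2) + length Y)%nat).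
- apply packs_one_row with (f := fun p => (1, fst p)) (g := fun p => (1, snd p))
    (R := fun p q => sep v (fst p) (fst q) /\ sep v (snd p) (snd q) /\
       sep v (fst p - snd p) (fst q - snd q)); try lia.
  + exact (pairwise_and _ _ _ _ (pairwise_map_inv _ _ _ _ _ HQ1)
      (pairwise_and _ _ _ _ (pairwise_map_inv _ _ _ _ _ HQ2) (pairwise_map_inv _ _ _ _ _ HE1))).
  + intros [x y] Hp; split.
    * assert (Hx : In x (map fst P)) by (apply in_map_iff; exists (x, y); auto).
      assert (Hy : In y (map snd P)) by (apply in_map_iff; exists (x, y); auto).
      apply valid_block1; try lia; intros [D D']; simpl in D, D'; try (mod4' D).
      apply (proj1 (HQ12 x y Hx Hy)), (divide_neg _ _ _ D'); lia.
    * intros d Hd; orbs Hd.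
      -- left; exists x; split; [apply in_or_app; left; apply in_map_iff; exists (x, y)|]; auto.
      -- left; exists y; split; [apply in_or_app; right; apply in_map_iff; exists (x, y)|]; auto.
      -- right; exists (x, y); simpl; split; [auto|reflexivity].
  + intros [x y] [x' y'] d d' Hp Hp' ([R1 _] & [R2 _] & R3) Hd Hd'; simpl in R1, R2, R3, Hd, Hd'.
    assert (Hx : In x (map fst P)) by (apply in_map_iff; exists (x, y); auto).
    assert (Hy : In y (map snd P)) by (apply in_map_iff; exists (x, y); auto).
    assert (Hx' : In x' (map fst P)) by (apply in_map_iff; exists (x', y'); auto).
    assert (Hy' : In y' (map snd P)) by (apply in_map_iff; exists (x', y'); auto).
    destruct R3 as [R3 R4].
    orbs Hd; orbs Hd'; split; intros [D D']; simpl in D, D'; try (mod4' D).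
    * exact (R1 D').
    * exact (proj1 (HQ12 x y' Hx Hy') D').
    * apply (proj1 (HQ12 x' y Hx' Hy)), (divide_neg _ _ _ D'); lia.
    * exact (R2 D').
    * apply R3, (divide_neg _ _ _ D'); lia.
    * apply R4, (divide_neg _ _ _ D'); lia.
- apply packs_union with (K1 := pure_region 4 v 0 K2) (K2 := pure_region 4 v 0 K3)
    (N1 := Z.to_nat ((v + 1) / 2)) (N2 := length Y); auto.
  + set (Kc := fun c (d : Z * Z) => exists t, (t = c \/ t = - c) /\ 
      ((d = (1, t) /\ forall x, In x Q -> ~ (v | x - t)) \/ d = (2, 2 * t))).
    replace (Z.to_nat ((v + 1) / 2)) with (Z.to_nat ((v + 1) / 2) * 1)%nat by lia.
    pose proof (Z.div_mod v 2 ltac:(lia)); pose proof (Z.div_mod (v + 1) 2 ltac:(lia)); 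
    pose proof (Z.mod_pos_bound (v + 1) 2 ltac:(lia)).
    eapply packs_sub;
      [apply (packs_range 4 v (fun c => pure_region 4 v 0 (Kc c)) 1 0 (Z.to_nat ((v + 1) / 2)))|].
    * intros c Hcr.
      assert (Ht : exists t, (t = c \/ t = - c) /\ forall x, In x Q -> ~ (v | x - t)).
      { destruct (Exists_dec (fun x => (v | x - c)) Q) as [He|He].
        { intros x; apply Zdivide_dec. }
        - apply Exists_exists in He as (x & Hx & Hxc).
          exists (- c); split; [auto|]; intros y Hy Hyc.
          destruct (ForallOrdPairs_In HQ x y Hx Hy) as [Exy|[S|S]].
          + subst y; apply (HQ0 x Hx), divide_twice; [exact Hodd|].
            replace (2 * x) with ((x - c) + (x - - c)) by lia; apply Z.divide_add_r; assumption.
          + apply (proj2 S); replace (x + y) with ((x - c) + (y - - c)) by lia.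
            apply Z.divide_add_r; assumption.
          + apply (proj2 S); replace (y + x) with ((x - c) + (y - - c)) by lia.
            apply Z.divide_add_r; assumption.
        - exists c; split; [auto|]; intros x Hx Hxc; apply He, Exists_exists; eauto. }
      destruct Ht as (t & Htc & Ht).
      eapply packs_sub; [apply packs_one, (valid_block1 _ _ 0) with (d := (1, t)) (d' := (2, 2 * t))|];
           try lia; try (intros [D D']; simpl in D, D'; mod4' D).
      intros k Hk; apply keys_block1 in Hk as (d & Hd & ->); exists d; split; [|reflexivity].
      assert (Hin : forall d, In d (orbits1 (1, t) (2, 2 * t)) -> Kc c d).
      { intros d' Hd'; exists t; split; [exact Htc|]; orbs Hd'.
        - left; split; auto.
        - right; reflexivity.
        - left; split; auto; f_equal; lia. }
      destruct Hd; auto.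
    * intros c c' Hcr Hcr' Hlt; apply pure_apart; try lia.
      intros d d' (t & Ht & Hd) (t' & Ht' & Hd').
      assert (N1 : ~ (v | t - t')).
      { intros D; destruct Ht, Ht'; subst t t'; small_divide D. }
      assert (N2 : ~ (v | t + t')).
      { intros D; destruct Ht, Ht'; subst t t'; small_divide D. }
      destruct Hd as [[-> _]| ->], Hd' as [[-> _]| ->]; split; intros [D D']; simpl in D, D'; try (mod4' D).
      -- auto.
      -- apply N1, divide_twice; [exact Hodd|]; replace (2 * (t - t')) with (2 * t - 2 * t') by lia; auto.
      -- apply N2, divide_twice; [exact Hodd|]; replace (2 * (t + t')) with (2 * t + 2 * t') by lia; auto.
    * intros k (c & Hcr & d & Hd & ->); exists d; split; [|reflexivity].
      assert (Hin : forall d, Kc c d -> K2 d).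
      { intros d' (t & Ht & [Hd'|Hd']); [left|right]; exists t; auto. }
      destruct Hd; auto.
  + apply packs_one_row with (f := fun y => (0, y)) (g := fun y => (0, 2 * y))
      (R := fun y y' => sep v y y' /\ sep v (2 * y) (2 * y')); try lia.
    * exact (pairwise_and _ _ _ _ HEY (pairwise_map_inv _ _ _ _ _ HE2Y)).
    * intros y Hy; assert (Hy2 : In (2 * y) (map (Z.mul 2) Y)) by (apply in_map; exact Hy).
      destruct (HEYY y (2 * y) Hy Hy2) as [S1 S2]; split.
      -- apply valid_block1; try lia; intros [D D']; simpl in D, D'.
         ++ exact (HY0 y Hy D').
         ++ exact (HY0 y Hy (divide_twice _ _ Hodd D')).
         ++ apply S1, (divide_neg _ _ _ D'); lia.
         ++ apply S2; replace (y + 2 * y) with (3 * y) by lia; exact D'.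
      -- intros d Hd; orbs Hd.
         ++ exists y; split; [apply in_or_app; left; exact Hy|reflexivity].
         ++ exists (2 * y); split; [apply in_or_app; right; exact Hy2|simpl; reflexivity].
         ++ exists y; split; [apply in_or_app; left; exact Hy|simpl; f_equal; lia].
    * intros y y' d d' Hy Hy' [[R1 R2] [R3 R4]] Hd Hd'.
      assert (Hy2 : In (2 * y) (map (Z.mul 2) Y)) by (apply in_map; exact Hy).
      assert (Hy2' : In (2 * y') (map (Z.mul 2) Y)) by (apply in_map; exact Hy').
      destruct (HEYY y (2 * y') Hy Hy2') as [S1 S2], (HEYY y' (2 * y) Hy' Hy2) as [S3 S4].
      assert (Hs : forall x x', (x = y \/ x = 2 * y) -> (x' = y' \/ x' = 2 * y') -> sep v x x').
      { intros x x' [->| ->] [->| ->]; try (split; assumption).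
        apply sep_sym; split; assumption. }
      assert (He : forall y d, In d (orbits1 (0, y) (0, 2 * y)) -> exists x, d = (0, x) /\ (x = y \/ x = 2 * y)).
      { clear; intros y e He; orbs He; [exists y|exists (2 * y)|exists y]; simpl; split; auto; f_equal; lia. }
      destruct (He y d Hd) as (x & -> & Hx), (He y' d' Hd') as (x' & -> & Hx').
      destruct (Hs x x' Hx Hx') as [T1 T2]; split; intros [D D']; simpl in D'; auto.
  + apply pure_apart; try lia.
    intros d d' Hd (x & Hx & ->); split; intros [D D'];
    destruct Hd as [(t & -> & Ht)|(t & ->)]; simpl in D; mod4' D.
- intros k H1 [H2|H2]; revert k H1 H2; apply pure_apart; try lia; intros d d' Hd Hd'.
  + split; intros [D D'];
    destruct Hd as [(y & Hy & ->)|(p & Hp & ->)], Hd' as [(t & -> & Ht)|(t & ->)]; 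
    simpl in D, D'; try (mod4' D).
    exact (Ht y Hy D').
  + split; intros [D D'];
    destruct Hd as [(y & Hy & ->)|(p & Hp & ->)], Hd' as (x & Hx & ->); simpl in D, D'; try (mod4' D);
    (destruct (HE12 (fst p - snd p) x) as [S1 S2];
     [apply in_map_iff; exists p; auto|exact Hx|]).
    * apply S2, (divide_neg _ _ _ D'); lia.
    * apply S1, (divide_neg _ _ _ D'); lia.
- intros k [H|[H|H]]; destruct H as (d & _ & ->); exists d; auto.
- lia.
Qed.
End Cyclic4.

Definition seg {A} (f : Z -> A) lo hi : list A := map f (zrange lo hi).

Lemma map_seg A B (g : A -> B) f lo hi : map g (seg f lo hi) = seg (fun x => g (f x)) lo hi.
Proof. apply map_map. Qed.

Lemma in_seg A (f : Z -> A) lo hi x : In x (seg f lo hi) -> exists i, lo <= i < hi /\ x = f i.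
Proof.
intros H; apply in_map_iff in H as (i & <- & Hi); apply in_zrange in Hi; eauto.
Qed.

Lemma length_seg A (f : Z -> A) lo hi : length (seg f lo hi) = Z.to_nat (hi - lo).
Proof. unfold seg; rewrite length_map; apply length_zrange. Qed.

Lemma pairwise_seg A (R : A -> A -> Prop) f lo hi :
  (forall i j, lo <= i < j -> j < hi -> R (f i) (f j)) -> ForallOrdPairs R (seg f lo hi).
Proof. apply pairwise_zrange. Qed.

Ltac in_segs H :=
  lazymatch type of H with
  | In _ (_ ++ _) => apply in_app_or in H; destruct H as [H|H]; in_segs H
  | In _ (seg _ _ _) => apply in_seg in H as (? & ? & ->)
  | In _ (_ :: _) => apply in_inv in H; destruct H as [<-|H]; [|in_segs H]
  | In _ [] => destruct H
  end.

Ltac each tac :=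
  lazymatch goal with
  | |- Forall _ [] => apply Forall_nil
  | |- Forall _ (_ :: _) => apply Forall_cons; [tac|each tac]
  | |- Forall _ _ => let Hx := fresh "Hx" in
      apply Forall_forall; intros ? Hx; in_segs Hx; tac
  end.

(** A pairwise condition on a concatenation of parametrised segments becomes one linear goal per
    pair of segments. The explicit families are verified in this way, uniformly in their
    parameters. *)
Ltac fop tac :=
  lazymatch goal with
  | |- ForallOrdPairs _ (_ ++ _) =>
      apply ForallOrdPairs_app; [fop tac|fop tac|let Ha := fresh "Ha" in let Hb := fresh "Hb" in
        intros ? ? Ha Hb; in_segs Ha; in_segs Hb; tac]
  | |- ForallOrdPairs _ (seg _ _ _) => apply pairwise_seg; intros; tac
  | |- ForallOrdPairs _ (_ :: _) => apply FOP_cons; [each tac|fop tac]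
  | |- ForallOrdPairs _ [] => apply FOP_nil
  end.

Ltac nodiv := intro; match goal with D : (_ | _) |- False => small_divide D end.
Ltac sep_tac := split; nodiv.
Ltac expand_lists := do 3 (rewrite ?map_app, ?map_seg; cbn [map fst snd app]).

Section Cyclic8.
Variable M : Z.
Hypothesis HM : 0 < M.

(** If [Q] is distinct already modulo M, it takes at most one of e and e + M in each class. *)
Lemma cyclic8_simple (P : list (Z * Z)) (Y : list Z) N :
  let Q := map fst P ++ map snd P in
  let E := map (fun p => fst p - snd p) P ++ Y ++ map (Z.mul 2) Y in
  ForallOrdPairs (fun x y => ~ (M | x - y)) Q ->
  ForallOrdPairs (sep (2 * M)) E ->
  (forall y, In y Y -> ~ (2 * M | 2 * y)) ->
  N = (length P + Z.to_nat M + length Y)%nat ->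
  packs (8 * M) 1 (pure_region (8 * M) 1 0 (fun _ => True)) N.
Proof.
intros Q E HQ HE HY HN.
assert (H2 : forall x, (2 * M | x) -> (M | x)) by (intros x; apply Z.divide_trans; exists 2; lia).
apply (cyclic8 M HM P Y 0 N); auto.
- revert HQ; apply pairwise_impl; intros a b _ _ H D; apply H, H2, D.
- intros c Hc; left.
  destruct (Exists_dec (fun x => (2 * M | x - c)) Q) as [He|He].
  { intros x; apply Zdivide_dec. }
  + apply Exists_exists in He as (x & Hx & Hxc).
    exists (c + M); split; [exists 1; lia|]; intros y Hy Hyc.
    assert (D : (M | x - y)).
    { replace (x - y) with ((x - c) - (y - (c + M)) - M) by lia.
      apply Z.divide_sub_r; [apply Z.divide_sub_r; auto|exists 1; lia]. }
    destruct (ForallOrdPairs_In HQ x y Hx Hy) as [Exy|[S|S]].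
    * subst y; assert (DM : (2 * M | M)).
      { replace M with ((x - c) - (x - (c + M))) at 2 by lia; apply Z.divide_sub_r; auto. }
      small_divide DM.
    * exact (S D).
    * apply S, (divide_neg _ _ _ D); lia.
  + exists c; split; [exists 0; lia|]; intros x Hx Hxc; apply He, Exists_exists; eauto.
Qed.

(** Here [Q] may take both lifts of the one class [c0]. The families with M = 3 modulo 4 rely on
    this: their [Q] has M + 1 members. *)
Lemma cyclic8_double (P : list (Z * Z)) (Y : list Z) c0 N :
  let Q := map fst P ++ map snd P in
  let E := map (fun p => fst p - snd p) P ++ Y ++ map (Z.mul 2) Y in
  (2 * M | 1 + 4 * c0 - M) -> 0 <= c0 < M ->
  ForallOrdPairs (fun x y => ~ (2 * M | x - y) /\ ((M | x - y) -> (M | x - c0))) Q ->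
  ForallOrdPairs (sep (2 * M)) E ->
  (forall y, In y E -> ~ (2 * M | y - M)) ->
  (forall y, In y Y -> ~ (2 * M | 2 * y)) ->
  N = (length P + Z.to_nat M + length Y)%nat ->
  packs (8 * M) 1 (pure_region (8 * M) 1 0 (fun _ => True)) N.
Proof.
intros Q E Hc0 Hc0r HQ HE HEM HY HN.
assert (H2 : forall x, (2 * M | x) -> (M | x)) by (intros x; apply Z.divide_trans; exists 2; lia).
apply (cyclic8 M HM P Y c0 N); auto.
- revert HQ; apply pairwise_impl; tauto.
- intros c Hc; destruct (Z.eq_dec c c0) as [->|Hcc]; [right; auto|left].
  assert (Hno : forall x, (M | x - c0) -> (M | x - c) -> False).
  { intros x D1 D2; pose proof (Z.divide_sub_r _ _ _ D1 D2) as D; small_divide D. }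
  destruct (Exists_dec (fun x => (2 * M | x - c)) Q) as [He|He].
  { intros x; apply Zdivide_dec. }
  + apply Exists_exists in He as (x & Hx & Hxc).
    exists (c + M); split; [exists 1; lia|]; intros y Hy Hyc.
    assert (D : (M | x - y)).
    { replace (x - y) with ((x - c) - (y - (c + M)) - M) by lia.
      apply Z.divide_sub_r; [apply Z.divide_sub_r; auto|exists 1; lia]. }
    destruct (ForallOrdPairs_In HQ x y Hx Hy) as [Exy|[[_ S]|[_ S]]].
    * subst y; assert (DM : (2 * M | M)).
      { replace M with ((x - c) - (x - (c + M))) at 2 by lia; apply Z.divide_sub_r; auto. }
      small_divide DM.
    * apply (Hno x); auto.
    * apply (Hno y); [apply S, (divide_neg _ _ _ D); lia|].
      replace (y - c) with ((y - (c + M)) + M) by lia; apply Z.divide_add_r; auto; exists 1; lia.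
  + exists c; split; [exists 0; lia|]; intros x Hx Hxc; apply He, Exists_exists; eauto.
Qed.
End Cyclic8.

(** * Explicit families for one row, m = 8M *)

Definition full1 m N := packs m 1 (pure_region m 1 0 (fun _ => True)) (Z.to_nat N).

Ltac lengths := do 3 (rewrite ?length_app, ?length_seg; cbn [length]); lia.

Ltac exc_tac := split; [nodiv|intro; match goal with D : (_ | _) |- _ =>
  first [exfalso; small_divide D
  | apply divide_small5 in D; [exists 0; lia|lia]
  | apply divide_small5 in D; [exists 1; lia|lia]
  | apply divide_small5 in D; [exists (-1); lia|lia]] end].

Ltac one_row_simple LP LY :=
  unfold full1; apply cyclic8_simple with (P := LP) (Y := LY);
  [ lia
  | expand_lists; subst; fop nodiv
  | expand_lists; subst; fop sep_tac
  | let Hy := fresh in intros ? Hy; in_segs Hy; subst; nodiv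
  | subst; lengths ].

Ltac one_row_double LP LY LC :=
  unfold full1; apply cyclic8_double with (P := LP) (Y := LY) (c0 := LC);
  [ lia
  | subst; first [exists 0; lia | exists 1; lia]
  | lia
  | expand_lists; subst; fop exc_tac
  | expand_lists; subst; fop sep_tac
  | expand_lists; let Hy := fresh in intros ? Hy; in_segs Hy; subst; nodiv
  | let Hy := fresh in intros ? Hy; in_segs Hy; subst; nodiv
  | subst; lengths ].

(** The shifts modulo 2M are divided by their power of 2. The first two segments have differences
    divisible by 4. The third segment, the last pair and all of [Y] but 2q give the odd ones, and
    the doubles of these members of [Y] are 2 modulo 4. The two gaps 2q and 4q = M are filled by 2q
    and its double. *)
Lemma one_row_8_q_odd w q M : 0 <= w -> q = 2 * w + 1 -> M = 8 * w + 4 ->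
  full1 (8 * M) (14 * w + 7).
Proof.
intros Hw Eq EM.
one_row_simple
  (seg (fun x => (- (2 * x), 2 * x)) 1 (w + 1) ++
   seg (fun x => (2 * (w - x) + 1, 2 * (w + x) + 1 + M)) 1 (w + 1) ++
   seg (fun i => (2 * (q + i), 2 * (w + q - i) + 1)) (- w) (w + 1) ++
   [(0, 2 * w + 1 + M)])
  (2 * q :: seg (fun i => 3 * q + 4 * i) (- w) 0 ++ seg (fun i => 3 * q + 4 * i) 1 (w + 1)).
Qed.

(** The same division by powers of 2. The member 4 of [Y] supplies 4 and 8 in place of x = 1, 2 in
    the second segment. The pairs (-3, -1) and (3, 5 + M) supply 2 and M + 2, which are doubles of
    no member of [Y]. *)
Lemma one_row_8_q_even w q M : 2 <= w -> q = 2 * w + 2 -> M = 8 * w + 8 ->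
  full1 (8 * M) (14 * w + 14).
Proof.
intros Hw Eq EM.
one_row_simple
  (seg (fun x => (- (2 * x), 2 * x + M)) 1 (w + 1) ++
   seg (fun x => (1 - 2 * x, 1 + 2 * x)) 3 (w + 1) ++
   seg (fun i => (2 * (q + i), 2 * (q - i) + 1)) (- w - 1) (w + 2) ++
   [(-3, -1); (3, 5 + M); (0, 1 + M)])
  (2 * q :: 4 :: seg (fun i => M - 1 + 4 * i) (- w) 0 ++ seg (fun i => M - 1 + 4 * i) 1 (w + 1)).
Qed.

(** The case w = 1, below the range of the family for even q. *)
Lemma one_row_128 : full1 128 28.
Proof.
apply (cyclic8_simple 16 ltac:(lia)
  [(0,17); (2,20); (3,7); (5,12); (6,11); (8,31); (9,30); (10,29)] [8; 1; 3; 10]).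
- cbn; repeat constructor; nodiv.
- cbn; repeat constructor; nodiv.
- intros y Hy; in_segs Hy; nodiv.
- reflexivity.
Qed.

(** Up to sign modulo 2M, [Y] and its doubles are q + 1, ..., 2q and the even numbers from 2q + 2 to
    4q. The first segment gives the odd numbers between 2q and 4q, the second the even and the third
    the odd numbers up to q. The remaining families for m = 8M vary this pattern. *)
Lemma one_row_8_r1 a b q M : 0 <= b <= a -> a <= b + 1 -> q = a + b -> M = 4 * q + 1 ->
  full1 (8 * M) (7 * q + 1).
Proof.
intros Hb Ha Eq EM.
one_row_double
  (seg (fun i => (2 * q - i, 2 * q + i + M)) 1 (q + 1) ++
   seg (fun i => (3 * q + 1 + b - i, 3 * q + 1 + b + i)) 1 (b + 1) ++
   seg (fun i => (3 * q + 2 + 2 * b + i, 5 * q + 1 - i)) 0 a)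
  (seg (fun i => i) (q + 1) (2 * q + 1)) q.
Qed.

Lemma one_row_8_r2 a b q M : 0 <= b <= a -> a <= b + 1 -> q = a + b -> M = 4 * q + 2 ->
  full1 (8 * M) (7 * q + 3).
Proof.
intros Hb Ha Eq EM.
one_row_simple
  (seg (fun i => (b - i, b + i)) 1 (b + 1) ++
   seg (fun i => (2 * b + 1 + i, 2 * q - i)) 0 a ++
   seg (fun i => (2 * q + 1 + i, 4 * q - i + M)) 0 q)
  (seg (fun i => i) (q + 1) (2 * q + 2)).
Qed.

(** The number q + 1 + b is omitted from [Y]: up to sign, it and its double are the differences of
    the two single pairs. The same holds for odd q. *)
Lemma one_row_8_r3_even b q M : 0 <= b -> q = 2 * b -> M = 4 * q + 3 ->
  full1 (8 * M) (7 * q + 5).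
Proof.
intros Hb Eq EM.
one_row_double
  (seg (fun i => (4 * q + 2 - i, 4 * q + 2 + i + M)) 1 (q + 1) ++
   seg (fun i => (5 * q + 4 + b - i, 5 * q + 4 + b + i)) 1 (b + 1) ++
   seg (fun i => (6 * q + 5 + i, 7 * q + 4 - i)) 0 b ++
   [(5 * q + 4 + b, 7 * q + 5); (4 * q + 2, 5 * q + 3 + M)])
  (seg (fun i => i) (q + 1) (q + 1 + b) ++ seg (fun i => i) (q + 2 + b) (2 * q + 2)) (3 * q + 2).
Qed.

Lemma one_row_8_r3_odd b q M : 0 <= b -> q = 2 * b + 1 -> M = 4 * q + 3 ->
  full1 (8 * M) (7 * q + 5).
Proof.
intros Hb Eq EM.
one_row_double
  (seg (fun i => (4 * q + 2 - i, 4 * q + 2 + i + M)) 1 (q + 1) ++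
   seg (fun i => (5 * q + 3 + b - i, 5 * q + 3 + b + i)) 1 (b + 1) ++
   seg (fun i => (6 * q + 4 + i, 7 * q + 4 - i)) 0 (b + 1) ++
   [(4 * q + 2, 5 * q + 3 + b); (6 * q + 3 + M, 7 * q + 5)])
  (seg (fun i => i) (q + 1) (q + 1 + b) ++ seg (fun i => i) (q + 2 + b) (2 * q + 2)) (3 * q + 2).
Qed.

Lemma one_row_8 M : 0 < M -> M <> 8 -> full1 (8 * M) (7 * M / 4).
Proof.
intros HM H8; pose proof (Z.div_mod M 4 ltac:(lia)) as EM; pose proof (Z.mod_pos_bound M 4 ltac:(lia)).
set (q := M / 4) in *; pose proof (Z.div_mod q 2 ltac:(lia)) as Eq; pose proof (Z.mod_pos_bound q 2 ltac:(lia)).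
assert (Hr : M mod 4 = 0 \/ M mod 4 = 1 \/ M mod 4 = 2 \/ M mod 4 = 3) by lia.
assert (Hp : q mod 2 = 0 \/ q mod 2 = 1) by lia.
assert (Hb : forall N, 4 * N <= 7 * M < 4 * N + 4 -> 7 * M / 4 = N).
{ intros N HN; symmetry; apply (Z.div_unique _ _ _ (7 * M - 4 * N)); lia. }
destruct Hr as [Hr|[Hr|[Hr|Hr]]], Hp as [Hp|Hp].
- destruct (Z.eq_dec q 4) as [E|E].
  + replace M with 16 by lia; exact one_row_128.
  + rewrite (Hb (14 * (q / 2 - 1) + 14)) by lia; apply (one_row_8_q_even _ q); lia.
- rewrite (Hb (14 * (q / 2) + 7)) by lia; apply (one_row_8_q_odd _ q); lia.
- rewrite (Hb (7 * q + 1)) by lia; apply (one_row_8_r1 (q / 2) (q / 2)); lia.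
- rewrite (Hb (7 * q + 1)) by lia; apply (one_row_8_r1 (q / 2 + 1) (q / 2)); lia.
- rewrite (Hb (7 * q + 3)) by lia; apply (one_row_8_r2 (q / 2) (q / 2)); lia.
- rewrite (Hb (7 * q + 3)) by lia; apply (one_row_8_r2 (q / 2 + 1) (q / 2)); lia.
- rewrite (Hb (7 * q + 5)) by lia; apply (one_row_8_r3_even (q / 2)); lia.
- rewrite (Hb (7 * q + 5)) by lia; apply (one_row_8_r3_odd (q / 2)); lia.
Qed.

(** * Explicit families for one row, m = 4v *)

Definition full4 v N := packs 4 v (pure_region 4 v 0 (fun _ => True)) (Z.to_nat N).

Ltac one_row4 LP LY :=
  unfold full4; apply cyclic4 with (P := LP) (Y := LY);
  [ lia
  | subst; Z.to_euclidean_division_equations; lia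
  | expand_lists; subst; fop sep_tac
  | expand_lists; let Hy := fresh in intros ? Hy; in_segs Hy; subst; nodiv
  | expand_lists; subst; fop sep_tac
  | let Hy := fresh in intros ? Hy; in_segs Hy; subst; nodiv
  | do 3 (rewrite ?length_app, ?length_seg; cbn [length]); subst;
    Z.to_euclidean_division_equations; lia ].

(** The differences 4q + 4 + 2i of the first segment are, up to sign modulo v, the q odd numbers
    from 2q + 2r - 1 on. The other two segments give 1, ..., q, and [Y] with its doubles the numbers
    between. *)
Lemma one_row_4_r12_even b q r v : 0 <= b -> q = 2 * b -> 1 <= r <= 2 -> v = 8 * q + 2 * r + 1 ->
  full4 v (7 * q + 2 * r).
Proof.
intros Hb Eq Hr Ev.
one_row4
  (seg (fun i => (q + 2 + i, - (3 * q + 2 + i))) 0 q ++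
   seg (fun i => (1 + b - i, 1 + b + i)) 1 (b + 1) ++
   seg (fun i => (2 * q + 2 + i, 3 * q + 1 - i)) 0 b)
  (seg (fun i => i) (q + 1) (2 * q + r)).
Qed.

Lemma one_row_4_r12_odd b q r v : 0 <= b -> q = 2 * b + 1 -> 1 <= r <= 2 -> v = 8 * q + 2 * r + 1 ->
  full4 v (7 * q + 2 * r).
Proof.
intros Hb Eq Hr Ev.
one_row4
  (seg (fun i => (q + 2 + i, - (3 * q + 2 + i))) 0 q ++
   seg (fun i => (1 + i, 2 * b + 2 - i)) 0 (b + 1) ++
   seg (fun i => (2 * q + 2 + b - i, 2 * q + 2 + b + i)) 1 (b + 1))
  (seg (fun i => i) (q + 1) (2 * q + r)).
Qed.

Lemma one_row_4_r3_even b q v : 0 <= b -> q = 2 * b -> v = 8 * q + 7 -> full4 v (7 * q + 6).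
Proof.
intros Hb Eq Ev.
one_row4
  (seg (fun i => (q + 2 + i, - (3 * q + 4 + i))) 0 q ++
   seg (fun i => (1 + b - i, 1 + b + i)) 1 (b + 1) ++
   seg (fun i => (2 * q + 2 + i, 3 * q + 3 - i)) 0 (b + 1))
  (seg (fun i => i) (q + 2) (2 * q + 3)).
Qed.

Lemma one_row_4_r3_odd b q v : 0 <= b -> q = 2 * b + 1 -> v = 8 * q + 7 -> full4 v (7 * q + 6).
Proof.
intros Hb Eq Ev.
one_row4
  (seg (fun i => (q + 2 + i, - (3 * q + 4 + i))) 0 q ++
   seg (fun i => (1 + i, 2 * b + 2 - i)) 0 (b + 1) ++
   seg (fun i => (2 * q + 3 + b - i, 2 * q + 3 + b + i)) 1 (b + 2))
  (seg (fun i => i) (q + 2) (2 * q + 3)).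
Qed.

(** For v = 8q + 1 nothing is left over. These pairs have the odd differences from 2q + 1 to 4q - 1
    and leave the places q + 1, ..., 3q, in which the differences 1, ..., q must be realised: a
    Skolem sequence of order q, which exists only for q = 0, 1 modulo 4. *)
Definition outer q : list (Z * Z) := seg (fun t => (t, 4 * q + 1 - t)) 1 (q + 1).

(* The classical Skolem sequences of orders [4 s] and [4 s + 1] and the hooked
   sequence of order [4 s + 2], translated by [k]. *)
Definition skolem0 k s : list (Z * Z) :=
  seg (fun i => (k + 4 * s + i - 1, k + 8 * s - i + 1)) 1 (2 * s + 1) ++
  seg (fun i => (k + i, k + 4 * s - i - 1)) 1 (s - 1) ++
  seg (fun i => (k + s + i + 1, k + 3 * s - i)) 1 (s - 1) ++
  [(k + s - 1, k + 3 * s); (k + s, k + s + 1); (k + 2 * s, k + 4 * s - 1); (k + 2 * s + 1, k + 6 * s)].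
Definition skolem1 k s : list (Z * Z) :=
  seg (fun i => (k + 4 * s + i + 1, k + 8 * s - i + 3)) 1 (2 * s + 1) ++
  seg (fun i => (k + i, k + 4 * s - i + 1)) 1 (s + 1) ++
  seg (fun i => (k + s + i + 2, k + 3 * s - i + 1)) 1 (s - 1) ++
  [(k + s + 1, k + s + 2); (k + 2 * s + 1, k + 6 * s + 2); (k + 2 * s + 2, k + 4 * s + 1)].
Definition hooked k s : list (Z * Z) :=
  seg (fun i => (k + i, k + 4 * s - i + 2)) 1 (2 * s + 1) ++
  seg (fun i => (k + 4 * s + i + 3, k + 8 * s - i + 4)) 1 s ++
  seg (fun i => (k + 5 * s + i + 2, k + 7 * s - i + 3)) 1 s ++
  [(k + 2 * s + 1, k + 6 * s + 2); (k + 4 * s + 2, k + 6 * s + 3); (k + 4 * s + 3, k + 8 * s + 5);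
   (k + 7 * s + 3, k + 7 * s + 4)].

Ltac one_row4_skolem LP LY :=
  let lp := eval unfold outer, skolem0, skolem1, hooked in LP in one_row4 lp LY.

Lemma one_row_4_sk0 s q v : 2 <= s -> q = 4 * s -> v = 8 * q + 1 -> full4 v (7 * q + 1).
Proof.
intros Hs Eq Ev.
one_row4_skolem (outer q ++ skolem0 q s) (seg (fun i => i) (q + 1) (2 * q + 1)).
Qed.

Lemma one_row_4_sk1 s q v : 2 <= s -> q = 4 * s + 1 -> v = 8 * q + 1 -> full4 v (7 * q + 1).
Proof.
intros Hs Eq Ev.
one_row4_skolem (outer q ++ skolem1 q s) (seg (fun i => i) (q + 1) (2 * q + 1)).
Qed.

(** For q = 2, 3 modulo 4 a sequence of order q - 1 leaves two places free, and they are paired with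
    opposite signs. Here q + 1 and - 3q differ by 4q + 1, which is - 4q modulo v; so [Y] runs from q
    to 2q - 1 instead of from q + 1 to 2q. *)
Lemma one_row_4_sk2 s q v : 2 <= s -> q = 4 * s + 2 -> v = 8 * q + 1 -> full4 v (7 * q + 1).
Proof.
intros Hs Eq Ev.
one_row4_skolem (outer q ++ skolem1 (q + 1) s ++ [(q + 1, - (3 * q))])
  (q :: seg (fun i => i) (q + 1) (2 * q)).
Qed.

(** The hole of a hooked sequence is the last place but one, so the free places are q + 1 and 3q -
    1. With opposite signs they differ by exactly 4q. *)
Lemma one_row_4_sk3 s q v : 1 <= s -> q = 4 * s + 3 -> v = 8 * q + 1 -> full4 v (7 * q + 1).
Proof.
intros Hs Eq Ev.
one_row4_skolem (outer q ++ hooked (q + 1) s ++ [(q + 1, - (3 * q - 1))])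
  (q :: seg (fun i => i) (q + 1) (2 * q)).
Qed.

Lemma one_row_4_skolem_small q v : 0 <= q <= 6 -> v = 8 * q + 1 -> full4 v (7 * q + 1).
Proof.
intros Hq Ev.
assert (E : q = 0 \/ q = 1 \/ q = 2 \/ q = 3 \/ q = 4 \/ q = 5 \/ q = 6) by lia.
destruct E as [E|[E|[E|[E|[E|[E|E]]]]]]; subst q v.
- one_row4 (@nil (Z * Z)) (@nil Z).
- one_row4 [(1, 4); (2, 3)] [2].
- one_row4 [(1, 8); (2, 7); (4, 5); (3, -6)] [3; 2].
- one_row4 [(1, 12); (2, 11); (3, 10); (5, 6); (7, 9); (4, -8)] [4; 5; 3].
- one_row4 [(1, 16); (2, 15); (3, 14); (4, 13); (5, 6); (8, 10); (9, 12); (7, 11)] [5; 6; 7; 8].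
- one_row4 [(1, 20); (2, 19); (3, 18); (4, 17); (5, 16); (6, 7); (12, 14); (8, 11); (9, 13); (10, 15)] [6; 7; 8; 9; 10].
- one_row4 [(1, 24); (2, 23); (3, 22); (4, 21); (5, 20); (6, 19); (8, 9); (14, 16); (10, 13); (11, 15); (12, 17); (7, -18)] [7; 8; 9; 10; 11; 6].
Qed.

Lemma one_row_4 v : 0 < v -> v mod 2 = 1 -> full4 v ((7 * v + 1) / 8).
Proof.
intros Hv Hodd; set (j := v / 2); set (q := j / 4).
assert (Hj : v = 2 * j + 1) by (unfold j; Z.to_euclidean_division_equations; lia).
assert (Hq : j = 4 * q + j mod 4) by (apply Z.div_mod; lia).
pose proof (Z.mod_pos_bound j 4 ltac:(lia)).
assert (Hb : forall N, 8 * N <= 7 * v + 1 < 8 * N + 8 -> (7 * v + 1) / 8 = N).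
{ intros N HN; symmetry; apply (Z.div_unique _ _ _ (7 * v + 1 - 8 * N)); lia. }
pose proof (Z.div_mod q 2 ltac:(lia)) as Eq; pose proof (Z.mod_pos_bound q 2 ltac:(lia)).
pose proof (Z.div_mod q 4 ltac:(lia)) as Eq4; pose proof (Z.mod_pos_bound q 4 ltac:(lia)).
clearbody q j.
assert (Hr : j mod 4 = 0 \/ j mod 4 = 1 \/ j mod 4 = 2 \/ j mod 4 = 3) by lia.
assert (Hp : q mod 2 = 0 \/ q mod 2 = 1) by lia.
assert (H4 : q mod 4 = 0 \/ q mod 4 = 1 \/ q mod 4 = 2 \/ q mod 4 = 3) by lia.
destruct Hr as [Hr|[Hr|[Hr|Hr]]].
- rewrite (Hb (7 * q + 1)) by lia; destruct (Z_le_dec q 6) as [H6|H6].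
  + apply one_row_4_skolem_small; lia.
  + destruct H4 as [H4|[H4|[H4|H4]]].
    * apply (one_row_4_sk0 (q / 4)); lia.
    * apply (one_row_4_sk1 (q / 4)); lia.
    * apply (one_row_4_sk2 (q / 4)); lia.
    * apply (one_row_4_sk3 (q / 4)); lia.
- rewrite (Hb (7 * q + 2 * 1)) by lia; destruct Hp.
  + apply (one_row_4_r12_even (q / 2)); lia.
  + apply (one_row_4_r12_odd (q / 2)); lia.
- rewrite (Hb (7 * q + 2 * 2)) by lia; destruct Hp.
  + apply (one_row_4_r12_even (q / 2)); lia.
  + apply (one_row_4_r12_odd (q / 2)); lia.
- rewrite (Hb (7 * q + 6)) by lia; destruct Hp.
  + apply (one_row_4_r3_even (q / 2)); lia.
  + apply (one_row_4_r3_odd (q / 2)); lia.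
Qed.

(** * Two rows *)

Definition link (m u r r' : Z) (d : Z * Z) : region := fun k =>
  k = (r, r', fst d mod m, snd d mod u) \/ k = (r', r, (- fst d) mod m, (- snd d) mod u).

Section Links.
Variables (m u : Z) (Hm : 0 < m) (Hu : 0 < u).

Lemma keys_links p q r k : In k (keys m u (p, q, r)) ->
  link m u (prow p) (prow q) (pa q - pa p, pc q - pc p) k \/
  link m u (prow q) (prow r) (pa r - pa q, pc r - pc q) k \/
  link m u (prow p) (prow r) (pa r - pa p, pc r - pc p) k.
Proof.
unfold keys, diff, link; simpl; rewrite !Z.opp_sub_distr, !Z.add_opp_l.
intros H; repeat (destruct H as [H|H]); try contradiction; subst k; tauto.
Qed.

Lemma link_apart r r' d e : r <> r' -> ~ zero2 m u (fst d - fst e, snd d - snd e) ->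
  apart (link m u r r' d) (link m u r r' e).
Proof.
intros Hr H k [->| ->] [E|E]; injection E; intros Ec Ea; try lia; apply H;
  apply mod_eq_divide in Ea; auto; apply mod_eq_divide in Ec; auto; split; simpl; auto;
  [apply (divide_neg _ _ _ Ea)|apply (divide_neg _ _ _ Ec)]; lia.
Qed.

Lemma link_apart_rows r r' s s' d e :
  ~ (r = s /\ r' = s') -> ~ (r = s' /\ r' = s) -> apart (link m u r r' d) (link m u s s' e).
Proof. intros H1 H2 k [->| ->] [E|E]; injection E; intros; lia. Qed.

Lemma link_apart_pure r d e : sep2 m u d e -> apart (link m u r r d) (link m u r r e).
Proof.
intros H; pose proof (pure_apart m u r Hm Hu (eq d) (eq e)) as P.
intros k H1 H2; apply (P ltac:(intros ? ? <- <-; exact H) k); unfold pure_region.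
- destruct H1 as [->| ->]; [exists d|exists (- fst d, - snd d)]; simpl; split; auto.
  right; destruct d; simpl; rewrite !Z.opp_involutive; reflexivity.
- destruct H2 as [->| ->]; [exists e|exists (- fst e, - snd e)]; simpl; split; auto.
  right; destruct e; simpl; rewrite !Z.opp_involutive; reflexivity.
Qed.
End Links.

Definition block2 (r r' d l : Z) : block := (Pt r 0 0, Pt r d 0, Pt r' l 0).

Lemma keys_block2 m r r' d l k : In k (keys m 1 (block2 r r' d l)) ->
  link m 1 r r (d, 0) k \/ link m 1 r r' (l, 0) k \/ link m 1 r r' (l - d, 0) k.
Proof.
intros H; apply keys_links in H; simpl in H; rewrite !Z.sub_0_r in H; tauto.
Qed.

Lemma valid_block2 m r r' d l : 0 < m -> r <> r' -> ~ (m | d) -> valid m 1 (block2 r r' d l).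
Proof.
intros Hm Hr Hd; unfold block2, valid, distinct; simpl; repeat split; auto.
right; left; rewrite Z.sub_0_r; apply mod_ne0; auto.
Qed.

Section TwoRows.
Variable m : Z.
Hypothesis Hm : 0 < m.

Definition pure_half (r r' s : Z) (P : list (Z * Z)) (D : list Z) : Prop :=
  packs m 1 (fun k => (exists d, link m 1 r r (d, 0) k) \/
     exists l, In l (map fst P ++ map snd P) /\ link m 1 r r' (s * l, 0) k)
   (length P + length D).

(** A pair (x, y) of [P] becomes a block with two points of row r at distance x - y, joined to one
    point of r' by the labels x and y. A member d of [D] becomes {0, d, 2d} in row r. With s = 1 for
    row 0 and s = -1 for row 1, both halves of a two-row packing read their labels from row 0 to row
    1, where the two lists must be disjoint. *)
Lemma two_rows_half r r' s (P : list (Z * Z)) (D : list Z) :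
  let Q := map fst P ++ map snd P in
  let E := map (fun p => fst p - snd p) P ++ D ++ map (Z.mul 2) D in
  r <> r' -> s = 1 \/ s = -1 ->
  ForallOrdPairs (fun x y => ~ (m | x - y)) Q -> ForallOrdPairs (sep m) E ->
  (forall d, In d D -> ~ (m | 2 * d)) ->
  pure_half r r' s P D.
Proof.
intros Q E Hr Hs HQ HE HD.
unfold E in HE.
apply pairwise_app_inv in HE as (HE1 & HE2 & HE12).
pose proof (pairwise_app_inv _ _ _ _ HE2) as (HEY & HE2Y & HEYY).
pose proof (pairwise_app_inv _ _ _ _ HQ) as (HQ1 & HQ2 & HQ12).
assert (HsN : forall x y, (m | s * x - s * y) -> (m | x - y)).
{ intros x y H; destruct Hs; subst s; [apply (eq_ind _ _ H); lia|apply (divide_neg _ _ _ H); lia]. }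
assert (Hin : forall p, In p P -> In (fst p) (map fst P) /\ In (snd p) (map snd P)).
{ intros p Hp; split; apply in_map; exact Hp. }
assert (Hsep : forall x y d e, sep m x y -> fst d = x \/ fst d = - x -> fst e = y -> sep2 m 1 d e).
{ intros x y [a c] [a' c'] [S1 S2] Hd He; simpl in *; subst.
  split; intros [Z1 _]; simpl in Z1; destruct Hd; subst; auto.
  - apply S2, (divide_neg _ _ _ Z1); lia.
  - apply S1, (divide_neg _ _ _ Z1); lia. }
apply packs_union with
  (K1 := fun k => exists p, In p P /\ (link m 1 r r (s * (fst p - snd p), 0) k \/
      link m 1 r r' (s * fst p, 0) k \/ link m 1 r r' (s * snd p, 0) k))
  (K2 := fun k => exists y, In y (D ++ map (Z.mul 2) D) /\ link m 1 r r (y, 0) k)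
  (N1 := length P) (N2 := length D); auto.
- apply packs_family with (f := fun p => block2 r r' (s * (fst p - snd p)) (s * fst p))
   (R := fun p q => ~ (m | fst p - fst q) /\ ~ (m | snd p - snd q) /\
       sep m (fst p - snd p) (fst q - snd q)).
  + exact (pairwise_and _ _ _ _ (pairwise_map_inv _ _ _ _ _ HQ1)
      (pairwise_and _ _ _ _ (pairwise_map_inv _ _ _ _ _ HQ2) (pairwise_map_inv _ _ _ _ _ HE1))).
  + intros p Hp; destruct (Hin p Hp) as [Hx Hy]; split.
    * apply valid_block2; auto; intros H; apply (HQ12 _ _ Hx Hy), HsN; rewrite <- Z.mul_sub_distr_l; exact H.
    * intros k Hk; apply keys_block2 in Hk.
      replace (s * fst p - s * (fst p - snd p)) with (s * snd p) in Hk by ring; exists p; auto.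
  + intros p q Hp Hq (R1 & R2 & R3) k Hk Hk'.
    destruct (Hin p Hp) as [Hx Hy], (Hin q Hq) as [Hx' Hy'].
    apply keys_block2 in Hk, Hk'.
    replace (s * fst p - s * (fst p - snd p)) with (s * snd p) in Hk by ring.
    replace (s * fst q - s * (fst q - snd q)) with (s * snd q) in Hk' by ring.
    revert k Hk Hk'; intros k [Hk|[Hk|Hk]] [Hk'|[Hk'|Hk']]; revert k Hk Hk';
    try (apply link_apart_rows; lia); try (apply link_apart; [lia|lia|assumption|intros [Z1 _]; simpl in Z1]).
    * apply link_apart_pure; auto; try lia.
      destruct R3 as [S1 S2]; destruct Hs; subst s; split; intros [Z1 _]; simpl in Z1.
      -- apply S1; apply (eq_ind _ _ Z1); lia.
      -- apply S2; apply (eq_ind _ _ Z1); lia.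
      -- apply S1, (divide_neg _ _ _ Z1); lia.
      -- apply S2, (divide_neg _ _ _ Z1); lia.
    * exact (R1 (HsN _ _ Z1)).
    * exact (HQ12 _ _ Hx Hy' (HsN _ _ Z1)).
    * apply (HQ12 _ _ Hx' Hy), HsN, (divide_neg _ _ _ Z1); lia.
    * exact (R2 (HsN _ _ Z1)).
- apply packs_family with (f := fun y => block1 r (y, 0) (2 * y, 0))
      (R := fun y y' => sep m y y' /\ sep m (2 * y) (2 * y')).
  + exact (pairwise_and _ _ _ _ HEY (pairwise_map_inv _ _ _ _ _ HE2Y)).
  + intros y Hy; assert (Hy2 : In (2 * y) (map (Z.mul 2) D)) by (apply in_map; exact Hy).
    destruct (HEYY y (2 * y) Hy Hy2) as [S1 S2]; split.
    * apply valid_block1; try lia; intros [Z1 _]; simpl in Z1.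
      -- apply S1, (divide_neg _ _ _ Z1); lia.
      -- exact (HD y Hy Z1).
      -- apply S1, (divide_neg _ _ _ Z1); lia.
      -- apply S2; apply (eq_ind _ _ Z1); lia.
    * intros k Hk; apply keys_links in Hk; simpl in Hk; rewrite !Z.sub_0_r in Hk.
      destruct Hk as [Hk|[Hk|Hk]].
      -- exists y; split; [apply in_or_app; left|]; auto.
      -- exists y; split; [apply in_or_app; left|]; auto.
         replace (2 * y - y) with y in Hk by lia; auto.
      -- exists (2 * y); split; [apply in_or_app; right|]; auto.
  + intros y y' Hy Hy' [R1 R3] k Hk Hk'.
    assert (Hy2 : In (2 * y) (map (Z.mul 2) D)) by (apply in_map; exact Hy).
    assert (Hy2' : In (2 * y') (map (Z.mul 2) D)) by (apply in_map; exact Hy').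
    pose proof (HEYY y (2 * y') Hy Hy2') as S1; pose proof (HEYY y' (2 * y) Hy' Hy2) as S2.
    apply keys_links in Hk, Hk'; simpl in Hk, Hk'; rewrite !Z.sub_0_r in Hk, Hk'.
    replace (2 * y - y) with y in Hk by lia; replace (2 * y' - y') with y' in Hk' by lia.
    assert (Hk1 : exists x, (x = y \/ x = 2 * y) /\ link m 1 r r (x, 0) k)
     by (destruct Hk as [Hk|[Hk|Hk]]; [exists y|exists y|exists (2 * y)]; auto).
    assert (Hk1' : exists x, (x = y' \/ x = 2 * y') /\ link m 1 r r (x, 0) k)
     by (destruct Hk' as [Hk'|[Hk'|Hk']]; [exists y'|exists y'|exists (2 * y')]; auto).
    destruct Hk1 as (x & Hx & K1), Hk1' as (x' & Hx' & K2).
    revert k K1 K2 Hk Hk'; enough (apart (link m 1 r r (x, 0)) (link m 1 r r (x', 0))) by (intros; eauto).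
    apply link_apart_pure; auto; try lia; apply sep2_1.
    destruct Hx, Hx'; subst; auto; apply sep_sym; auto.
- intros k (p & Hp & H1) (y & Hy & H2); revert k H1 H2.
  intros k [H1|[H1|H1]] H2; revert k H1 H2; try (apply link_apart_rows; lia).
  apply link_apart_pure; auto; try lia.
  apply (Hsep (fst p - snd p) y); simpl; auto.
  + apply HE12; [apply in_map_iff; exists p; auto|exact Hy].
  + destruct Hs; subst s; [left|right]; lia.
- intros k [(p & Hp & [H|[H|H]])|(y & Hy & H)].
  + left; eauto.
  + right; exists (fst p); split; [apply in_or_app; left; apply Hin|]; auto.
  + right; exists (snd p); split; [apply in_or_app; right; apply Hin|]; auto.
  + left; eauto.
Qed.

Lemma two_rows (P0 P1 : list (Z * Z)) (D0 D1 : list Z) N :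
  let E P D := map (fun p : Z * Z => fst p - snd p) P ++ D ++ map (Z.mul 2) D in
  ForallOrdPairs (fun x y => ~ (m | x - y))
    ((map fst P0 ++ map snd P0) ++ map fst P1 ++ map snd P1) ->
  ForallOrdPairs (sep m) (E P0 D0) -> ForallOrdPairs (sep m) (E P1 D1) ->
  (forall d, In d (D0 ++ D1) -> ~ (m | 2 * d)) ->
  N = (length P0 + length P1 + length D0 + length D1)%nat ->
  packs m 1 (fun k => exists r r' d, (0 <= r < 2) /\ (0 <= r' < 2) /\ k = (r, r', d, 0)) N.
Proof.
intros E HQ HE0 HE1 HD ->.
apply pairwise_app_inv in HQ as (HQ0 & HQ1 & HQ01).
pose proof (two_rows_half 0 1 1 P0 D0 ltac:(lia) ltac:(lia) HQ0 HE0
  ltac:(intros; apply HD, in_or_app; auto)) as F0.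
pose proof (two_rows_half 1 0 (-1) P1 D1 ltac:(lia) ltac:(lia) HQ1 HE1
  ltac:(intros; apply HD, in_or_app; auto)) as F1.
eapply packs_union; [exact F0|exact F1| | |lia].
- assert (Hsw : forall l k, link m 1 1 0 (-1 * l, 0) k -> link m 1 0 1 (l, 0) k).
  { intros l k [->| ->]; unfold link; simpl; [right|left].
    - replace (-1 * l) with (- l) by lia; reflexivity.
    - replace (- (-1 * l)) with l by lia; reflexivity. }
  intros k [(d & H)|(l & Hl & H)] [(d' & H')|(l' & Hl' & H')].
  + revert k H H'; apply link_apart_rows; lia.
  + revert k H H'; apply link_apart_rows; lia.
  + revert k H H'; apply link_apart_rows; lia.
  + apply Hsw in H'; replace (1 * l) with l in H by lia.
    revert k H H'; apply link_apart; try lia; intros [Z1 _]; exact (HQ01 _ _ Hl Hl' Z1).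
- intros k [[(d & H)|(l & _ & H)]|[(d & H)|(l & _ & H)]]; destruct H as [->| ->];
  simpl; rewrite Z.mod_1_r; do 3 eexists; (split; [|split; [|reflexivity]]); lia.
Qed.
End TwoRows.

Definition full2 m N :=
  packs m 1 (fun k => exists r r' d, (0 <= r < 2) /\ (0 <= r' < 2) /\ k = (r, r', d, 0)) (Z.to_nat N).

Ltac two_rows_tac p0 p1 d0 d1 :=
  unfold full2; apply two_rows with (P0 := p0) (P1 := p1) (D0 := d0) (D1 := d1);
  [ lia
  | expand_lists; subst; fop nodiv
  | expand_lists; subst; fop sep_tac
  | expand_lists; subst; fop sep_tac
  | let Hy := fresh in intros ? Hy; in_segs Hy; subst; nodiv
  | do 3 (rewrite ?length_app, ?length_seg; cbn [length]); lia ].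

(** In each row the pairs give the multiples of 4 and half of the odd shifts. [D0] and [D1] consist
    of the other odd shifts, and their doubles are the shifts that are 2 modulo 4. The 8M labels of
    both rows together exhaust the residues modulo m. *)
Lemma two_rows_8 M m : 0 < M -> m = 8 * M -> full2 m (6 * M).
Proof.
intros HM Em.
two_rows_tac
  (seg (fun x => (- (2 * x), 2 * x)) 1 (M + 1) ++
   seg (fun i => (2 * (2 * M - i) + 1, 2 * (2 * M + i))) 0 M)
  (seg (fun x => (1 - 2 * x, 1 + 2 * x)) 1 (M + 1) ++
   seg (fun i => (2 * (2 * M - i) + 1, 2 * (2 * M + i))) (1 - M) 0 ++ [(1, 0)])
  (seg (fun i => 4 * M + 1 - 4 * i) 0 M)
  (seg (fun i => 4 * M + 1 - 4 * i) (1 - M) 0 ++ [4 * M + 1]).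
Qed.

(** Now m / 2 = 2u is 2 modulo 4: it is the double of u in row 0 and the difference of (1, 2u + 1)
    in row 1. The shifts 2 and 4 of row 0 come from one block {0, 2, 4}, which is why x starts at 2
    there. *)
Lemma two_rows_4_even h u m : 1 <= h -> u = 4 * h + 1 -> m = 4 * u -> full2 m (3 * u).
Proof.
intros HM Eu Em.
two_rows_tac
  (seg (fun x => (-1 - 2 * x, -1 + 2 * x)) 2 (2 * h + 1) ++
   seg (fun i => (2 * u - 2 * i - 1, 2 * (u + i))) 0 h ++
   seg (fun j => (2 * u + 2 * j - 1, 2 * (u - j))) 2 (h + 1) ++
   [(-3, 0); (-1, 2 * u - 2)])
  (seg (fun x => (- (2 * x), 2 * x)) 1 (2 * h + 1) ++
   seg (fun i => (2 * u - 2 * i - 1, 2 * (u + i))) h (2 * h + 1) ++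
   seg (fun j => (2 * u + 2 * j - 1, 2 * (u - j))) (h + 1) (2 * h + 1) ++
   [(1, 2 * u + 1)])
  (seg (fun i => 2 * u - 1 - 4 * i) 1 h ++ seg (fun j => 2 * u - 1 + 4 * j) 1 (h + 1) ++ [u; 2])
  (seg (fun i => 2 * u - 1 - 4 * i) (h + 1) (2 * h + 1) ++ seg (fun j => 2 * u - 1 + 4 * j) (h + 1) (2 * h + 1)).
Qed.

Lemma two_rows_4_odd h u m : 1 <= h -> u = 4 * h + 3 -> m = 4 * u -> full2 m (3 * u).
Proof.
intros HM Eu Em.
two_rows_tac
  (seg (fun x => (-1 - 2 * x, -1 + 2 * x)) 2 (2 * h + 2) ++
   seg (fun i => (2 * u - 2 * i - 1, 2 * (u + i))) 0 (h + 1) ++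
   seg (fun j => (2 * u + 2 * j - 1, 2 * (u - j))) 2 (h + 1) ++
   [(-3, 0); (-1, 2 * u - 2)])
  (seg (fun x => (- (2 * x), 2 * x)) 1 (2 * h + 2) ++
   seg (fun i => (2 * u - 2 * i - 1, 2 * (u + i))) (h + 1) (2 * h + 2) ++
   seg (fun j => (2 * u + 2 * j - 1, 2 * (u - j))) (h + 1) (2 * h + 2) ++
   [(1, 2 * u + 1)])
  (seg (fun i => 2 * u - 1 - 4 * i) 1 (h + 1) ++ seg (fun j => 2 * u - 1 + 4 * j) 1 (h + 1) ++ [u; 2])
  (seg (fun i => 2 * u - 1 - 4 * i) (h + 1) (2 * h + 2) ++ seg (fun j => 2 * u - 1 + 4 * j) (h + 2) (2 * h + 2)).
Qed.

Lemma two_rows_12 : full2 12 9.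
Proof.
two_rows_tac [(5, 6); (-1, 4)] [(-2, 2); (3, 8); (-3, 0); (1, 7)] [3; 2] [1].
Qed.

Lemma two_rows_full m : 4 < m -> m mod 4 = 0 -> full2 m (3 * (m / 4)).
Proof.
intros Hm H4; pose proof (Z.div_mod m 4 ltac:(lia)) as Em; set (u := m / 4) in *; clearbody u.
pose proof (Z.div_mod u 4 ltac:(lia)) as Eu; pose proof (Z.mod_pos_bound u 4 ltac:(lia)).
assert (Hr : u mod 4 = 0 \/ u mod 4 = 1 \/ u mod 4 = 2 \/ u mod 4 = 3) by lia.
destruct Hr as [Hr|[Hr|[Hr|Hr]]].
- replace (3 * u) with (6 * (2 * (u / 4))) by lia; apply two_rows_8; lia.
- apply (two_rows_4_even (u / 4)); lia.
- replace (3 * u) with (6 * (2 * (u / 4) + 1)) by lia; apply two_rows_8; lia.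
- destruct (Z.eq_dec u 3) as [->|H3].
  + replace m with 12 by lia; exact two_rows_12.
  + apply (two_rows_4_odd (u / 4)); lia.
Qed.

(** * Rows in three levels *)

(** The 2-colouring of the path formed by the reflections x + y = E and x + y + 1 = E. In terms of q
    = 2x - E modulo 2t they are q -> - q and q -> - 2 - q. The first preserves the distance from q
    to 0, and the second changes it by 2 (away from its fixed points), so the parity of half this
    distance has the two required properties. *)
Definition alpha (t x E : Z) : Z :=
  let q := (2 * x - E) mod (2 * t) in (Z.min q (2 * t - q) / 2) mod 2.

Lemma alpha_01 t x E : alpha t x E = 0 \/ alpha t x E = 1.
Proof. unfold alpha; pose proof (Z.mod_pos_bound (Z.min ((2 * x - E) mod (2 * t)) (2 * t - (2 * x - E) mod (2 * t)) / 2) 2); lia. Qed.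

Lemma mod_sum t a b c : 0 < t -> (2 * t | a + b - c) -> 
  exists k, a mod (2 * t) + b mod (2 * t) = c + k * (2 * t).
Proof.
intros Ht [z Hz]; pose proof (Z.div_mod a (2 * t) ltac:(lia)); pose proof (Z.div_mod b (2 * t) ltac:(lia)).
exists (z - a / (2 * t) - b / (2 * t)); nia.
Qed.

Lemma alpha_same t x y E : 0 < t -> (t | E - (x + y)) -> alpha t x E = alpha t y E.
Proof.
intros Ht H; unfold alpha.
destruct (mod_sum t (2 * x - E) (2 * y - E) 0 Ht) as [k Hk].
{ destruct H as [z Hz]; exists (- z); lia. }
pose proof (Z.mod_pos_bound (2 * x - E) (2 * t) ltac:(lia)).
pose proof (Z.mod_pos_bound (2 * y - E) (2 * t) ltac:(lia)).
set (q := (2 * x - E) mod (2 * t)) in *; set (r := (2 * y - E) mod (2 * t)) in *.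
assert (k = 0 \/ k = 1) by nia; assert (Hm : Z.min q (2 * t - q) = Z.min r (2 * t - r)) by lia.
rewrite Hm; reflexivity.
Qed.

Lemma alpha_opposite t x y E : 0 < t -> (t | E - (x + y + 1)) -> ~ (t | x - y) ->
  alpha t x E + alpha t y E = 1.
Proof.
intros Ht H Hxy; unfold alpha.
destruct (mod_sum t (2 * x - E) (2 * y - E) (-2) Ht) as [k Hk].
{ destruct H as [z Hz]; exists (- z); lia. }
assert (Hne : (2 * x - E) mod (2 * t) <> (2 * y - E) mod (2 * t)).
{ intros E0; apply mod_eq_divide in E0; [|lia]; apply Hxy.
  destruct E0 as [z Hz]; exists z; lia. }
pose proof (Z.mod_pos_bound (2 * x - E) (2 * t) ltac:(lia)).
pose proof (Z.mod_pos_bound (2 * y - E) (2 * t) ltac:(lia)).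
set (q := (2 * x - E) mod (2 * t)) in *; set (r := (2 * y - E) mod (2 * t)) in *; clearbody q r.
assert (Hk' : k = 1 \/ k = 2) by nia.
destruct Hk' as [-> | ->]; [|lia].
destruct (Z.min_spec q (2 * t - q)) as [[? ->]|[? ->]], (Z.min_spec r (2 * t - r)) as [[? ->]|[? ->]];
  Z.to_euclidean_division_equations; lia.
Qed.

Definition nx (l : Z) : Z := if l =? 2 then 0 else l + 1.

Lemma nx_spec l : 0 <= l < 3 -> (l = 0 /\ nx l = 1) \/ (l = 1 /\ nx l = 2) \/ (l = 2 /\ nx l = 0).
Proof. unfold nx; destruct (Z.eqb_spec l 2); lia. Qed.

Fixpoint pairs (n : nat) : list (Z * Z) :=
  match n with
  | O => []
  | S n => pairs n ++ map (fun x => (x, Z.of_nat n)) (zrange 0 (Z.of_nat n))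
  end.

Lemma in_pairs n x y : In (x, y) (pairs n) <-> 0 <= x < y /\ y < Z.of_nat n.
Proof.
induction n as [|n IH]; simpl pairs; [simpl; lia|].
rewrite in_app_iff, IH, in_map_iff; split.
- intros [H|(z & Hz & H)]; [lia|injection Hz as <- <-; apply in_zrange in H; lia].
- intros H; destruct (Z.eq_dec y (Z.of_nat n)) as [->|]; [right|left; lia].
  exists x; split; [reflexivity|apply in_zrange; lia].
Qed.

Lemma NoDup_zrange lo hi : NoDup (zrange lo hi).
Proof.
apply Injective_map_NoDup; [intros a b; lia|apply seq_NoDup].
Qed.

Lemma NoDup_prod A B (l : list A) (l' : list B) : NoDup l -> NoDup l' -> NoDup (list_prod l l').
Proof.
intros Hl Hl'; induction Hl as [|a l Ha Hl IH]; simpl; [constructor|].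
apply NoDup_app; [|exact IH|].
- apply Injective_map_NoDup; [intros x y E; congruence|exact Hl'].
- intros [x y] H1 H2; apply in_map_iff in H1 as (z & Hz & _); apply in_prod_iff in H2.
  injection Hz as -> ->; tauto.
Qed.

Lemma NoDup_pairs n : NoDup (pairs n).
Proof.
induction n as [|n IH]; simpl; [constructor|].
apply NoDup_app; [exact IH| |].
- apply Injective_map_NoDup; [intros a b E; congruence|apply NoDup_zrange].
- intros [x y] H1 H2; apply in_pairs in H1; apply in_map_iff in H2 as (z & Hz & _).
  injection Hz as <- <-; lia.
Qed.

Lemma length_pairs n : (2 * length (pairs n) = n * (n - 1))%nat.
Proof.
induction n as [|n IH]; [reflexivity|].
simpl pairs; rewrite length_app, length_map, length_zrange; destruct n; simpl in *; lia.
Qed.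

(** * The design shared by all numbers of rows 3t *)

Section Design.
Variables (m u t : Z) (E : Z -> Z -> Z) (A : Z -> Z -> Z -> Z -> Z -> Prop).
Hypotheses (Hm : 0 < m) (Hu : 0 < u) (Ht : 0 < t).

Definition flat l x y : region := fun k => exists a c,
  k = (3 * x + l, 3 * y + l, a, c) \/ k = (3 * y + l, 3 * x + l, a, c).

Definition side l x z p q : region := fun k => 0 <= p < m /\ 0 <= q < u /\
  link m u (3 * x + l) (3 * z + nx l) (p, q) k.

(* [E l] is the map [s_l]. The pair [{x, y}] shares the keys towards a row [z]
   with [E l z = x + y] or [x + y + 1] with the other pairs of that sum; [A]
   tells which ones belong to the sum [x + y]. *)
Definition owned l x y : region := fun k => flat l x y k \/
  exists a z p q, (a = x \/ a = y) /\ 0 <= z < t /\ side l a z p q k /\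
    ((t | E l z - (x + y)) /\ A l a z p q \/ (t | E l z - (x + y + 1)) /\ ~ A l a z p q).

Lemma side_inj l a z p q l' a' z' p' q' k : 0 <= l < 3 -> 0 <= l' < 3 ->
  side l a z p q k -> side l' a' z' p' q' k ->
  l = l' /\ a = a' /\ z = z' /\ p = p' /\ q = q'.
Proof.
intros Hl Hl' (Hp & Hq & H) (Hp' & Hq' & H').
pose proof (nx_spec l Hl); pose proof (nx_spec l' Hl').
assert (Hneg : forall N x y, 0 < N -> 0 <= x < N -> 0 <= y < N -> (- x) mod N = (- y) mod N -> x = y).
{ intros N x y HN Hx Hy HE; apply mod_eq_divide in HE; [|exact HN].
  apply divide_small in HE; lia. }
destruct H as [H|H], H' as [H'|H']; rewrite H in H'; simpl in H'; injection H' as Er Es Ep Eq; try lia.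
- rewrite !Z.mod_small in Ep, Eq by lia; lia.
- apply Hneg in Ep; auto; apply Hneg in Eq; auto; lia.
Qed.

Lemma flat_side l x y l' a z p q k : 0 <= l < 3 -> 0 <= l' < 3 ->
  flat l x y k -> side l' a z p q k -> False.
Proof.
intros Hl Hl' (b & c & H) (_ & _ & H'); pose proof (nx_spec l' Hl').
destruct H as [->| ->], H' as [H'|H']; injection H'; intros; lia.
Qed.

(** A key towards the next level determines l, a, z and its label. Then [A] decides between the sums
    E l z and E l z - 1, and the sum fixes the partner of a. *)
Lemma owned_apart l x y l' x' y' : 0 <= l < 3 -> 0 <= l' < 3 ->
  0 <= x < t -> 0 <= y < t -> 0 <= x' < t -> 0 <= y' < t ->
  ~ (l = l' /\ (x = x' /\ y = y' \/ x = y' /\ y = x')) ->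
  apart (owned l x y) (owned l' x' y').
Proof.
intros Hl Hl' Hx Hy Hx' Hy' Hne k [Hf|(a & z & p & q & Ha & Hz & Hs & Hown)]
  [Hf'|(a' & z' & p' & q' & Ha' & Hz' & Hs' & Hown')].
- destruct Hf as (b & c & [->| ->]), Hf' as (b' & c' & [H|H]); injection H; intros; lia.
- exact (flat_side _ _ _ _ _ _ _ _ _ Hl Hl' Hf Hs').
- exact (flat_side _ _ _ _ _ _ _ _ _ Hl' Hl Hf' Hs).
- destruct (side_inj _ _ _ _ _ _ _ _ _ _ _ Hl Hl' Hs Hs') as (<- & <- & <- & <- & <-).
  destruct Hown as [[D H]|[D H]], Hown' as [[D' H']|[D' H']]; try tauto;
  pose proof (Z.divide_sub_r _ _ _ D D') as D2; apply divide_small2 in D2; try lia;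
  destruct Ha, Ha'; subst; lia.
Qed.

(** The degenerate pairs x = y own the shifts inside a row and the labels whose partner is the row
    itself. They form the remainder, which has a different structure for odd and for even t. *)
Lemma design c N :
  (forall l x y, 0 <= l < 3 -> 0 <= x < y -> y < t -> packs m u (owned l x y) c) ->
  packs m u (fun k => exists l x, 0 <= l < 3 /\ 0 <= x < t /\ owned l x x k) N ->
  packs m u (fun k => exists p q a b, 0 <= p < 3 * t /\ 0 <= q < 3 * t /\ k = (p, q, a, b))
    (3 * (length (pairs (Z.to_nat t)) * c) + N).
Proof.
intros Hmain Hleft.
set (K1 := fun k => exists l, 0 <= l < 0 + Z.of_nat 3 /\
   exists xy, In xy (pairs (Z.to_nat t)) /\ owned l (fst xy) (snd xy) k).
eapply packs_union with (K1 := K1); [|exact Hleft| | |reflexivity].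
- apply packs_range.
  + intros l Hl; apply packs_list; [apply NoDup_pairs| |].
    * intros [x y] H; apply in_pairs in H; simpl; apply Hmain; lia.
    * intros [x y] [x' y'] H H' Hne; apply in_pairs in H, H'; simpl.
      apply owned_apart; try lia.
      intros [_ [[-> ->]|[-> ->]]]; [congruence|lia].
  + intros l l' Hl Hl' Hlt k ([x y] & H & Hk) ([x' y'] & H' & Hk').
    apply in_pairs in H, H'; simpl in Hk, Hk'; revert k Hk Hk'; apply owned_apart; lia.
- intros k (l & Hl & [x y] & H & Hk) (l' & x' & Hl' & Hx' & Hk').
  apply in_pairs in H; simpl in Hk; revert k Hk Hk'; apply owned_apart; lia.
- assert (Hrows : forall l x y k, 0 <= l < 3 -> 0 <= x < t -> 0 <= y < t -> owned l x y k ->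
    exists p q a b, 0 <= p < 3 * t /\ 0 <= q < 3 * t /\ k = (p, q, a, b)).
  { intros l x y k Hl Hx Hy [(a & b & [->| ->])|(a & z & p & q & Ha & Hz & Hs & _)].
    - do 4 eexists; split; [|split; [|reflexivity]]; lia.
    - do 4 eexists; split; [|split; [|reflexivity]]; lia.
    - pose proof (nx_spec l Hl).
      destruct Hs as (_ & _ & [->| ->]); do 4 eexists; (split; [|split; [|reflexivity]]); lia. }
  intros k [(l & Hl & [x y] & H & Hk)|(l & x & Hl & Hx & Hk)].
  + apply in_pairs in H; apply (Hrows l x y); auto; lia.
  + apply (Hrows l x x); auto.
Qed.
End Design.

Lemma neg_mod_mod p m : 0 < m -> (- (p mod m)) mod m = (- p) mod m.
Proof.
intros Hm; apply divide_mod_eq; auto; pose proof (Z.div_mod p m ltac:(lia)).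
exists (p / m); nia.
Qed.

Lemma link_mod m u r r' p q k : 0 < m -> 0 < u ->
  link m u r r' (p, q) k -> link m u r r' (p mod m, q mod u) k.
Proof.
intros Hm Hu [->| ->]; [left|right]; simpl; rewrite ?Z.mod_mod, ?neg_mod_mod by lia; reflexivity.
Qed.

Lemma link_side m u l x z p q k : 0 < m -> 0 < u ->
  link m u (3 * x + l) (3 * z + nx l) (p, q) k -> side m u l x z (p mod m) (q mod u) k.
Proof.
intros Hm Hu H; split; [apply Z.mod_pos_bound; exact Hm|split; [apply Z.mod_pos_bound; exact Hu|]].
apply link_mod; auto.
Qed.

Definition wedge_block l x y z (d e : Z * Z) : block :=
  (Pt (3 * x + l) 0 0, Pt (3 * y + l) (fst d) (snd d), Pt (3 * z + nx l) (fst e) (snd e)).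

Lemma valid_wedge m u l x y z d e : 0 <= l < 3 -> x <> y -> valid m u (wedge_block l x y z d e).
Proof.
intros Hl Hxy; pose proof (nx_spec l Hl).
unfold wedge_block, valid, distinct; simpl; repeat split; left; lia.
Qed.

Lemma wedge_keys m u l x y z d e k : In k (keys m u (wedge_block l x y z d e)) ->
  link m u (3 * x + l) (3 * y + l) d k \/
  link m u (3 * x + l) (3 * z + nx l) e k \/
  link m u (3 * y + l) (3 * z + nx l) (fst e - fst d, snd e - snd d) k.
Proof.
destruct d as [d d'], e as [e e']; intros H; apply keys_links in H; simpl in *.
rewrite !Z.sub_0_r in H; tauto.
Qed.

Lemma link_flat m u l x y d k : link m u (3 * x + l) (3 * y + l) d k -> flat l x y k.
Proof. intros [->| ->]; do 2 eexists; [left|right]; reflexivity. Qed.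

Lemma wedge_disjoint m u l x y z z' d d' e e' : 0 < m -> 0 < u -> 0 <= l < 3 -> x <> y ->
  ~ zero2 m u (fst d - fst d', snd d - snd d') ->
  (z = z' -> ~ zero2 m u (fst e - fst e', snd e - snd e') /\
     ~ zero2 m u (fst e - fst d - (fst e' - fst d'), snd e - snd d - (snd e' - snd d'))) ->
  disjoint_keys m u (wedge_block l x y z d e) (wedge_block l x y z' d' e').
Proof.
intros Hm Hu Hl Hxy Hd He k Hk Hk'; pose proof (nx_spec l Hl).
apply wedge_keys in Hk, Hk'.
destruct Hk as [Hk|[Hk|Hk]], Hk' as [Hk'|[Hk'|Hk']]; revert k Hk Hk';
  try (apply link_apart_rows; lia).
- apply link_apart; auto; lia.
- destruct (Z.eq_dec z z') as [<-|Hz]; [|apply link_apart_rows; lia].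
  apply link_apart; auto; [lia|apply He; reflexivity].
- destruct (Z.eq_dec z z') as [<-|Hz]; [|apply link_apart_rows; lia].
  apply link_apart; auto; [lia|apply He; reflexivity].
Qed.

(** The remainder on three rows when t is odd: all shifts inside the rows, and all labels from a
    level to the next except [mu], which is lent to the sum x + y + 1. *)
Definition filler_region m mu : region := fun k =>
  (exists r c, 0 <= r < 3 /\ k = (r, r, c, 0)) \/
  exists l p, 0 <= l < 3 /\ 0 <= p < m /\ p <> mu /\ link m 1 l (nx l) (p, 0) k.

(** * An odd number of rows on each level *)

Section OddDesign.
Variables (h s : Z).
Hypotheses (Hh : 0 < h) (Hs : 0 < s) (Hodd : s mod 2 = 1).

(** The remainders have to close up after three levels. Following 2x = E l z, and also 2x + 1 = E l
    z, through the multipliers a, b, c gives the identity modulo s as soon as abc = 8 and 4 + 2a +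
    ab = 0; the solution a = -1, b = 2, c = -4 is used. The representatives are even (s - 1 stands
    for -1), and with the summand s in [sum_at] every sum is odd, so that [alpha] takes one value on
    all remainders of the same kind. *)
Definition mult l := if l =? 0 then s - 1 else if l =? 1 then 2 else -4.
Definition sum_at l z := s + mult l * z.

Lemma mult_spec l : 0 <= l < 3 ->
  (l = 0 /\ nx l = 1 /\ mult l = s - 1) \/ (l = 1 /\ nx l = 2 /\ mult l = 2) \/
  (l = 2 /\ nx l = 0 /\ mult l = -4).
Proof. intros Hl; assert (E : l = 0 \/ l = 1 \/ l = 2) by lia; destruct E as [->|[->| ->]]; cbn; lia. Qed.

Lemma odd_half : exists g, s = 2 * g + 1 /\ 0 <= g.
Proof. exists (s / 2); pose proof (Z.div_mod s 2 ltac:(lia)); lia. Qed.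

Lemma sum_at_onto l e : 0 <= l < 3 -> exists z, 0 <= z < s /\ (s | sum_at l z - e).
Proof.
intros Hl; destruct odd_half as (g & Hg & _).
assert (Hinv : exists i, (s | mult l * i - 1)).
{ destruct (mult_spec l Hl) as [(_ & _ & ->)|[(_ & _ & ->)|(_ & _ & ->)]].
  - exists (-1); exists (-1); lia.
  - exists (g + 1); exists 1; lia.
  - exists (- (g + 1) * (g + 1)); exists (s + 2); nia. }
destruct Hinv as [i [k Hk]]; exists ((i * e) mod s); split; [apply Z.mod_pos_bound; exact Hs|].
pose proof (Z.div_mod (i * e) s ltac:(lia)) as D; unfold sum_at.
set (r := (i * e) mod s) in *; set (w := i * e / s) in *; clearbody r w.
exists (1 + k * e - mult l * w).
replace r with (i * e - s * w) by lia; transitivity (s + (mult l * i - 1) * e - mult l * s * w); [ring|rewrite Hk; ring].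
Qed.

Definition odd_side l a z (p q : Z) : Prop := p <> h * alpha s a (sum_at l z).

Let m := 2 * h.

(** For the shifts d other than h, the labels [lam d] and [lam d - d], relative to h alpha, both run
    through all nonzero residues: they are 2d + 1 and d + 1 below h, 2d and d above. This fits one
    row z because [alpha] agrees at x and y. The shift h goes to z2 with the two omitted labels,
    which differ by h because [alpha] is opposite there. *)
Lemma odd_pair l x y : 0 <= l < 3 -> 0 <= x < y -> y < s ->
  packs m 1 (owned m 1 s sum_at odd_side l x y) (Z.to_nat m).
Proof.
intros Hl Hxy Hy.
destruct (sum_at_onto l (x + y) Hl) as (z & Hz & Dz).
destruct (sum_at_onto l (x + y + 1) Hl) as (z2 & Hz2 & Dz2).
pose proof (alpha_same s x y _ Hs Dz) as Hal.
assert (Nxy : ~ (s | x - y)) by (intros D; apply divide_small in D; lia).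
pose proof (alpha_opposite s x y _ Hs Dz2 Nxy) as Hal2.
pose proof (alpha_01 s x (sum_at l z)); pose proof (alpha_01 s x (sum_at l z2)).
assert (Hzz : z <> z2).
{ intros <-; pose proof (Z.divide_sub_r _ _ _ Dz Dz2) as D.
  replace (sum_at l z - (x + y) - (sum_at l z - (x + y + 1))) with 1 in D by lia.
  destruct D as [w Hw]; nia. }
set (a := alpha s x (sum_at l z)) in *.
set (a2 := alpha s x (sum_at l z2)) in *.
set (zz := fun d => if d =? h then z2 else z).
set (lam := fun d => if d =? h then h * a2 else (if d <? h then 2 * d + 1 else 2 * d) + h * a).
assert (Hm : 0 < m) by (unfold m; lia).
apply packs_blocks with (f := fun d => wedge_block l x y (zz d) (d, 0) (lam d, 0)) (lo := 0).
- intros d Hd; split; [apply valid_wedge; lia|].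
  intros k Hk; apply wedge_keys in Hk; simpl in Hk; destruct Hk as [Hk|[Hk|Hk]].
  + left; exact (link_flat _ _ _ _ _ _ _ Hk).
  + right; apply link_side in Hk; try lia; rewrite Z.mod_1_r in Hk.
    exists x, (zz d), (lam d mod m), 0.
    split; [auto|split; [unfold zz; destruct (d =? h); lia|split; [exact Hk|]]].
    unfold zz, lam, odd_side in *; destruct (Z.eqb_spec d h) as [->|Hdh].
    * right; split; [exact Dz2|]; intros HN; apply HN; fold a2; apply Z.mod_small; unfold m; nia.
    * left; split; [exact Dz|]; fold a; intros E.
      rewrite <- (Z.mod_small (h * a) m) in E at 2 by (unfold m; nia).
      apply mod_eq_divide in E; [|exact Hm]; unfold m in *; revert E; destruct (Z.ltb_spec d h); intros E; small_divide E.
  + right; rewrite ?Z.sub_diag in Hk; apply link_side in Hk; try lia; rewrite Z.mod_1_r in Hk.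
    exists y, (zz d), ((lam d - d) mod m), 0.
    split; [auto|split; [unfold zz; destruct (d =? h); lia|split; [exact Hk|]]].
    unfold zz, lam, odd_side in *; destruct (Z.eqb_spec d h) as [->|Hdh].
    * right; split; [exact Dz2|]; intros HN; apply HN.
      replace (alpha s y (sum_at l z2)) with (1 - a2) by lia.
      replace (h * (1 - a2)) with ((h * (1 - a2)) mod m) by (apply Z.mod_small; unfold m; nia).
      apply divide_mod_eq; [exact Hm|]; exists (a2 - 1); unfold m; lia.
    * left; split; [exact Dz|]; rewrite <- Hal; fold a; intros E.
      rewrite <- (Z.mod_small (h * a) m) in E at 2 by (unfold m; nia).
      apply mod_eq_divide in E; [|exact Hm]; unfold m in *; revert E; destruct (Z.ltb_spec d h); intros E; small_divide E.
- intros d d' Hd Hd' Hlt; apply wedge_disjoint; try lia; simpl.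
  + intros [D _]; simpl in D; unfold m in *; small_divide D.
  + unfold zz, lam; destruct (Z.eqb_spec d h), (Z.eqb_spec d' h); try (intros; lia); intros _;
    destruct (Z.ltb_spec d h), (Z.ltb_spec d' h); try lia;
    split; intros [D _]; simpl in D; unfold m in *; small_divide D.
Qed.

(** The closed chains of rows, one on each level: [row_u] follows 2x = E l z, and [row_v] follows 2x
    + 1 = E l z. The factor (s + 1) / 2 in the latter is the inverse of 2 modulo s. *)
Definition row_u x r := if r =? 0 then x else (- 2 * x) mod s.
Definition row_v x r :=
  if r =? 0 then x else if r =? 1 then (- 2 * x - 1) mod s else ((- 4 * x - 1) * ((s + 1) / 2)) mod s.

Lemma mod_split a : exists w, a mod s = a - s * w /\ 0 <= a mod s < s.
Proof.
exists (a / s); pose proof (Z.div_mod a s ltac:(lia)); pose proof (Z.mod_pos_bound a s Hs); lia.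
Qed.

Lemma even_odd_multiple c x : (s | c) -> c = 2 * x -> (2 * s | c).
Proof.
intros H ->; apply divide_twice in H; auto; destruct H as [k ->]; exists k; ring.
Qed.

Lemma row_u_spec l x : 0 <= l < 3 -> 0 <= x < s ->
  0 <= row_u x l < s /\ (s | sum_at l (row_u x (nx l)) - 2 * row_u x l) /\
  alpha s (row_u x l) (sum_at l (row_u x (nx l))) = ((s - 1) / 2) mod 2.
Proof.
intros Hl Hx; destruct odd_half as (g & Hg & Hg0); destruct (mod_split (- 2 * x)) as (w & Ew & Bw).
assert (D : (s | sum_at l (row_u x (nx l)) - 2 * row_u x l)).
{ unfold sum_at, row_u.
  destruct (mult_spec l Hl) as [(-> & -> & ->)|[(-> & -> & ->)|(-> & -> & ->)]]; cbn -[Z.mul Z.add Z.sub Z.modulo].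
  - rewrite Ew; exists (1 - 2 * x - (s - 1) * w); ring.
  - exists 1; ring.
  - rewrite Ew; exists (1 + 2 * w); ring. }
split; [|split; [exact D|]].
{ unfold row_u; destruct (l =? 0); lia. }
unfold alpha.
(* A multiple of s that is odd is s modulo 2s; this is where the oddness of the sums is used. *)
assert (E : (2 * row_u x l - sum_at l (row_u x (nx l))) mod (2 * s) = s).
{ rewrite <- (Z.mod_small s (2 * s)) at 2 by lia; apply divide_mod_eq; [lia|].
  apply (even_odd_multiple _ (row_u x l - s - (if l =? 0 then g else if l =? 1 then 1 else -2) * row_u x (nx l))).
  - destruct D as [k Hk]; exists (- k - 1); lia.
  - unfold sum_at.
    destruct (mult_spec l Hl) as [(-> & -> & ->)|[(-> & -> & ->)|(-> & -> & ->)]]; cbn -[Z.mul Z.add Z.sub Z.modulo row_u]; try ring.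
    replace (s - 1) with (2 * g) by lia; ring. }
rewrite E; replace (Z.min s (2 * s - s)) with s by lia.
f_equal; Z.to_euclidean_division_equations; lia.
Qed.

Lemma row_v_spec l x : 0 <= l < 3 -> 0 <= x < s ->
  0 <= row_v x l < s /\ (s | sum_at l (row_v x (nx l)) - (2 * row_v x l + 1)) /\
  alpha s (row_v x l) (sum_at l (row_v x (nx l))) = 0.
Proof.
intros Hl Hx; destruct odd_half as (g & Hg & Hg0).
assert (Eg : (s + 1) / 2 = g + 1) by (symmetry; apply (Z.div_unique _ _ _ 0); lia).
destruct (mod_split (- 2 * x - 1)) as (w & Ew & Bw).
destruct (mod_split ((- 4 * x - 1) * (g + 1))) as (w2 & Ew2 & Bw2).
assert (D : (s | sum_at l (row_v x (nx l)) - (2 * row_v x l + 1))).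
{ unfold sum_at, row_v; rewrite Eg.
  destruct (mult_spec l Hl) as [(-> & -> & ->)|[(-> & -> & ->)|(-> & -> & ->)]]; cbn -[Z.mul Z.add Z.sub Z.modulo].
  - rewrite Ew; exists (1 - 2 * x - 1 - (s - 1) * w); ring.
  - rewrite Ew, Ew2; exists (1 - 4 * x - 1 - 2 * w2 + 2 * w); rewrite Hg; ring.
  - rewrite Ew2; exists (1 + 4 * x + 1 + 2 * w2); rewrite Hg; ring. }
split; [|split; [exact D|]].
{ unfold row_v; rewrite Eg; destruct (l =? 0), (l =? 1); lia. }
unfold alpha.
assert (E : (2 * row_v x l - sum_at l (row_v x (nx l))) mod (2 * s) = 2 * s - 1).
{ rewrite <- (Z.mod_small (2 * s - 1) (2 * s)) by lia; apply divide_mod_eq; [lia|].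
  apply (even_odd_multiple _ (row_v x l - 3 * g - 1 - (if l =? 0 then g else if l =? 1 then 1 else -2) * row_v x (nx l))).
  - destruct D as [k Hk]; exists (- k - 2); lia.
  - unfold sum_at.
    destruct (mult_spec l Hl) as [(-> & -> & ->)|[(-> & -> & ->)|(-> & -> & ->)]]; cbn -[Z.mul Z.add Z.sub Z.modulo row_v]; rewrite Hg; ring. }
rewrite E; replace (Z.min (2 * s - 1) (2 * s - (2 * s - 1))) with 1 by lia; reflexivity.
Qed.

Lemma row_u_inj l x x' : 0 <= l < 3 -> 0 <= x < s -> 0 <= x' < s -> row_u x l = row_u x' l -> x = x'.
Proof.
intros Hl Hx Hx'; unfold row_u; destruct (l =? 0); auto; intros E.
apply mod_eq_divide in E; auto.
assert (D : (s | x - x')).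
{ apply divide_twice; auto; apply (divide_neg _ _ _ E); lia. }
small_divide D.
Qed.

Lemma row_v_inj l x x' : 0 <= l < 3 -> 0 <= x < s -> 0 <= x' < s -> row_v x l = row_v x' l -> x = x'.
Proof.
intros Hl Hx Hx'; unfold row_v; destruct (l =? 0); auto.
destruct odd_half as (g & Hg & Hg0).
assert (Eg : (s + 1) / 2 = g + 1) by (symmetry; apply (Z.div_unique _ _ _ 0); lia).
assert (D : (s | 2 * (x - x')) -> x = x').
{ intros D; apply divide_twice in D; auto; small_divide D. }
destruct (l =? 1); intros E; apply mod_eq_divide in E; auto; apply D.
- apply (divide_neg _ _ _ E); lia.
- rewrite Eg in E; destruct E as [k Hk]; exists (- k - 2 * (x - x')); rewrite Hg at 1; nia.
Qed.

(** The parts of [owned l x x] that belong to the sums 2x and 2x + 1. They are separated because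
    they close up along different chains. *)
Definition owned_u l x : region := fun k => flat l x x k \/
  exists z p q, side m 1 l x z p q k /\ (s | sum_at l z - (x + x)) /\ odd_side l x z p q /\ 0 <= z < s.
Definition owned_v l x : region := fun k => 
  exists z p q, side m 1 l x z p q k /\ (s | sum_at l z - (x + x + 1)) /\ ~ odd_side l x z p q /\ 0 <= z < s.

Lemma owned_u_owned l x k : owned_u l x k -> owned m 1 s sum_at odd_side l x x k.
Proof.
intros [H|(z & p & q & H1 & H2 & H3 & H4)]; [left; exact H|].
right; exists x, z, p, q; split; [auto|split; [exact H4|split; [exact H1|left; auto]]].
Qed.

Lemma owned_v_owned l x k : owned_v l x k -> owned m 1 s sum_at odd_side l x x k.
Proof.
intros (z & p & q & H1 & H2 & H3 & H4).
right; exists x, z, p, q; split; [auto|split; [exact H4|split; [exact H1|right; auto]]].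
Qed.

Lemma owned_u_v l x l' x' : 0 <= l < 3 -> 0 <= l' < 3 -> apart (owned_u l x) (owned_v l' x').
Proof.
intros Hl Hl' k [H|(z & p & q & H1 & H2 & H3 & H4)] (z' & p' & q' & H1' & H2' & H3' & H4').
- exact (flat_side m 1 _ _ _ _ _ _ _ _ _ Hl Hl' H H1').
- assert (Hm : 0 < m) by (unfold m; lia).
  destruct (side_inj m 1 Hm Z.lt_0_1 _ _ _ _ _ _ _ _ _ _ _ Hl Hl' H1 H1') as (<- & <- & <- & <- & <-); tauto.
Qed.

(** Each x gives a filler on the chain [row_u] and a single block on the chain [row_v]. In the
    latter only the lent label remains on each step; it is 0 there, and three labels 0 do form a
    triangle. *)
Lemma odd_left NF : packs m 1 (filler_region m (h * (((s - 1) / 2) mod 2))) NF ->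
  packs m 1 (fun k => exists l x, 0 <= l < 3 /\ 0 <= x < s /\ owned m 1 s sum_at odd_side l x x k)
    (Z.to_nat s * (NF + 1)).
Proof.
intros HF.
assert (Hm : 0 < m) by (unfold m; lia).
set (U := fun x k => exists l, 0 <= l < 3 /\ owned_u l (row_u x l) k).
set (V := fun x k => exists l, 0 <= l < 3 /\ owned_v l (row_v x l) k).
eapply packs_sub; [apply (packs_range m 1 (fun x k => U x k \/ V x k) (NF + 1) 0)|].
- intros x Hx; apply packs_union with (K1 := U x) (K2 := V x) (N1 := NF) (N2 := 1%nat); auto.
  + eapply packs_sub; [apply packs_rows with (n := 3) (f := fun r => 3 * row_u x r + r); [| |exact HF]|].
    * intros p q a c [(r & c' & Hr & E)|(l & c' & Hl & Hc & Hmu & [E|E])]; injection E; intros; try lia;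
      pose proof (nx_spec l Hl); lia.
    * intros p q Hp Hq; lia.
    * intros [[[p q] a] c] (p' & q' & -> & -> & H).
      destruct H as [(r & c' & Hr & E)|(l & c' & Hl & Hc & Hmu & E)].
      -- injection E as -> -> -> ->; exists r; split; [exact Hr|left]; do 2 eexists; left; reflexivity.
      -- exists l; split; [exact Hl|right].
         destruct (row_u_spec l x Hl ltac:(lia)) as (S1 & S2 & S3).
         pose proof (nx_spec l Hl) as Hnx.
         destruct (row_u_spec (nx l) x ltac:(lia) ltac:(lia)) as (S4 & _ & _).
         exists (row_u x (nx l)), c', 0; split; [|split; [|split; [|exact S4]]].
         ++ split; [exact Hc|split; [lia|]].
            destruct E as [E|E]; [left|right]; injection E as -> -> -> ->; reflexivity.
         ++ replace (row_u x l + row_u x l) with (2 * row_u x l) by ring; exact S2.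
         ++ unfold odd_side; rewrite S3; exact Hmu.
  + eapply packs_sub; [apply packs_one with (b := (Pt (3 * row_v x 0 + 0) 0 0, Pt (3 * row_v x 1 + 1) 0 0, Pt (3 * row_v x 2 + 2) 0 0))|].
    * unfold valid, distinct; simpl; repeat split; left; lia.
    * assert (HV : forall l k, 0 <= l < 3 -> link m 1 (3 * row_v x l + l) (3 * row_v x (nx l) + nx l) (0, 0) k -> V x k).
      { intros l k Hl Hk; exists l; split; [exact Hl|].
        destruct (row_v_spec l x Hl ltac:(lia)) as (S1 & S2 & S3).
        pose proof (nx_spec l Hl) as Hnx.
        destruct (row_v_spec (nx l) x ltac:(lia) ltac:(lia)) as (S4 & _ & _).
        exists (row_v x (nx l)), 0, 0; split; [|split; [|split; [|exact S4]]].
        - split; [lia|split; [lia|exact Hk]].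
        - replace (row_v x l + row_v x l + 1) with (2 * row_v x l + 1) by ring; exact S2.
        - unfold odd_side; rewrite S3; lia. }
      intros k Hk; apply keys_links in Hk; simpl in Hk; rewrite !Z.sub_diag in Hk.
      destruct Hk as [Hk|[Hk|Hk]].
      -- apply (HV 0); [lia|exact Hk].
      -- apply (HV 1); [lia|exact Hk].
      -- apply (HV 2); [lia|]; destruct Hk as [Hk|Hk]; [right|left]; exact Hk.
  + intros k (l & Hl & H) (l' & Hl' & H'); exact (owned_u_v _ _ _ _ Hl Hl' k H H').
- intros x x' Hx Hx' Hlt.
  assert (Hap : forall l y l' y' k, 0 <= l < 3 -> 0 <= l' < 3 -> 0 <= y < s -> 0 <= y' < s ->
    owned m 1 s sum_at odd_side l y y k -> owned m 1 s sum_at odd_side l' y' y' k -> l = l' /\ y = y').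
  { intros l y l' y' k Hl Hl' Hy Hy' H H'.
    destruct (Z.eq_dec l l') as [<-|Hll]; [destruct (Z.eq_dec y y') as [<-|Hyy]; [auto|]|]; exfalso;
    revert k H H'; apply owned_apart; lia. }
  intros k [(l & Hl & H)|(l & Hl & H)] [(l' & Hl' & H')|(l' & Hl' & H')].
  + destruct (Hap l (row_u x l) l' (row_u x' l') k) as [<- E]; auto using owned_u_owned;
      try (apply row_u_spec; lia); apply row_u_inj in E; lia.
  + exact (owned_u_v _ _ _ _ Hl Hl' k H H').
  + exact (owned_u_v _ _ _ _ Hl' Hl k H' H).
  + destruct (Hap l (row_v x l) l' (row_v x' l') k) as [<- E]; auto using owned_v_owned;
      try (apply row_v_spec; lia); apply row_v_inj in E; lia.
- intros k (x & Hx & [(l & Hl & H)|(l & Hl & H)]).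
  + exists l, (row_u x l); split; [exact Hl|split; [apply row_u_spec; lia|apply owned_u_owned; exact H]].
  + exists l, (row_v x l); split; [exact Hl|split; [apply row_v_spec; lia|apply owned_v_owned; exact H]].
Qed.

Theorem odd_design NF : packs m 1 (filler_region m (h * (((s - 1) / 2) mod 2))) NF ->
  packs m 1 (fun k => exists p q a b, 0 <= p < 3 * s /\ 0 <= q < 3 * s /\ k = (p, q, a, b))
    (3 * (length (pairs (Z.to_nat s)) * Z.to_nat m) + Z.to_nat s * (NF + 1)).
Proof.
intros HF; assert (Hm : 0 < m) by (unfold m; lia).
apply (design m 1 s sum_at odd_side Hm Z.lt_0_1 Hs).
- intros l x y Hl Hx Hy; apply odd_pair; auto.
- apply odd_left; exact HF.
Qed.
End OddDesign.

(** * Tables *)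

(* Block schemes: [wb] has two points on the level [l] and one on the next
   level, [tb] one point on each level. The suffixes [g], [h], [z] fix the
   coefficients of the indeterminate. *)
Definition lam l := if l =? 2 then -2 else 1.
Definition wb l i j a f b f2 : block :=
  (Pt (l + 3 * i) 0 0, Pt (l + 3 * i) (a - b) (lam l * (f - f2)), Pt (nx l + 3 * j) a (lam l * f)).
Definition tb i0 i1 i2 a0 f0 a1 f1 : block :=
  (Pt (3 * i0) 0 0, Pt (1 + 3 * i1) a0 f0, Pt (2 + 3 * i2) (a0 + a1) (f0 + f1)).
Definition wg l i j a b := wb l i j a 1 b (-1).
Definition wz l i j a b := wb l i j a 0 b 0.
Definition tg i0 i1 i2 a0 a1 := tb i0 i1 i2 a0 1 a1 1.
Definition th i0 i1 i2 a0 a1 := tb i0 i1 i2 a0 (-1) a1 (-1).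
Definition tz i0 i1 i2 a0 a1 := tb i0 i1 i2 a0 0 a1 0.

(** The names give the number of rows and the power of 2. The digit after them, if any, is the
    parity of T for six rows and, for three rows, 1 or 0 according to whether the missing label is
    half of the modulus or 0. A [base] table is for c = 0 (for six rows and the power 4, also for y
    = 1, 2), a [fibre] table for each further pair +-y. *)
Definition six_4_0_base : list block := [
  wb 0 0 0 3 1 0 (-1); wb 0 1 1 1 1 0 (-1); wb 0 0 0 3 2 0 (-2); wb 0 1 1 1 2 0 (-2);
  wb 1 0 0 1 1 2 (-1); wb 1 1 1 3 1 2 (-1); wb 1 0 0 1 2 2 (-2); wb 1 1 1 3 2 2 (-2);
  wb 2 0 1 2 0 3 (-2); wb 2 1 0 3 2 2 0; wb 2 0 0 2 2 3 (-2); wb 2 1 1 0 2 3 (-2);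
  tb 0 1 0 0 (-2) 2 (-2); tb 0 1 0 0 (-1) 2 (-1); tb 0 1 1 3 (-2) 3 (-2); tb 0 0 1 3 (-2) 2 (-2);
  tb 0 1 1 3 (-1) 3 (-1); tb 1 1 0 1 (-1) 1 (-1); tb 1 1 0 1 (-2) 1 (-2); tb 0 0 0 0 0 1 (-2);
  tb 0 1 0 0 0 2 0; tb 0 0 1 3 (-1) 2 (-1); tb 1 0 1 3 (-2) 1 (-2); tb 1 0 1 3 (-1) 1 (-1);
  tb 1 0 1 0 (-2) 1 0; tb 1 0 0 0 (-1) 1 (-1); tb 0 0 0 3 0 2 0; tb 0 1 1 3 0 2 0;
  tb 0 1 1 0 2 2 2; tb 0 1 0 3 2 2 2; tb 1 1 1 1 0 3 0; tb 1 0 0 0 2 2 2; tb 1 1 0 0 2 1 2;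
  tb 1 1 0 0 0 1 0; tb 1 0 1 0 0 1 2; tb 1 0 1 3 0 2 0; tb 0 0 0 0 2 1 0; tb 1 0 0 0 1 2 1;
  tb 1 0 1 3 1 1 1; tb 0 0 1 0 1 2 1; tb 1 0 1 3 2 2 2; tb 0 1 0 0 1 2 1; tb 0 1 1 3 1 2 1;
  tb 1 1 0 0 1 1 1].

Definition six_4_0_fibre : list block := [
  wg 0 0 0 3 0; wg 0 1 1 1 0; wg 1 0 0 1 2; wg 1 1 1 3 2; wg 2 0 0 2 3; wg 2 1 1 0 3; tg 0 0 1 0 1;
  tg 1 0 0 0 2; tg 1 0 1 3 2; tg 0 1 0 3 2; tg 0 1 1 0 2; tg 1 1 0 0 1; th 0 0 1 3 2; th 1 0 0 0 1;
  th 1 0 1 3 1; th 0 1 0 0 2; th 0 1 1 3 3; th 1 1 0 1 1].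

Definition six_4_1_base : list block := [
  wb 0 0 0 1 1 0 (-1); wb 0 1 1 3 1 0 (-1); wb 0 0 0 1 2 0 (-2); wb 0 1 1 3 2 0 (-2);
  wb 1 0 0 2 1 1 (-1); wb 1 1 1 0 1 1 (-1); wb 1 0 0 2 2 1 (-2); wb 1 1 1 0 2 1 (-2);
  wb 2 0 1 2 0 1 (-2); wb 2 1 0 3 2 0 0; wb 2 0 0 3 2 2 (-2); wb 2 1 1 1 2 2 (-2);
  tb 0 1 0 3 (-2) 2 (-2); tb 0 1 0 3 (-1) 2 (-1); tb 0 1 1 0 (-2) 0 (-2); tb 0 0 1 1 (-2) 0 (-2);
  tb 0 1 1 0 (-1) 0 (-1); tb 1 1 0 3 (-1) 3 (-1); tb 1 1 0 3 (-2) 3 (-2); tb 0 0 0 0 0 2 (-2);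
  tb 0 1 0 3 0 2 0; tb 0 0 1 1 (-1) 0 (-1); tb 1 0 1 2 (-2) 1 (-2); tb 1 0 1 2 (-1) 1 (-1);
  tb 1 0 1 1 (-2) 1 0; tb 1 0 0 1 (-1) 2 (-1); tb 0 0 0 1 0 1 0; tb 0 1 1 0 0 1 0;
  tb 0 1 1 3 2 1 2; tb 0 1 0 0 2 2 2; tb 1 1 1 3 0 0 0; tb 1 0 0 1 2 1 2; tb 1 1 0 0 2 3 2;
  tb 1 1 0 0 0 3 0; tb 1 0 1 1 0 1 2; tb 1 0 1 2 0 0 0; tb 0 0 0 0 2 2 0; tb 1 0 0 1 1 1 1;
  tb 1 0 1 2 1 1 1; tb 0 0 1 0 1 0 1; tb 1 0 1 2 2 0 2; tb 0 1 1 0 1 1 1; tb 0 1 0 3 1 2 1;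
  tb 1 1 0 0 1 3 1].

Definition six_4_1_fibre : list block := [
  wg 0 0 0 1 0; wg 0 1 1 3 0; wg 1 0 0 2 1; wg 1 1 1 0 1; wg 2 0 0 3 2; wg 2 1 1 1 2; tg 0 0 1 0 1;
  tg 1 0 0 1 1; tg 1 0 1 2 0; tg 0 1 0 0 2; tg 0 1 1 3 1; tg 1 1 0 0 3; th 0 0 1 1 0; th 1 0 0 1 2;
  th 1 0 1 2 1; th 0 1 1 0 0; th 0 1 0 3 2; th 1 1 0 3 3].

Definition six_8_0_base : list block := [
  wz 0 0 0 4 3; wz 0 1 1 5 2; wz 0 0 1 4 1; wz 0 1 0 6 5; wz 1 0 0 1 6; wz 1 1 1 0 5; wz 1 0 0 0 7;
  wz 1 1 1 7 6; wz 2 0 0 7 4; wz 2 1 1 7 6; wz 2 0 1 6 5; wz 2 1 0 7 4; tz 1 0 1 3 5; tz 0 0 1 5 6;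
  tz 0 0 1 6 4; tz 1 0 1 4 7; tz 1 1 0 4 0; tz 0 1 0 2 1; tz 0 1 0 3 7; tz 1 1 0 3 6].

Definition six_8_0_fibre : list block := [
  wg 0 0 1 2 3; wg 0 1 0 4 3; wg 0 0 1 3 2; wg 0 1 0 5 6; wg 1 0 0 0 1; wg 1 1 1 0 7; wg 1 0 0 7 6;
  wg 1 1 1 7 0; wg 2 0 1 6 7; wg 2 1 0 4 5; wg 2 0 0 6 5; wg 2 1 1 0 7; tg 0 1 0 1 0; tg 1 1 0 2 1;
  tg 1 1 0 3 6; tg 1 1 1 4 5; tg 1 0 1 3 7; tg 0 0 0 3 1; tg 0 0 1 4 6; tg 0 0 1 6 5; tg 1 0 0 6 6;
  tg 0 0 1 5 4; tg 0 1 0 4 7; tg 1 1 1 5 6; th 0 1 0 1 0; th 0 0 1 6 6; th 0 0 0 3 7; th 1 0 1 5 5;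
  th 0 0 1 5 4; th 0 0 0 4 0; th 1 0 1 4 7; th 0 1 1 4 6; th 1 1 0 2 1; th 1 1 0 4 6; th 1 1 1 3 5;
  th 1 1 0 5 7].

Definition six_8_1_base : list block := [
  wz 0 0 1 0 5; wz 0 1 0 2 7; wz 0 0 0 1 0; wz 0 1 1 6 5; wz 1 0 0 6 3; wz 1 1 1 7 4; wz 1 0 0 5 4;
  wz 1 1 1 6 5; wz 2 0 1 2 1; wz 2 1 0 6 3; wz 2 0 0 5 2; wz 2 1 1 4 3; tz 1 1 0 0 4; tz 1 1 0 7 6;
  tz 0 1 0 6 7; tz 0 1 0 7 5; tz 0 0 1 7 4; tz 0 0 1 6 6; tz 1 0 1 0 7; tz 1 0 1 1 5].

Definition six_8_1_fibre : list block := [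
  wg 0 0 1 6 5; wg 0 1 0 7 0; wg 0 0 0 7 0; wg 0 1 1 6 5; wg 1 0 0 5 4; wg 1 1 1 7 6; wg 1 0 1 6 7;
  wg 1 1 0 4 5; wg 2 0 0 2 3; wg 2 1 1 2 1; wg 2 0 1 3 2; wg 2 1 0 5 6; tg 1 1 0 5 7; tg 1 0 0 1 6;
  tg 0 0 1 6 7; tg 1 1 1 7 6; tg 1 0 1 0 4; tg 1 1 0 0 6; tg 1 0 1 2 5; tg 0 1 1 5 5; tg 0 1 0 7 5;
  tg 0 0 0 0 3; tg 0 0 0 1 4; tg 0 1 1 0 4; th 0 1 0 7 4; th 1 1 0 0 7; th 0 1 1 0 4; th 0 0 0 1 5;
  th 0 0 1 6 5; th 0 0 1 7 6; th 1 0 0 7 6; th 1 0 1 2 4; th 1 0 0 1 3; th 0 1 0 6 6; th 1 1 1 6 7;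
  th 1 1 1 7 5].

Definition six_32_0_base : list block := [
  wz 0 0 0 9 2; wz 0 1 1 8 7; wz 0 0 0 11 8; wz 0 1 1 6 3; wz 0 0 0 12 0; wz 0 1 1 4 29;
  wz 0 0 1 3 30; wz 0 1 0 8 4; wz 0 0 1 11 7; wz 0 1 0 11 6; wz 0 0 1 2 1; wz 0 1 0 14 2;
  wz 1 0 0 12 8; wz 1 1 1 5 2; wz 1 0 1 9 2; wz 1 1 0 8 7; wz 1 0 0 14 2; wz 1 1 1 8 28;
  wz 1 0 1 3 30; wz 1 1 0 4 0; wz 1 0 0 6 3; wz 1 1 1 3 30; wz 1 0 0 11 10; wz 1 1 1 7 0;
  wz 2 0 1 21 17; wz 2 1 0 19 15; wz 2 0 0 25 22; wz 2 1 1 30 18; wz 2 0 1 28 16; wz 2 1 0 20 17;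
  wz 2 0 0 13 12; wz 2 1 1 26 21; wz 2 0 0 24 17; wz 2 1 1 23 16; wz 2 0 0 26 21; wz 2 1 1 28 27;
  tz 1 0 1 15 29; tz 0 1 1 28 10; tz 0 1 0 29 12; tz 1 1 1 10 29; tz 0 0 0 1 15; tz 0 0 1 10 31;
  tz 0 1 0 0 14; tz 0 1 1 31 11; tz 1 0 1 13 27; tz 0 0 0 5 7; tz 0 0 1 3 5; tz 0 1 0 4 13;
  tz 0 1 1 5 6; tz 0 0 1 7 7; tz 0 0 0 4 9; tz 0 0 1 14 6; tz 0 1 1 9 9; tz 0 1 0 10 11;
  tz 0 1 1 6 1; tz 0 0 1 6 10; tz 0 0 1 15 4; tz 0 1 0 8 10; tz 0 0 1 13 8; tz 1 1 1 11 4;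
  tz 1 1 1 2 31; tz 1 0 1 7 28; tz 1 0 1 10 0; tz 1 0 1 12 1; tz 1 1 0 12 5; tz 1 1 0 9 3;
  tz 1 0 0 0 5; tz 1 0 0 1 13; tz 1 1 0 31 9; tz 1 1 0 30 15; tz 1 0 0 9 1; tz 1 0 0 5 4;
  tz 1 0 0 3 0; tz 1 1 0 1 1; tz 1 1 0 0 6; tz 1 1 0 5 2].

Definition six_32_0_fibre : list block := [
  wg 0 0 1 29 30; wg 0 1 0 8 5; wg 0 0 0 8 7; wg 0 1 1 7 8; wg 0 0 0 7 12; wg 0 1 1 3 2;
  wg 0 0 0 1 8; wg 0 1 1 2 9; wg 0 0 1 1 28; wg 0 1 0 15 10; wg 0 0 0 2 6; wg 0 1 1 9 12;
  wg 0 0 0 0 3; wg 0 1 1 30 3; wg 0 0 1 10 6; wg 0 1 0 13 9; wg 0 0 1 7 0; wg 0 1 0 10 14;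
  wg 0 0 1 8 5; wg 0 1 0 14 7; wg 1 0 1 3 28; wg 1 1 0 4 3; wg 1 0 1 2 5; wg 1 1 0 12 5;
  wg 1 0 1 1 2; wg 1 1 0 1 4; wg 1 0 1 30 3; wg 1 1 0 11 12; wg 1 0 1 4 31; wg 1 1 0 6 1;
  wg 1 0 0 13 9; wg 1 1 1 0 28; wg 1 0 0 10 7; wg 1 1 1 31 4; wg 1 0 1 31 6; wg 1 1 0 3 7;
  wg 1 0 1 28 27; wg 1 1 0 9 6; wg 1 0 1 6 10; wg 1 1 0 8 15; wg 2 0 1 20 23; wg 2 1 0 15 14;
  wg 2 0 0 21 16; wg 2 1 1 26 31; wg 2 0 1 28 27; wg 2 1 0 23 19; wg 2 0 0 17 14; wg 2 1 1 20 17;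
  wg 2 0 0 22 18; wg 2 1 1 29 24; wg 2 0 0 12 13; wg 2 1 1 23 30; wg 2 0 0 26 19; wg 2 1 1 19 20;
  wg 2 0 1 26 30; wg 2 1 0 18 21; wg 2 0 1 19 24; wg 2 1 0 22 15; wg 2 0 0 16 23; wg 2 1 1 17 21;
  tg 0 1 0 28 13; tg 1 1 0 11 0; tg 1 0 0 12 5; tg 1 0 1 11 29; tg 1 1 1 12 2; tg 0 1 1 9 30;
  tg 1 1 1 5 28; tg 1 1 1 8 29; tg 1 1 0 10 5; tg 0 1 1 31 7; tg 1 1 1 4 6; tg 1 1 0 29 10;
  tg 0 1 0 30 14; tg 0 1 1 0 11; tg 0 1 0 2 15; tg 1 1 0 0 2; tg 0 1 1 4 4; tg 0 1 1 5 8;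
  tg 0 1 1 3 9; tg 0 1 0 6 7; tg 0 1 1 11 5; tg 1 1 1 31 3; tg 1 1 1 1 10; tg 1 1 1 6 1;
  tg 1 0 1 9 27; tg 0 0 1 15 0; tg 0 0 1 14 5; tg 1 0 0 5 0; tg 0 0 1 11 7; tg 0 0 0 9 12;
  tg 1 0 0 4 6; tg 1 0 0 3 11; tg 0 0 0 3 4; tg 0 0 0 4 14; tg 1 0 0 1 15; tg 0 0 0 5 3;
  tg 0 0 0 6 8; tg 0 0 1 13 8; tg 0 0 0 12 7; tg 0 0 1 10 10; tg 1 0 0 0 9; tg 1 0 0 2 1;
  tg 1 0 0 6 2; tg 1 0 1 7 9; th 0 0 1 14 7; th 0 1 1 11 9; th 0 1 1 8 8; th 0 1 1 9 10;
  th 1 1 1 6 1; th 1 1 1 7 29; th 1 1 1 11 30; th 1 0 1 6 8; th 0 1 1 7 31; th 1 1 0 4 0;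
  th 0 1 1 10 2; th 1 1 1 5 0; th 1 1 1 10 6; th 1 1 0 1 2; th 1 1 1 0 3; th 0 0 1 9 1;
  th 0 0 1 15 0; th 0 0 0 10 10; th 0 0 0 13 8; th 0 1 1 2 5; th 1 0 1 13 29; th 1 1 1 31 7;
  th 0 0 1 4 4; th 0 1 1 3 11; th 0 0 1 0 9; th 1 0 1 15 30; th 0 1 0 4 13; th 1 1 0 30 8;
  th 0 1 0 31 11; th 0 1 0 29 9; th 0 1 0 1 10; th 1 1 0 29 14; th 1 0 0 12 0; th 0 0 0 11 1;
  th 0 0 0 1 6; th 0 0 0 2 13; th 0 0 0 5 3; th 1 0 0 8 2; th 1 0 0 0 14; th 1 0 0 2 15;
  th 1 0 0 1 12; th 1 0 0 3 4; th 1 0 0 4 11; th 1 0 0 11 5].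

Definition six_32_1_base : list block := [
  wz 0 0 1 1 21; wz 0 1 0 12 7; wz 0 0 0 10 3; wz 0 1 1 30 18; wz 0 0 0 4 0; wz 0 1 1 27 20;
  wz 0 0 1 25 22; wz 0 1 0 4 1; wz 0 0 0 14 13; wz 0 1 1 26 22; wz 0 0 0 7 2; wz 0 1 1 29 28;
  wz 1 0 1 4 29; wz 1 1 0 30 27; wz 1 0 0 28 23; wz 1 1 1 3 31; wz 1 0 0 27 24; wz 1 1 1 6 26;
  wz 1 0 1 8 28; wz 1 1 0 16 15; wz 1 0 0 22 21; wz 1 1 1 8 1; wz 1 0 1 3 31; wz 1 1 0 29 24;
  wz 2 0 1 29 28; wz 2 1 0 14 2; wz 2 0 1 31 19; wz 2 1 0 6 3; wz 2 0 0 8 5; wz 2 1 1 30 23;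
  wz 2 0 0 10 3; wz 2 1 1 22 18; wz 2 0 1 24 20; wz 2 1 0 13 12; wz 2 0 0 14 9; wz 2 1 1 26 21;
  tz 1 1 1 0 4; tz 1 1 1 1 7; tz 1 1 0 31 17; tz 1 0 1 2 1; tz 1 0 1 3 2; tz 1 0 1 5 7;
  tz 1 0 1 6 27; tz 1 0 0 11 26; tz 1 0 1 8 5; tz 1 0 1 10 6; tz 1 0 1 15 0; tz 1 0 0 16 18;
  tz 1 0 0 14 25; tz 1 0 0 13 29; tz 1 0 1 9 30; tz 1 1 0 19 19; tz 1 1 0 24 23; tz 1 1 0 23 18;
  tz 1 1 0 25 21; tz 1 1 0 21 22; tz 0 0 1 1 26; tz 0 1 1 19 9; tz 0 1 1 18 30; tz 0 1 1 30 27;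
  tz 0 1 1 26 5; tz 0 1 1 20 2; tz 0 0 1 8 9; tz 0 1 1 24 29; tz 0 1 1 23 0; tz 0 1 1 28 28;
  tz 0 1 0 29 20; tz 0 1 0 31 26; tz 0 1 0 0 28; tz 0 0 0 9 17; tz 0 1 0 27 25; tz 0 0 0 6 15;
  tz 0 0 0 5 14; tz 0 0 0 15 16; tz 0 0 0 11 19; tz 0 0 0 12 20].

Definition six_32_1_fibre : list block := [
  wg 0 0 1 24 29; wg 0 1 0 4 11; wg 0 0 0 8 11; wg 0 1 1 21 20; wg 0 0 0 6 1; wg 0 1 1 27 31;
  wg 0 0 0 5 6; wg 0 1 1 31 0; wg 0 0 0 14 13; wg 0 1 1 23 28; wg 0 0 0 1 8; wg 0 1 1 26 22;
  wg 0 0 0 11 7; wg 0 1 1 24 27; wg 0 0 1 31 24; wg 0 1 0 13 8; wg 0 0 0 10 14; wg 0 1 1 30 23;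
  wg 0 0 0 13 10; wg 0 1 1 0 29; wg 1 0 0 27 24; wg 1 1 1 3 2; wg 1 0 0 19 20; wg 1 1 1 1 8;
  wg 1 0 1 2 5; wg 1 1 0 26 27; wg 1 0 0 18 25; wg 1 1 1 30 26; wg 1 0 1 30 29; wg 1 1 0 22 25;
  wg 1 0 0 26 22; wg 1 1 1 5 30; wg 1 0 0 28 23; wg 1 1 1 27 31; wg 1 0 1 28 0; wg 1 1 0 16 21;
  wg 1 0 1 1 6; wg 1 1 0 29 26; wg 1 0 1 8 1; wg 1 1 0 28 23; wg 2 0 1 16 23; wg 2 1 0 6 11;
  wg 2 0 1 18 19; wg 2 1 0 14 10; wg 2 0 0 15 11; wg 2 1 1 31 28; wg 2 0 1 21 16; wg 2 1 0 8 15;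
  wg 2 0 0 4 7; wg 2 1 1 16 20; wg 2 0 1 24 29; wg 2 1 0 11 4; wg 2 0 1 22 21; wg 2 1 0 4 7;
  wg 2 0 0 0 4; wg 2 1 1 24 19; wg 2 0 1 29 26; wg 2 1 0 12 13; wg 2 0 1 27 20; wg 2 1 0 10 9;
  tg 0 1 1 18 9; tg 1 1 0 25 19; tg 1 1 0 18 15; tg 1 1 0 22 23; tg 1 1 0 19 17; tg 1 1 1 28 8;
  tg 1 1 0 29 18; tg 1 1 0 20 21; tg 0 1 1 22 7; tg 1 1 1 1 4; tg 0 1 1 25 6; tg 0 1 1 19 29;
  tg 0 1 1 20 31; tg 0 1 1 30 0; tg 0 1 0 0 20; tg 0 1 1 21 2; tg 0 1 1 23 26; tg 0 1 1 29 28;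
  tg 0 0 0 12 14; tg 0 0 0 15 16; tg 0 1 0 1 24; tg 0 1 0 27 27; tg 0 1 0 28 25; tg 0 1 0 26 30;
  tg 0 0 0 2 17; tg 0 0 0 3 15; tg 0 0 0 9 21; tg 0 0 0 0 23; tg 0 0 0 4 25; tg 0 0 0 7 20;
  tg 1 0 0 16 22; tg 1 0 0 15 24; tg 1 0 0 5 29; tg 1 0 1 1 6; tg 1 0 1 6 9; tg 1 0 1 2 0;
  tg 1 0 1 3 7; tg 1 0 1 11 3; tg 1 0 1 10 31; tg 1 0 1 12 26; tg 1 0 1 9 4; tg 1 0 1 7 5;
  tg 1 0 1 8 27; tg 1 0 1 14 29; th 0 1 1 18 6; th 0 1 1 19 1; th 1 1 0 25 15; th 1 1 0 21 18;
  th 1 1 0 24 22; th 1 1 1 26 9; th 1 1 0 18 16; th 0 1 0 0 20; th 0 1 0 31 19; th 0 0 0 15 16;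
  th 1 1 0 30 17; th 0 1 1 20 28; th 1 1 1 19 29; th 0 1 1 23 27; th 0 1 0 1 28; th 0 1 1 21 5;
  th 0 1 1 22 7; th 0 1 1 28 3; th 1 1 1 1 0; th 0 1 1 26 4; th 0 1 0 25 30; th 0 0 1 0 27;
  th 0 1 0 27 24; th 0 1 0 30 29; th 0 0 0 2 15; th 0 0 0 12 14; th 0 0 0 9 21; th 0 0 0 5 19;
  th 0 0 0 3 29; th 0 0 0 4 18; th 1 0 0 16 17; th 1 0 0 10 26; th 1 0 0 15 27; th 1 0 0 9 28;
  th 1 0 1 14 28; th 1 0 1 13 26; th 1 0 1 4 30; th 1 0 1 1 8; th 1 0 1 7 7; th 1 0 1 5 3;
  th 1 0 1 3 2; th 1 0 1 6 9; th 1 0 1 2 4; th 1 0 1 12 31].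

Definition three_8_0_base : list block := [
  wz 0 0 0 2 3; wz 0 0 0 6 1; wz 1 0 0 1 2; wz 1 0 0 4 7; wz 2 0 0 7 2; wz 2 0 0 4 5; tz 0 0 0 5 5;
  tz 0 0 0 4 3; tz 0 0 0 7 6].

Definition three_8_1_base : list block := [
  wz 0 0 0 2 5; wz 0 0 0 6 7; wz 1 0 0 1 2; wz 1 0 0 3 6; wz 2 0 0 7 0; wz 2 0 0 3 6; tz 0 0 0 0 7;
  tz 0 0 0 1 5; tz 0 0 0 3 0].

Definition three_8_fibre : list block := [
  wg 0 0 0 3 4; wg 0 0 0 0 7; wg 1 0 0 1 2; wg 1 0 0 0 7; wg 2 0 0 6 5; wg 2 0 0 2 3; tg 0 0 0 4 4;
  tg 0 0 0 1 2; tg 0 0 0 5 7; tg 0 0 0 6 3; tg 0 0 0 2 5; tg 0 0 0 7 6; th 0 0 0 0 6; th 0 0 0 2 0;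
  th 0 0 0 1 3; th 0 0 0 5 4; th 0 0 0 3 5; th 0 0 0 6 1].

Definition three_32_0_base : list block := [
  wz 0 0 0 11 16; wz 0 0 0 24 25; wz 0 0 0 18 30; wz 0 0 0 31 3; wz 0 0 0 14 21; wz 0 0 0 1 4;
  wz 1 0 0 8 11; wz 1 0 0 10 17; wz 1 0 0 4 9; wz 1 0 0 26 6; wz 1 0 0 13 14; wz 1 0 0 15 19;
  wz 2 0 0 9 21; wz 2 0 0 18 19; wz 2 0 0 23 28; wz 2 0 0 13 20; wz 2 0 0 12 16; wz 2 0 0 14 17;
  tz 0 0 0 20 18; tz 0 0 0 13 29; tz 0 0 0 17 20; tz 0 0 0 15 16; tz 0 0 0 8 31; tz 0 0 0 9 24;
  tz 0 0 0 10 12; tz 0 0 0 28 25; tz 0 0 0 23 3; tz 0 0 0 22 7; tz 0 0 0 26 2; tz 0 0 0 5 30;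
  tz 0 0 0 27 22; tz 0 0 0 12 28; tz 0 0 0 2 23; tz 0 0 0 19 5; tz 0 0 0 29 1; tz 0 0 0 6 21;
  tz 0 0 0 7 27].

Definition three_32_1_base : list block := [
  wz 0 0 0 6 13; wz 0 0 0 4 8; wz 0 0 0 18 19; wz 0 0 0 3 15; wz 0 0 0 23 28; wz 0 0 0 2 5;
  wz 1 0 0 10 13; wz 1 0 0 28 29; wz 1 0 0 20 27; wz 1 0 0 14 18; wz 1 0 0 26 31; wz 1 0 0 11 23;
  wz 2 0 0 26 6; wz 2 0 0 22 23; wz 2 0 0 17 20; wz 2 0 0 5 10; wz 2 0 0 25 29; wz 2 0 0 12 19;
  tz 0 0 0 7 1; tz 0 0 0 1 3; tz 0 0 0 31 15; tz 0 0 0 14 4; tz 0 0 0 20 5; tz 0 0 0 29 8;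
  tz 0 0 0 9 25; tz 0 0 0 0 24; tz 0 0 0 21 0; tz 0 0 0 17 12; tz 0 0 0 25 30; tz 0 0 0 27 22;
  tz 0 0 0 10 21; tz 0 0 0 12 7; tz 0 0 0 22 6; tz 0 0 0 26 17; tz 0 0 0 24 9; tz 0 0 0 11 19;
  tz 0 0 0 30 2].

Definition three_32_fibre : list block := [
  wg 0 0 0 0 25; wg 0 0 0 8 7; wg 0 0 0 1 29; wg 0 0 0 27 24; wg 0 0 0 16 21; wg 0 0 0 11 14;
  wg 0 0 0 9 4; wg 0 0 0 4 5; wg 0 0 0 30 2; wg 0 0 0 13 20; wg 1 0 0 14 18; wg 1 0 0 31 26;
  wg 1 0 0 26 29; wg 1 0 0 9 6; wg 1 0 0 10 3; wg 1 0 0 3 31; wg 1 0 0 27 2; wg 1 0 0 24 23;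
  wg 1 0 0 8 9; wg 1 0 0 2 7; wg 2 0 0 2 5; wg 2 0 0 3 10; wg 2 0 0 19 12; wg 2 0 0 23 20;
  wg 2 0 0 28 23; wg 2 0 0 9 14; wg 2 0 0 14 13; wg 2 0 0 5 1; wg 2 0 0 26 27; wg 2 0 0 30 2;
  tg 0 0 0 23 12; tg 0 0 0 2 5; tg 0 0 0 26 17; tg 0 0 0 7 30; tg 0 0 0 24 28; tg 0 0 0 14 0;
  tg 0 0 0 25 1; tg 0 0 0 18 15; tg 0 0 0 22 25; tg 0 0 0 17 11; tg 0 0 0 6 18; tg 0 0 0 5 16;
  tg 0 0 0 10 6; tg 0 0 0 12 19; tg 0 0 0 3 7; tg 0 0 0 29 22; tg 0 0 0 15 29; tg 0 0 0 20 20;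
  tg 0 0 0 19 13; tg 0 0 0 28 21; tg 0 0 0 21 4; tg 0 0 0 31 23; th 0 0 0 26 19; th 0 0 0 17 0;
  th 0 0 0 13 22; th 0 0 0 1 1; th 0 0 0 31 30; th 0 0 0 6 10; th 0 0 0 16 5; th 0 0 0 9 24;
  th 0 0 0 8 17; th 0 0 0 23 16; th 0 0 0 15 13; th 0 0 0 10 14; th 0 0 0 12 28; th 0 0 0 19 27;
  th 0 0 0 0 11; th 0 0 0 11 21; th 0 0 0 28 8; th 0 0 0 18 20; th 0 0 0 27 15; th 0 0 0 3 12;
  th 0 0 0 22 4; th 0 0 0 30 25].

Definition three_20_0_base : list block := [
  wz 0 0 0 17 18; wz 0 0 0 9 12; wz 1 0 0 1 2; wz 1 0 0 14 17; wz 2 0 0 13 16; wz 2 0 0 5 6;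
  tz 0 0 0 8 3; tz 0 0 0 16 13; tz 0 0 0 5 11; tz 0 0 0 14 5; tz 0 0 0 1 7; tz 0 0 0 3 9;
  tz 0 0 0 15 18; tz 0 0 0 4 6; tz 0 0 0 19 19; tz 0 0 0 13 8; tz 0 0 0 6 16; tz 0 0 0 10 15;
  tz 0 0 0 2 4; tz 0 0 0 11 12; tz 0 0 0 7 10].

Definition three_20_1_base : list block := [
  wz 0 0 0 12 13; wz 0 0 0 19 2; wz 1 0 0 8 11; wz 1 0 0 17 18; wz 2 0 0 12 13; wz 2 0 0 6 9;
  tz 0 0 0 5 7; tz 0 0 0 8 5; tz 0 0 0 11 4; tz 0 0 0 3 2; tz 0 0 0 14 3; tz 0 0 0 16 6;
  tz 0 0 0 18 1; tz 0 0 0 7 13; tz 0 0 0 0 16; tz 0 0 0 1 0; tz 0 0 0 6 12; tz 0 0 0 4 19;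
  tz 0 0 0 9 15; tz 0 0 0 17 9; tz 0 0 0 15 14].

(* The absolute value of the coefficient of the indeterminate in a key of a
   fibre table. *)
Definition kappa (p q : Z) : Z :=
  if p =? q then (if p mod 3 =? 2 then 4 else 2)
  else if p mod 3 + q mod 3 =? 2 then 2 else 1.

Definition pow2 (c : Z) : bool := existsb (Z.eqb (Z.abs c)) [1; 2; 4; 8; 16].
(** Coefficients in the window are [kappa] times f with |f| <= 2, so their nonzero differences are
    powers of 2 or 3, 6, 12 up to sign. These are invertible modulo u when u is coprime to 6. *)
Definition smooth (c : Z) : bool := pow2 c || existsb (Z.eqb (Z.abs c)) [3; 6; 12].

Lemma divide_abs u c y : (u | c * y) -> (u | Z.abs c * y).
Proof.
intros H; destruct (Z.abs_eq_or_opp c) as [-> | ->]; [exact H|].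
apply (divide_neg _ _ _ H); lia.
Qed.

Lemma pow2_cancel u c y : u mod 2 = 1 -> pow2 c = true -> (u | c * y) -> (u | y).
Proof.
intros Hu Hc H; apply divide_abs in H.
unfold pow2 in Hc; simpl in Hc; rewrite !orb_true_iff, !Z.eqb_eq in Hc.
assert (E : exists k, (k = 0 \/ k = 1 \/ k = 2 \/ k = 3 \/ k = 4) /\ Z.abs c = 2 ^ k).
{ destruct Hc as [E|[E|[E|[E|[E|E]]]]]; try discriminate; rewrite E;
  [exists 0|exists 1|exists 2|exists 3|exists 4]; split; auto 6. }
destruct E as (k & Hk & E); rewrite E in H; clear E Hc.
assert (D : forall x, (u | 2 * x) -> (u | x)) by (intros; apply divide_twice; auto).
destruct Hk as [->|[->|[->|[->| ->]]]];
  [|apply D|do 2 apply D|do 3 apply D|do 4 apply D]; apply (eq_ind _ _ H); lia.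
Qed.

Lemma smooth_cancel u c y : u mod 2 = 1 -> u mod 3 <> 0 -> smooth c = true -> (u | c * y) -> (u | y).
Proof.
intros Hu H3 Hc H; unfold smooth in Hc; apply orb_true_iff in Hc as [Hc|Hc].
- exact (pow2_cancel u c y Hu Hc H).
- apply divide_abs in H; simpl in Hc; rewrite !orb_true_iff, !Z.eqb_eq in Hc.
  apply divide_thrice; auto.
  assert (D : forall x, (u | 2 * x) -> (u | x)) by (intros; apply divide_twice; auto).
  destruct Hc as [E|[E|[E|E]]]; try discriminate; rewrite E in H.
  + exact H.
  + apply D; apply (eq_ind _ _ H); lia.
  + do 2 apply D; apply (eq_ind _ _ H); lia.
Qed.

Definition fibre_region m u lo Q : region := fun k =>
  exists y, lo <= y <= (u - 1) / 2 /\ table_region u y Q k /\ 0 < m.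

(** The coefficient of a key is +-[kappa], which depends on its rows alone and is a power of 2. As u
    is odd, [kappa] y and [kappa] y' never agree up to sign for different y, y' up to (u - 1) / 2,
    so a single table can be repeated for every y. *)
Lemma table_family m u T Q lo : 0 < m -> 0 < u -> u mod 2 = 1 -> 1 <= lo -> lo <= (u + 1) / 2 ->
  table_ok m pow2 T = true ->
  (forall p q a c, Q (p, q, a, c) = true -> Z.abs c = kappa p q) ->
  forallb (fun b => forallb Q (coefs m b)) T = true ->
  packs m u (fibre_region m u lo Q) (Z.to_nat ((u + 1) / 2 - lo) * length T).
Proof.
intros Hm Hu Hodd Hlo Hhi Hok HQ HT.
assert (Hhalf : exists g, u = 2 * g + 1 /\ (u + 1) / 2 = g + 1 /\ (u - 1) / 2 = g).
{ exists (u / 2); Z.to_euclidean_division_equations; lia. }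
destruct Hhalf as (g & Eg & Eg1 & Eg2); rewrite Eg1 in *.
assert (Hk : forall p q, pow2 (kappa p q) = true /\ 0 < kappa p q).
{ intros p q; unfold kappa; destruct (p =? q), (p mod 3 =? 2), (p mod 3 + q mod 3 =? 2); split; reflexivity. }
eapply packs_sub; [apply (packs_range m u (fun y => table_region u y Q) (length T) lo)|].
- intros y Hy; apply table_packs with (unit := pow2); auto.
  intros c Hc; apply mod_ne0; auto; intros D; rewrite Z.mul_comm in D.
  apply (pow2_cancel u c y Hodd Hc) in D; small_divide D.
- intros y y' Hy Hy' Hlt [[[p q] a] c0] (c & HQc & ->) (c' & HQc' & E).
  apply mod_eq_divide in E; auto.
  apply HQ in HQc, HQc'; destruct (Hk p q) as [H1 H2].
  assert (D : (u | kappa p q * (y - y')) \/ (u | kappa p q * (y + y'))).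
  { destruct (Z.abs_eq_or_opp c), (Z.abs_eq_or_opp c').
    - left; apply (eq_ind _ _ E); nia.
    - right; apply (eq_ind _ _ E); nia.
    - right; apply (divide_neg _ _ _ E); nia.
    - left; apply (divide_neg _ _ _ E); nia. }
  destruct D as [D|D]; apply (pow2_cancel _ _ _ Hodd H1) in D; small_divide D.
- intros k (y & Hy & Hk'); exists y; split; [lia|auto].
Qed.

(** * Completing tables by blocks {0, d, 2d} inside the rows *)

Definition dbl (d : Z * Z) : Z * Z := (2 * fst d, 2 * snd d).

Definition equi_apart m u (i j : Z * Z) : Prop :=
  (sep2 m u i j /\ sep2 m u i (dbl j)) /\ (sep2 m u (dbl i) j /\ sep2 m u (dbl i) (dbl j)).

Lemma equi_row m u r I (D : Z * Z -> Prop) : 0 < m -> 0 < u ->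
  ForallOrdPairs (equi_apart m u) I ->
  (forall i, In i I -> ~ zero2 m u (dbl i) /\ ~ zero2 m u (3 * fst i, 3 * snd i) /\ D i /\ D (dbl i)) ->
  packs m u (pure_region m u r D) (length I).
Proof.
intros Hm Hu HI HD.
assert (Horb : forall i d, In d (orbits1 i (dbl i)) -> d = i \/ d = dbl i).
{ intros [a c] d [<-|[<-|[<-|[]]]]; auto; left; unfold dbl; simpl; f_equal; ring. }
apply packs_one_row with (f := fun i => i) (g := dbl) (R := equi_apart m u); auto.
- intros i Hi; destruct (HD i Hi) as (H2 & H3 & D1 & D2).
  assert (H1 : ~ zero2 m u i).
  { intros [Z1 Z2]; apply H2; split; simpl; apply Z.divide_mul_r; assumption. }
  split.
  + apply valid_block1; auto; unfold dbl; simpl.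
    intros H; apply H1; destruct i as [a c], H as [Z1 Z2]; simpl in *; split; simpl;
      [apply (eq_ind _ _ Z1)|apply (eq_ind _ _ Z2)]; ring.
  + intros d Hd; apply Horb in Hd as [-> | ->]; auto.
- intros i j d d' Hi Hj ((R1 & R2) & R3 & R4) Hd Hd'.
  apply Horb in Hd as [-> | ->]; apply Horb in Hd' as [-> | ->]; auto.
Qed.

Definition pure_in (r : Z) (PP : Z -> Z -> Prop) : region := fun k =>
  exists a c, PP a c /\ k = (r, r, a, c).

Definition mixed_in m u n (OK : Z -> Z -> Z -> Z -> Prop) : region := fun k =>
  exists p q a c, 0 <= p < n /\ 0 <= q < n /\ q mod 3 = nx (p mod 3) /\ 0 <= a < m /\ 0 <= c < u /\
    OK p q a c /\ link m u p q (a, c) k.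

Definition table_keys m u n (PP : Z -> Z -> Z -> Prop) OK : region := fun k =>
  (exists r, 0 <= r < n /\ pure_in r (PP r) k) \/ mixed_in m u n OK k.

Definition all_keys m u n OK : region := table_keys m u n (fun _ _ _ => True) OK.

Lemma nx_neq l : 0 <= l < 3 -> nx l <> l.
Proof. intros Hl; pose proof (nx_spec l Hl); lia. Qed.

Lemma fill_rows m u n PP OK Nt Ne : 0 <= n ->
  packs m u (table_keys m u n PP OK) Nt ->
  (forall r, 0 <= r < n -> packs m u (pure_in r (fun a c => ~ PP r a c)) Ne) ->
  packs m u (all_keys m u n OK) (Nt + Z.to_nat n * Ne).
Proof.
intros Hn Ht Hr.
eapply packs_union; [exact Ht|apply (packs_range m u (fun r => pure_in r (fun a c => ~ PP r a c)) Ne 0 (Z.to_nat n))| | |reflexivity].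
- intros r Hrn; apply Hr; lia.
- intros i j Hi Hj Hij k (a & c & _ & ->) (a' & c' & _ & E); injection E; lia.
- intros k [(r & Hrn & a & c & HP & ->)|(p & q & a & c & Hp & Hq & Hpq & _ & _ & _ & [->| ->])]
    (r' & Hr' & a' & c' & HN & E); injection E; intros; subst.
  + exact (HN HP).
  + subst; apply (nx_neq (r' mod 3)); [apply Z.mod_pos_bound; lia|auto].
  + subst; apply (nx_neq (r' mod 3)); [apply Z.mod_pos_bound; lia|auto].
- intros k [[(r & Hrn & a & c & HP & ->)|H]|(r & Hrn & a & c & HN & ->)].
  + left; exists r; split; [exact Hrn|exists a, c; auto].
  + right; exact H.
  + left; exists r; split; [lia|exists a, c; auto].
Qed.

(* [ok p q a] decides which labels a table uses between the rows [p] and [q];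
   [pp r a c] which differences it uses in the row [r]. *)
Definition table_query m n (pp ok : Z -> Z -> Z -> bool) (k : key) : bool :=
  let '(p, q, a, c) := k in
  (0 <=? p) && (p <? n) && (0 <=? q) && (q <? n) && (0 <=? a) && (a <? m) &&
  (if p =? q then pp p a c
   else if q mod 3 =? nx (p mod 3) then ok p q a
   else (p mod 3 =? nx (q mod 3)) && ok q p ((- a) mod m)).

Lemma table_query_keys m u n pp ok p q a c c' (PP : Z -> Z -> Z -> Prop) (OK : Z -> Z -> Z -> Z -> Prop) :
  0 < m -> 0 < u -> 0 <= c' < u ->
  table_query m n pp ok (p, q, a, c) = true ->
  (pp p a c = true -> PP p a c') ->
  (forall p q a, ok p q a = true -> OK p q a c' /\ OK p q a ((- c') mod u)) ->
  table_keys m u n PP OK (p, q, a, c').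
Proof.
intros Hm Hu Hc HQ HP HO; unfold table_query in HQ.
rewrite !andb_true_iff, !Z.leb_le, !Z.ltb_lt in HQ.
destruct HQ as ((((((H1 & H2) & H3) & H4) & H5) & H6) & H7).
destruct (Z.eqb_spec p q) as [<-|Hpq].
- left; exists p; split; [lia|exists a, c'; auto].
- destruct (Z.eqb_spec (q mod 3) (nx (p mod 3))) as [Hn|Hn].
  + right; exists p, q, a, c'; split; [lia|split; [lia|split; [exact Hn|split; [lia|split; [lia|split; [apply HO; exact H7|]]]]]].
    left; simpl; rewrite !Z.mod_small; auto.
  + apply andb_true_iff in H7 as [H7 H8]; apply Z.eqb_eq in H7.
    right; exists q, p, ((- a) mod m), ((- c') mod u).
    split; [lia|split; [lia|split; [exact H7|split; [apply Z.mod_pos_bound; lia|split; [apply Z.mod_pos_bound; lia|split; [apply HO; exact H8|]]]]]].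
    right; simpl; rewrite !neg_mod_mod, !Z.opp_involutive, !Z.mod_small by lia; auto.
Qed.

Definition base_query m n pp ok (k : key) : bool :=
  let '(p, q, a, c) := k in table_query m n pp ok k && (c =? 0).
Definition fibre_query m n pp ok (k : key) : bool :=
  let '(p, q, a, c) := k in table_query m n pp ok k && (Z.abs c =? kappa p q).

Definition table_fits m (unit : Z -> bool) (Q : key -> bool) (T : list block) : bool :=
  table_ok m unit T && forallb (fun b => forallb Q (coefs m b)) T.

Lemma base_packs m u n pp ok T : 0 < m -> 0 < u ->
  table_fits m (fun _ => false) (base_query m n pp ok) T = true ->
  packs m u (table_keys m u n (fun r a c => pp r a 0 = true /\ c = 0)
    (fun p q a c => ok p q a = true /\ c = 0)) (length T).
Proof.
intros Hm Hu H; apply andb_true_iff in H as [H1 H2].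
eapply packs_sub; [apply (table_packs m u (fun _ => false) 0 T (base_query m n pp ok)); auto; discriminate|].
intros [[[p q] a] c'] (c & HQ & ->); apply andb_true_iff in HQ as [HQ Hc]; apply Z.eqb_eq in Hc; subst c.
apply (table_query_keys m u n pp ok p q a 0); auto.
apply Z.mod_pos_bound; exact Hu.
Qed.

Lemma pow2_nonzero u c y : 0 < u -> u mod 2 = 1 -> pow2 c = true -> 1 <= y <= (u - 1) / 2 ->
  (y * c) mod u <> 0.
Proof.
intros Hu Hodd Hc Hy; apply mod_ne0; auto; intros D; rewrite Z.mul_comm in D.
apply (pow2_cancel u c y Hodd Hc) in D; apply divide_small in D; [lia|].
pose proof (Z.div_mod (u - 1) 2 ltac:(lia)); pose proof (Z.mod_pos_bound (u - 1) 2 ltac:(lia)); lia.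
Qed.

Lemma kappa_pow2 p q : pow2 (kappa p q) = true /\ 0 < kappa p q.
Proof.
unfold kappa; destruct (p =? q), (p mod 3 =? 2), (p mod 3 + q mod 3 =? 2); split; reflexivity.
Qed.

Lemma pow2_abs c : pow2 (Z.abs c) = pow2 c.
Proof. unfold pow2; rewrite Z.abs_involutive; reflexivity. Qed.

Lemma fibre_packs m u n pp ok T lo : 0 < m -> 0 < u -> u mod 2 = 1 -> 1 <= lo -> lo <= (u + 1) / 2 ->
  table_fits m pow2 (fibre_query m n pp ok) T = true ->
  packs m u (table_keys m u n
      (fun r a c => exists y e, lo <= y <= (u - 1) / 2 /\ Z.abs e = kappa r r /\ 
         pp r a e = true /\ c = (y * e) mod u)
      (fun p q a c => ok p q a = true /\ exists y e, lo <= y <= (u - 1) / 2 /\ Z.abs e = kappa p q /\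
         c = (y * e) mod u))
    (Z.to_nat ((u + 1) / 2 - lo) * length T).
Proof.
intros Hm Hu Hodd Hlo Hhi H; apply andb_true_iff in H as [H1 H2].
eapply packs_sub; [apply (table_family m u T (fibre_query m n pp ok) lo); auto|].
- intros p q a c HQ; apply andb_true_iff in HQ as [_ HQ]; apply Z.eqb_eq; exact HQ.
- intros [[[p q] a] c'] (y & Hy & (c & HQ & ->) & _); apply andb_true_iff in HQ as [HQ Hc].
  apply Z.eqb_eq in Hc.
  unfold table_query in HQ.
rewrite !andb_true_iff, !Z.leb_le, !Z.ltb_lt in HQ.
destruct HQ as ((((((Q1 & Q2) & Q3) & Q4) & Q5) & Q6) & Q7).
destruct (Z.eqb_spec p q) as [<-|Hpq].
+ left; exists p; split; [lia|exists a, ((y * c) mod u)]; split; [|reflexivity]; exists y, c; auto.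
+ destruct (Z.eqb_spec (q mod 3) (nx (p mod 3))) as [Hn|Hn].
  * right; exists p, q, a, ((y * c) mod u).
    split; [lia|split; [lia|split; [exact Hn|split; [lia|split; [apply Z.mod_pos_bound; lia|split; [split; [exact Q7|exists y, c; auto]|]]]]]].
    left; simpl; rewrite Z.mod_mod, (Z.mod_small a m) by lia; reflexivity.
  * apply andb_true_iff in Q7 as [Q7 Q8]; apply Z.eqb_eq in Q7.
    right; exists q, p, ((- a) mod m), ((- (y * c)) mod u).
    split; [lia|split; [lia|split; [exact Q7|split; [apply Z.mod_pos_bound; lia|split; [apply Z.mod_pos_bound; lia|split; [split; [exact Q8|]|]]]]]].
    -- exists y, (- c); split; [lia|split].
       ++ rewrite Z.abs_opp, Hc; unfold kappa; rewrite (Z.eqb_sym p q).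
          destruct (Z.eqb_spec q p); [congruence|]; rewrite Z.add_comm; reflexivity.
       ++ f_equal; ring.
    -- right; simpl; rewrite !neg_mod_mod, !Z.opp_involutive by lia; rewrite (Z.mod_small a m) by lia; reflexivity.
Qed.

(** The shifts reserved for the tables: [P0] on the fibre c = 0, [P1] on every other fibre. *)
Definition split_keys (P0 P1 : list Z) (a c : Z) : Prop := (c = 0 /\ In a P0) \/ (c <> 0 /\ In a P1).
Definition mem (P : list Z) (a : Z) : bool := existsb (Z.eqb a) P.

Lemma mem_In P a : mem P a = true <-> In a P.
Proof.
unfold mem; rewrite existsb_exists; split.
- intros (x & Hx & E); apply Z.eqb_eq in E; subst; exact Hx.
- intros H; exists a; split; [exact H|apply Z.eqb_refl].
Qed.

Definition avoids m (P : list Z) (a : Z) : bool :=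
  negb (mem P (a mod m)) && negb (mem P ((- a) mod m)).

Lemma equi_table m u r P0 P1 (I : list (Z * Z)) : 0 < m -> 0 < u -> u mod 2 = 1 ->
  ForallOrdPairs (equi_apart m u) I ->
  (forall a c, In (a, c) I -> ~ zero2 m u (2 * a, 2 * c) /\ ~ zero2 m u (3 * a, 3 * c) /\
     ((c = 0 /\ avoids m P0 a && avoids m P0 (2 * a) = true) \/
      (~ (u | c) /\ avoids m P1 a && avoids m P1 (2 * a) = true))) ->
  packs m u (pure_in r (fun a c => ~ split_keys P0 P1 a c)) (length I).
Proof.
intros Hm Hu Hodd HI HD.
set (D := fun d : Z * Z => (snd d = 0 /\ avoids m P0 (fst d) = true) \/
    (~ (u | snd d) /\ avoids m P1 (fst d) = true)).
eapply packs_sub; [apply (equi_row m u r I D); auto|].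
- intros [a c] Hi; destruct (HD a c Hi) as (H2 & H3 & H4); split; [exact H2|split; [exact H3|]].
  destruct H4 as [[-> H4]|[H4 H5]]; rewrite andb_true_iff in *.
  + split; left; simpl; tauto.
  + split; right; simpl; split; try tauto.
    intros Dv; apply H4, divide_twice; auto.
- assert (HN : forall d, D d -> ~ split_keys P0 P1 (fst d mod m) (snd d mod u)
      /\ ~ split_keys P0 P1 ((- fst d) mod m) ((- snd d) mod u)).
  { intros [a c] Hd; simpl; unfold split_keys.
    destruct Hd as [[E H]|[E H]]; simpl in E, H; apply andb_true_iff in H as [H1 H2];
    apply negb_true_iff in H1, H2.
    - subst c; rewrite Z.mod_0_l by lia; split; (intros [[_ K]|[K _]]; [|apply K; reflexivity]);
      apply mem_In in K; congruence.
    - split; (intros [[K _]|[_ K]]; [|apply mem_In in K; congruence]).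
      + apply E, Z.mod_divide; [lia|exact K].
      + apply E, Z.divide_opp_r, Z.mod_divide; [lia|exact K]. }
  intros k (d & Hd & ->); do 2 eexists; split; [|reflexivity].
  destruct Hd as [Hd|Hd]; [apply HN; exact Hd|].
  destruct (HN _ Hd) as [_ H]; simpl in H; rewrite !Z.opp_involutive in H; exact H.
Qed.

Ltac equi_tac := unfold equi_apart, sep2, zero2, dbl; cbn [fst snd];
  repeat split; intros [? ?]; first
  [ match goal with D : (8 | _) |- False => destruct D; lia end
  | match goal with D : (4 | _) |- False => destruct D; lia end
  | match goal with D : (32 | _) |- False => destruct D; lia end
  | match goal with D : (_ | _), D' : (_ | _) |- False => small_divide D' end ].

Ltac in_cases H tac :=
  lazymatch type of H with
  | In _ [] => destruct H
  | In _ (_ :: _) => apply in_inv in H; destruct H as [H|H]; [injection H as <- <-; tac|in_cases H tac]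
  | In _ (_ ++ _) => apply in_app_or in H; destruct H as [H|H]; in_cases H tac
  | In _ (seg _ _ _) => apply in_seg in H as (? & ? & H); injection H as -> ->; tac
  end.

Ltac nonzero_tac := intros [? ?]; cbn [fst snd] in *; first
  [ match goal with D : (8 | _) |- False => destruct D; lia end
  | match goal with D : (32 | _) |- False => destruct D; lia end
  | match goal with D : (_ | _), D' : (_ | 2 * _) |- False => apply divide_twice in D'; [small_divide D'|assumption] end ].

Ltac equi_member_tac := split; [nonzero_tac|split; [nonzero_tac|first
  [ left; split; reflexivity
  | right; split; [intro; match goal with D : (_ | _) |- False => small_divide D end|reflexivity] ]]].

(** The doublings 2 -> 4 for c = 0, and 3 -> 6 and 4 -> 0 for c <> 0, use up all shifts that the
    tables leave, up to sign. *)
Lemma equi_8 u g r : u = 2 * g + 1 -> 0 <= g ->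
  packs 8 u (pure_in r (fun a c => ~ split_keys [1; 3; 5; 7] [1; 7] a c)) (Z.to_nat (3 * g + 1)).
Proof.
intros Eu Hg.
assert (Hodd : u mod 2 = 1) by (subst u; Z.to_euclidean_division_equations; lia).
replace (Z.to_nat (3 * g + 1)) with (length ((2, 0) :: seg (fun w => (3, w)) 1 u ++ seg (fun w => (4, w)) 1 (g + 1)))
  by (cbn [length]; rewrite length_app, !length_seg; lia).
apply equi_table; try lia.
- clear Hodd; subst u; fop equi_tac.
- intros a c H; in_cases H equi_member_tac.
Qed.

(** Likewise: the odd shifts from 9 to 15 are doubled on all fibres, together with 8 -> 16 for c =
    0, and 12 -> 24 and 16 -> 0 for c <> 0. *)
Lemma equi_32 u g r : u = 2 * g + 1 -> 0 <= g ->
  packs 32 u (pure_in r (fun a c => ~ split_keys [1; 3; 5; 7; 4; 12; 31; 29; 27; 25; 28; 20]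
    [1; 3; 5; 7; 4; 31; 29; 27; 25; 28] a c)) (Z.to_nat (11 * g + 5)).
Proof.
intros Eu Hg.
assert (Hodd : u mod 2 = 1) by (subst u; Z.to_euclidean_division_equations; lia).
replace (Z.to_nat (11 * g + 5)) with (length ((9, 0) :: (11, 0) :: (13, 0) :: (15, 0) :: (8, 0) ::
    seg (fun w => (9, w)) 1 u ++ seg (fun w => (11, w)) 1 u ++ seg (fun w => (13, w)) 1 u ++
    seg (fun w => (15, w)) 1 u ++ seg (fun w => (12, w)) 1 u ++ seg (fun w => (16, w)) 1 (g + 1)))
  by (cbn [length]; rewrite !length_app, !length_seg; lia).
apply equi_table; try lia.
- clear Hodd; subst u; fop equi_tac.
- intros a c H; in_cases H equi_member_tac.
Qed.

(** * Groups of three rows, shifts modulo 8u and 32u *)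

Definition three_ok (mu0 p q a : Z) : bool := negb (a =? mu0).

Lemma tables_union m u n PP OK PP1 OK1 PP2 OK2 N1 N2 : 0 < m -> 0 < u ->
  (forall r a c, PP1 r a c -> c = 0) -> (forall p q a c, OK1 p q a c -> c = 0) ->
  (forall r a c, PP2 r a c -> c <> 0) -> (forall p q a c, OK2 p q a c -> c <> 0) ->
  (forall r a c, PP1 r a c \/ PP2 r a c -> PP r a c) ->
  (forall p q a c, 0 <= a < m -> 0 <= c < u -> OK1 p q a c \/ OK2 p q a c -> OK p q a c) ->
  packs m u (table_keys m u n PP1 OK1) N1 -> packs m u (table_keys m u n PP2 OK2) N2 ->
  packs m u (table_keys m u n PP OK) (N1 + N2).
Proof.
intros Hm Hu H1 H2 H3 H4 H5 H6 K1 K2.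
assert (Z1 : forall k, table_keys m u n PP1 OK1 k -> snd k = 0).
{ intros k [(r & _ & a & c & H & ->)|(p & q & a & c & _ & _ & _ & _ & _ & H & [->| ->])]; simpl.
  - exact (H1 _ _ _ H).
  - rewrite (H2 _ _ _ _ H); apply Z.mod_0_l; lia.
  - rewrite (H2 _ _ _ _ H); apply Z.mod_0_l; lia. }
assert (Z2 : forall k, table_keys m u n PP2 OK2 k -> snd k <> 0).
{ intros k [(r & _ & a & c & H & ->)|(p & q & a & c & _ & _ & _ & _ & Hc & H & [->| ->])]; simpl.
  - exact (H3 _ _ _ H).
  - pose proof (H4 _ _ _ _ H); rewrite Z.mod_small by lia; exact H0.
  - pose proof (H4 _ _ _ _ H) as Hc0; intros E; apply Z.mod_divide in E; [|lia].
    small_divide E. }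
eapply packs_union; [exact K1|exact K2| | |reflexivity].
- intros k Hk Hk'; exact (Z2 k Hk' (Z1 k Hk)).
- intros k [[(r & Hr & a & c & H & ->)|(p & q & a & c & Hp & Hq & Hpq & Ha & Hc & H & L)]
    |[(r & Hr & a & c & H & ->)|(p & q & a & c & Hp & Hq & Hpq & Ha & Hc & H & L)]].
  + left; exists r; split; [exact Hr|exists a, c; auto].
  + right; exists p, q, a, c; do 5 (split; [assumption|]); split; [apply H6; auto|exact L].
  + left; exists r; split; [exact Hr|exists a, c; auto].
  + right; exists p, q, a, c; do 5 (split; [assumption|]); split; [apply H6; auto|exact L].
Qed.

Lemma product_filler m u g n P0 P1 (ok ok' : Z -> Z -> Z -> bool) OK T0 T1 Ne :
  0 < m -> u = 2 * g + 1 -> 0 <= g -> 0 <= n ->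
  table_fits m (fun _ => false) (base_query m n (fun _ a _ => mem P0 a) ok) T0 = true ->
  table_fits m pow2 (fibre_query m n (fun _ a _ => mem P1 a) ok') T1 = true ->
  (forall p q a, 0 <= a < m -> ok p q a = true -> OK p q a 0) ->
  (forall p q a c, 0 <= a < m -> 0 < c < u -> ok' p q a = true -> OK p q a c) ->
  (forall r, packs m u (pure_in r (fun a c => ~ split_keys P0 P1 a c)) Ne) ->
  packs m u (all_keys m u n OK) (length T0 + Z.to_nat g * length T1 + Z.to_nat n * Ne).
Proof.
intros Hm Eu Hg Hn HT0 HT1 HO HO' He.
assert (Hodd : u mod 2 = 1) by (subst u; Z.to_euclidean_division_equations; lia).
assert (Eg1 : (u + 1) / 2 = g + 1) by (subst u; Z.to_euclidean_division_equations; lia).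
assert (Eg2 : (u - 1) / 2 = g) by (subst u; Z.to_euclidean_division_equations; lia).
assert (Hu : 0 < u) by lia.
assert (Hnz : forall y e c p q, 1 <= y <= (u - 1) / 2 -> Z.abs e = kappa p q -> c = (y * e) mod u -> c <> 0).
{ intros y e c p q Hy He' ->; apply pow2_nonzero; auto.
  rewrite <- pow2_abs, He'; apply kappa_pow2. }
apply (fill_rows m u n (fun _ => split_keys P0 P1) OK); auto.
pose proof (base_packs m u n _ ok T0 Hm Hu HT0) as B0.
pose proof (fibre_packs m u n _ ok' T1 1 Hm Hu Hodd ltac:(lia) ltac:(lia) HT1) as B1.
replace (Z.to_nat g * length T1)%nat with (Z.to_nat ((u + 1) / 2 - 1) * length T1)%nat by (f_equal; lia).
refine (tables_union m u n _ _ _ _ _ _ _ _ Hm Hu _ _ _ _ _ _ B0 B1).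
- intros r a c [_ H]; exact H.
- intros p q a c [_ H]; exact H.
- intros r a c (y & e & Hy & He' & _ & E); exact (Hnz y e c r r Hy He' E).
- intros p q a c (_ & y & e & Hy & He' & E); exact (Hnz y e c p q Hy He' E).
- intros r a c [[H ->]|(y & e & Hy & He' & H & E)].
  + left; split; [reflexivity|apply mem_In; exact H].
  + right; split; [exact (Hnz y e c r r Hy He' E)|apply mem_In; exact H].
- intros p q a c Ha Hc [[H ->]|(H & y & e & Hy & He' & E)].
  + apply HO; auto.
  + apply HO'; auto; pose proof (Hnz y e c p q Hy He' E); lia.
Qed.

Lemma filler_of_product m u mu0 mu N : 0 < m -> 0 < u -> Z.gcd m u = 1 ->
  0 <= mu < m * u -> mu mod m = mu0 -> mu mod u = 0 ->
  packs m u (all_keys m u 3 (fun p q a c => ~ (a = mu0 /\ c = 0))) N ->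
  packs (m * u) 1 (filler_region (m * u) mu) N.
Proof.
intros Hm Hu Hg Hmu E1 E2 H; apply (packs_crt m u Hm Hu Hg) in H.
eapply packs_sub; [exact H|].
intros [[[p q] a] c] (Hk & Ha & ->).
assert (Hgoal : forall x p q a0 c0, 0 <= p < 3 -> q mod 3 = nx (p mod 3) -> 0 <= q < 3 -> 
   ~ (a0 = mu0 /\ c0 = 0) -> 0 <= x < m * u -> x mod m = a0 -> x mod u = c0 ->
   0 <= p < 3 /\ 0 <= x < m * u /\ x <> mu /\ q = nx p).
{ intros x p0 q0 a0 c0 Hp Hq Hq0 HN Hx Ex Ex'; rewrite !Z.mod_small in Hq by lia.
  repeat split; try lia; intros ->; apply HN; split; congruence. }
destruct Hk as [(r & Hr & a' & c' & _ & E)|(p' & q' & a' & c' & Hp & Hq & Hpq & Ha' & Hc' & HN & [E|E])];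
  simpl in E; injection E as -> -> Ea Ec.
- left; exists r, a; auto.
- rewrite (Z.mod_small a' m) in Ea by lia; rewrite (Z.mod_small c' u) in Ec by lia.
  destruct (Hgoal a p' q' a' c') as (_ & _ & Hne & ->); auto.
  right; exists p', a; split; [exact Hp|split; [exact Ha|split; [exact Hne|]]].
  left; simpl; rewrite Z.mod_small by lia; rewrite Z.mod_1_r; reflexivity.
- assert (F1 : ((- a) mod (m * u)) mod m = a').
  { rewrite <- Zmod_div_mod; try nia; [|exists u; ring].
    rewrite <- neg_mod_mod, Ea, neg_mod_mod, Z.opp_involutive by lia; apply Z.mod_small; lia. }
  assert (F2 : ((- a) mod (m * u)) mod u = c').
  { rewrite <- Zmod_div_mod; try nia; [|exists m; ring].
    rewrite <- neg_mod_mod, Ec, neg_mod_mod, Z.opp_involutive by lia; apply Z.mod_small; lia. }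
  assert (Hb : 0 <= (- a) mod (m * u) < m * u) by (apply Z.mod_pos_bound; nia).
  destruct (Hgoal ((- a) mod (m * u)) p' q' a' c') as (_ & _ & Hne & ->); auto.
  right; exists p', ((- a) mod (m * u)); split; [exact Hp|split; [exact Hb|split; [exact Hne|]]].
  right; simpl; rewrite neg_mod_mod, Z.opp_involutive by lia; rewrite (Z.mod_small a) by lia; reflexivity.
Qed.

Lemma gcd_pow2 u g : u = 2 * g + 1 -> Z.gcd 4 u = 1 /\ Z.gcd 8 u = 1 /\ Z.gcd 32 u = 1.
Proof.
intros ->.
assert (Hk : exists k, g * (g + 1) = 2 * k).
{ pose proof (Z.div_mod g 2 ltac:(lia)); pose proof (Z.mod_pos_bound g 2 ltac:(lia)).
  assert (E : g mod 2 = 0 \/ g mod 2 = 1) by lia; set (w := g / 2) in *; clearbody w.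
  destruct E as [E|E]; rewrite E in *.
  - exists (w * (2 * w + 1)); nia.
  - exists ((2 * w + 1) * (w + 1)); nia. }
destruct Hk as [k Hk].
(* All Bezout coefficients come from u^2 = 8k + 1; for 32 the fourth power of 8k + 1 is 1 modulo
   32. *)
assert (H8 : (2 * g + 1) * (2 * g + 1) = 8 * k + 1) by nia.
repeat split; apply Z.bezout_1_gcd.
- exists (- (2 * k)), (2 * g + 1); nia.
- exists (- k), (2 * g + 1); nia.
- exists (- (k * (4 * k + 1) * (32 * k * k + 8 * k + 1))),
   ((8 * k + 1) * (8 * k + 1) * (8 * k + 1) * (2 * g + 1)).
  replace ((8 * k + 1) * (8 * k + 1) * (8 * k + 1) * (2 * g + 1) * (2 * g + 1))
    with ((8 * k + 1) * (8 * k + 1) * (8 * k + 1) * ((2 * g + 1) * (2 * g + 1))) by ring.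
  rewrite H8; ring.
Qed.

Lemma three_filler m h u g e P0 P1 T0 T1 Ne : m = 2 * h -> 0 < h -> u = 2 * g + 1 -> 0 <= g ->
  Z.gcd m u = 1 -> e = 0 \/ e = 1 ->
  table_fits m (fun _ => false) (base_query m 3 (fun _ a _ => mem P0 a) (three_ok (h * e))) T0 = true ->
  table_fits m pow2 (fibre_query m 3 (fun _ a _ => mem P1 a) (fun _ _ _ => true)) T1 = true ->
  (forall r, packs m u (pure_in r (fun a c => ~ split_keys P0 P1 a c)) Ne) ->
  packs (m * u) 1 (filler_region (m * u) (h * u * e)) (length T0 + Z.to_nat g * length T1 + 3 * Ne).
Proof.
intros Em Hh Eu Hg Hgcd He H0 H1 HE.
assert (Hbound : 0 <= h * e < m) by (destruct He; subst; lia).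
apply (filler_of_product m u (h * e)); auto; try lia.
(* As u = 2g + 1, the missing label h u e is h e modulo 2h, so the tables need not know u. *)
- symmetry; apply (Z.mod_unique _ _ (g * e)); [lia|subst; ring].
- replace (h * u * e) with (h * e * u) by ring; apply Z.mod_mul; lia.
- apply (product_filler m u g 3 P0 P1 (three_ok (h * e)) (fun _ _ _ => true)); auto; try lia.
  + intros p q a Ha H [E _]; unfold three_ok in H; apply negb_true_iff, Z.eqb_neq in H; auto.
Qed.

Lemma three_filler_8 u g e : u = 2 * g + 1 -> 0 <= g -> e = 0 \/ e = 1 ->
  packs (8 * u) 1 (filler_region (8 * u) (4 * u * e)) (Z.to_nat (27 * g + 12)).
Proof.
intros Eu Hg He; destruct (gcd_pow2 u g Eu) as (_ & Hgcd & _).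
assert (EN : Z.to_nat (27 * g + 12) = (9 + Z.to_nat g * 18 + 3 * Z.to_nat (3 * g + 1))%nat) by lia.
rewrite EN; destruct He as [-> | ->].
- apply (three_filler 8 4 u g 0 [1; 3; 5; 7] [1; 7] three_8_0_base three_8_fibre); auto; try lia;
    [vm_compute; reflexivity..|intros r; apply equi_8; auto].
- apply (three_filler 8 4 u g 1 [1; 3; 5; 7] [1; 7] three_8_1_base three_8_fibre); auto; try lia;
    [vm_compute; reflexivity..|intros r; apply equi_8; auto].
Qed.

Lemma three_filler_32 u g e : u = 2 * g + 1 -> 0 <= g -> e = 0 \/ e = 1 ->
  packs (32 * u) 1 (filler_region (32 * u) (16 * u * e)) (Z.to_nat (107 * g + 52)).
Proof.
intros Eu Hg He; destruct (gcd_pow2 u g Eu) as (_ & _ & Hgcd).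
assert (EN : Z.to_nat (107 * g + 52) = (37 + Z.to_nat g * 74 + 3 * Z.to_nat (11 * g + 5))%nat) by lia.
rewrite EN; destruct He as [-> | ->].
- apply (three_filler 32 16 u g 0 [1; 3; 5; 7; 4; 12; 31; 29; 27; 25; 28; 20]
    [1; 3; 5; 7; 4; 31; 29; 27; 25; 28] three_32_0_base three_32_fibre); auto; try lia;
    [vm_compute; reflexivity..|intros r; apply equi_32; auto].
- apply (three_filler 32 16 u g 1 [1; 3; 5; 7; 4; 12; 31; 29; 27; 25; 28; 20]
    [1; 3; 5; 7; 4; 31; 29; 27; 25; 28] three_32_1_base three_32_fibre); auto; try lia;
    [vm_compute; reflexivity..|intros r; apply equi_32; auto].
Qed.

(** * Three rows and shifts modulo 4u *)

Ltac equi_20_tac := unfold equi_apart, sep2, zero2, dbl; cbn [fst snd]; repeat split;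
  intros [D _]; destruct D; lia.
Ltac member_20_tac := split; [|split];
  [intros [D _]; destruct D; cbn [fst snd] in *; lia..|left; split; reflexivity].

(** The case u = 5, below the range of the explicit families for 4u. The table lives modulo 20, with
    a trivial second component. *)
Lemma three_filler_20 e : e = 0 \/ e = 1 -> packs 20 1 (filler_region 20 (10 * e)) 33.
Proof.
intros He.
assert (HE : forall r, packs 20 1 (pure_in r (fun a c => ~ split_keys [1; 3; 17; 19] [] a c)) 4).
{ intros r; apply (equi_table 20 1 r [1; 3; 17; 19] [] [(9, 0); (7, 0); (5, 0); (4, 0)]); try lia.
  - reflexivity.
  - fop equi_20_tac.
  - intros a c H; in_cases H member_20_tac. }
assert (H : forall T, table_fits 20 (fun _ => false) (base_query 20 3 (fun _ a _ => mem [1; 3; 17; 19] a) (three_ok (10 * e))) T = true ->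
  length T = 21%nat -> packs 20 1 (filler_region 20 (10 * e)) 33).
{ intros T HT Hl; apply (filler_of_product 20 1 (10 * e) (10 * e)); try lia; try reflexivity.
  - destruct He; subst; reflexivity.
  - apply Z.mod_1_r.
  - replace 33%nat with (21 + Z.to_nat 3 * 4)%nat by reflexivity.
    apply (fill_rows 20 1 3 (fun _ => split_keys [1; 3; 17; 19] [])); [lia| |intros; apply HE].
    pose proof (base_packs 20 1 3 _ (three_ok (10 * e)) T ltac:(lia) ltac:(lia) HT) as B.
    rewrite Hl in B; eapply packs_sub; [exact B|].
    intros k [(r & Hr & a & c & (Hp & ->) & ->)|(p & q & a & c & Hp & Hq & Hpq & Ha & Hc & (Ho & ->) & L)].
    + left; exists r; split; [exact Hr|exists a, 0; split; [|reflexivity]].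
      left; split; [reflexivity|apply mem_In; exact Hp].
    + right; exists p, q, a, 0; do 5 (split; [assumption|]); split; [|exact L].
      intros [E _]; unfold three_ok in Ho; apply negb_true_iff, Z.eqb_neq in Ho; auto. }
destruct He as [-> | ->]; [apply (H three_20_0_base)|apply (H three_20_1_base)]; vm_compute; reflexivity.
Qed.

(** * Fillers invariant under rotation of the three rows *)

Definition third (p : Z * Z) : Z := - fst p - snd p.
Definition rotate (p : Z * Z) : Z * Z := (snd p, third p).

Section Cyclic3.
Variables (m mu : Z).
Hypothesis Hm : 0 < m.

Lemma link_swap r r' x k : link m 1 r r' (x, 0) k -> link m 1 r' r (- x, 0) k.
Proof.
intros [->| ->]; [right|left]; simpl; rewrite ?Z.opp_involutive; reflexivity.
Qed.

(** A block with one point in each row has labels a, b, - a - b around the cycle 0, 1, 2. Its three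
    rotations put each of these labels on each of the three steps, so that all steps see the same
    list [L]. *)
Lemma transversals (T : list (Z * Z)) :
  let L := map fst T ++ map snd T ++ map third T in
  ForallOrdPairs (fun x y => ~ (m | x - y)) L ->
  packs m 1 (fun k => exists l x, 0 <= l < 3 /\ In x L /\ link m 1 l (nx l) (x, 0) k)
    (3 * length T).
Proof.
intros L HL.
apply pairwise_app_inv in HL as (H1 & H23 & H1x); apply pairwise_app_inv in H23 as (H2 & H3 & H23).
assert (H12 : forall a b, In a (map fst T) -> In b (map snd T) -> ~ (m | a - b))
  by (intros; apply H1x; auto; apply in_or_app; auto).
assert (H13 : forall a b, In a (map fst T) -> In b (map third T) -> ~ (m | a - b))
  by (intros; apply H1x; auto; apply in_or_app; auto).
assert (Hsym : forall a b, ~ (m | a - b) -> ~ (m | b - a)).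
{ intros a b H D; apply H, (divide_neg _ _ _ D); lia. }
apply pairwise_map_inv in H1, H2, H3.
assert (F : ForallOrdPairs (fun p q => ~ (m | fst p - fst q) /\ ~ (m | snd p - snd q) /\ ~ (m | third p - third q)) T)
  by (exact (pairwise_and _ _ _ _ H1 (pairwise_and _ _ _ _ H2 H3))).
assert (Hr : forall p, third (rotate p) = fst p) by (intros [a b]; unfold third, rotate, third; simpl; lia).
assert (Hin : forall p, In p T -> In (fst p) (map fst T) /\ In (snd p) (map snd T) /\ In (third p) (map third T)).
{ intros p Hp; repeat split; apply in_map; exact Hp. }
set (I := T ++ map rotate T ++ map (fun p => rotate (rotate p)) T).
assert (HI : ForallOrdPairs (fun p q => ~ (m | fst p - fst q) /\ ~ (m | snd p - snd q) /\ ~ (m | third p - third q)) I).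
{ assert (Fm : forall (f : Z * Z -> Z * Z), (forall p q, ~ (m | fst p - fst q) /\ ~ (m | snd p - snd q) /\ ~ (m | third p - third q) ->
     ~ (m | fst (f p) - fst (f q)) /\ ~ (m | snd (f p) - snd (f q)) /\ ~ (m | third (f p) - third (f q))) ->
     ForallOrdPairs (fun p q => ~ (m | fst p - fst q) /\ ~ (m | snd p - snd q) /\ ~ (m | third p - third q)) (map f T)).
  { intros f Hf; clear -F Hf; induction F as [|p T Hp F IH]; simpl; constructor; auto.
    rewrite Forall_forall in *; intros q Hq; apply in_map_iff in Hq as (q' & <- & Hq); auto. }
  apply ForallOrdPairs_app; [exact F|apply ForallOrdPairs_app|].
  - apply Fm; intros p q; rewrite !Hr; simpl; tauto.
  - apply Fm; intros p q; rewrite !Hr; simpl; rewrite !Hr; simpl; tauto.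
  - intros p q Hp Hq; apply in_map_iff in Hp as (p' & <- & Hp); apply in_map_iff in Hq as (q' & <- & Hq).
    destruct (Hin p' Hp) as (I1 & I2 & I3), (Hin q' Hq) as (J1 & J2 & J3).
    rewrite !Hr; simpl; rewrite !Hr; auto.
  - intros p q Hp Hq; destruct (Hin p Hp) as (I1 & I2 & I3).
    apply in_app_or in Hq; destruct Hq as [Hq|Hq]; apply in_map_iff in Hq as (q' & <- & Hq);
    destruct (Hin q' Hq) as (J1 & J2 & J3); rewrite ?Hr; simpl; rewrite ?Hr; auto 7. }
replace (3 * length T)%nat with (length I)
  by (unfold I; rewrite !length_app, !length_map; lia).
assert (HIL : forall p, In p I -> In (fst p) L /\ In (snd p) L /\ In (third p) L).
{ intros p Hp; unfold L; apply in_app_or in Hp; destruct Hp as [Hp|Hp]; [|apply in_app_or in Hp; destruct Hp as [Hp|Hp]];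
  try (apply in_map_iff in Hp as (q & <- & Hp)).
  - destruct (Hin p Hp) as (I1 & I2 & I3); rewrite !in_app_iff; auto.
  - destruct (Hin q Hp) as (I1 & I2 & I3); rewrite Hr; simpl; rewrite !in_app_iff; auto.
  - destruct (Hin q Hp) as (I1 & I2 & I3); rewrite Hr; simpl; rewrite Hr, !in_app_iff; auto. }
assert (HK : forall p k, In k (keys m 1 (Pt 0 0 0, Pt 1 (fst p) 0, Pt 2 (fst p + snd p) 0)) ->
  link m 1 0 1 (fst p, 0) k \/ link m 1 1 2 (snd p, 0) k \/ link m 1 2 0 (third p, 0) k).
{ intros p k Hk; apply keys_links in Hk; simpl in Hk; rewrite !Z.sub_0_r in Hk.
  replace (fst p + snd p - fst p) with (snd p) in Hk by lia.
  destruct Hk as [Hk|[Hk|Hk]]; auto.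
  apply link_swap in Hk; replace (- (fst p + snd p)) with (third p) in Hk by (unfold third; lia); auto. }
apply packs_family with (f := fun p => (Pt 0 0 0, Pt 1 (fst p) 0, Pt 2 (fst p + snd p) 0))
  (R := fun p q => ~ (m | fst p - fst q) /\ ~ (m | snd p - snd q) /\ ~ (m | third p - third q)); auto.
- intros p Hp; split; [unfold valid, distinct; simpl; repeat split; left; lia|].
  intros k Hk; apply HK in Hk; destruct (HIL p Hp) as (I1 & I2 & I3).
  destruct Hk as [Hk|[Hk|Hk]]; [exists 0, (fst p)|exists 1, (snd p)|exists 2, (third p)]; 
    (split; [lia|split; [assumption|exact Hk]]).
- intros p q Hp Hq (R1 & R2 & R3) k Hk Hk'; apply HK in Hk, Hk'.
  destruct Hk as [Hk|[Hk|Hk]], Hk' as [Hk'|[Hk'|Hk']]; revert k Hk Hk'; try (apply link_apart_rows; lia);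
  (apply link_apart; [lia|lia|lia|]; intros [D _]; simpl in D; auto).
Qed.

Lemma cyclic_filler (T P : list (Z * Z)) (D : list Z) N :
  ForallOrdPairs (fun x y => ~ (m | x - y))
    ((map fst T ++ map snd T ++ map third T) ++ map fst P ++ map snd P) ->
  (forall x, In x ((map fst T ++ map snd T ++ map third T) ++ map fst P ++ map snd P) -> ~ (m | x - mu)) ->
  0 <= mu < m ->
  ForallOrdPairs (sep m) (map (fun p : Z * Z => fst p - snd p) P ++ D ++ map (Z.mul 2) D) ->
  (forall d, In d D -> ~ (m | 2 * d)) ->
  N = (3 * (length T + length P + length D))%nat ->
  packs m 1 (filler_region m mu) N.
Proof.
intros HL Hmu Hmub HE HD ->.
apply pairwise_app_inv in HL as (HT & HP & HTP).
pose proof (transversals T HT) as KT.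
set (K := fun l k => (exists d, link m 1 l l (d, 0) k) \/
     exists x, In x (map fst P ++ map snd P) /\ link m 1 l (nx l) (1 * x, 0) k).
assert (KP : forall l, 0 <= l < 0 + Z.of_nat 3 -> packs m 1 (K l) (length P + length D)).
{ intros l Hl; apply (two_rows_half m Hm); auto.
  pose proof (nx_spec l ltac:(lia)); lia. }
assert (Hlab : forall l x k, 0 <= l < 3 -> link m 1 l (nx l) (x, 0) k -> ~ (m | x - mu) -> filler_region m mu k).
{ intros l x k Hl Hk Hx; right; exists l, (x mod m); split; [exact Hl|].
  split; [apply Z.mod_pos_bound; exact Hm|split].
  - intros E; apply Hx; rewrite <- (Z.mod_small mu m) in E by lia; apply mod_eq_divide in E; auto.
  - apply link_mod in Hk; auto; lia. }
eapply packs_union; [exact KT|apply (packs_range m 1 K (length P + length D) 0 3 KP)| | |lia].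
- intros l l' Hl Hl' Hlt k Hk Hk'; pose proof (nx_spec l ltac:(lia)); pose proof (nx_spec l' ltac:(lia)).
  destruct Hk as [(d & Hk)|(x & Hx & Hk)], Hk' as [(d' & Hk')|(x' & Hx' & Hk')]; revert k Hk Hk';
  apply link_apart_rows; lia.
- intros k (l & x & Hl & Hx & Hk) (l' & Hl' & Hk'); pose proof (nx_spec l ltac:(lia)); pose proof (nx_spec l' ltac:(lia)).
  destruct Hk' as [(d' & Hk')|(x' & Hx' & Hk')].
  + revert k Hk Hk'; apply link_apart_rows; lia.
  + destruct (Z.eq_dec l l') as [<-|Hll]; [|revert k Hk Hk'; apply link_apart_rows; lia].
    rewrite Z.mul_1_l in Hk'; revert k Hk Hk'; apply link_apart; [lia|lia|lia|].
    intros [E _]; exact (HTP x x' Hx Hx' E).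
- intros k [(l & x & Hl & Hx & Hk)|(l & Hl & [(d & Hk)|(x & Hx & Hk)])].
  + apply (Hlab l x); auto; apply Hmu, in_or_app; auto.
  + left; destruct Hk as [->| ->]; simpl; exists l; eexists; (split; [lia|]); rewrite Z.mod_1_r; reflexivity.
  + apply (Hlab l x); auto; try lia; [rewrite Z.mul_1_l in Hk; exact Hk|apply Hmu, in_or_app; auto].
Qed.
End Cyclic3.

Lemma pairwise_perm A (R : A -> A -> Prop) l l' : (forall a b, R a b -> R b a) ->
  Permutation l l' -> ForallOrdPairs R l -> ForallOrdPairs R l'.
Proof.
intros Hs HP; induction HP as [|x l l' HP IH|x y l|l l' l'' HP1 IH1 HP2 IH2]; intros H; auto.
- inversion H as [|? ? Hx H']; subst; constructor; auto.
  rewrite Forall_forall in *; intros a Ha; apply Hx, (Permutation_in a (Permutation_sym HP) Ha).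
- inversion H as [|? ? Hy H']; subst; inversion H' as [|? ? Hx H'']; subst.
  inversion Hy as [|? ? Hyx Hyl]; subst; constructor; [constructor; auto|constructor; auto].
Qed.

(** For u = 1 modulo 4 the prescribed length makes [Y] and its doubles meet every nonzero pair +-y
    exactly once. *)
Definition doubling_list (u : Z) (Y : list Z) : Prop :=
  ForallOrdPairs (sep u) (Y ++ map (Z.mul 2) Y) /\ (forall y, In y Y -> ~ (u | y)) /\
  length Y = Z.to_nat ((u - 1) / 4).

(** Multiples of 4 and other shifts modulo 4u do not interact, so a doubling list modulo u can be
    scaled by 4 and adjoined. *)
Lemma sep_level_two u E D Y : 0 < u -> doubling_list u Y ->
  ForallOrdPairs (sep (4 * u)) (E ++ D ++ map (Z.mul 2) D) ->
  (forall x, In x (E ++ D ++ map (Z.mul 2) D) -> ~ (4 | x)) ->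
  ForallOrdPairs (sep (4 * u)) (E ++ (D ++ map (Z.mul 4) Y) ++ map (Z.mul 2) (D ++ map (Z.mul 4) Y)).
Proof.
intros Hu (HY & _ & _) HE H4.
apply (pairwise_perm _ _ ((E ++ D ++ map (Z.mul 2) D) ++ map (Z.mul 4) (Y ++ map (Z.mul 2) Y))).
- intros a b; apply sep_sym.
- rewrite !map_app, !map_map, <- !app_assoc; apply Permutation_app_head, Permutation_app_head.
  rewrite !app_assoc; apply Permutation_app.
  + apply Permutation_app_comm.
  + apply Permutation_refl' , map_ext; intros; ring.
- apply ForallOrdPairs_app; [exact HE| |].
  + clear -HY Hu; generalize dependent (Y ++ map (Z.mul 2) Y); intros l HY.
    induction HY as [|y l Hy HY IH]; simpl; constructor; auto.
    rewrite Forall_forall in *; intros x Hx; apply in_map_iff in Hx as (z & <- & Hz).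
    destruct (Hy z Hz) as [S1 S2]; split; intros Hd; [apply S1|apply S2];
    destruct Hd as [w Hw]; exists w; lia.
  + intros x z Hx Hz; apply in_map_iff in Hz as (y & <- & _).
    assert (H : forall w, (4 * u | w) -> (4 | w)) by (intros w; apply Z.divide_trans; exists u; ring).
    split; intros Hd; apply H in Hd; apply (H4 x Hx); destruct Hd as [w Hw]; [exists (w + y)|exists (w - y)]; lia.
Qed.

Ltac nodiv4 := intro; match goal with D : (4 | _) |- False => destruct D; lia end.

(** The counts are exact. [T] and [P] use all 4u - 1 labels other than the missing one. The pairs of
    [P] have odd differences, and the explicit part of [D] consists of the other odd shifts, with u
    among them; its doubles are all shifts that are 2 modulo 4, with 2u among them. The multiples of
    4 are left to 4 [Y] and its doubles. *)
Lemma three_filler_4_0 c k u m U Y : 2 <= c -> k = 2 * c -> u = 4 * c + 1 -> U = 2 * u -> m = 4 * u ->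
  doubling_list u Y -> packs m 1 (filler_region m 0) (Z.to_nat (27 * c + 6)).
Proof.
intros Hc Ek Eu EU Em HY.
apply cyclic_filler with
  (T := (k, k + 1) :: (- k, - (k + 1)) ::
   seg (fun i => (k - 2 * i + U, k + 1 + i)) 1 c ++ seg (fun i => (2 * i - k - U, - (k + 1 + i))) 1 c ++
   seg (fun i => (k - 1 - 2 * i - U, k + 1 + i + U)) 0 (c - 1) ++
   seg (fun i => (- (k - 1 - 2 * i) + U, - (k + 1 + i + U))) 0 (c - 1) ++
   [(1, k + c + U); (U - 1, - (k + c + U)); (3 * c + 1 + U, - (3 * c + 1))])
  (P := seg (fun j => (- j, j - 1)) (c + 1) k ++ seg (fun j => (- j, j + 1)) 1 (c - 1) ++
   [(- k + U, k - 1); (- c, 1 - c); (1 + U, k + U)])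
  (D := (1 + U :: k - 1 + U :: 2 * k - 1 :: u :: seg (fun j => 2 * j + 1 + U) 1 (c - 1) ++
   seg (fun j => 2 * j - 1 + U) (c + 1) k) ++ map (Z.mul 4) Y).
- lia.
- unfold third; expand_lists; subst; fop nodiv.
- unfold third; expand_lists; intros x H; in_segs H; subst; nodiv.
- lia.
- subst m; apply sep_level_two; [lia|assumption|expand_lists; subst; fop sep_tac|
      expand_lists; intros x H; in_segs H; subst; nodiv4 ].
- intros d H; apply in_app_or in H; destruct H as [H|H]; [in_segs H; subst; nodiv|].
  apply in_map_iff in H as (y & <- & Hy); destruct HY as (_ & HY & _).
  intros D; apply (HY y Hy); apply divide_twice; [subst u; Z.to_euclidean_division_equations; lia|].
  destruct D as [w Hw]; exists w; lia.
- destruct HY as (_ & _ & HY).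
  do 3 (rewrite ?length_app, ?length_seg, ?length_map; cbn [length app]); rewrite HY.
  subst; Z.to_euclidean_division_equations; lia.
Qed.

(** The lists for the missing label 0, with a few entries moved by U, half of the modulus. *)
Lemma three_filler_4_1 c k u m U Y : 2 <= c -> k = 2 * c -> u = 4 * c + 1 -> U = 2 * u -> m = 4 * u ->
  doubling_list u Y -> packs m 1 (filler_region m (2 * u)) (Z.to_nat (27 * c + 6)).
Proof.
intros Hc Ek Eu EU Em HY.
apply cyclic_filler with
  (T := (k, k + 1) :: (- k, - (k + 1)) ::
   seg (fun i => (k - 2 * i + U, k + 1 + i)) 1 c ++ seg (fun i => (2 * i - k - U, - (k + 1 + i))) 1 c ++
   seg (fun i => (k - 1 - 2 * i - U, k + 1 + i + U)) 0 (c - 1) ++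
   seg (fun i => (- (k - 1 - 2 * i) + U, - (k + 1 + i + U))) 0 (c - 1) ++
   [(1 - U, k + c + U); (U - 1, - (k + c + U)); (3 * c + 1 + U, - (3 * c + 1 + U))])
  (P := seg (fun j => (- j, j - 1)) (c + 1) k ++ seg (fun j => (- j, j + 1)) 1 (c - 1) ++
   [(- k + U, k - 1); (- c, 1 - c); (1, k + U)])
  (D := (1 + U :: k - 1 :: 2 * k - 1 :: u :: seg (fun j => 2 * j + 1 + U) 1 (c - 1) ++
   seg (fun j => 2 * j - 1 + U) (c + 1) k) ++ map (Z.mul 4) Y).
- lia.
- unfold third; expand_lists; subst; fop nodiv.
- unfold third; expand_lists; intros x H; in_segs H; subst; nodiv.
- lia.
- subst m; apply sep_level_two; [lia|assumption|expand_lists; subst; fop sep_tac|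
      expand_lists; intros x H; in_segs H; subst; nodiv4 ].
- intros d H; apply in_app_or in H; destruct H as [H|H]; [in_segs H; subst; nodiv|].
  apply in_map_iff in H as (y & <- & Hy); destruct HY as (_ & HY & _).
  intros D; apply (HY y Hy); apply divide_twice; [subst u; Z.to_euclidean_division_equations; lia|].
  destruct D as [w Hw]; exists w; lia.
- destruct HY as (_ & _ & HY).
  do 3 (rewrite ?length_app, ?length_seg, ?length_map; cbn [length app]); rewrite HY.
  subst; Z.to_euclidean_division_equations; lia.
Qed.

(** * Groups of six rows *)

Section EvenDesign.
Variables (h u T : Z) (gam : Z -> Z -> Z).
Hypotheses (Hh : 0 < h) (Hu : 0 < u) (Hodd : u mod 2 = 1) (HT : 0 < T).

Let m := 2 * h.
Let t := 2 * T.

Definition half_of z : Z := if z <? T then 0 else 1.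
(** With t = 2T, the residues g and g + T have the same double 2g. Even sums go to z < T and odd
    ones to the rest, so that z = g and z = g + T carry the sums 2g and 2g + 1, and the remainders
    of both residues stay within one group. *)
Definition even_sum (l z : Z) : Z := if z <? T then 2 * z else 2 * z - t + 1.
Definition even_side l a z (p q : Z) : Prop :=
  (p - alpha t a (even_sum l z) - gam l (half_of z)) mod m < h.

Lemma even_sum_onto l e : exists z, 0 <= z < t /\ (t | even_sum l z - e).
Proof.
assert (Ht : 0 < t) by (unfold t; lia).
pose proof (Z.div_mod e t ltac:(lia)); pose proof (Z.mod_pos_bound e t Ht).
set (r := e mod t) in *; set (w := e / t) in *; clearbody r w.
pose proof (Z.div_mod r 2 ltac:(lia)); pose proof (Z.mod_pos_bound r 2 ltac:(lia)).
set (r0 := r / 2) in *; set (b := r mod 2) in *; clearbody r0 b.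
exists (r0 + b * T); split; [unfold t in *; nia|].
exists (- w); unfold even_sum; destruct (Z.ltb_spec (r0 + b * T) T); unfold t in *;
  assert (b = 0 \/ b = 1) by lia; nia.
Qed.

(** Reversing an interval, the labels i and h - 1 - i give the shifts 2i + 1 - h, all of one parity.
    For the second sum the values of [alpha] at x and y differ, which moves the shift by one and
    yields the other parity. In the component of odd order the labels w and - w give the shift
    2w. *)
Lemma even_pair l x y : 0 <= l < 3 -> 0 <= x < y -> y < t ->
  packs m u (owned m u t even_sum even_side l x y) (Z.to_nat (m * u)).
Proof.
intros Hl Hxy Hy.
assert (Ht : 0 < t) by (unfold t; lia).
assert (Hm : 0 < m) by (unfold m; lia).
destruct (even_sum_onto l (x + y)) as (z & Hz & Dz).
destruct (even_sum_onto l (x + y + 1)) as (z2 & Hz2 & Dz2).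
pose proof (alpha_same t x y _ Ht Dz) as Hal.
assert (Nxy : ~ (t | x - y)) by (intros D; apply divide_small in D; lia).
pose proof (alpha_opposite t x y _ Ht Dz2 Nxy) as Hal2.
pose proof (alpha_01 t x (even_sum l z2)) as H01.
assert (Hzz : z <> z2).
{ intros <-; pose proof (Z.divide_sub_r _ _ _ Dz Dz2) as D.
  replace (even_sum l z - (x + y) - (even_sum l z - (x + y + 1))) with 1 in D by lia.
  destruct D as [w Hw]; unfold t in *; nia. }
set (a := alpha t x (even_sum l z)) in *.
set (ax := alpha t x (even_sum l z2)) in *.
set (ay := alpha t y (even_sum l z2)) in *.
set (g := gam l (half_of z)); set (g2 := gam l (half_of z2)).
set (zz := fun b => if b =? 0 then z else z2).
set (dd := fun b i w => (2 * i + 1 - h + (if b =? 0 then 0 else ax - ay), 2 * w)).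
set (lam := fun b i w : Z => ((if b =? 0 then i + a + g else h + i + ax + g2), w)).
set (I := list_prod (zrange 0 2) (list_prod (zrange 0 h) (zrange 0 u))).
assert (HI : NoDup I) by (unfold I; repeat apply NoDup_prod; apply NoDup_zrange).
assert (Hin : forall b i w, In (b, (i, w)) I -> 0 <= b < 2 /\ 0 <= i < h /\ 0 <= w < u).
{ intros b i w H; unfold I in H; rewrite !in_prod_iff, !in_zrange in H; exact H. }
replace (Z.to_nat (m * u)) with (length I)
  by (unfold I; rewrite !length_prod, !length_zrange; unfold m; nia).
apply packs_family with (R := fun i j => i <> j)
  (f := fun j => wedge_block l x y (zz (fst j)) (dd (fst j) (fst (snd j)) (snd (snd j)))
     (lam (fst j) (fst (snd j)) (snd (snd j)))).
- clear -HI; induction HI as [|i I Hi HI IH]; constructor; auto.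
  rewrite Forall_forall; intros j Hj ->; exact (Hi Hj).
- intros [b [i w]] Hj; destruct (Hin _ _ _ Hj) as (Hb & Hi & Hw); cbn [fst snd].
  split; [apply valid_wedge; lia|].
  assert (Hmod : forall v c, 0 <= v < m -> (v + c) mod m - c = v + m * (- ((v + c) / m))).
  { intros v c Hv; pose proof (Z.div_mod (v + c) m ltac:(lia)); lia. }
  assert (Hval : forall v c1 c2, 0 <= v < m -> ((v + c1 + c2) mod m - c1 - c2) mod m = v).
  { intros v c1 c2 Hv; rewrite <- (Z.mod_small v m Hv) at 2; apply divide_mod_eq; auto.
    pose proof (Z.div_mod (v + c1 + c2) m ltac:(lia)).
    exists (- ((v + c1 + c2) / m)); lia. }
  assert (Hb' : b = 0 \/ b = 1) by lia; clear Hb; clear Hmod.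
  intros k Hk; apply wedge_keys in Hk; destruct Hk as [Hk|[Hk|Hk]].
  + left; exact (link_flat _ _ _ _ _ _ _ Hk).
  + right; apply link_side in Hk; auto; exists x, (zz b); do 2 eexists.
    split; [auto|split; [destruct Hb'; subst b; assumption|split; [exact Hk|]]].
    unfold even_side; destruct Hb' as [-> | ->]; cbn.
    * left; split; [exact Dz|]; fold a; fold g; rewrite Hval; unfold m; lia.
    * right; split; [exact Dz2|]; fold ax; fold g2; rewrite Hval; unfold m; lia.
  + right; apply link_side in Hk; auto; exists y, (zz b); do 2 eexists.
    split; [auto|split; [destruct Hb'; subst b; assumption|split; [exact Hk|]]].
    unfold even_side; destruct Hb' as [-> | ->]; cbn -[Z.add Z.sub Z.mul].
    * left; split; [exact Dz|]; rewrite <- Hal; fold g.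
      replace (i + a + g - (2 * i + 1 - h + 0)) with (h - 1 - i + a + g) by ring.
      rewrite Hval; unfold m; lia.
    * right; split; [exact Dz2|]; fold ay; fold g2.
      replace (h + i + ax + g2 - (2 * i + 1 - h + (ax - ay))) with (2 * h - 1 - i + ay + g2) by ring.
      rewrite Hval; unfold m; lia.
- intros [b [i w]] [b' [i' w']] Hj Hj' Hne; cbn [fst snd].
  destruct (Hin _ _ _ Hj) as (Hb & Hi & Hw), (Hin _ _ _ Hj') as (Hb' & Hi' & Hw').
  assert (Hbb : b = 0 \/ b = 1) by lia; assert (Hbb' : b' = 0 \/ b' = 1) by lia.
  assert (Hne' : b = b' -> i = i' -> w = w' -> False) by (intros; subst; apply Hne; reflexivity).
  apply wedge_disjoint; auto; [lia| |].
  + intros [D1 D2]; cbn [fst snd dd] in D1, D2.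
    assert (D3 : (u | w - w')) by (apply divide_twice; auto; apply (eq_ind _ _ D2); unfold dd; simpl; ring).
    apply divide_small in D3; [|lia]; unfold dd, m in D1; simpl in D1.
    apply divide_small3 in D1; [|destruct Hbb, Hbb'; subst b b'; simpl; lia].
    destruct Hbb, Hbb'; subst b b'; simpl in D1; try lia; apply Hne'; lia.
  + intros Ez.
    assert (Eb : b = b').
    { unfold zz in Ez; destruct Hbb, Hbb'; subst; simpl in Ez; congruence. }
    subst b'; split; intros [D1 D2]; unfold lam, dd, m in D1, D2; simpl in D1, D2.
    * apply divide_small in D2; [|lia].
      apply divide_small in D1; [|destruct (b =? 0); lia]; apply Hne'; destruct (b =? 0); lia.
    * apply divide_small in D2; [|lia].
      apply divide_small in D1; [|destruct (b =? 0); lia]; apply Hne'; destruct (b =? 0); lia.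
Qed.

(** The values of [alpha] on the remainders: there 2x - E is 0, -1, 2T or 2T - 1, so only the parity
    of T matters. *)
Definition six_alpha (i j : Z) : Z :=
  if i =? 0 then 0 else if j =? 0 then T mod 2 else 1 - T mod 2.
Definition six_ok (p q a : Z) : bool :=
  let v := (a - six_alpha (p / 3) (q / 3) - gam (p mod 3) (q / 3)) mod m in
  if q / 3 =? 0 then v <? h else h <=? v.

Lemma alpha_holes g i j : 0 <= g < T -> i = 0 \/ i = 1 -> j = 0 \/ j = 1 ->
  alpha t (g + i * T) (2 * g + j) = six_alpha i j.
Proof.
intros Hg Hi Hj; unfold alpha, six_alpha, t.
assert (Hq : forall q, 0 <= q < 2 * (2 * T) -> 2 * (g + i * T) - (2 * g + j) = q \/
   2 * (g + i * T) - (2 * g + j) = q - 2 * (2 * T) ->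
   (2 * (g + i * T) - (2 * g + j)) mod (2 * (2 * T)) = q).
{ intros q Hq1 [E|E]; symmetry; [apply (Z.mod_unique _ _ 0)|apply (Z.mod_unique _ _ (-1))]; lia. }
destruct Hi as [-> | ->], Hj as [-> | ->]; cbn [Z.eqb].
- rewrite (Hq 0) by lia; rewrite Z.min_l by lia; reflexivity.
- rewrite (Hq (2 * (2 * T) - 1)) by lia; rewrite Z.min_r by lia.
  replace (2 * (2 * T) - (2 * (2 * T) - 1)) with 1 by ring; reflexivity.
- rewrite (Hq (2 * T)) by lia; rewrite Z.min_l by lia.
  rewrite Z.mul_comm, Z.div_mul by lia; reflexivity.
- rewrite (Hq (2 * T - 1)) by lia; rewrite Z.min_l by lia.
  Z.to_euclidean_division_equations; lia.
Qed.

(** The remainders of g and g + T meet only the rows g and g + T of the next level. For each g < T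
    this is the same problem on six rows. *)
Lemma even_left N : 
  packs m u (all_keys m u 6 (fun p q a _ => six_ok p q a = true)) N ->
  packs m u (fun k => exists l x, 0 <= l < 3 /\ 0 <= x < t /\ owned m u t even_sum even_side l x x k)
    (Z.to_nat T * N).
Proof.
intros H6.
set (f := fun g r => 3 * (g + (r / 3) * T) + r mod 3).
set (K := all_keys m u 6 (fun p q a _ => six_ok p q a = true)) in *.
assert (Hrow : forall r, 0 <= r < 6 -> (r / 3 = 0 \/ r / 3 = 1) /\ 0 <= r mod 3 < 3 /\ r = 3 * (r / 3) + r mod 3).
{ intros r Hr; Z.to_euclidean_division_equations; lia. }
assert (HR : rows_in K 6).
{ intros p q a c [(r & Hr & a' & c' & _ & E)|(p' & q' & a' & c' & Hp & Hq & _ & _ & _ & _ & [E|E])];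
  injection E; intros; subst; auto. }
assert (Hf : forall g g' p p', 0 <= g < T -> 0 <= g' < T -> 0 <= p < 6 -> 0 <= p' < 6 -> f g p = f g' p' -> g = g' /\ p = p').
{ intros g g' p p' Hg Hg' Hp Hp' E; unfold f in E.
  destruct (Hrow p Hp) as (B1 & B2 & B3), (Hrow p' Hp') as (C1 & C2 & C3).
  assert (E2 : p mod 3 = p' mod 3) by lia.
  assert (E3 : g + p / 3 * T = g' + p' / 3 * T) by lia.
  destruct B1 as [B1|B1], C1 as [C1|C1]; rewrite B1, C1 in *; lia. }
eapply packs_sub; [apply (packs_range m u (fun g => row_region (f g) K) N 0 (Z.to_nat T))|].
- intros g Hg; apply packs_rows with (n := 6); auto.
  intros p q Hp Hq E; apply (Hf g g) in E; lia.
- intros g g' Hg Hg' Hlt [[[p q] a] c] (p1 & q1 & E1 & E2 & Hk) (p2 & q2 & E3 & E4 & Hk').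
  apply HR in Hk, Hk'; rewrite E1 in E3; apply Hf in E3; lia.
- intros [[[p q] a] c] (g & Hg & p1 & q1 & -> & -> & Hk).
  destruct Hk as [(r & Hr & a' & c' & _ & E)|(p & q & a' & c' & Hp & Hq & Hpq & Ha & Hc & Hok & L)].
  + injection E as -> -> -> ->; destruct (Hrow r Hr) as (B1 & B2 & B3).
    exists (r mod 3), (g + r / 3 * T); split; [exact B2|split].
    * unfold t; destruct B1 as [-> | ->]; lia.
    * left; exists a', c'; left; reflexivity.
  + destruct (Hrow p Hp) as (B1 & B2 & B3), (Hrow q Hq) as (C1 & C2 & C3).
    exists (p mod 3), (g + p / 3 * T); split; [exact B2|split].
    * unfold t; destruct B1 as [-> | ->]; lia.
    * right; exists (g + p / 3 * T), (g + q / 3 * T), a', c'; split; [auto|split; [|split]].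
      -- unfold t; destruct C1 as [-> | ->]; lia.
      -- split; [exact Ha|split; [exact Hc|]]; rewrite <- Hpq.
         destruct L as [E|E]; injection E as -> -> -> ->; [left|right]; reflexivity.
      -- assert (Es : even_sum (p mod 3) (g + q / 3 * T) = 2 * g + q / 3 /\ half_of (g + q / 3 * T) = q / 3).
         { unfold even_sum, half_of, t; destruct C1 as [-> | ->];
           [destruct (Z.ltb_spec (g + 0 * T) T)|destruct (Z.ltb_spec (g + 1 * T) T)]; lia. }
         destruct Es as [Es Eh]; unfold even_side; rewrite Es, Eh, alpha_holes by (auto; lia).
         unfold six_ok in Hok; cbv zeta in Hok.
         destruct C1 as [C1|C1]; rewrite C1 in *; cbn [Z.eqb] in Hok.
         ++ left; split; [|apply Z.ltb_lt; exact Hok].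
            exists (- (p / 3)); unfold t; ring.
         ++ right; split; [|apply Z.leb_le in Hok; apply Z.le_ngt; exact Hok].
            exists (- (p / 3)); unfold t; ring.
Qed.

Theorem even_design N : 
  packs m u (all_keys m u 6 (fun p q a _ => six_ok p q a = true)) N ->
  packs m u (fun k => exists p q a b, 0 <= p < 3 * t /\ 0 <= q < 3 * t /\ k = (p, q, a, b))
    (3 * (length (pairs (Z.to_nat t)) * Z.to_nat (m * u)) + Z.to_nat T * N).
Proof.
intros H6; apply (design m u t even_sum even_side); try (unfold m, t; lia).
- intros l x y Hl Hx Hy; apply even_pair; auto.
- apply even_left; exact H6.
Qed.
End EvenDesign.

Definition gam_of (L : list Z) (l j : Z) : Z := nth (Z.to_nat (2 * l + j)) L 0.

Lemma six_ok_mod h T gam p q a : six_ok h T gam p q a = six_ok h (T mod 2) gam p q a.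
Proof. unfold six_ok, six_alpha; rewrite Z.mod_mod by lia; reflexivity. Qed.

Definition six_keys h u T gam := all_keys (2 * h) u 6 (fun p q a _ => six_ok h T gam p q a = true).

Lemma six_keys_mod h u T gam N : 
  packs (2 * h) u (six_keys h u (T mod 2) gam) N -> packs (2 * h) u (six_keys h u T gam) N.
Proof.
intros H; eapply packs_sub; [exact H|].
intros k [Hk|(p & q & a & c & H1 & H2 & H3 & H4 & H5 & H6 & H7)]; [left; exact Hk|].
right; exists p, q, a, c; rewrite six_ok_mod; auto 8.
Qed.

Lemma six_filler h u g T P0 P1 gam T0 T1 Ne : 0 < h -> u = 2 * g + 1 -> 0 <= g ->
  table_fits (2 * h) (fun _ => false) (base_query (2 * h) 6 (fun _ a _ => mem P0 a) (six_ok h (T mod 2) gam)) T0 = true ->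
  table_fits (2 * h) pow2 (fibre_query (2 * h) 6 (fun _ a _ => mem P1 a) (six_ok h (T mod 2) gam)) T1 = true ->
  (forall r, packs (2 * h) u (pure_in r (fun a c => ~ split_keys P0 P1 a c)) Ne) ->
  packs (2 * h) u (six_keys h u T gam) (length T0 + Z.to_nat g * length T1 + 6 * Ne).
Proof.
intros Hh Eu Hg H0 H1 HE; apply six_keys_mod.
apply (product_filler (2 * h) u g 6 P0 P1 (six_ok h (T mod 2) gam) (six_ok h (T mod 2) gam)); auto; lia.
Qed.

Lemma parity T : T mod 2 = 0 \/ T mod 2 = 1.
Proof. pose proof (Z.mod_pos_bound T 2); lia. Qed.

Lemma six_filler_8 u g T : u = 2 * g + 1 -> 0 <= g -> exists gam,
  packs 8 u (six_keys 4 u T gam) (Z.to_nat (54 * g + 26)).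
Proof.
intros Eu Hg; destruct (parity T) as [E|E].
- exists (gam_of [3; 5; 6; 0; 4; 0]).
  replace (Z.to_nat (54 * g + 26)) with (length six_8_0_base + Z.to_nat g * length six_8_0_fibre + 6 * Z.to_nat (3 * g + 1))%nat
   by (change (length six_8_0_base) with 20%nat; change (length six_8_0_fibre) with 36%nat; lia).
  apply (six_filler 4 u g T [1; 3; 5; 7] [1; 7]); auto; try lia; rewrite ?E;
    [vm_compute; reflexivity..|intros r; apply equi_8; auto].
- exists (gam_of [6; 1; 3; 0; 2; 5]).
  replace (Z.to_nat (54 * g + 26)) with (length six_8_1_base + Z.to_nat g * length six_8_1_fibre + 6 * Z.to_nat (3 * g + 1))%nat
   by (change (length six_8_1_base) with 20%nat; change (length six_8_1_fibre) with 36%nat; lia).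
  apply (six_filler 4 u g T [1; 3; 5; 7] [1; 7]); auto; try lia; rewrite ?E;
    [vm_compute; reflexivity..|intros r; apply equi_8; auto].
Qed.

Lemma six_filler_32 u g T : u = 2 * g + 1 -> 0 <= g -> exists gam,
  packs 32 u (six_keys 16 u T gam) (Z.to_nat (214 * g + 106)).
Proof.
intros Eu Hg; destruct (parity T) as [E|E].
- exists (gam_of [0; 12; 0; 11; 11; 31]).
  replace (Z.to_nat (214 * g + 106)) with (length six_32_0_base + Z.to_nat g * length six_32_0_fibre + 6 * Z.to_nat (11 * g + 5))%nat
   by (change (length six_32_0_base) with 76%nat; change (length six_32_0_fibre) with 148%nat; lia).
  apply (six_filler 16 u g T [1; 3; 5; 7; 4; 12; 31; 29; 27; 25; 28; 20] [1; 3; 5; 7; 4; 31; 29; 27; 25; 28]);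
    auto; try lia; rewrite ?E; [vm_compute; reflexivity..|intros r; apply equi_32; auto].
- exists (gam_of [0; 2; 14; 10; 0; 0]).
  replace (Z.to_nat (214 * g + 106)) with (length six_32_1_base + Z.to_nat g * length six_32_1_fibre + 6 * Z.to_nat (11 * g + 5))%nat
   by (change (length six_32_1_base) with 76%nat; change (length six_32_1_fibre) with 148%nat; lia).
  apply (six_filler 16 u g T [1; 3; 5; 7; 4; 12; 31; 29; 27; 25; 28; 20] [1; 3; 5; 7; 4; 31; 29; 27; 25; 28]);
    auto; try lia; rewrite ?E; [vm_compute; reflexivity..|intros r; apply equi_32; auto].
Qed.

(* For [m = 4] the fibres [y = 1, 2] do not split off and are filled together
   with [y = 0] by one table, whose coefficients are at most [2 kappa]. *)
Definition window_query m n pp ok (k : key) : bool :=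
  let '(p, q, a, c) := k in
  table_query m n pp ok k && existsb (fun f => c =? kappa p q * f) [-2; -1; 0; 1; 2].

Section SixFour.
Variables (u g T : Z) (gam : Z -> Z -> Z).
Hypotheses (Eu : u = 2 * g + 1) (Hg : 2 <= g) (H3 : u mod 3 <> 0).

Let Hu : 0 < u. Proof. lia. Qed.
Let Hodd : u mod 2 = 1. Proof. rewrite Eu; Z.to_euclidean_division_equations; lia. Qed.
Let Eg : (u - 1) / 2 = g. Proof. rewrite Eu; Z.to_euclidean_division_equations; lia. Qed.
Let Eg1 : (u + 1) / 2 = g + 1. Proof. rewrite Eu; Z.to_euclidean_division_equations; lia. Qed.

(** The coefficient with which the tables use the shift 1 in row r. Only one of (1, c), (1, - c) is
    taken, and the other is left for a block {0, (1, - c), (2, - 2c)}, as in the case of one row. *)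
Definition six_sign (e r : Z) : Z := (if r / 3 =? e then -1 else 1) * 2 * lam (r mod 3).
Definition six_pp_window (e r a c : Z) : bool :=
  ((a =? 1) && ((c =? six_sign e r) || (c =? six_sign e r * 2))) ||
  ((a =? 3) && ((c =? - six_sign e r) || (c =? - (six_sign e r * 2)))).
Definition six_pp_fibre (e r a c : Z) : bool :=
  ((a =? 1) && (c =? six_sign e r)) || ((a =? 3) && (c =? - six_sign e r)).
Definition six_pp (e r a c : Z) : Prop := exists y, 1 <= y <= g /\
  ((a = 1 /\ c = (six_sign e r * y) mod u) \/ (a = 3 /\ c = (- (six_sign e r * y)) mod u)).

Lemma six_sign_cases e r : exists s, (s = 2 \/ s = -2 \/ s = 4 \/ s = -4) /\ six_sign e r = s.
Proof.
eexists; split; [|reflexivity]; unfold six_sign, lam.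
destruct (r / 3 =? e), (r mod 3 =? 2); lia.
Qed.

Lemma window_packs e T0 :
  table_fits 4 smooth (window_query 4 6 (six_pp_window e) (six_ok 2 T gam)) T0 = true ->
  packs 4 u (fun k => table_keys 4 u 6 (six_pp e) (fun p q a _ => six_ok 2 T gam p q a = true) k /\
    let '(p, q, a, c) := k in exists f, -2 <= f <= 2 /\ c = (kappa p q * f) mod u) (length T0).
Proof.
intros H; apply andb_true_iff in H as [H1 H2].
eapply packs_sub; [apply (table_packs 4 u smooth 1 T0 (window_query 4 6 (six_pp_window e) (six_ok 2 T gam))); auto; try lia|].
- intros c Hc; apply mod_ne0; auto; intros D.
  rewrite Z.mul_comm in D; apply (smooth_cancel u c 1 Hodd H3 Hc) in D; small_divide D.
- intros [[[p q] a] c'] (c & HQ & ->); apply andb_true_iff in HQ as [HQ Hc].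
  rewrite Z.mul_1_l; split.
  + apply (table_query_keys 4 u 6 (six_pp_window e) (six_ok 2 T gam) p q a c); auto; try lia.
    * apply Z.mod_pos_bound; exact Hu.
    * unfold six_pp_window, six_pp; rewrite orb_true_iff, !andb_true_iff, !orb_true_iff, !Z.eqb_eq.
      intros [[-> [-> | ->]]|[-> [-> | ->]]]; [exists 1|exists 2|exists 1|exists 2]; (split; [lia|]);
      [left|left|right|right]; split; auto; f_equal; ring.
  + apply existsb_exists in Hc as (f & Hf & E); apply Z.eqb_eq in E; subst c.
    exists f; split; [|reflexivity]; simpl in Hf; lia.
Qed.

Lemma six_four_table e T0 T1 :
  table_fits 4 smooth (window_query 4 6 (six_pp_window e) (six_ok 2 T gam)) T0 = true ->
  table_fits 4 pow2 (fibre_query 4 6 (six_pp_fibre e) (six_ok 2 T gam)) T1 = true ->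
  packs 4 u (table_keys 4 u 6 (six_pp e) (fun p q a _ => six_ok 2 T gam p q a = true))
    (length T0 + Z.to_nat (g - 2) * length T1).
Proof.
intros HT0 HT1.
pose proof (window_packs e T0 HT0) as K0.
apply andb_true_iff in HT1 as [H1 H2].
pose proof (table_family 4 u T1 (fibre_query 4 6 (six_pp_fibre e) (six_ok 2 T gam)) 3 ltac:(lia) Hu Hodd ltac:(lia) ltac:(lia) H1
  ltac:(intros p q a c HQ; apply andb_true_iff in HQ as [_ HQ]; apply Z.eqb_eq; exact HQ) H2) as K1.
replace (Z.to_nat ((u + 1) / 2 - 3)) with (Z.to_nat (g - 2)) in K1 by (rewrite Eg1; f_equal; lia).
eapply packs_union; [exact K0|exact K1| | |reflexivity].
- intros [[[p q] a] c] [_ (f & Hf & E)] (y & Hy & (c' & HQ & E') & _).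
  apply andb_true_iff in HQ as [_ HQ]; apply Z.eqb_eq in HQ.
  rewrite E in E'; apply mod_eq_divide in E'; auto.
  destruct (kappa_pow2 p q) as [P1 P2]; rewrite Eg in Hy.
  (* The window has |f| <= 2 and the fibres have y from 3 to g; f and +-y cannot agree modulo u = 2g
     + 1. *)
  assert (D : (u | kappa p q * (f - y)) \/ (u | kappa p q * (f + y))).
  { destruct (Z.abs_eq_or_opp c'); [left|right]; apply (eq_ind _ _ E'); nia. }
  destruct D as [D|D]; apply (pow2_cancel _ _ _ Hodd P1) in D; small_divide D.
- intros k [[Hk _]|(y & Hy & Hk & _)]; [exact Hk|]; rewrite Eg in Hy.
  destruct k as [[[p q] a] c'], Hk as (c & HQ & ->); apply andb_true_iff in HQ as [HQ _].
  apply (table_query_keys 4 u 6 (six_pp_fibre e) (six_ok 2 T gam) p q a c); auto; try lia.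
  + apply Z.mod_pos_bound; exact Hu.
  + unfold six_pp_fibre, six_pp; rewrite orb_true_iff, !andb_true_iff, !Z.eqb_eq.
    intros [[-> ->]|[-> ->]]; exists y; (split; [lia|]); [left|right]; split; auto; f_equal; ring.
Qed.

(** The free shifts (1, c) represent every c up to sign once, so their doubles exhaust the shifts
    (2, c) up to sign; [Y] and its doubles exhaust the shifts (0, c). *)
Lemma six_four_equi e r Y : doubling_list u Y ->
  packs 4 u (pure_in r (fun a c => ~ six_pp e r a c)) (Z.to_nat (1 + g) + length Y).
Proof.
intros (HY & HY0 & _).
apply pairwise_app_inv in HY as (HY1 & HY2 & HYY).
destruct (six_sign_cases e r) as (s & Hs & Es).
assert (Hs2 : pow2 s = true /\ pow2 (2 * s) = true /\ pow2 (3 * s) = false).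
{ destruct Hs as [->|[->|[->| ->]]]; repeat split; reflexivity. }
destruct Hs2 as (P1 & P2 & _).
set (I := ((1, 0) :: seg (fun y => (1, - (s * y))) 1 (g + 1)) ++ map (fun y => (0, y)) Y).
replace (Z.to_nat (1 + g) + length Y)%nat with (length I)
  by (unfold I; rewrite length_app, length_map; cbn [length]; rewrite length_seg; lia).
assert (Hc : forall c y, pow2 c = true -> (u | c * y) -> (u | y)) by (intros c y; apply pow2_cancel; auto).
assert (Hsgn : forall y y', 1 <= y <= g -> 1 <= y' <= g -> ~ (u | y + y')) by (intros y y' Hy Hy' D; small_divide D).
assert (H0 : forall y, 1 <= y <= g -> ~ (u | y)) by (intros y Hy D; small_divide D).
set (D := fun d : Z * Z => (fst d = 1 /\ (snd d = 0 \/ exists y, 1 <= y <= g /\ snd d = - (s * y))) \/ fst d = 2 \/ fst d = 0).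
eapply packs_sub; [apply (equi_row 4 u r I D); auto; try lia|].
- unfold I; apply ForallOrdPairs_app.
  + apply FOP_cons.
    * apply Forall_forall; intros x Hx; apply in_seg in Hx as (y & Hy & ->).
      unfold equi_apart, sep2, zero2, dbl; cbn [fst snd]; repeat split; intros [D1 D2];
      try (destruct D1; lia); apply (H0 y); try lia.
      -- apply (Hc s); auto; apply (eq_ind _ _ D2); ring.
      -- apply (Hc (2 * s)); auto; apply (eq_ind _ _ D2); ring.
      -- apply (Hc (2 * s)); auto; apply (divide_neg _ _ _ D2); ring.
    * apply pairwise_seg; intros y y' Hy Hy'.
      assert (HN : ~ (u | y - y')) by (intros Dv; small_divide Dv).
      unfold equi_apart, sep2, zero2, dbl; cbn [fst snd]; repeat split; intros [D1 D2];
      try (destruct D1; lia).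
      -- apply HN, (Hc s); auto; apply (divide_neg _ _ _ D2); ring.
      -- apply HN, (Hc (2 * s)); auto; apply (divide_neg _ _ _ D2); ring.
      -- apply (Hsgn y y'); try lia; apply (Hc (2 * s)); auto; apply (divide_neg _ _ _ D2); ring.
  + clear -HY1 HY2 HYY; pose proof (pairwise_and _ _ _ _ HY1 (pairwise_map_inv _ _ _ _ _ HY2)) as F.
    assert (G : ForallOrdPairs (fun y y' => equi_apart 4 u (0, y) (0, y')) Y).
    { revert F; apply pairwise_impl; intros y y' Hy Hy' [[R1 R2] [R3 R4]].
      assert (Hy2 : In (2 * y) (map (Z.mul 2) Y)) by (apply in_map; exact Hy).
      assert (Hy2' : In (2 * y') (map (Z.mul 2) Y)) by (apply in_map; exact Hy').
      destruct (HYY y (2 * y') Hy Hy2') as [S1 S2].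
      destruct (sep_sym _ _ _ (HYY y' (2 * y) Hy' Hy2)) as [S3 S4].
      unfold equi_apart, sep2, zero2, dbl; cbn [fst snd]; repeat split; intros [_ D2]; auto. }
    clear -G; induction G as [|y Y Hy G IH]; simpl; constructor; auto.
    rewrite Forall_forall in *; intros x Hx; apply in_map_iff in Hx as (y' & <- & Hy'); auto.
  + intros a b Ha Hb; apply in_map_iff in Hb as (y & <- & Hy).
    apply in_inv in Ha; destruct Ha as [<-|Ha]; [|apply in_seg in Ha as (y' & Hy' & ->)];
    unfold equi_apart, sep2, zero2, dbl; cbn [fst snd]; repeat split; intros [D1 D2]; destruct D1; lia.
- intros i Hi; unfold I in Hi; apply in_app_or in Hi; destruct Hi as [Hi|Hi];
  [apply in_inv in Hi; destruct Hi as [<-|Hi]; [|apply in_seg in Hi as (y & Hy & ->)]|apply in_map_iff in Hi as (y & <- & Hy)];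
  unfold zero2, dbl, D; cbn [fst snd].
  + split; [intros [D1 _]; destruct D1; lia|split; [intros [D1 _]; destruct D1; lia|]]; split; [left; auto|right; left; lia].
  + split; [intros [D1 _]; destruct D1; lia|split; [intros [D1 _]; destruct D1; lia|]]; split; [left|right; left; lia].
    split; [reflexivity|right; exists y; split; [lia|reflexivity]].
  + split; [intros [_ D2]; apply (HY0 y Hy), divide_twice; auto|split; [|split; right; right; lia]].
    intros [_ D2]; apply (HY0 y Hy), divide_thrice; auto.
- assert (HN : forall d, D d -> ~ six_pp e r (fst d mod 4) (snd d mod u) /\ ~ six_pp e r ((- fst d) mod 4) ((- snd d) mod u)).
  { unfold six_pp; rewrite Es; intros [a c] Hd; unfold D in Hd; cbn [fst snd] in Hd |- *.
    destruct Hd as [[-> Hc0]|[->| ->]].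
    - assert (Hbad : forall y, 1 <= y <= g -> ~ (u | c - s * y)).
      { intros y Hy Dv; destruct Hc0 as [->|(y' & Hy' & ->)].
        - apply (H0 y Hy), (Hc s); auto; apply (divide_neg _ _ _ Dv); ring.
        - apply (Hsgn y' y Hy' Hy), (Hc s); auto; apply (divide_neg _ _ _ Dv); ring. }
      split; intros (y & Hy & [[E1 E2]|[E1 E2]]); try discriminate E1;
      apply mod_eq_divide in E2; auto; apply (Hbad y Hy).
      + exact E2.
      + apply (divide_neg _ _ _ E2); ring.
    - split; intros (y & Hy & [[E1 E2]|[E1 E2]]); discriminate E1.
    - split; intros (y & Hy & [[E1 E2]|[E1 E2]]); discriminate E1. }
  intros k (d & Hd & ->); do 2 eexists; split; [|reflexivity].
  destruct Hd as [Hd|Hd]; [apply HN; exact Hd|].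
  destruct (HN _ Hd) as [_ H]; simpl in H; rewrite !Z.opp_involutive in H; exact H.
Qed.
End SixFour.

Lemma six_filler_4 u g T Y : u = 2 * g + 1 -> 2 <= g -> u mod 3 <> 0 -> g mod 2 = 0 -> doubling_list u Y -> exists gam,
  packs 4 u (six_keys 2 u T gam) (Z.to_nat (27 * g + 14)).
Proof.
intros Eu Hg H3 Hg2 HY.
assert (HN : forall e T0 T1 gam, e = T mod 2 -> length T0 = 44%nat -> length T1 = 18%nat ->
  table_fits 4 smooth (window_query 4 6 (six_pp_window e) (six_ok 2 e gam)) T0 = true ->
  table_fits 4 pow2 (fibre_query 4 6 (six_pp_fibre e) (six_ok 2 e gam)) T1 = true ->
  packs 4 u (six_keys 2 u T gam) (Z.to_nat (27 * g + 14))).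
{ intros e T0 T1 gam Ee L0 L1 H0 H1; apply (six_keys_mod 2); rewrite <- Ee.
  replace (Z.to_nat (27 * g + 14)) with (44 + Z.to_nat (g - 2) * 18 + Z.to_nat 6 * (Z.to_nat (1 + g) + length Y))%nat.
  - apply (fill_rows 4 u 6 (six_pp u g e)); [lia| |].
    + rewrite <- L0, <- L1; apply (six_four_table u g e gam); auto.
    + intros r Hr; apply six_four_equi; auto.
  - destruct HY as (_ & _ & ->); subst u; Z.to_euclidean_division_equations; lia. }
destruct (parity T) as [E|E].
- exists (gam_of [3; 1; 1; 3; 2; 0]); apply (HN 0 six_4_0_base six_4_0_fibre); auto; vm_compute; reflexivity.
- exists (gam_of [0; 1; 1; 2; 2; 3]); apply (HN 1 six_4_1_base six_4_1_fibre); auto; vm_compute; reflexivity.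
Qed.

(** * Splitting the pairs +-y by doubling *)

Section Doubling.
Variable u : Z.
Hypotheses (Hu : 0 < u) (Hodd : u mod 2 = 1).
Hypothesis Heven : forall k y, 0 <= k -> ~ (u | y) ->
  (u | 2 ^ k * y - y) \/ (u | 2 ^ k * y + y) -> k mod 2 = 0.

Definition eqs (x y : Z) : Prop := (u | x - y) \/ (u | x + y).

Lemma eqs_sym x y : eqs x y -> eqs y x.
Proof. intros [H|H]; [left; apply (divide_neg _ _ _ H)|right; apply (eq_ind _ _ H)]; lia. Qed.

Lemma eqs_trans x y z : eqs x y -> eqs y z -> eqs x z.
Proof.
intros [H|H] [H'|H'].
- left; replace (x - z) with ((x - y) + (y - z)) by ring; apply Z.divide_add_r; assumption.
- right; replace (x + z) with ((x - y) + (y + z)) by ring; apply Z.divide_add_r; assumption.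
- right; replace (x + z) with ((x + y) - (y - z)) by ring; apply Z.divide_sub_r; assumption.
- left; replace (x - z) with ((x + y) - (y + z)) by ring; apply Z.divide_sub_r; assumption.
Qed.

Lemma eqs_mul c x y : eqs x y -> eqs (c * x) (c * y).
Proof.
intros [H|H]; [left; rewrite <- Z.mul_sub_distr_l|right; rewrite <- Z.mul_add_distr_l];
apply Z.divide_mul_r; exact H.
Qed.

Lemma eqs_cancel k x y : 0 <= k -> eqs (2 ^ k * x) (2 ^ k * y) -> eqs x y.
Proof.
intros Hk; revert x y; pattern k; apply natlike_ind; [| |exact Hk].
- intros x y H; rewrite !Z.mul_1_l in H; exact H.
- intros j Hj IH x y H; apply IH; rewrite Z.pow_succ_r in H by exact Hj.
  destruct H as [H|H]; [left|right]; apply divide_twice; auto; apply (eq_ind _ _ H); ring.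
Qed.

(** Here b is the parity of the number of doublings and halvings leading from +-y to +-z. [Heven]
    makes it well defined: the graph of doubling on the nonzero pairs is bipartite, and a colour
    class will be the list Y. *)
Definition linked (y z : Z) (b : Z) : Prop := exists i j, 0 <= i /\ 0 <= j /\
  (i + j) mod 2 = b /\ eqs (2 ^ i * y) (2 ^ j * z).
Definition related (y z : Z) : Prop := exists b, linked y z b.
(** A base point for the orbit of y, chosen classically. Two points of one orbit define equal
    predicates by extensionality and hence receive the same base point. *)
Definition rep (y : Z) : Z := epsilon (inhabits 0) (related y).

Lemma linked_sym y z b : linked y z b -> linked z y b.
Proof. intros (i & j & Hi & Hj & Hb & H); exists j, i; rewrite Z.add_comm; auto using eqs_sym. Qed.

Lemma linked_trans x y z b b' : linked x y b -> linked y z b' -> linked x z ((b + b') mod 2).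
Proof.
intros (i & j & Hi & Hj & Hb & H) (i' & j' & Hi' & Hj' & Hb' & H').
exists (i' + i), (j + j'); split; [lia|split; [lia|split]].
- subst b b'; rewrite <- Z.add_mod by lia; f_equal; ring.
- apply (eqs_trans _ (2 ^ (i' + j) * y)).
  + rewrite !Z.pow_add_r by lia; rewrite <- !Z.mul_assoc; apply eqs_mul; exact H.
  + rewrite (Z.add_comm i' j), !Z.pow_add_r by lia; rewrite <- !Z.mul_assoc; apply eqs_mul; exact H'.
Qed.

Lemma linked_refl y : linked y y 0.
Proof. exists 0, 0; repeat split; try lia; left; exists 0; ring. Qed.

Lemma linked_self y b : ~ (u | y) -> linked y y b -> b = 0.
Proof.
intros Hy (i & j & Hi & Hj & Hb & H).
assert (Hk : forall a c, 0 <= a <= c -> eqs (2 ^ a * y) (2 ^ c * y) -> (c - a) mod 2 = 0).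
{ intros a c Hac Ha; apply (Heven (c - a) y); auto; [lia|].
  replace c with (a + (c - a)) in Ha by ring; rewrite Z.pow_add_r, <- Z.mul_assoc in Ha by lia.
  apply eqs_cancel in Ha; [|lia]; apply eqs_sym in Ha; exact Ha. }
destruct (Z_le_dec i j) as [Hij|Hij].
- specialize (Hk i j ltac:(lia) H); subst b; Z.to_euclidean_division_equations; lia.
- specialize (Hk j i ltac:(lia) (eqs_sym _ _ H)); subst b; Z.to_euclidean_division_equations; lia.
Qed.

Lemma rep_eq y z : related y z -> rep y = rep z.
Proof.
intros [b Hb]; unfold rep; f_equal; apply functional_extensionality; intros x.
apply propositional_extensionality; split; intros [c Hc].
- exists ((b + c) mod 2); apply (linked_trans _ y); [apply linked_sym|]; assumption.
- exists ((b + c) mod 2); apply (linked_trans _ z); assumption.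
Qed.

Definition colour (y : Z) (b : Z) : Prop := linked y (rep y) b.

Lemma colour_exists y : colour y 0 \/ colour y 1.
Proof.
assert (H : related y (rep y)).
{ unfold rep; apply epsilon_spec; exists y, 0; apply linked_refl. }
destruct H as (b & i & j & Hi & Hj & Hb & H).
pose proof (Z.mod_pos_bound (i + j) 2 ltac:(lia)).
assert (E : b = 0 \/ b = 1) by lia.
destruct E as [-> | ->]; [left|right]; exists i, j; auto.
Qed.

Lemma colour_linked y z b c d : ~ (u | y) -> colour y b -> colour z c -> linked y z d ->
  (b + c + d) mod 2 = 0.
Proof.
intros Hy Hb Hc Hd; unfold colour in *.
rewrite <- (rep_eq y z) in Hc by (exists d; exact Hd).
pose proof (linked_trans _ _ _ _ _ (linked_trans _ _ _ _ _ Hd Hc) (linked_sym _ _ _ Hb)) as H.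
apply linked_self in H; auto; rewrite Z.add_mod_idemp_l in H by lia.
rewrite <- H; f_equal; ring.
Qed.

Let g := (u - 1) / 2.
Hypothesis Hg2 : g mod 2 = 0.

Lemma u_odd : u = 2 * g + 1.
Proof. unfold g; clear -Hodd; Z.to_euclidean_division_equations; lia. Qed.

Definition is_colour (b y : Z) : bool := if excluded_middle_informative (colour y b) then true else false.

Lemma is_colourP b y : is_colour b y = true <-> colour y b.
Proof. unfold is_colour; destruct excluded_middle_informative; split; auto; discriminate. Qed.

Definition class (b : Z) : list Z := filter (is_colour b) (zrange 1 (g + 1)).

Lemma in_class b y : In y (class b) <-> 1 <= y <= g /\ colour y b.
Proof. unfold class; rewrite filter_In, in_zrange, is_colourP; split; intros [H1 H2]; split; auto; lia. Qed.

Lemma small_nonzero y : 1 <= y <= g -> ~ (u | y).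
Proof. intros H D; pose proof u_odd; small_divide D. Qed.

Lemma linked_double y : linked y (2 * y) 1.
Proof. exists 1, 0; repeat split; try lia; left; exists 0; ring. Qed.

Lemma linked_eqs y z : eqs y z -> linked y z 0.
Proof. intros H; exists 0, 0; repeat split; try lia; rewrite !Z.mul_1_l; exact H. Qed.

(** Doubling, read on the representatives 1, ..., g of the pairs +-y. *)
Definition double (y : Z) : Z := if 2 * y <=? g then 2 * y else u - 2 * y.

Lemma double_spec y : 1 <= y <= g -> 1 <= double y <= g /\ linked y (double y) 1.
Proof.
intros Hy; pose proof u_odd; unfold double; destruct (Z.leb_spec (2 * y) g); split; try lia.
- apply linked_double.
- apply (linked_trans y (2 * y) _ 1 0); [apply linked_double|apply linked_eqs].
  right; exists 1; ring.
Qed.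

Lemma NoDup_class b : NoDup (class b).
Proof. apply NoDup_filter, NoDup_zrange. Qed.

(** Doubling is injective and exchanges the colours. Applied both ways, this shows that the classes
    have the same size g / 2. *)
Lemma class_le b c : b = 0 /\ c = 1 \/ b = 1 /\ c = 0 -> (length (class b) <= length (class c))%nat.
Proof.
intros Hbc; rewrite <- (length_map double (class b)); apply NoDup_incl_length.
- assert (Hinj : forall x y, In x (class b) -> In y (class b) -> double x = double y -> x = y).
  { intros x y Hx Hy E; apply in_class in Hx, Hy; pose proof u_odd.
    unfold double in E; destruct (Z.leb_spec (2 * x) g), (Z.leb_spec (2 * y) g); lia. }
  pose proof (NoDup_class b) as ND; revert Hinj; generalize (class b) ND; clear.
  intros l ND; induction ND as [|x l Hx ND IH]; intros Hinj; simpl; constructor.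
  + intros H; apply in_map_iff in H as (y & E & Hy); apply Hx.
    rewrite (Hinj x y); simpl; auto.
  + apply IH; intros; apply Hinj; simpl; auto.
- intros z Hz; apply in_map_iff in Hz as (y & <- & Hy); apply in_class in Hy as [Hy Hc].
  destruct (double_spec y Hy) as [H1 H2]; apply in_class; split; [exact H1|].
  pose proof (small_nonzero y Hy) as Hn.
  destruct (colour_exists (double y)) as [H|H]; pose proof (colour_linked _ _ _ _ _ Hn Hc H H2) as E;
  destruct Hbc as [[-> ->]|[-> ->]]; auto; discriminate E.
Qed.

Lemma class_total : (length (class 0) + length (class 1) = Z.to_nat g)%nat.
Proof.
replace (Z.to_nat g) with (length (zrange 1 (g + 1))) by (rewrite length_zrange; f_equal; lia).
unfold class.
assert (H : forall y, In y (zrange 1 (g + 1)) -> is_colour 1 y = negb (is_colour 0 y)).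
{ intros y Hy; apply in_zrange in Hy; pose proof (small_nonzero y ltac:(lia)) as Hn.
  destruct (is_colour 0 y) eqn:E0, (is_colour 1 y) eqn:E1; auto.
  - apply is_colourP in E0, E1.
    pose proof (colour_linked _ _ _ _ _ Hn E0 E1 (linked_refl y)) as E; discriminate E.
  - destruct (colour_exists y) as [H|H]; apply is_colourP in H; congruence. }
rewrite (filter_ext_in _ _ _ H); apply filter_length.
Qed.

Lemma doubling_exists : exists Y, doubling_list u Y.
Proof.
exists (class 0); split; [|split].
- apply ForallOrdPairs_app.
  + assert (Hs : forall y z, In y (class 0) -> In z (class 0) -> y <> z -> sep u y z).
    { intros y z Hy Hz Hne; apply in_class in Hy, Hz; pose proof u_odd; split; intros D; small_divide D. }
    pose proof (NoDup_class 0) as ND; revert Hs; generalize (class 0) ND; clear.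
    intros l ND; induction ND as [|x l Hx ND IH]; intros Hs; constructor.
    * apply Forall_forall; intros y Hy; apply Hs; simpl; auto; intros ->; auto.
    * apply IH; intros; apply Hs; simpl; auto.
  + assert (Hs : forall y z, In y (class 0) -> In z (class 0) -> y <> z -> sep u (2 * y) (2 * z)).
    { intros y z Hy Hz Hne; apply in_class in Hy, Hz; pose proof u_odd; split; intros D.
      - rewrite <- Z.mul_sub_distr_l in D; apply divide_twice in D; auto; small_divide D.
      - rewrite <- Z.mul_add_distr_l in D; apply divide_twice in D; auto; small_divide D. }
    pose proof (NoDup_class 0) as ND; revert Hs; generalize (class 0) ND; clear.
    intros l ND; induction ND as [|x l Hx ND IH]; intros Hs; simpl; constructor.
    * apply Forall_forall; intros y Hy; apply in_map_iff in Hy as (z & <- & Hz); apply Hs; simpl; auto.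
      intros ->; auto.
    * apply IH; intros; apply Hs; simpl; auto.
  + intros y z Hy Hz; apply in_map_iff in Hz as (x & <- & Hx).
    apply in_class in Hy as [Hy Cy], Hx as [Hx Cx].
    assert (HN : ~ eqs y (2 * x)).
    { intros HE; pose proof (linked_trans _ _ _ _ _ (linked_eqs _ _ HE) (linked_sym _ _ _ (linked_double x))) as HL.
      pose proof (colour_linked _ _ _ _ _ (small_nonzero y Hy) Cy Cx HL) as E; discriminate E. }
    split; intros D; apply HN; [left|right]; exact D.
- intros y Hy; apply in_class in Hy; apply small_nonzero; tauto.
- pose proof class_total; pose proof (class_le 0 1 ltac:(auto)); pose proof (class_le 1 0 ltac:(auto)).
  pose proof u_odd; replace ((u - 1) / 4) with (g / 2); [|Z.to_euclidean_division_equations; lia].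
  Z.to_euclidean_division_equations; lia.
Qed.
End Doubling.

(** * Packings attaining the bounds *)

Lemma one_row_64 : full1 64 13.
Proof.
apply (cyclic8_simple 8 ltac:(lia) [(0, 9); (2, 12); (3, 6)] [4; 1]).
- cbn; repeat constructor; nodiv.
- cbn; repeat constructor; nodiv.
- intros y Hy; in_segs Hy; nodiv.
- reflexivity.
Qed.

Lemma two_rows_small : full2 4 2.
Proof. two_rows_tac [(3, 0)] [(1, 2)] (@nil Z) (@nil Z). Qed.

Lemma three_rows_small : packs 4 1 (all_keys 4 1 3 (fun _ _ _ _ => True)) 6.
Proof.
assert (T : table_fits 4 (fun _ => false) (base_query 4 3 (fun _ _ _ => false) (fun _ _ _ => true))
  [(Pt 0 0 0, Pt 1 0 0, Pt 2 0 0); (Pt 0 0 0, Pt 1 1 0, Pt 2 2 0); (Pt 0 0 0, Pt 1 2 0, Pt 2 1 0)] = true)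
  by (vm_compute; reflexivity).
apply (base_packs 4 1) in T; [|lia|lia].
apply (fill_rows 4 1 3 (fun _ _ _ => False) (fun _ _ _ _ => True) 3 1); [lia| |].
- eapply packs_sub; [exact T|].
  intros k [(r & _ & a & c & (H & _) & _)|(p & q & a & c & Hp & Hq & Hpq & Ha & Hc & _ & H)]; [discriminate H|].
  right; exists p, q, a, c; tauto.
- intros r Hr; eapply packs_sub; [apply (packs_one 4 1 (Pt r 0 0, Pt r 1 0, Pt r 2 0))|].
  + unfold valid, distinct; cbn; repeat split; right; [left|left|left|right; left]; discriminate.
  + intros k Hk; simpl in Hk; decompose [or] Hk; try contradiction; subst; unfold diff; simpl;
    eexists _, _; (split; [tauto|reflexivity]).
Qed.

(** The region only has to keep the rows in range, which is all that the passage to codewords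
    needs. *)
Definition attains (n m N : Z) : Prop :=
  exists K c, rows_in K n /\ packs m 1 K c /\ Z.of_nat c = N.

Definition all_rows n : region := fun k =>
  exists p q a b, 0 <= p < n /\ 0 <= q < n /\ k = (p, q, a, b).

Lemma all_rows_in n : rows_in (all_rows n) n.
Proof. intros p q a c (p' & q' & a' & b & Hp & Hq & E); injection E; intros; subst; auto. Qed.

Lemma crt_rows m u K n : rows_in K n -> rows_in (crt_region m u K) n.
Proof. intros H p q a c [Hk _]; exact (H _ _ _ _ Hk). Qed.

Lemma pure_rows m u D : rows_in (pure_region m u 0 D) 1.
Proof.
intros p q a c H; unfold pure_region in H.
destruct H as (d & _ & H); injection H; lia.
Qed.

Lemma one_row_attains_8 M : 0 < M -> attains 1 (8 * M) (if M =? 8 then 13 else 7 * M / 4).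
Proof.
intros HM; destruct (Z.eqb_spec M 8) as [->|HM8]; eexists _, _; (split; [apply pure_rows|]).
- split; [exact one_row_64|reflexivity].
- split; [exact (one_row_8 M HM HM8)|]; apply Z2Nat.id, Z.div_pos; lia.
Qed.

Lemma one_row_attains_4 v : 0 < v -> v mod 2 = 1 -> attains 1 (4 * v) ((7 * v + 1) / 8).
Proof.
intros Hv Ho; eexists _, _; split; [apply crt_rows, pure_rows|].
split; [apply packs_crt; [lia|lia| |exact (one_row_4 v Hv Ho)]|].
- apply (gcd_pow2 v (v / 2)); rewrite <- Ho; apply Z.div_mod; lia.
- apply Z2Nat.id, Z.div_pos; lia.
Qed.

Lemma two_rows_attains m : 0 < m -> m mod 4 = 0 -> attains 2 m (if m =? 4 then 2 else 3 * (m / 4)).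
Proof.
intros Hm H4.
assert (E : exists c, full2 m c /\ 0 <= c /\ c = if m =? 4 then 2 else 3 * (m / 4)).
{ destruct (Z.eqb_spec m 4) as [->|N4]; eexists; (split; [|split; [|reflexivity]]).
  - exact two_rows_small.
  - lia.
  - apply two_rows_full; Z.to_euclidean_division_equations; lia.
  - Z.to_euclidean_division_equations; lia. }
destruct E as (c & Hc & Hp & <-); eexists _, _; split; [|split; [exact Hc|lia]].
intros p q a c' (r & r' & d & Hr & Hr' & E); injection E; intros; subst; auto.
Qed.

Lemma three_rows_attains : attains 3 4 6.
Proof.
eexists _, _; split; [|split; [exact three_rows_small|reflexivity]].
intros p q a c [(r & Hr & a' & c' & _ & E)|(r & r' & a' & c' & Hr & Hr' & _ & _ & _ & _ & [E|E])];
  injection E; intros; subst; auto.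
Qed.

Lemma design_count s m T N : 0 < s -> 0 <= m -> 0 <= T ->
  2 * Z.of_nat (3 * (length (pairs (Z.to_nat s)) * Z.to_nat m) + Z.to_nat T * N) =
  3 * m * (s * (s - 1)) + 2 * (T * Z.of_nat N).
Proof.
intros Hs Hm HT; pose proof (f_equal Z.of_nat (length_pairs (Z.to_nat s))) as E.
rewrite !Nat2Z.inj_mul, Nat2Z.inj_sub, Z2Nat.id in E by lia.
rewrite Nat2Z.inj_add, !Nat2Z.inj_mul, !Z2Nat.id by lia.
change (Z.of_nat 1) with 1 in E; rewrite <- E; ring.
Qed.

Lemma odd_attains h s NF : 0 < h -> 0 < s -> s mod 2 = 1 ->
  packs (2 * h) 1 (filler_region (2 * h) (h * (((s - 1) / 2) mod 2))) NF ->
  attains (3 * s) (2 * h) (3 * h * s * (s - 1) + s * (Z.of_nat NF + 1)).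
Proof.
intros Hh Hs Ho HF; apply odd_design in HF; auto.
eexists _, _; split; [apply all_rows_in|split; [exact HF|]].
apply (Z.mul_reg_l _ _ 2); [lia|rewrite design_count, Nat2Z.inj_add by lia].
change (Z.of_nat 1) with 1; ring.
Qed.

Lemma even_attains h u T gam N : 0 < h -> 0 < u -> u mod 2 = 1 -> 0 < T -> Z.gcd (2 * h) u = 1 ->
  packs (2 * h) u (six_keys h u T gam) N ->
  attains (3 * (2 * T)) (2 * h * u) (3 * h * u * (2 * T) * (2 * T - 1) + T * Z.of_nat N).
Proof.
intros Hh Hu Ho HT Hg HN; apply even_design in HN; auto.
eexists _, _; split; [apply crt_rows, all_rows_in|].
split; [apply packs_crt; [lia|lia|exact Hg|exact HN]|].
apply (Z.mul_reg_l _ _ 2); [lia|rewrite design_count by (try apply Z.mul_nonneg_nonneg; lia); ring].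
Qed.

Lemma even_half s : 0 < s -> s mod 2 = 0 -> exists T, 0 < T /\ s = 2 * T.
Proof. intros Hs He; exists (s / 2); pose proof (Z.div_mod s 2 ltac:(lia)); lia. Qed.

Lemma attains_eq n m N n' m' N' : attains n m N -> n = n' -> m = m' -> N = N' -> attains n' m' N'.
Proof. intros; subst; assumption. Qed.

(** Both parities of s give c blocks per three remaining rows: the filler and the extra block of the
    second chain for odd s, half of a group of six rows for even s. *)
Lemma triple_attains h u s NF NT c g : 0 < h -> 0 < s -> u = 2 * g + 1 -> 0 <= g ->
  Z.gcd (2 * h) u = 1 ->
  (forall e, e = 0 \/ e = 1 -> packs (2 * h * u) 1 (filler_region (2 * h * u) (h * u * e)) NF) ->
  (forall T, exists gam, packs (2 * h) u (six_keys h u T gam) NT) ->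
  Z.of_nat NF + 1 = c -> Z.of_nat NT = 2 * c ->
  attains (3 * s) (2 * h * u) (3 * h * u * s * (s - 1) + s * c).
Proof.
intros Hh Hs Eu Hg Hgcd HF HT HcF HcT.
assert (Hr : s mod 2 = 0 \/ s mod 2 = 1) by (pose proof (Z.mod_pos_bound s 2 ltac:(lia)); lia).
assert (Ho : u mod 2 = 1) by (rewrite Eu, Z.add_comm, Z.mul_comm; apply Z.mod_add; lia).
destruct Hr as [Hr|Hr].
- destruct (even_half s Hs Hr) as (T & HT0 & ->); destruct (HT T) as [gam Hgam].
  eapply attains_eq; [apply (even_attains h u T gam NT); auto; lia|lia|lia|].
  rewrite HcT; lia.
- eapply attains_eq; [apply (odd_attains (h * u) s NF); auto; [nia|]|lia|lia|].
  + replace (2 * (h * u)) with (2 * h * u) by lia; apply HF.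
    pose proof (Z.mod_pos_bound ((s - 1) / 2) 2 ltac:(lia)); lia.
  + rewrite HcF; lia.
Qed.

Lemma three_attains_8 s u g : 0 < s -> u = 2 * g + 1 -> 0 <= g ->
  attains (3 * s) (8 * u) (12 * u * s * (s - 1) + s * (27 * g + 13)).
Proof.
intros Hs Eu Hg; apply (triple_attains 4 u s (Z.to_nat (27 * g + 12)) (Z.to_nat (54 * g + 26)) _ g); try lia.
- apply (gcd_pow2 u g Eu).
- intros e He; apply three_filler_8; auto.
- intros T; apply six_filler_8; auto.
Qed.

Lemma three_attains_32 s u g : 0 < s -> u = 2 * g + 1 -> 0 <= g ->
  attains (3 * s) (32 * u) (48 * u * s * (s - 1) + s * (107 * g + 53)).
Proof.
intros Hs Eu Hg; apply (triple_attains 16 u s (Z.to_nat (107 * g + 52)) (Z.to_nat (214 * g + 106)) _ g); try lia.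
- apply (gcd_pow2 u g Eu).
- intros e He; apply three_filler_32; auto.
- intros T; apply six_filler_32; auto.
Qed.

Lemma three_attains_4 s u c Y : 0 < s -> u = 4 * c + 1 -> 1 <= c -> u mod 3 <> 0 -> doubling_list u Y ->
  attains (3 * s) (4 * u) (6 * u * s * (s - 1) + s * (27 * c + 7)).
Proof.
intros Hs Eu Hc H3 HY; apply (triple_attains 2 u s (Z.to_nat (27 * c + 6)) (Z.to_nat (27 * (2 * c) + 14)) _ (2 * c)); try lia.
- apply (gcd_pow2 u (2 * c)); lia.
- intros e He; change (2 * 2 * u) with (4 * u); destruct (Z.eq_dec c 1) as [->|Hc1].
  + subst u; exact (three_filler_20 e He).
  + destruct He as [-> | ->]; [rewrite Z.mul_0_r; apply (three_filler_4_0 c (2 * c) u (4 * u) (2 * u) Y)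
      |rewrite Z.mul_1_r; apply (three_filler_4_1 c (2 * c) u (4 * u) (2 * u) Y)]; lia || auto.
- intros T; apply (six_filler_4 u (2 * c) T Y); try lia; auto.
  rewrite Z.mul_comm; apply Z.mod_mul; lia.
Qed.

End Packing.

Require Import Defs.
Import Packing.
From mathcomp Require Import all_boot all_order all_algebra cyclic boolp.
From mathcomp Require Import zify.
Set Implicit Arguments. Unset Strict Implicit. Unset Printing Implicit Defensive.
Import GRing.Theory.
Local Open Scope nat_scope.
Delimit Scope Z_scope with coqZ.

(** * Packings and codes *)

Lemma addmodZ m (x : 'I_m) (s : int) :
  Z.of_nat (addmod x s) = Z.modulo (Z.of_nat x + ssrZ.Z_of_int s) (Z.of_nat m).
Proof.
case: x => x /= Hx.
set a := (_ + s)%R.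
have Ha : ssrZ.Z_of_int a = Z.add (Z.of_nat x) (ssrZ.Z_of_int s) by lia.
have Hq : exists q, ssrZ.Z_of_int a = Z.add (Z.mul q (Z.of_nat m)) (ssrZ.Z_of_int (modz a m)).
  exists (ssrZ.Z_of_int (divz a m)); have := intdiv.divz_eq a m; lia.
have H0 : (0 <= modz a m)%R by apply: intdiv.modz_ge0; lia.
have H1 : (modz a m < m)%R by apply: intdiv.ltz_pmod; lia.
case: Hq => q Hq; rewrite -Ha Hq.
apply: (Zdiv.Zmod_unique _ _ q); lia.
Qed.

Definition shift n m (x : 'I_n * 'I_m) (s : int) := (x.1, addmod x.2 s).

(** The link between both formalisms: it is invariant under translation, and on the points of a
    block it is [diff]. *)
Definition row_shift n m (x y : 'I_n * 'I_m) : key :=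
  (Z.of_nat x.1, Z.of_nat y.1, Z.modulo (Z.of_nat y.2 - Z.of_nat x.2) (Z.of_nat m), Z0).

Lemma shiftZ n m (x : 'I_n * 'I_m) s :
  Z.of_nat (shift x s).2 = Z.modulo (Z.of_nat x.2 + ssrZ.Z_of_int s) (Z.of_nat m).
Proof. exact: addmodZ. Qed.

Lemma row_shift_shift n m (x y : 'I_n * 'I_m) s : row_shift (shift x s) (shift y s) = row_shift x y.
Proof.
rewrite /row_shift /= !addmodZ -Zdiv.Zminus_mod; congr (_, _, Z.modulo _ _, _); lia.
Qed.

Lemma shift_inj n m (x y : 'I_n * 'I_m) s : shift x s = shift y s -> x = y.
Proof.
case: x y => [i x] [j y] [-> H].
congr pair; apply: val_inj => /=.
have E := addmodZ x s; rewrite /addmod /= H in E.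
have := addmodZ y s; rewrite /addmod /= E => {}E.
have xm := ltn_ord x; have ym := ltn_ord y.
have D := @mod_eq_divide (Z.of_nat m) _ _ ltac:(lia) E.
have := @divide_small _ _ D; lia.
Qed.

Section Codeword.
Variables n m : nat.
Let I := ('I_n.+1 * 'I_m.+1)%type.
Let M := Z.of_nat m.+1.

Definition pt (p : point) : I :=
  (inord (Z.to_nat (prow p)), inord (Z.to_nat (Z.modulo (pa p) M))).

Definition cw (b : block) : {set I} := let '(p, q, r) := b in [set pt p; pt q; pt r].

Definition inrow (p : point) := Z.le Z0 (prow p) /\ Z.lt (prow p) (Z.of_nat n.+1).

Lemma pt2E p : Z.of_nat (pt p).2 = Z.modulo (pa p) M.
Proof.
have H := Z.mod_pos_bound (pa p) M ltac:(lia).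
rewrite /= inordK; lia.
Qed.

Lemma pt1E p : inrow p -> Z.of_nat (pt p).1 = prow p.
Proof. by move=> [H1 H2]; rewrite /= inordK; lia. Qed.

Lemma row_shiftE p q : inrow p -> inrow q -> row_shift (pt p) (pt q) = diff M (Zpos xH) p q.
Proof.
move=> Hp Hq; rewrite /row_shift /diff pt1E // pt1E // !pt2E Z.mod_1_r -Zdiv.Zminus_mod //.
Qed.

Lemma row_shift_keys b x y : let '(p, q, r) := b in inrow p -> inrow q -> inrow r ->
  x \in cw b -> y \in cw b -> x != y -> List.In (row_shift x y) (keys M (Zpos xH) b).
Proof.
case: b => [[p q] r] Hp Hq Hr; rewrite !inE /keys -!row_shiftE //.
by do 2 (case/orP=> [/orP [] |] /eqP ->); rewrite ?eqxx //= => _; tauto.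
Qed.

Lemma pt_neq p q : inrow p -> inrow q -> distinct M (Zpos xH) p q -> pt p != pt q.
Proof.
move=> Hp Hq Hd; apply/eqP => E.
have E1 : prow p = prow q by rewrite -!pt1E // E.
have E2 : Z.modulo (pa p) M = Z.modulo (pa q) M by rewrite -!pt2E E.
case: Hd => [//|[[]|[]]]; last exact: Z.mod_1_r.
by rewrite Zdiv.Zminus_mod E2 Z.sub_diag.
Qed.

Lemma cw_card p q r : inrow p -> inrow q -> inrow r ->
  valid M (Zpos xH) (p, q, r) -> #|cw (p, q, r)| = 3%N.
Proof.
move=> Hp Hq Hr [V1 [V2 [V3 _]]].
by rewrite /cw setUC cardsU1 cards2 !inE negb_or ![pt r == _]eq_sym !pt_neq.
Qed.

(* Only a translation permuting the three points cyclically fixes a codeword. *)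
Lemma cw_auto p q r (s : int) : inrow p -> inrow q -> inrow r ->
  valid M (Zpos xH) (p, q, r) -> ~~ (m.+1 %| s)%Z ->
  (#|cw (p, q, r) :&: translate (cw (p, q, r)) s| <= 2)%N.
Proof.
move=> Hp Hq Hr V Hs; set B := cw _.
have cB : #|B| = 3%N by exact: cw_card.
rewrite leqNgt; apply/negP => H.
have EB : B :&: translate B s = B.
  by apply/eqP; rewrite eqEcard subsetIl cB.
have ET : translate B s = B.
  apply/esym/eqP; rewrite eqEcard -{1}EB subsetIr /=.
  by rewrite card_imset // => x y /shift_inj.
have Sfix (x : I) : shift x s != x.
  apply/eqP => E; move/negP: Hs; apply.
  have E2 : Z.of_nat (addmod x.2 s) = Z.of_nat x.2 by rewrite -[in RHS]E.
  rewrite addmodZ in E2.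
  have xm := ltn_ord x.2.
  have D : Z.divide (Z.of_nat m.+1) (ssrZ.Z_of_int s).
    have -> : ssrZ.Z_of_int s = Z.sub (Z.of_nat x.2 + ssrZ.Z_of_int s) (Z.of_nat x.2) by lia.
    apply: mod_eq_divide; [lia | rewrite E2 Z.mod_small //; lia].
  case: D => k Hk; apply/intdiv.dvdzP; exists (ssrZ.int_of_Z k); lia.
have Sin (x : I) : x \in B -> shift x s \in B by move=> Hx; rewrite -ET; apply: imset_f.
have [V1 [V2 [V3 V4]]] := V.
have N1 := pt_neq Hp Hq V1; have N2 := pt_neq Hq Hr V2; have N3 := pt_neq Hp Hr V3.
(* A 3-cycle makes three times the translation trivial and puts the points in one row, against the
   last clause of [valid]. *)
have key3 (x y z : I) : shift x s = y -> shift y s = z -> shift z s = x ->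
  x.1 = y.1 /\ y.1 = z.1 /\ Z.modulo (Z.mul 3 (Z.of_nat y.2 - Z.of_nat x.2)) M = Z0.
  move=> <- <- E3; split=> //; split=> //; rewrite shiftZ.
  have : Z.of_nat (shift (shift (shift x s) s) s).2 = Z.of_nat x.2 by rewrite E3.
  rewrite !shiftZ => E4.
  set S := ssrZ.Z_of_int s in E4 *.
  set X := Z.of_nat x.2 in E4 *.
  have xm : Z.lt X M by have := ltn_ord x.2; rewrite /X /M; lia.
  have D : Z.divide M (Z.mul 3 S).
    have -> : Z.mul 3 S = Z.sub (X + S + S + S) X by lia.
    apply: mod_eq_divide; first by lia.
    rewrite !(Zdiv.Zplus_mod_idemp_l) -Z.add_assoc !(Zdiv.Zplus_mod_idemp_l) -/M in E4.
    rewrite Z.add_assoc in E4; rewrite E4 Z.mod_small //; rewrite /X; lia.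
  apply/Z.mod_divide; first by lia.
  have -> : Z.mul 3 (Z.modulo (X + S) M - X) = Z.sub (Z.mul 3 S) (Z.mul M (Z.mul 3 (Z.div (X + S) M))).
    by have := Z.div_mod (X + S) M; lia.
  by apply: Z.divide_sub_r => //; exact: Z.divide_factor_l.
have inP : pt p \in B by rewrite !inE eqxx.
have inQ : pt q \in B by rewrite !inE eqxx ?orbT.
have inR : pt r \in B by rewrite !inE eqxx ?orbT.
have done3 (x y z : I) : shift x s = y -> shift y s = z -> shift z s = x ->
   pt p = x -> (pt q = y /\ pt r = z) \/ (pt q = z /\ pt r = y) -> False.
  move=> H1 H2 H3 Ep Eqr.
  have [F1 [F2 F3]] := key3 _ _ _ H1 H2 H3.
  have [G1 [G2 G3]] := key3 _ _ _ H3 H1 H2.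
  have R1 : prow p = prow q.
    by rewrite -!pt1E // Ep; case: Eqr => [] [-> _]; rewrite F1 ?F2.
  have R2 : prow p = prow r.
    by rewrite -!pt1E // Ep; case: Eqr => [] [_ ->]; rewrite F1 ?F2.
  case: V4 => [//|[//|[]]]; last by rewrite Z.mod_1_r.
  have E3 : Z.modulo (Z.mul 3 (pa q - pa p)) M = Z.modulo (Z.mul 3 (Z.of_nat (pt q).2 - Z.of_nat (pt p).2)) M.
    by rewrite !pt2E Zdiv.Zmult_mod [in RHS]Zdiv.Zmult_mod -Zdiv.Zminus_mod.
  rewrite E3 Ep; case: Eqr => [] [-> _]; apply => //.
  apply/Z.mod_divide; first by lia.
  have /(Z.mod_divide) D := G3.
  have -> : Z.mul 3 (Z.of_nat z.2 - Z.of_nat x.2) = Z.opp (Z.mul 3 (Z.of_nat x.2 - Z.of_nat z.2)) by lia.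
  by apply/Z.divide_opp_r; apply: D; lia.
have := Sin _ inP; have := Sin _ inQ; have := Sin _ inR; rewrite !inE !(negPf (Sfix _)) ?orbF /=.
(* Of the eight fixed-point-free maps of the three points only the two 3-cycles are injective. *)
case/orP=> /eqP Er; case/orP=> /eqP Eq; case/orP=> /eqP Ep.
- by move/eqP: N2; apply; apply: (@shift_inj _ _ _ _ s); rewrite Eq Er.
- by move/eqP: N2; apply; apply: (@shift_inj _ _ _ _ s); rewrite Eq Er.
- exact: (done3 _ _ _ Ep Eq Er erefl (or_introl (conj erefl erefl))).
- by move/eqP: N1; apply; apply: (@shift_inj _ _ _ _ s); rewrite Ep Eq.
- by move/eqP: N3; apply; apply: (@shift_inj _ _ _ _ s); rewrite Ep Er.
- exact: (done3 _ _ _ Ep Er Eq erefl (or_intror (conj erefl erefl))).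
- by move/eqP: N3; apply; apply: (@shift_inj _ _ _ _ s); rewrite Ep Er.
- by move/eqP: N1; apply; apply: (@shift_inj _ _ _ _ s); rewrite Ep Eq.
Qed.
End Codeword.

(** Two points of a codeword lying in a translate of another one give both codewords the key of this
    pair. So disjoint keys bound the intersections by 1 and, with the translation 0, also show that
    the N codewords are distinct. *)
Lemma packs_Phi (n m : nat) (K : region) (N : nat) : (0 < n)%N -> (0 < m)%N ->
  rows_in K (Z.of_nat n) -> packs (Z.of_nat m) (Zpos xH) K N -> (N <= Phi n m 3 2 1)%N.
Proof.
case: n m => [//|n] [//|m] _ _ HK [L [<- [HL HD]]].
have rL b : List.In b L -> let '(p, q, r) := b in [/\ inrow n p, inrow n q & inrow n r].
  case: b => [[p q] r] /HL [_ H].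
  have /HK [H1 H2] := H (diff (Z.of_nat m.+1) (Zpos xH) p q) (or_introl erefl).
  have /HK [H3 H4] := H (diff (Z.of_nat m.+1) (Zpos xH) q r) ltac:(simpl; tauto).
  by split.
have share b b' x y s : List.In b L -> List.In b' L -> x != y ->
  x \in cw n m b -> y \in cw n m b -> x \in translate (cw n m b') s ->
  y \in translate (cw n m b') s -> exists k,
    List.In k (keys (Z.of_nat m.+1) (Zpos xH) b) /\ List.In k (keys (Z.of_nat m.+1) (Zpos xH) b').
  move=> Hb Hb' Nxy Hx Hy /imsetP [x' Hx' Ex] /imsetP [y' Hy' Ey].
  exists (row_shift x y); split.
    by have := @row_shift_keys n m b x y; case: (b) (rL b Hb) Hx Hy => [[p q] r] [? ? ?] ? ?; apply.
  have -> : row_shift x y = row_shift x' y' by rewrite Ex Ey; exact: row_shift_shift.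
  have N' : x' != y' by apply: contra Nxy => /eqP E; rewrite Ex Ey E.
  by have := @row_shift_keys n m b' x' y'; case: (b') (rL b' Hb') Hx' Hy' => [[p q] r] [? ? ?] ? ?; apply.
have tr0 (B : {set 'I_n.+1 * 'I_m.+1}) : translate B 0%R = B.
  apply/setP => x; apply/imsetP/idP => [[y Hy ->]|Hx].
    suff -> : (y.1, addmod y.2 0%R) = y by [].
    case: (y) => i j; congr pair; apply: val_inj; have := addmodZ j 0%R; have := ltn_ord j.
    by rewrite /= Z.add_0_r => jm; rewrite Z.mod_small; lia.
  exists x => //; case: (x) => i j; congr pair; apply: val_inj.
  have := addmodZ j 0%R; have := ltn_ord j.
  by rewrite /= Z.add_0_r => jm; rewrite Z.mod_small; lia.
have card3 b : List.In b L -> #|cw n m b| = 3%N.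
  by case: b => [[p q] r] Hb; have [? ? ?] := rL _ Hb; apply: cw_card => //; case: (HL _ Hb).
have two b : List.In b L -> exists x y, [/\ x != y, x \in cw n m b & y \in cw n m b].
  move=> Hb; have /card_gt1P [x [y [Hx Hy Nxy]]] : (1 < #|cw n m b|)%N by rewrite card3.
  by exists x, y.
pose C := [set B in [seq cw n m b | b <- L]].
have cwL b : List.In b L -> cw n m b \in [seq cw n m b | b <- L].
  elim: (L) => //= a l IH [->|Hb]; rewrite inE ?eqxx //; apply/orP; right; exact: IH.
have Lcw B : B \in [seq cw n m b | b <- L] -> exists2 b, List.In b L & B = cw n m b.
  elim: (L) => //= a l IH; rewrite inE => /orP [/eqP ->|/IH [b Hb ->]]; first by exists a => //; left.
  by exists b => //; right.
have cC : #|C| = length L.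
  rewrite cardsE; have -> : length L = size [seq cw n m b | b <- L] by rewrite size_map.
  apply/card_uniqP; elim: HD HL rL share card3 two {cwL Lcw} => //= a l Ha Hd IH HL rL share card3 two.
  apply/andP; split; last first.
    by apply: IH => [b Hb|b Hb|b b' x y s Hb Hb'|b Hb|b Hb]; [apply: HL|apply: rL|apply: share|apply: card3|apply: two]; right.
  apply/negP => Hin.
  have [b Hb E] : exists2 b, List.In b l & cw n m a = cw n m b.
    elim: (l) Hin => //= a' l' IH'; rewrite inE => /orP [/eqP ->|/IH' [b Hb ->]]; first by exists a' => //; left.
    by exists b => //; right.
  have [x [y [Nxy Hx Hy]]] := two a (or_introl erefl).
  have [||k [Hk Hk']] := share a b x y 0%R (or_introl erefl) (or_intror Hb) Nxy Hx Hy; rewrite ?tr0 -?E //.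
  by move/Forall_forall: Ha => /(_ b Hb k Hk Hk').
rewrite -cC; apply: (@leq_bigmax_cond _ _ (fun C : {set {set _}} => #|C|)).
apply/asboolP; split.
- by move=> B; rewrite inE => /Lcw [b Hb ->]; exact: card3.
- move=> B s; rewrite inE => /Lcw [b Hb ->].
  by case: b Hb => [[p q] r] Hb; have [? ? ?] := rL _ Hb; apply: cw_auto => //; case: (HL _ Hb).
- move=> A B s; rewrite !inE => /Lcw [b Hb ->] /Lcw [b' Hb' ->] Nab.
  rewrite leqNgt; apply/negP => /card_gt1P [x [y [/setIP [Hx1 Hx2] /setIP [Hy1 Hy2] Nxy]]].
  have [k [Hk Hk']] := share b b' x y s Hb Hb' Nxy Hx1 Hy1 Hx2 Hy2.
  have [E|[H|H]] := ForallOrdPairs_In HD _ _ Hb Hb'.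
  + by rewrite E eqxx in Nab.
  + exact: H Hk Hk'.
  + exact: H Hk' Hk.
Qed.

(** * Upper bounds by weights *)

Section Weights.
Variables (n m c W : nat) (v : nat -> nat).
Local Notation Zm := 'I_m.+1.
Local Notation I := ('I_n * Zm)%type.

Definition delta (B : {set I}) : {set 'I_n * 'I_n * Zm} :=
  [set (p.1.1, p.2.1, (p.2.2 - p.1.2)%R) | p : I * I
    in [set p : I * I | [&& p.1 \in B, p.2 \in B & p.1 != p.2]]].

Lemma mem_delta (B : {set I}) x y :
  x \in B -> y \in B -> x != y -> (x.1, y.1, (y.2 - x.2)%R) \in delta B.
Proof. by move=> Hx Hy N; apply/imsetP; exists (x, y); rewrite // inE Hx Hy. Qed.

Lemma addmod_sub (x y z : Zm) : addmod z (x%:Z - y%:Z)%R = (z + (x - y))%R.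
Proof.
apply: val_inj; rewrite /= !modnDmr.
have xm := ltn_ord x; have ym := ltn_ord y; have zm := ltn_ord z.
have -> : (z%:Z + (x%:Z - y%:Z) = (-1) * m.+1%:Z + (z + (x + (m.+1 - y)))%N%:Z)%R by lia.
by rewrite intdiv.modzMDl intdiv.modz_nat absz_nat -(modnDmr z (_ + _)) -(modnDmr x (_ - _)) modnDmr.
Qed.

(** Pairs with the same difference are translates of each other, so the two codewords would meet in
    two points after this translation. *)
Lemma delta_disjoint (la : nat) (C : {set {set I}}) (A B : {set I}) k :
  is_ooc 3 la 1 C -> A \in C -> B \in C -> k \in delta A -> k \in delta B -> A = B.
Proof.
move=> [_ _ H] HA HB /imsetP [[x y]]; rewrite inE /= => /and3P [Hx Hy Nxy] ->.
move=> /imsetP [[x' y']]; rewrite inE => /and3P [Hx' Hy' Nxy'] E.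
have E1 : x.1 = x'.1 := congr1 (fun k => k.1.1) E.
have E2 : y.1 = y'.1 := congr1 (fun k => k.1.2) E.
have E3 : (y.2 - x.2 = y'.2 - x'.2)%R := congr1 snd E.
apply/eqP/negPn/negP => NAB; have := H _ _ (x.2%:Z - x'.2%:Z)%R HA HB NAB.
rewrite leqNgt => /negP; apply; apply/card_gt1P; exists x, y.
have sh z z' : z.1 = z'.1 -> z.2 = (z'.2 + (x.2 - x'.2))%R ->
    z = (z'.1, addmod z'.2 (x.2%:Z - x'.2%:Z)%R).
  by case: z => [i z] /= -> ->; rewrite addmod_sub.
split=> //; rewrite inE ?Hx ?Hy /=; apply/imsetP.
  by exists x' => //; apply: sh => //; rewrite addrC subrK.
exists y' => //; apply: sh => //.
by apply: (addIr (- x.2)%R); rewrite E3 [(x.2 - _)%R]addrC addrA addrK.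
Qed.

Definition wt (k : 'I_n * 'I_n * Zm) : nat := if k.1.1 == k.1.2 then v k.2 else c.

Definition orb (d : Zm) : {set Zm} := [set d; (- d)%R].
Definition orb_weight (d : Zm) : nat := \sum_(x in orb d) v x.

Lemma orb_disjoint a b : a != b -> (a + b)%R != 0%R -> [disjoint orb a & orb b].
Proof.
move=> N1 N2; rewrite -setI_eq0; apply/eqP/setP => x; rewrite !inE.
apply/negbTE/negP => /andP [/orP [] /eqP -> /orP [] /eqP E].
- by rewrite E eqxx in N1.
- by rewrite E addrC subrr eqxx in N2.
- by rewrite -E subrr eqxx in N2.
- by move/oppr_inj: E => E; rewrite E eqxx in N1.
Qed.

(** One hypothesis per shape of block: this one for {0, a, 2a}, which covers two shifts up to sign;
    [HT] for other triples in one row; [H2] and [H3] for blocks meeting two and three rows. *)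
Hypothesis HE : forall a : Zm, (a + a)%R != 0%R -> (a + a + a)%R != 0%R ->
  W <= orb_weight a + orb_weight (a + a)%R.
Hypothesis HT : forall a b : Zm, a != 0%R -> b != 0%R -> (a + b)%R != 0%R ->
  W <= orb_weight a + orb_weight b + orb_weight (a + b)%R.

Lemma orb_weightN a : orb_weight (- a)%R = orb_weight a.
Proof. by rewrite /orb_weight; congr bigop; apply: funext => x; rewrite /orb opprK setUC. Qed.

Lemma sum_seq_le (T : finType) (F : T -> nat) (S : {set T}) (s : seq T) :
  uniq s -> {subset s <= S} -> \sum_(x <- s) F x <= \sum_(x in S) F x.
Proof.
move=> Us Ss; rewrite big_uniq //= (big_setID [set x in s]) /= -[X in X <= _]addn0 leq_add //.
apply: eq_leq; apply: eq_bigl => x; rewrite !inE.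
by case Ex: (x \in s); rewrite ?andbF // Ss.
Qed.

Definition pkey (i : 'I_n) (d : Zm) : 'I_n * 'I_n * Zm := (i, i, d).

Lemma pkey_inj i : injective (pkey i). Proof. by move=> d d' []. Qed.

Lemma sum_orb i (s : seq Zm) :
  \sum_(k <- map (pkey i) s) wt k = \sum_(d <- s) v d.
Proof. by rewrite big_map; apply: eq_bigr => d _; rewrite /wt /= eqxx. Qed.

Lemma orb_weight_seq d : \sum_(x <- enum (orb d)) v x = orb_weight d.
Proof. by rewrite /orb_weight big_enum. Qed.

(** The orbits of a, b and a + b are disjoint unless a = b, b = - 2a or a = - 2b. In each
    exceptional case the three points are in arithmetic progression, and [HE] applies. *)
Lemma weight_pure i (a b : Zm) (D : {set 'I_n * 'I_n * Zm}) :
  a != 0%R -> b != 0%R -> (a + b)%R != 0%R -> ~~ ((a == b) && (a + a + a == 0)%R) ->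
  (forall d, d \in orb a :|: orb b :|: orb (a + b)%R -> pkey i d \in D) ->
  W <= \sum_(k in D) wt k.
Proof.
move=> a0 b0 ab0 N3 HD.
have two x y : (x + y)%R != 0%R -> x != y ->
    (forall d, d \in orb x :|: orb y -> pkey i d \in D) ->
    orb_weight x + orb_weight y <= \sum_(k in D) wt k.
  move=> N1 N2 H; rewrite -!orb_weight_seq -big_cat /= -(sum_orb i); apply: sum_seq_le.
    rewrite (map_inj_uniq (@pkey_inj i)) cat_uniq !enum_uniq andbT /=.
    by rewrite -disjoint_has (eq_disjoint (mem_enum _)) disjoint_sym (eq_disjoint (mem_enum _)) orb_disjoint.
  move=> k /mapP [d Hd ->]; apply: H; rewrite inE.
  by rewrite mem_cat !mem_enum in Hd.
have [Eab|Nab] := eqVneq a b.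
  subst b; rewrite eqxx /= in N3.
  apply: leq_trans (HE ab0 N3) _; apply: two => //; first by rewrite addrA.
    by apply: contra a0 => /eqP E; rewrite -(inj_eq (addrI a)) addr0 -E.
  by move=> d Hd; apply: HD; move: Hd; rewrite !inE => /orP [] ->; rewrite ?orbT.
have [Ea|Na] := eqVneq (a + (a + b))%R 0%R.
  have Eb : b = (- (a + a))%R by apply/eqP; rewrite -addr_eq0 addrC -addrA Ea.
  have F0 : (a + a)%R != 0%R by rewrite -oppr_eq0 -Eb.
  have F3 : (a + a + a)%R != 0%R.
    by apply: contra Nab => /eqP F; rewrite Eb -addr_eq0 addrA F.
  apply: leq_trans (HE F0 F3) _; rewrite -(orb_weightN (a + a)%R) -Eb; apply: two => //.
  by move=> d Hd; apply: HD; move: Hd; rewrite !inE => /orP [] ->; rewrite ?orbT.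
have [Ebb|Nb] := eqVneq (b + (a + b))%R 0%R.
  have Eb : a = (- (b + b))%R by apply/eqP; rewrite -addr_eq0 addrC -addrA [(b + a)%R]addrC Ebb.
  have F0 : (b + b)%R != 0%R by rewrite -oppr_eq0 -Eb.
  have F3 : (b + b + b)%R != 0%R.
    by apply: contra Nab => /eqP F; rewrite Eb eq_sym -addr_eq0 addrA F.
  apply: leq_trans (HE F0 F3) _; rewrite -(orb_weightN (b + b)%R) -Eb addnC; apply: two => //.
  by move=> d Hd; apply: HD; move: Hd; rewrite !inE => /orP [] ->; rewrite ?orbT.
apply: leq_trans (HT a0 b0 ab0) _.
have D1 := orb_disjoint Nab ab0.
have D2 : [disjoint orb a & orb (a + b)%R].
  by apply: orb_disjoint => //; apply: contra b0 => /eqP E; rewrite -(inj_eq (addrI a)) addr0 -E.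
have D3 : [disjoint orb b & orb (a + b)%R].
  by apply: orb_disjoint => //; apply: contra a0 => /eqP E; rewrite -(inj_eq (addIr b)) add0r -E.
rewrite -!orb_weight_seq -!big_cat /= -(sum_orb i); apply: sum_seq_le.
  rewrite -catA (map_inj_uniq (@pkey_inj i)) !cat_uniq !enum_uniq has_cat negb_or /= !andbT.
  rewrite -!disjoint_has !(eq_disjoint (mem_enum _)) ![[disjoint _ & enum _]]disjoint_sym.
  by rewrite !(eq_disjoint (mem_enum _)) D1 D2 D3.
move=> k /mapP [d Hd ->]; apply: HD; rewrite !inE.
by move: Hd; rewrite !mem_cat !mem_enum !inE.
Qed.

Hypothesis H2 : 1 < n -> forall d : Zm, d != 0%R -> W <= 4 * c + orb_weight d.
Hypothesis H3 : 2 < n -> W <= 6 * c.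

Lemma wt_mixed (i j : 'I_n) d : i != j -> wt (i, j, d) = c.
Proof. by rewrite /wt /= => /negPf ->. Qed.

Lemma weight_two (x y z : I) (D : {set 'I_n * 'I_n * Zm}) :
  x.1 = y.1 -> x != y -> z.1 != x.1 ->
  (forall p q, p \in [:: x; y; z] -> q \in [:: x; y; z] -> p != q ->
     (p.1, q.1, (q.2 - p.2)%R) \in D) ->
  W <= \sum_(k in D) wt k.
Proof.
case: x y z => [i x] [j y] [k z] /= <- {j} Nxy Nik HD.
have Nxy' : x != y by apply: contra Nxy => /eqP ->.
have n1 : 1 < n by have := ltn_ord i; have := ltn_ord k; move: Nik; rewrite -val_eqE /=; lia.
have d0 : (y - x)%R != 0%R by rewrite subr_eq0 eq_sym.
apply: leq_trans (H2 n1 d0) _.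
have Nki : i != k by rewrite eq_sym.
pose s := [:: (i, k, (z - x)%R); (k, i, (x - z)%R); (i, k, (z - y)%R); (k, i, (y - z)%R)].
have -> : 4 * c + orb_weight (y - x)%R = \sum_(l <- s ++ map (pkey i) (enum (orb (y - x)%R))) wt l.
  by rewrite big_cat /= sum_orb orb_weight_seq !big_cons big_nil !wt_mixed //; lia.
apply: sum_seq_le.
  rewrite cat_uniq (map_inj_uniq (@pkey_inj i)) enum_uniq andbT; apply/andP; split.
    rewrite /= !inE !xpair_eqE !eqxx /= !(negPf Nik) !(negPf Nki) /= !andbT !orbF.
    by rewrite (inj_eq (addrI z)) (inj_eq oppr_inj) Nxy' (inj_eq (addIr (- z)%R)) Nxy'.
  apply/hasPn => l /mapP [d _ ->]; rewrite /pkey !inE !xpair_eqE !eqxx /=.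
  by rewrite ?(negPf Nik) ?(negPf Nki) ?andbF.
have Nz t : (i, t) != (k, z) by rewrite xpair_eqE (negPf Nki).
move=> l; rewrite mem_cat => /orP [|/mapP [d]].
  rewrite !inE => /or4P [] /eqP ->.
  - by apply: (HD (i, x) (k, z)); rewrite ?inE ?eqxx ?orbT.
  - by apply: (HD (k, z) (i, x)); rewrite ?inE ?eqxx ?orbT // eq_sym.
  - by apply: (HD (i, y) (k, z)); rewrite ?inE ?eqxx ?orbT.
  - by apply: (HD (k, z) (i, y)); rewrite ?inE ?eqxx ?orbT // eq_sym.
rewrite mem_enum !inE => /orP [] /eqP -> ->; rewrite /pkey.
- by apply: (HD (i, x) (i, y)); rewrite ?inE ?eqxx ?orbT.
- by rewrite opprB; apply: (HD (i, y) (i, x)); rewrite ?inE ?eqxx ?orbT // eq_sym.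
Qed.

Lemma block_weight (C : {set {set I}}) B : is_ooc 3 2 1 C -> B \in C ->
  W <= \sum_(k in delta B) wt k.
Proof.
move=> [Hk Hla _] HB; have cB := Hk _ HB.
have /card_gt2P [x [y [z [[Hx Hy Hz] [Nxy Nyz Nzx]]]]] : 2 < #|B| by rewrite cB.
have inB p : p \in [:: x; y; z] -> p \in B by rewrite !inE => /or3P [] /eqP ->.
have HD p q : p \in [:: x; y; z] -> q \in [:: x; y; z] -> p != q ->
    (p.1, q.1, (q.2 - p.2)%R) \in delta B.
  by move=> /inB Hp /inB Hq; apply: mem_delta.
have [Exy|Rxy] := eqVneq x.1 y.1; last first.
  have [Exz|Rxz] := eqVneq x.1 z.1.
    apply: (@weight_two x z y) => //; [by rewrite eq_sym|by rewrite eq_sym|].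
    by move=> p q Hp Hq; apply: HD; [move: Hp|move: Hq]; rewrite !inE => /or3P [] ->; rewrite ?orbT.
  have [Eyz|Ryz] := eqVneq y.1 z.1.
    apply: (@weight_two y z x) => //.
    by move=> p q Hp Hq; apply: HD; [move: Hp|move: Hq]; rewrite !inE => /or3P [] ->; rewrite ?orbT.
  have n2 : 2 < n.
    have := ltn_ord x.1; have := ltn_ord y.1; have := ltn_ord z.1.
    by move: Rxy Rxz Ryz; rewrite -!val_eqE /=; lia.
  apply: leq_trans (H3 n2) _.
  pose k p q := ((p : I).1, (q : I).1, (q.2 - p.2)%R).
  have -> : 6 * c = \sum_(l <- [:: k x y; k y x; k x z; k z x; k y z; k z y]) wt l.
    by rewrite !big_cons big_nil !wt_mixed // eq_sym.
  apply: sum_seq_le.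
    rewrite /= !inE !xpair_eqE !eqxx /= ![y.1 == x.1]eq_sym ![z.1 == x.1]eq_sym ![z.1 == y.1]eq_sym.
    by rewrite !(negPf Rxy) !(negPf Rxz) !(negPf Ryz) /= ?andbF.
  move=> l; rewrite !inE => /orP [/eqP ->|/orP [/eqP ->|/or4P [] /eqP ->]];
    by apply: mem_delta => //; rewrite eq_sym.
have [Exz|Rxz] := eqVneq z.1 x.1; last first.
  exact: (weight_two Exy Nxy Rxz HD).
have E2 p q : p \in [:: x; y; z] -> q \in [:: x; y; z] -> p.1 = q.1.
  have E r : r \in [:: x; y; z] -> r.1 = x.1 by rewrite !inE => /or3P [] /eqP ->.
  by move=> /E -> /E ->.
have Pi p q : p \in [:: x; y; z] -> q \in [:: x; y; z] -> p != q ->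
    pkey x.1 (q.2 - p.2)%R \in delta B.
  move=> Hp Hq N; have := HD _ _ Hp Hq N.
  by rewrite (E2 p x) ?(E2 q x) ?Hp ?Hq /pkey // !inE eqxx.
have xi : x \in [:: x; y; z] by rewrite !inE eqxx.
have yi : y \in [:: x; y; z] by rewrite !inE eqxx ?orbT.
have zi : z \in [:: x; y; z] by rewrite !inE eqxx ?orbT.
have N2 p q : p \in [:: x; y; z] -> q \in [:: x; y; z] -> p != q -> (q.2 - p.2)%R != 0%R.
  move=> Hp Hq; apply: contra; rewrite subr_eq0 => /eqP E.
  by have := E2 _ _ Hp Hq; case: (p) (q) E => [i a] [j b] /= -> ->.
have Eab : ((y.2 - x.2) + (z.2 - y.2) = z.2 - x.2)%R by rewrite addrC addrA subrK.
have Nxz : x != z by rewrite eq_sym.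
apply: (@weight_pure x.1 (y.2 - x.2)%R (z.2 - y.2)%R); rewrite ?Eab ?N2 //; last first.
  move=> d; rewrite !inE -!orbA !opprB => /orP [/eqP ->|/orP [/eqP ->|/or4P [] /eqP ->]];
    by apply: Pi => //; rewrite eq_sym.
(* Three equidistant points with 3a = 0 are permuted by the translation by a and meet their
   translate in 3 > 2 points. *)
apply/negP => /andP [/eqP E1 /eqP E3].
pose s := (y.2%:Z - x.2%:Z)%R.
have sh p q : p \in [:: x; y; z] -> q \in [:: x; y; z] -> (q.2 - p.2)%R = (y.2 - x.2)%R ->
    q = (p.1, addmod p.2 s).
  move=> Hp Hq E; rewrite addmod_sub -E; have := E2 _ _ Hp Hq.
  by case: (p) (q) => [i a] [j b] /= ->; rewrite addrC subrK.
have Ezx : (x.2 - z.2 = y.2 - x.2)%R.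
  apply/eqP; rewrite -opprB -Eab -E1 eq_sym -addr_eq0 addrA E3 //.
have Ns : ~~ (m.+1 %| s)%Z.
  apply/negP => /intdiv.dvdzP [t Ht].
  have : y.2 = x.2 :> nat.
    have := ltn_ord x.2; have := ltn_ord y.2; move: Ht; rewrite /s => Ht Hy2 Hx2.
    have : (t = 0)%R by nia.
    by move=> t0; move: Ht; rewrite t0; lia.
  move=> /val_inj E; have := N2 _ _ xi yi Nxy; by rewrite E subrr eqxx.
have := Hla B s HB Ns; rewrite leqNgt => /negP; apply.
apply/card_gt2P; exists x, y, z; split=> //.
have im p q : p \in [:: x; y; z] -> q \in [:: x; y; z] -> p \in B -> q \in B ->
    (q.2 - p.2)%R = (y.2 - x.2)%R -> q \in B :&: translate B s.
  by move=> Hp Hq Hp' Hq' E; rewrite inE Hq' /=; apply/imsetP; exists p => //; apply: sh.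
by split; [apply: (im z)|apply: (im x)|apply: (im y)].
Qed.

Lemma Phi_weight : W * Phi n m.+1 3 2 1 <= \sum_(k : 'I_n * 'I_n * Zm | (k.1.1 != k.1.2) || (k.2 != 0%R)) wt k.
Proof.
have [C /asboolP HC ->] : exists2 C : {set {set I}}, `[< is_ooc 3 2 1 C >] & Phi n m.+1 3 2 1 = #|C|.
  rewrite /Phi; have := @eq_bigmax_cond _ (fun C : {set {set I}} => `[< is_ooc 3 2 1 C >]) (fun C => #|C|).
  case=> [|C HC E]; last by exists C.
  apply/card_gt0P; exists set0; apply/asboolP; split=> [B|B s|A B s]; by rewrite inE.
rewrite mulnC -sum_nat_const.
apply: leq_trans (_ : \sum_(B in C) \sum_(k in delta B) wt k <= _).
  by apply: leq_sum => B HB; exact: block_weight HC HB.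
rewrite (exchange_big_dep (fun k : 'I_n * 'I_n * Zm => (k.1.1 != k.1.2) || (k.2 != 0%R))) /=.
  apply: leq_sum => k _; rewrite sum_nat_const -[X in _ <= X]mul1n leq_mul2r; apply/orP; right.
  rewrite leqNgt; apply/negP => /card_gt1P [A [B [/andP [HA kA] /andP [HB kB] N]]].
  by move/eqP: N; apply; apply: delta_disjoint HC HA HB kA kB.
move=> B k HB /imsetP [[x y]]; rewrite inE => /and3P [_ _ N] -> /=.
rewrite -negb_and; apply: contra N => /andP [/eqP E1]; rewrite subr_eq0 => /eqP E2 /=.
by apply/eqP; move: E1 E2; case: (x) (y) => [i a] [j b] /= -> ->.
Qed.
End Weights.

Section Residues.
Variables (n m P c W : nat) (f : nat -> nat).
Hypotheses (m_even : ~~ odd m) (P_gt0 : 0 < P) (m_gt0 : 0 < m) (P_m : P %| m).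
Hypothesis f_sym : forall r, r < P -> f ((P - r) %% P) = f r.
Hypothesis f_double : forall r, r < P -> W <= 2 * (f r + f ((r + r) %% P)).
Hypothesis f_sum : forall r s, r < P -> s < P -> W <= 2 * (f r + f s + f ((r + s) %% P)).
Hypothesis H2 : 1 < n -> forall r, r < P -> W <= 4 * c + 2 * f r.
Hypothesis H3 : 2 < n -> W <= 6 * c.

(** The shift m / 2 is its own negative; its double weight makes all orbits weigh 2 f. *)
Let v d := (if d.*2 == m then 2 else 1) * f (d %% P).

Lemma residue_orbit m' (E : m = m'.+1) (d : 'I_m'.+1) :
  d != 0%R -> orb_weight v d = 2 * f (d %% P).
Proof.
move=> d0; have dm : d < m by rewrite E.
have d1 : 0 < d by move: d0; rewrite -val_eqE /= lt0n.
have Nd : val (- d)%R = m - d by rewrite /= modn_small; lia.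
have [Ed|Ed] := eqVneq d.*2 m.
  have Ed' : (- d)%R = d by apply: val_inj; rewrite Nd /=; lia.
  by rewrite /orb_weight /orb Ed' setUid big_set1 /v Ed eqxx.
have Ed' : d != (- d)%R by rewrite -val_eqE Nd /=; lia.
rewrite /orb_weight /orb big_setU1 ?inE //= big_set1 [nat_of_ord (- d)%R]Nd /v (negPf Ed) ifN; last by lia.
rewrite !mul1n mul2n -addnn; congr addn.
rewrite -(f_sym (ltn_pmod d P_gt0)); congr f.
have Em : m = (m %/ P) * P by rewrite divnK.
have Edd := divn_eq d P; have rP := ltn_pmod d P_gt0.
have lt : d %/ P < m %/ P by rewrite ltn_divLR // -Em.
have [t Et] : exists t, m %/ P = d %/ P + t.+1.
  by exists (m %/ P - d %/ P).-1; move: lt; move: (m %/ P) (d %/ P); lia.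
suff -> : m - d = t * P + (P - d %% P) by rewrite modnMDl.
rewrite [in LHS]Em Et mulnDl mulSn; move: Edd rP; move: (d %/ P) (d %% P) => q r -> rP.
by rewrite subnDl -addnBAC ?(ltnW rP) // addnC.
Qed.

(** The corrections are [f 0] for the excluded shift 0 on the left and one more [f] at m / 2, for
    its double weight, on the right. *)
Lemma residue_sum m' : m = m'.+1 ->
  \sum_(k : 'I_n * 'I_n * 'I_m'.+1 | (k.1.1 != k.1.2) || (k.2 != 0%R)) wt c v k + n * f 0
  = n * ((m %/ P) * (\sum_(r < P) f r) + f ((m./2) %% P)) + n * n.-1 * m * c.
Proof.
move=> E.
have S0 : \sum_(d < m'.+1) f (d %% P) = (m %/ P) * (\sum_(r < P) f r).
  have -> : m'.+1 = (m %/ P) * P by rewrite divnK.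
  elim: (m %/ P) => [|k IH]; first by rewrite big_ord0.
  rewrite mulSn addnC big_split_ord /= IH mulSn addnC; congr addn.
  by apply: eq_bigr => i _; rewrite modnMDl modn_small.
have S1 : \sum_(d < m'.+1) v d = \sum_(d < m'.+1) f (d %% P) + f ((m./2) %% P).
  have hm : m./2 < m'.+1 by rewrite -E; lia.
  rewrite (bigD1 (Ordinal hm)) //= [in RHS](bigD1 (Ordinal hm)) //= /v.
  rewrite ifT; last by lia.
  rewrite mul2n -addnn -!addnA; congr addn; rewrite addnC; congr addn.
  apply: eq_bigr => d; rewrite -val_eqE /= => Hd; rewrite ifN ?mul1n //.
  by apply: contra Hd => /eqP; lia.
have S2 : \sum_(d < m'.+1 | d != 0%R) v d + f 0 = \sum_(d < m'.+1) v d.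
  rewrite [in RHS](bigD1 (0%R : 'I_m'.+1)) //= addnC; congr addn.
  by rewrite /v mod0n ifN ?mul1n //; lia.
rewrite -S0 -S1 -S2 mulnDr addnAC; congr addn.
rewrite (eq_bigr (fun k => wt c v (k.1, k.2))); last by case.
rewrite -(pair_big_dep xpredT (fun (p : 'I_n * 'I_n) (d : 'I_m'.+1) => (p.1 != p.2) || (d != 0%R)) (fun p d => wt c v (p, d))) /=.
rewrite (eq_bigr (fun p => \sum_(d < m'.+1 | ((p.1, p.2).1 != (p.1, p.2).2) || (d != 0%R)) wt c v ((p.1, p.2), d))); last by case.
rewrite -(pair_bigA _ (fun i j : 'I_n => \sum_(d < m'.+1 | (i != j) || (d != 0%R)) wt c v ((i, j), d))) /=.
rewrite (eq_bigr (fun _ => \sum_(d < m'.+1 | d != 0%R) v d + n.-1 * m * c)).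
  rewrite sum_nat_const card_ord mulnDr !mulnA //.
move=> i _; rewrite (bigD1 i) //=; congr addn.
  by rewrite eqxx /=; apply: eq_bigr => d _; rewrite /wt eqxx.
rewrite (eq_bigr (fun _ => m * c)).
  rewrite sum_nat_const cardC1 card_ord mulnA //.
move=> j Hj; rewrite eq_sym in Hj; rewrite (eq_bigl xpredT); last by move=> d; rewrite Hj.
rewrite (eq_bigr (fun _ => c)); last by move=> d _; rewrite /wt /= (negPf Hj).
by rewrite sum_nat_const card_ord E.
Qed.

Theorem Phi_residue : W * Phi n m 3 2 1 + n * f 0 <=
  n * ((m %/ P) * (\sum_(r < P) f r) + f ((m./2) %% P)) + n * n.-1 * m * c.
Proof.
have [m' E] : exists m', m = m'.+1 by exists m.-1; lia.
have val_add (a b : 'I_m'.+1) : val (a + b)%R %% P = (a %% P + b %% P) %% P.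
  by rewrite /= modn_dvdm ?modnDm // -E.
rewrite -(residue_sum E) leq_add2r; move: E (@residue_orbit m' E) => E V; rewrite [in Phi _ _]E.
apply: Phi_weight => [a a2 a3|a b a0 b0 ab|n1 d d0|//].
- have a0 : a != 0%R by apply: contra a2 => /eqP ->; rewrite addr0.
  rewrite !V // [in X in _ + 2 * f X]val_add -mulnDr; apply: f_double; exact: ltn_pmod.
- rewrite !V // [in X in _ + _ + 2 * f X]val_add -!mulnDr; apply: f_sum; exact: ltn_pmod.
- by rewrite V //; apply: H2 => //; exact: ltn_pmod.
Qed.
End Residues.

Definition residues_ok P c W (f : nat -> nat) (n : nat) : bool :=
  [&& all (fun r => f ((P - r) %% P) == f r) (iota 0 P),
      all (fun r => W <= 2 * (f r + f ((r + r) %% P))) (iota 0 P),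
      all (fun r => all (fun s => W <= 2 * (f r + f s + f ((r + s) %% P))) (iota 0 P)) (iota 0 P),
      (1 < n) ==> all (fun r => W <= 4 * c + 2 * f r) (iota 0 P)
    & (2 < n) ==> (W <= 6 * c)].

Lemma all_iota P (p : pred nat) : all p (iota 0 P) -> forall r, r < P -> p r.
Proof. by move=> /allP H r Hr; apply: H; rewrite mem_iota. Qed.

Lemma residues_ok3 P c W f n : residues_ok P c W f 3 -> residues_ok P c W f n.
Proof.
by rewrite /residues_ok /= => /and5P [-> -> -> -> ->]; rewrite !implybT.
Qed.

Lemma Phi_residues_ok n m P c W f : ~~ odd m -> 0 < P -> 0 < m -> P %| m ->
  residues_ok P c W f n ->
  W * Phi n m 3 2 1 + n * f 0 <=
    n * ((m %/ P) * sumn [seq f r | r <- iota 0 P] + f ((m./2) %% P)) + n * n.-1 * m * c.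
Proof.
move=> m_even P0 m0 Pm /and5P [h1 h2 h3 h4 h5].
have -> : sumn [seq f r | r <- iota 0 P] = \sum_(r < P) f r.
  by rewrite sumnE big_map -(big_mkord xpredT) /index_iota subn0.
apply: Phi_residue => //.
- by move=> r Hr; apply/eqP; exact: (all_iota h1).
- exact: (all_iota h2).
- by move=> r s Hr Hs; exact: (all_iota (all_iota h3 Hr) Hs).
- by move=> n1; move: h4; rewrite n1 => h4 r Hr; exact: (all_iota h4).
- by move=> n2; move: h5; rewrite n2.
Qed.

(** An odd d and its double weigh 1 + 3, two multiples of 4 weigh 2 + 2, and two odd shifts
    differing by a multiple of 4 weigh 1 + 1 + 2: half of W = 8 each time. No other combination of
    residues is lighter. *)
Lemma Phi_upper1 m : 0 < m -> 4 %| m ->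
  8 * Phi 1 m 3 2 1 + 1 <= (m %/ 4) * 7 + (if 8 %| m then 2 else 3).
Proof.
move=> m0 m4; have H := @Phi_residues_ok 1 m 4 0 8 (nth 0 [:: 2; 1; 3; 1]) ltac:(lia) isT m0 m4 isT.
rewrite /= in H.
have [m8|m8] := boolP (8 %| m).
  by rewrite (_ : m./2 %% 4 = 0) /= in H; lia.
by rewrite (_ : m./2 %% 4 = 2) /= in H; lia.
Qed.

Lemma Phi_upper2 m : 0 < m -> 4 %| m -> 4 * Phi 2 m 3 2 1 <= 3 * m.
Proof.
move=> m0 m4; have := @Phi_residues_ok 2 m 1 1 8 (fun _ => 2) ltac:(lia) isT m0 (dvd1n m) isT.
by rewrite /= divn1; lia.
Qed.

(** The weights of d and 2d must add up to 6, so they alternate 2, 4, 2 with the power of 2 dividing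
    d. The class 0 modulo 8 contains the doubles of the class 4, of weight 2, and therefore weighs
    4. *)
Lemma Phi_upper3_8 n m : 0 < m -> m %% 16 = 8 -> 48 * Phi n m 3 2 1 + 8 * n <= n * (8 * n * m + 3 * m).
Proof.
move=> m0 mP; pose f r := nth 0 [:: 4; 2; 4; 2; 2; 2; 4; 2] r.
have R : residues_ok 8 2 12 f n by apply: residues_ok3; vm_compute.
have := Phi_residues_ok _ _ m0 _ R; rewrite (_ : odd m = false); last by lia.
move=> /(_ isT isT ltac:(lia)).
rewrite (_ : sumn _ = 22); last by vm_compute.
rewrite (_ : m./2 %% 8 = 4); last by lia.
rewrite (_ : f 4 = 2) // (_ : f 0 = 4) //.
have Em : m = 8 * (m %/ 8) by lia.
have u1 : 0 < m %/ 8 by lia.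
move: (m %/ 8) Em u1 => u -> u1; clear.
by move: (Phi _ _ _ _ _) => p; case: n => [|n] /=; lia.
Qed.

(** The same alternation up to 32: weight 4 on the shifts whose 2-adic order is 1, 3 or at least
    5. *)
Lemma Phi_upper3_32 n m : 0 < m -> m %% 64 = 32 -> 192 * Phi n m 3 2 1 + 32 * n <= n * (32 * n * m + 11 * m).
Proof.
move=> m0 mP; pose f r := if (r %% 4 == 2) || (r %% 16 == 8) || (r == 0) then 4 else 2.
have R : residues_ok 32 2 12 f n by apply: residues_ok3; vm_compute.
have := Phi_residues_ok _ _ m0 _ R; rewrite (_ : odd m = false); last by lia.
move=> /(_ isT isT ltac:(lia)).
rewrite (_ : sumn _ = 86); last by vm_compute.
rewrite (_ : m./2 %% 32 = 16); last by lia.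
rewrite (_ : f 16 = 2) // (_ : f 0 = 4) //.
have Em : m = 32 * (m %/ 32) by lia.
have u1 : 0 < m %/ 32 by lia.
move: (m %/ 32) Em u1 => u -> u1; clear.
by move: (Phi _ _ _ _ _) => p; case: n => [|n] /=; lia.
Qed.

(** Modulo 4 the class 0 follows a class of weight 4 and is closed under doubling, so the weight 3
    is enough for it. *)
Lemma Phi_upper3_4 n m : 0 < m -> m %% 8 = 4 -> 48 * Phi n m 3 2 1 <= n * (8 * n * m + 3 * m + 4).
Proof.
move=> m0 mP; pose f r := nth 0 [:: 3; 2; 4; 2] r.
have R : residues_ok 4 2 12 f n by apply: residues_ok3; vm_compute.
have := Phi_residues_ok _ _ m0 _ R; rewrite (_ : odd m = false); last by lia.
move=> /(_ isT isT ltac:(lia)).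
rewrite (_ : sumn _ = 11); last by vm_compute.
rewrite (_ : m./2 %% 4 = 2); last by lia.
rewrite (_ : f 2 = 4) // (_ : f 0 = 3) //.
have Em : m = 4 * (m %/ 4) by lia.
have u1 : 0 < m %/ 4 by lia.
move: (m %/ 4) Em u1 => u -> u1; clear.
by move: (Phi _ _ _ _ _) => p; case: n => [|n] /=; lia.
Qed.

(** * The order of 2 *)

Lemma prod_even_odd N :
  (\prod_(j < N) (2 * j + 2)) * (\prod_(j < N) (2 * j + 1)) = (2 * N)`!.
Proof.
elim: N => [|N IH]; first by rewrite !big_ord0.
rewrite !big_ord_recr /= mulnACA IH (_ : 2 * N.+1 = (2 * N).+2); last by lia.
by rewrite addn2 addn1 [in RHS]factS [in RHS]factS mulnC mulnA.
Qed.

(** Gauss's argument with p = 4N + 1. The product of the even numbers up to p - 1 is 2^(2N) times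
    (2N)!. Its upper N factors are the negatives of the odd numbers below 2N, so it is also (-1)^N
    times (2N)!, and N is odd. *)
Lemma two_nonresidue p : prime p -> p = 5 %[mod 8] -> p %| 2 ^ (p.-1)./2 + 1.
Proof.
move=> pp p5; pose k := p %/ 8; have Ep : p = 8 * k + 5 by rewrite /k; lia.
pose N := 2 * k + 1; have En : (p.-1)./2 = 2 * N by rewrite /N; lia.
have p0 : (p%:R = 0 :> 'F_p)%R by exact: pchar_Fp_0.
have nz : ((2 * N)`!%:R != 0 :> 'F_p)%R.
  rewrite -(dvdn_pcharf (pchar_Fp pp)) (_ : p %| (2 * N)`! = false) //.
  apply/negbTE; rewrite -prime_coprime // coprime_sym.
  have : 2 * N < p by rewrite /N; lia.
  elim: (2 * N) => [|n IH] Hn; first by rewrite coprime1n.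
  rewrite factS coprimeMl IH ?andbT; last by lia.
  by rewrite coprime_sym prime_coprime // gtnNdvd.
have E1 : (\prod_(j < 2 * N) (2 * j + 2)%:R = 2%:R ^+ (2 * N) * (2 * N)`!%:R :> 'F_p)%R.
  elim: (2 * N) => [|n IH]; first by rewrite big_ord0 expr0 mul1r.
  rewrite big_ord_recr /= IH factS natrM exprSr (_ : 2 * n + 2 = 2 * n.+1) ?natrM; last by lia.
  by rewrite -!mulrA; congr (_ * _)%R; rewrite mulrC -mulrA.
have E2 : (\prod_(j < 2 * N) (2 * j + 2)%:R = - (2 * N)`!%:R :> 'F_p)%R.
  rewrite (_ : 2 * N = N + N); last by lia.
  rewrite big_split_ord /= [in (N + N)`!](_ : N + N = 2 * N); last by lia.
  rewrite -prod_even_odd natrM -mulrN natr_prod; congr (_ * _)%R; rewrite natr_prod.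
  have -> : (\prod_(j < N) (2 * (N + j) + 2)%:R = \prod_(j < N) - (2 * j + 1)%:R :> 'F_p)%R.
    rewrite (reindex_inj rev_ord_inj) /=; apply: eq_bigr => j _.
    apply/eqP; rewrite -addr_eq0 -natrD (_ : _ + _ = p) ?p0 //.
    by have := ltn_ord j; rewrite /N in j *; lia.
  rewrite prodrN card_ord /N -signr_odd (_ : odd (2 * k + 1)) ?expr1 ?mulN1r //; lia.
move: E2; rewrite E1 -mulN1r => /(mulIf nz) E3.
by rewrite (dvdn_pcharf (pchar_Fp pp)) natrD natrX En E3 addNr.
Qed.

Lemma ord_mod_dvd p n : odd p -> 2 ^ n = 1 %[mod p] -> ord_mod p 2 %| n.
Proof.
move=> op Hn; have c2 : coprime 2 p by rewrite coprime2n.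
rewrite /ord_mod; case: ex_minnP => l /andP [l0]; rewrite c2 /= => /eqP Hl Hmin.
have Hr : 2 ^ (n %% l) = 1 %[mod p].
  have E : 2 ^ (n %/ l * l) = 1 %[mod p] by rewrite mulnC expnM -modnXm Hl modnXm exp1n.
  by rewrite -Hn [in RHS](divn_eq n l) expnD -[in RHS]modnMml E modnMml mul1n.
rewrite /dvdn; apply/eqP; have [//|r0] := posnP (n %% l).
by have := Hmin (n %% l); rewrite r0 /= Hr eqxx => /(_ isT); have := ltn_pmod n l0; lia.
Qed.

Lemma ord_mod_spec p : odd p -> 2 ^ ord_mod p 2 = 1 %[mod p].
Proof.
move=> op; have c2 : coprime 2 p by rewrite coprime2n.
by rewrite /ord_mod; case: ex_minnP => l /andP [l0]; rewrite c2 /= => /eqP.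
Qed.

(** Let c be the quotient of p - 1 by the order. If c is odd, the factor 4 of p - 1 lies in the
    order; if c were even, 2^((p - 1) / 2) would be 1 instead of -1. *)
Lemma four_dvd_ord p : prime p -> p = 5 %[mod 8] -> 4 %| ord_mod p 2.
Proof.
move=> pp p5; have op : odd p by lia.
have c2 : coprime 2 p by rewrite coprime2n.
have Hf : 2 ^ p.-1 = 1 %[mod p] by rewrite -[X in 2 ^ X](totient_prime pp) Euler_exp_totient.
have /dvdnP [c Hc] := ord_mod_dvd op Hf.
have [oc|ec] := boolP (odd c).
  have : 4 %| c * ord_mod p 2 by rewrite -Hc; lia.
  by rewrite Gauss_dvdr // -[4]/(2 ^ 2) coprimeXl // coprime2n.
have E : (p.-1)./2 = c./2 * ord_mod p 2 by rewrite Hc; have := odd_double_half c; rewrite (negbTE ec); lia.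
have : 2 ^ (p.-1)./2 = 1 %[mod p].
  by rewrite E mulnC expnM -modnXm (ord_mod_spec op) modnXm exp1n.
have := two_nonresidue pp p5; rewrite /dvdn => /eqP H0 H1.
move: H0; rewrite -modnDml H1 modnDml => H0.
have p3 : 2 < p by have := prime_gt1 pp; lia.
by rewrite modn_small in H0.
Qed.

(** From 2^k y = +-y it follows that u divides (2^(2k) - 1) y. A prime p dividing u / gcd(u, y) then
    divides 2^(2k) - 1, so the order of 2 modulo p divides 2k. This order is a multiple of 4, whence
    k is even. *)
Lemma in_S_even u : in_S u -> forall k y : Z, Z.le 0 k -> ~ Z.divide (Z.of_nat u) y ->
  Z.divide (Z.of_nat u) (Z.pow 2 k * y - y) \/ Z.divide (Z.of_nat u) (Z.pow 2 k * y + y) ->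
  Z.modulo k 2 = Z0.
Proof.
move=> [u0 u12 Hp] k y k0 Ny H.
pose K := Z.to_nat k; pose a := Z.to_nat (Z.modulo y (Z.of_nat u)).
have Ha : Z.of_nat a = Z.modulo y (Z.of_nat u).
  by rewrite /a Z2Nat.id //; have := Z.mod_pos_bound y (Z.of_nat u); lia.
have au : a < u by have := Z.mod_pos_bound y (Z.of_nat u); lia.
have a0 : 0 < a.
  rewrite lt0n; apply/eqP => E; apply: Ny; apply/Z.mod_divide; lia.
have EX : Z.of_nat (2 ^ (2 * K)) = Z.mul (Z.pow 2 k) (Z.pow 2 k).
  rewrite mulnC expnM -mulnn (_ : k = Z.of_nat K); last by rewrite /K; lia.
  by rewrite Nat2Z.inj_mul; congr Z.mul; elim: (K) => // n IH; rewrite expnS Nat2Z.inj_mul IH -Z.pow_succ_r; lia.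
have D1 : Z.divide (Z.of_nat u) (y * (Z.pow 2 k * Z.pow 2 k - 1)).
  case: H => [[w Hw]|[w Hw]].
    by exists (Z.mul w (Z.pow 2 k + 1)); nia.
  by exists (Z.mul w (Z.pow 2 k - 1)); nia.
have D2 : Z.divide (Z.of_nat u) (Z.of_nat a * (Z.pow 2 k * Z.pow 2 k - 1)).
  rewrite Ha; have -> : Z.modulo y (Z.of_nat u) = Z.sub y (Z.of_nat u * Z.div y (Z.of_nat u)).
    by have := Z.div_mod y (Z.of_nat u); lia.
  rewrite Z.mul_sub_distr_r; apply: Z.divide_sub_r => //.
  by rewrite -Z.mul_assoc; exact: Z.divide_factor_l.
have D3 : u %| a * (2 ^ (2 * K) - 1).
  case: D2 => w Hw; apply/dvdnP; exists (Z.to_nat w).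
  have P1 : 0 < 2 ^ (2 * K) by rewrite expn_gt0.
  have w0 : Z.le 0 w by nia.
  nia.
pose d := gcdn u a; have d0 : 0 < d by rewrite gcdn_gt0 u0.
have D4 : u %/ d %| 2 ^ (2 * K) - 1.
  have Ed : u = (u %/ d) * d by rewrite divnK // dvdn_gcdl.
  have Ea : a = (a %/ d) * d by rewrite divnK // dvdn_gcdr.
  rewrite -(@Gauss_dvdr _ (a %/ d)).
    by rewrite -(dvdn_pmul2r d0) -Ed mulnAC -Ea.
  by rewrite /coprime -(eqn_pmul2r d0) muln_gcdl -Ed -Ea mul1n.
have q1 : 1 < u %/ d.
  rewrite ltn_divRL ?dvdn_gcdl // mul1n; apply: leq_ltn_trans au.
  by apply: dvdn_leq => //; exact: dvdn_gcdr.
pose p := pdiv (u %/ d); have pp : prime p by exact: pdiv_prime.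
have pu : p %| u by apply: dvdn_trans (pdiv_dvd _) _; apply/dvdnP; exists d; rewrite mulnC divnK // dvdn_gcdl.
have pX : p %| 2 ^ (2 * K) - 1 by apply: dvdn_trans (pdiv_dvd _) D4.
have op : odd p.
  have : odd u by case: u12; lia.
  by case/dvdnP: pu => w ->; rewrite oddM => /andP [].
have E1 : 2 ^ (2 * K) = 1 %[mod p].
  by apply/eqP; rewrite eqn_mod_dvd // expn_gt0.
have o4 : 4 %| ord_mod p 2.
  by case: (Hp _ pp pu) => [p5|[_ //]]; exact: four_dvd_ord.
have : 4 %| 2 * K by apply: dvdn_trans o4 (ord_mod_dvd op E1).
rewrite /K; clear -k0 => /dvdnP [w Hw].
have -> : k = Z.mul (Z.mul (Z.of_nat w) 1) 2 by lia.
by rewrite Z.mod_mul.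
Qed.

(** * Codes attaining a weight bound *)

Definition nkey := (nat * nat * nat)%type.

(** The rows are i, j, k, and a translation brings the shifts to 0, a, b. The duplicates of a block
    {0, d, 2d} are removed because differences are counted as a set. *)
Definition block_keys (m i j k a b : nat) : seq nkey := undup
  [:: (i, j, a); (j, i, (m - a) %% m); (i, k, b); (k, i, (m - b) %% m);
      (j, k, (b + (m - a)) %% m); (k, j, (a + (m - b)) %% m)].

Definition block_ok (i j k a b : nat) : bool :=
  [&& (i != j) || (a != 0), (i != k) || (b != 0) & (j != k) || (a != b)].

Definition all_blocks n m (P : seq nkey -> bool) : bool :=
  all (fun i => all (fun j => all (fun k => all (fun a => all (fun b =>
    block_ok i j k a b ==> P (block_keys m i j k a b))
    (iota 0 m)) (iota 0 m)) (iota 0 n)) (iota 0 n)) (iota 0 n).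

Definition proper_keys n m : seq nkey :=
  [seq k <- [seq (p, d) | p <- [seq (i, j) | i <- iota 0 n, j <- iota 0 n], d <- iota 0 m]
     | (k.1.1 != k.1.2) || (k.2 != 0)].

Section Brute.
Variables n m : nat.
Local Notation I := ('I_n * 'I_m.+1)%type.

Definition nk (k : 'I_n * 'I_n * 'I_m.+1) : nkey := (val k.1.1, val k.1.2, val k.2).

Lemma nk_inj : injective nk.
Proof. by move=> [[i j] d] [[i' j'] d'] [/val_inj -> /val_inj -> /val_inj ->]. Qed.

Definition dkeys (B : {set I}) : seq nkey := [seq nk k | k <- enum (delta B)].

Lemma dkeys_block (B : {set I}) : #|B| = 3 -> exists i j k a b,
  [/\ [/\ i < n, j < n & k < n], a < m.+1, b < m.+1, block_ok i j k a b &
      perm_eq (dkeys B) (block_keys m.+1 i j k a b)].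
Proof.
move=> cB; have /card_gt2P [x [y [z [[Hx Hy Hz] [Nxy Nyz Nzx]]]]] : 2 < #|B| by rewrite cB.
have EB : B = [set x; y; z].
  apply/eqP; rewrite eq_sym eqEcard !subUset !sub1set Hx Hy Hz cB /=.
  by rewrite setUC cardsU1 cards2 !inE negb_or Nxy Nzx eq_sym Nyz.
exists (x.1 : nat), (y.1 : nat), (z.1 : nat), ((y.2 - x.2)%R : nat), ((z.2 - x.2)%R : nat).
have neq (p q : I) (i j : nat) : p != q -> i = p.1 -> j = q.1 -> (i != j) || (((q.2 - p.2)%R : nat) != 0).
  move=> N -> ->; rewrite -negb_and; apply: contra N => /andP [/eqP/val_inj E1].
  rewrite -[0]/(val (0%R : 'I_m.+1)) val_eqE subr_eq0 => /eqP E2.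
  by apply/eqP; case: (p) (q) E1 E2 => [? ?] [? ?] /= -> ->.
have Nxz : x != z by rewrite eq_sym.
split; rewrite ?ltn_ord //.
  rewrite /block_ok neq // neq //=.
  have -> : (((y.2 - x.2)%R : nat) != ((z.2 - x.2)%R : nat)) = (((z.2 - y.2)%R : nat) != 0).
    by rewrite -[0]/(val (0%R : 'I_m.+1)) !val_eqE (inj_eq (addIr _)) subr_eq0 eq_sym.
  exact: (neq y z).
have Eyz : ((z.2 - y.2)%R : nat) = (((z.2 - x.2)%R : nat) + (m.+1 - ((y.2 - x.2)%R : nat))) %% m.+1.
  have -> : (z.2 - y.2 = (z.2 - x.2) - (y.2 - x.2))%R by rewrite opprB addrA subrK.
  by rewrite [LHS]/= modnDmr.
have Ezy : ((y.2 - z.2)%R : nat) = (((y.2 - x.2)%R : nat) + (m.+1 - ((z.2 - x.2)%R : nat))) %% m.+1.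
  have -> : (y.2 - z.2 = (y.2 - x.2) - (z.2 - x.2))%R by rewrite opprB addrA subrK.
  by rewrite [LHS]/= modnDmr.
have Eyx : ((x.2 - y.2)%R : nat) = (m.+1 - ((y.2 - x.2)%R : nat)) %% m.+1 by rewrite -(opprB y.2 x.2).
have Ezx : ((x.2 - z.2)%R : nat) = (m.+1 - ((z.2 - x.2)%R : nat)) %% m.+1 by rewrite -(opprB z.2 x.2).
apply: uniq_perm.
- by rewrite map_inj_uniq ?enum_uniq //; exact: nk_inj.
- exact: undup_uniq.
move=> k; rewrite mem_undup -Eyx -Ezx -Eyz -Ezy; apply/mapP/idP.
  move=> [d]; rewrite mem_enum => /imsetP [[p q]]; rewrite inE => /and3P [Hp Hq N] -> ->.
  move: Hp Hq N; rewrite EB !inE /nk ![(_, _).1]/= ![(_, _).2]/=.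
  case/orP=> [/orP [] |] /eqP -> /orP [/orP [] |] /eqP ->; rewrite ?eqxx // => _;
    by rewrite ?orbT // ?(eqxx (T := nkey)) ?orbT.
have mk (p q : I) : p \in B -> q \in B -> p != q ->
    exists2 d, d \in enum (delta B) & (val p.1, val q.1, val (q.2 - p.2)%R) = nk d.
  by move=> Hp Hq N; exists (p.1, q.1, (q.2 - p.2)%R) => //; rewrite mem_enum; apply: mem_delta.
rewrite !in_cons in_nil orbF => /orP [/eqP ->|/orP [/eqP ->|/orP [/eqP ->|/orP [/eqP ->|/orP [] /eqP ->]]]].
- exact: (mk x y).
- by apply: mk => //; rewrite eq_sym.
- exact: (mk x z).
- exact: mk.
- exact: mk.
- by apply: mk => //; rewrite eq_sym.
Qed.

Lemma all_blocksP P (B : {set I}) : all_blocks n m.+1 P -> #|B| = 3 ->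
  exists2 s, perm_eq (dkeys B) s & P s.
Proof.
move=> H cB; have [i [j [k [a [b [[Hi Hj Hk] Ha Hb Hok Hp]]]]]] := dkeys_block cB.
exists (block_keys m.+1 i j k a b) => //.
have A N (Q : pred nat) x : all Q (iota 0 N) -> x < N -> Q x by move=> /allP HQ Hx; apply: HQ; rewrite mem_iota.
have := A _ _ _ (A _ _ _ (A _ _ _ (A _ _ _ (A _ _ _ H Hi) Hj) Hk) Ha) Hb.
by rewrite Hok.
Qed.

Lemma mem_proper k : k \in proper_keys n m.+1 ->
  exists2 d : 'I_n * 'I_n * 'I_m.+1, k = nk d & (d.1.1 != d.1.2) || (d.2 != 0%R).
Proof.
rewrite mem_filter => /andP [Hk /allpairsP [[p d] [Hp Hd Ek]]].
case/allpairsP: Hp => [[i j] [Hi Hj Ep]].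
rewrite /= in Ek Ep Hi Hj; rewrite [(_, _).2]/= in Hd.
rewrite mem_iota in Hi; rewrite mem_iota in Hj; rewrite mem_iota in Hd.
exists (Ordinal Hi, Ordinal Hj, Ordinal Hd) => /=; first by rewrite Ek Ep.
by move: Hk; rewrite Ek Ep -!val_eqE.
Qed.

Lemma sum_proper (F : nkey -> nat) :
  \sum_(d : 'I_n * 'I_n * 'I_m.+1 | (d.1.1 != d.1.2) || (d.2 != 0%R)) F (nk d) =
  sumn [seq F k | k <- proper_keys n m.+1].
Proof.
rewrite sumnE big_map.
have : perm_eq [seq nk d | d <- enum [pred d : 'I_n * 'I_n * 'I_m.+1 | (d.1.1 != d.1.2) || (d.2 != 0%R)]] (proper_keys n m.+1).
  apply: uniq_perm.
  - by rewrite map_inj_uniq ?enum_uniq //; exact: nk_inj.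
  - apply: filter_uniq; apply: allpairs_uniq => //; rewrite ?iota_uniq //.
      by apply: allpairs_uniq; rewrite ?iota_uniq // => [[? ?] [? ?]].
    by move=> [? ?] [? ?].
  move=> k; apply/mapP/idP => [[d Hd ->]|/mem_proper [d -> Hd]].
    rewrite mem_enum inE in Hd; rewrite mem_filter; apply/andP; split.
      by move: Hd; rewrite -!val_eqE.
    apply/allpairsP; exists ((val d.1.1, val d.1.2), val d.2); split=> //; last by rewrite mem_iota /=.
    by apply/allpairsP; exists (val d.1.1, val d.1.2); split=> //=; rewrite mem_iota /=.
  by exists d => //; rewrite mem_enum inE.
by move=> Hperm; rewrite -(perm_big _ Hperm) big_map big_enum.
Qed.

(** When W times the number of codewords reaches the total weight, every inequality of the weight
    bound is an equality. The codewords then partition the differences, so any second function J can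
    be summed over them and compared with its total. *)
Lemma tight (wt : nkey -> nat) W (C : {set {set I}}) : is_ooc 3 2 1 C ->
  all_blocks n m.+1 (fun s => W <= sumn [seq wt k | k <- s]) ->
  all (fun k => 0 < wt k) (proper_keys n m.+1) ->
  sumn [seq wt k | k <- proper_keys n m.+1] <= W * #|C| ->
  [/\ forall k, k \in proper_keys n m.+1 -> exists2 B, B \in C & k \in dkeys B,
      forall B, B \in C -> sumn [seq wt k | k <- dkeys B] = W
    & forall J, \sum_(B in C) sumn [seq J k | k <- dkeys B] =
        sumn [seq J k | k <- proper_keys n m.+1]].
Proof.
move=> HC Hall Hpos Htot; have [Hk _ _] := HC.
pose K0 : {set 'I_n * 'I_n * 'I_m.+1} := [set d | (d.1.1 != d.1.2) || (d.2 != 0%R)].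
pose U := \bigcup_(B in C) delta B.
have sumB (F : nkey -> nat) B : sumn [seq F k | k <- dkeys B] = \sum_(d in delta B) F (nk d).
  by rewrite sumnE !big_map big_enum.
have sumU (F : nkey -> nat) : \sum_(B in C) sumn [seq F k | k <- dkeys B] = \sum_(d in U) F (nk d).
  rewrite (eq_bigr (fun B => \sum_(d in delta B) F (nk d))); last by move=> B _; exact: sumB.
  rewrite /U (exchange_big_dep (mem U)) /=; last first.
    by move=> B d HB Hd; apply/bigcupP; exists B.
  apply: eq_bigr => d /bigcupP [B HB Hd]; rewrite (big_pred1 B) // => B'.
  apply/andP/eqP => [[HB' Hd']|->]; last by [].
  exact: delta_disjoint HC HB' HB Hd' Hd.
have UK : U \subset K0.
  apply/subsetP => d /bigcupP [B HB /imsetP [[x y]]]; rewrite inE => /and3P [_ _ N] -> /=.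
  rewrite inE /= -negb_and; apply: contra N => /andP [/eqP E1]; rewrite subr_eq0 => /eqP E2 /=.
  by apply/eqP; move: E1 E2; case: (x) (y) => [i a] [j b] /= -> ->.
have sumK (F : nkey -> nat) : sumn [seq F k | k <- proper_keys n m.+1] = \sum_(d in K0) F (nk d).
  by rewrite -sum_proper; apply: eq_bigl => d; rewrite inE.
have geW B : B \in C -> W <= sumn [seq wt k | k <- dkeys B].
  move=> HB; have [s Hs Ws] := all_blocksP Hall (Hk _ HB).
  by rewrite (perm_sumn (perm_map wt Hs)).
have S1 : W * #|C| <= \sum_(B in C) sumn [seq wt k | k <- dkeys B].
  by rewrite mulnC -sum_nat_const; apply: leq_sum.
have S2 : \sum_(d in K0) wt (nk d) = \sum_(d in U) wt (nk d) + \sum_(d in K0 :\: U) wt (nk d).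
  by rewrite (big_setID U) /= (setIidPr UK).
rewrite sumK S2 -sumU in Htot.
have E0 : \sum_(d in K0 :\: U) wt (nk d) = 0 by lia.
have ESum : \sum_(B in C) sumn [seq wt k | k <- dkeys B] = W * #|C| by lia.
have UE : U = K0.
  apply/eqP; rewrite eqEsubset UK -setD_eq0 /=; apply/set0Pn => [[d Hd]].
  have Hd0 : wt (nk d) = 0.
    by move/eqP: E0; rewrite sum_nat_eq0 => /forallP /(_ d) /implyP /(_ Hd) /eqP.
  have : 0 < wt (nk d); last by rewrite Hd0.
  move/allP: Hpos; apply; move: Hd; rewrite !inE => /andP [_ Hd].
  rewrite mem_filter; apply/andP; split; first by move: Hd; rewrite -!val_eqE.
  apply/allpairsP; exists ((val d.1.1, val d.1.2), val d.2); split=> //; last by rewrite mem_iota /=.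
  by apply/allpairsP; exists (val d.1.1, val d.1.2); split=> //=; rewrite mem_iota /=.
split.
- move=> k /mem_proper [d -> Hd]; have : d \in U by rewrite UE inE.
  by move=> /bigcupP [B HB HdB]; exists B => //; apply/mapP; exists d; rewrite ?mem_enum.
- move=> B HB; apply/eqP; rewrite eqn_leq geW // andbT leqNgt; apply/negP => lt.
  have : W * #|C| < \sum_(B in C) sumn [seq wt k | k <- dkeys B].
    rewrite mulnC -sum_nat_const (bigD1 B) //= [X in _ < X](bigD1 B) //= -addSn leq_add //.
    by apply: leq_sum => B' /andP [HB' _]; exact: geW.
  by rewrite ESum ltnn.
- by move=> J; rewrite sumU UE sumK.
Qed.
End Brute.

Lemma Phi_le n m N : (forall C : {set {set 'I_n * 'I_m}}, is_ooc 3 2 1 C -> #|C| <= N) ->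
  Phi n m 3 2 1 <= N.
Proof. by move=> H; apply/bigmax_leqP => C /asboolP; exact: H. Qed.

Lemma dkeys_disjoint n m (C : {set {set 'I_n * 'I_m.+1}}) B B' k : is_ooc 3 2 1 C ->
  B \in C -> B' \in C -> k \in dkeys B -> k \in dkeys B' -> B = B'.
Proof.
move=> HC HB HB' /mapP [d Hd ->] /mapP [d' Hd' /nk_inj E]; subst d'.
by move: Hd Hd'; rewrite !mem_enum => Hd Hd'; exact: delta_disjoint HC HB HB' Hd Hd'.
Qed.

Lemma proper_keysE n m i j d :
  ((i, j, d) \in proper_keys n m) = [&& (i != j) || (d != 0), i < n, j < n & d < m].
Proof.
rewrite mem_filter /=; congr andb; apply/allpairsP/and3P => [[[[i' j'] d'] [Hp Hd [-> -> ->]]]|[Hi Hj Hd]].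
  case/allpairsP: Hp => [[i'' j''] [Hi Hj [-> ->]]].
  by rewrite /= !mem_iota /= in Hi Hj Hd.
exists ((i, j), d); split=> //; last by rewrite mem_iota.
by apply/allpairsP; exists (i, j); rewrite /= !mem_iota.
Qed.

Definition weight (F : nkey -> nat) (s : seq nkey) := sumn [seq F k | k <- s].

Lemma weight_perm F s t : perm_eq s t -> weight F s = weight F t.
Proof. by move=> H; exact: perm_sumn (perm_map _ H). Qed.

Definition wt24 (k : nkey) : nat :=
  if k.1.1 == k.1.2 then (if k.2 == 2 then 4 else 2) else 1.
(** Every tight block has value 0 modulo 8: two labels x, y contribute 2 + 4 (x + y), where x + y
    has the parity of the shift x - y, and the values of the shifts compensate for this. The total
    28 is not 0 modulo 8. *)
Definition inv24 (k : nkey) : nat :=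
  if k.1.1 == k.1.2 then nth 0 [:: 0; 2; 6; 0] k.2
  else if k.1.1 == 0 then 4 * (k.2 %% 2) + 1 else 0.

Lemma Phi_upper_2_4 : Phi 2 4 3 2 1 <= 2.
Proof.
apply: Phi_le => C HC; rewrite leqNgt; apply/negP => HN.
have [|||_ Hw HJ] := @tight 2 3 wt24 8 C HC; [by vm_compute | by vm_compute | |].
  by have -> : sumn [seq wt24 k | k <- proper_keys 2 4] = 24; [vm_compute | rewrite (leq_mul2l 8 3)].
have A : all_blocks 2 4 (fun s => (weight wt24 s == 8) ==> (weight inv24 s %% 8 == 0)) by vm_compute.
have := HJ inv24; have -> : sumn [seq inv24 k | k <- proper_keys 2 4] = 28 by vm_compute.
move=> E; have : 8 %| 28; last by [].
rewrite -E; apply: dvdn_sum => B HB.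
have [s Hs] := all_blocksP A (let: And3 H _ _ := HC in H B HB).
rewrite -(weight_perm _ Hs) -(weight_perm inv24 Hs) /weight Hw // eqxx implyTb.
Qed.

Definition wt34 (k : nkey) : nat :=
  if k.1.1 == k.1.2 then (if k.2 == 2 then 8 else 2) else 2.
Definition inv34 (k : nkey) : nat :=
  if (k.1.2 == (k.1.1 + 1) %% 3) then k.2 else 0.

(** A tight block covering the shift 2 of a row lies in this row and covers the shift 1 as well.
    Since 2 is covered in each row, no tight block has two points at distance 1 in one row and the
    third in another. The labels counted by [inv34] then sum to 0 modulo 4 on each block, namely
    once around the three rows, but their total is 18. *)
Lemma Phi_upper_3_4 : Phi 3 4 3 2 1 <= 6.
Proof.
apply: Phi_le => C HC; rewrite leqNgt; apply/negP => HN.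
have [|||Hc Hw HJ] := @tight 3 3 wt34 12 C HC; [by vm_compute | by vm_compute | |].
  by have -> : sumn [seq wt34 k | k <- proper_keys 3 4] = 84; [vm_compute | rewrite (leq_mul2l 12 7)].
have A1 : all_blocks 3 4 (fun s => (weight wt34 s == 12) ==>
  all (fun r => ((r, r, 2) \in s) ==> ((r, r, 1) \in s)) (iota 0 3)) by vm_compute.
have A2 : all_blocks 3 4 (fun s => (weight wt34 s == 12) ==> ((weight inv34 s %% 4 == 0) ||
  has (fun r => ((r, r, 1) \in s) && ((r, r, 2) \notin s)) (iota 0 3))) by vm_compute.
have P3 : all (fun r => (r, r, 2) \in proper_keys 3 4) (iota 0 3) by vm_compute.
have := HJ inv34; have -> : sumn [seq inv34 k | k <- proper_keys 3 4] = 18 by vm_compute.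
move=> E; have : 4 %| 18; last by [].
have card3 B (HB : B \in C) : #|B| = 3 by case: HC => H _ _; exact: H.
rewrite -E; apply: dvdn_sum => B HB.
have [s Hs] := all_blocksP A2 (card3 B HB).
rewrite -(weight_perm _ Hs) -(weight_perm inv34 Hs) /weight Hw // eqxx implyTb.
case/orP => // /hasP [r Hr /andP [H1 H2]].
have [B' HB' H2'] := Hc _ (allP P3 _ Hr).
have [s' Hs'] := all_blocksP A1 (card3 B' HB').
rewrite -(weight_perm _ Hs') /weight Hw // eqxx implyTb => /allP /(_ _ Hr).
rewrite -(perm_mem Hs') H2' implyTb -(perm_mem Hs') => H1'.
rewrite -(perm_mem Hs) in H1; rewrite -(perm_mem Hs) in H2.
by move: H2; rewrite (dkeys_disjoint HC HB HB' H1 H1') H2'.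
Qed.

Definition wt64 (k : nkey) : nat :=
  if k.2 == 32 then 4 else nth 0 [:: 2; 1; 3; 1] (k.2 %% 4).
(** The three conditions select one of d, - d. The value is 0 modulo 8 on {0, 1 + 4x, 1 + 4y}, where
    it is 4 (x + y) + 2 + 4 (x - y) + 6, and on {0, d, 2d} with d = 1 + 4e, where it is 8e + 8.
    Among the tight blocks only one that covers 16 can have another value. *)
Definition inv64 (k : nkey) : nat :=
  if k.2 %% 4 == 1 then 4 * ((k.2 %/ 4) %% 2) + 1
  else if k.2 %% 8 == 2 then 4 * ((k.2 %/ 8) %% 2) + 7
  else if (k.2 %% 4 == 0) && (k.2 <= 32) then 4 * ((k.2 %/ 4) %% 2) + 6 else 0.

Definition key64 (e : nat) : nkey := (0, 0, e %% 64).

Lemma proper_double b : odd b -> key64 (2 * b) \in proper_keys 1 64.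
Proof. by move=> Ob; rewrite proper_keysE; apply/and4P; split=> //; lia. Qed.

Lemma blocks64_inv : all_blocks 1 64 (fun s => (weight wt64 s == 8) ==>
  if key64 16 \in s then (key64 32 \in s) ==> (weight inv64 s %% 8 == 4) else weight inv64 s %% 8 == 0).
Proof. by vm_compute. Qed.

Lemma blocks64_32 : all_blocks 1 64 (fun s => [&& weight wt64 s == 8, key64 32 \in s & key64 16 \notin s] ==>
  has (fun b => [&& odd b, key64 b \in s, key64 (b + 32) \in s & key64 (2 * b) \notin s]) (iota 0 64)).
Proof. by vm_compute. Qed.

Lemma blocks64_double : all_blocks 1 64 (fun s => (weight wt64 s == 8) ==>
  all (fun b => odd b && (key64 (2 * b) \in s) ==> (key64 b \in s) || (key64 (b + 32) \in s)) (iota 0 64)).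
Proof. by vm_compute. Qed.

(** With 14 codewords the bound would be attained. If one block covers 16 and 32, the values of
    [inv64] sum to 4 modulo 8, against the total 184. Otherwise 32 lies in a block {0, b, b + 32}
    with b odd, and the block covering 2b would have to cover b or b + 32 a second time. *)
Lemma Phi_upper_1_64 : Phi 1 64 3 2 1 <= 13.
Proof.
apply: Phi_le => C HC; rewrite leqNgt; apply/negP => HN.
have [|||Hc Hw HJ] := @tight 1 63 wt64 8 C HC; [by vm_compute | by vm_compute | |].
  by have -> : sumn [seq wt64 k | k <- proper_keys 1 64] = 112; [vm_compute | rewrite (leq_mul2l 8 14)].
have [B1 HB1 H16] : exists2 B, B \in C & key64 16 \in dkeys B by apply: Hc; rewrite proper_keysE.
have [B2 HB2 H32] : exists2 B, B \in C & key64 32 \in dkeys B by apply: Hc; rewrite proper_keysE.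
have card3 B (HB : B \in C) : #|B| = 3 by case: HC => H _ _; exact: H.
have [E12|N12] := eqVneq B1 B2.
  have := HJ inv64; have -> : sumn [seq inv64 k | k <- proper_keys 1 64] = 184 by vm_compute.
  rewrite (bigD1 B1) //= => E.
  have D : 8 %| \sum_(B in C | B != B1) sumn [seq inv64 k | k <- dkeys B].
    apply: dvdn_sum => B /andP [HB NB]; have [s Hs] := all_blocksP blocks64_inv (card3 B HB).
    rewrite -(weight_perm _ Hs) -(weight_perm inv64 Hs) /weight Hw // eqxx implyTb.
    case: ifP => // H; case/negP: NB; apply/eqP; apply: (dkeys_disjoint HC HB HB1 _ H16).
    by rewrite (perm_mem Hs).
  have [s Hs] := all_blocksP blocks64_inv (card3 B1 HB1).
  rewrite -(weight_perm _ Hs) -(weight_perm inv64 Hs) /weight Hw // eqxx implyTb.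
  rewrite -!(perm_mem Hs) H16 E12 H32 implyTb -E12.
  move: D E; move: (sumn _) (\sum_(_ in _ | _) _) => x y; clear; lia.
have [s Hs] := all_blocksP blocks64_32 (card3 B2 HB2).
rewrite -(weight_perm _ Hs) /weight Hw // eqxx -!(perm_mem Hs) H32.
have -> : key64 16 \notin dkeys B2.
  by apply: contra N12 => H; rewrite (dkeys_disjoint HC HB1 HB2 H16 H).
rewrite implyTb => /hasP [b Hb /and4P [Ob]].
rewrite -!(perm_mem Hs) => H1 H2 H3.
have [B3 HB3 H4] := Hc _ (proper_double Ob).
have [s' Hs'] := all_blocksP blocks64_double (card3 B3 HB3).
rewrite -(weight_perm _ Hs') /weight Hw // eqxx implyTb => /allP /(_ _ Hb).
rewrite -!(perm_mem Hs') Ob H4 implyTb => /orP [] H5; move: H3.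
  by rewrite (dkeys_disjoint HC HB2 HB3 H1 H5) H4.
by rewrite (dkeys_disjoint HC HB2 HB3 H2 H5) H4.
Qed.

From mathcomp Require Import ring lra.

(** * Sizes of optimal codes *)

Ltac zlia := Z.to_euclidean_division_equations; lia.

Lemma attains_Phi n m N : 0 < n -> 0 < m -> attains (Z.of_nat n) (Z.of_nat m) N ->
  (N <= Z.of_nat (Phi n m 3 2 1))%coqZ.
Proof.
move=> Hn Hm [K [c [HK [Hc <-]]]].
by have /leP := packs_Phi Hn Hm HK Hc; lia.
Qed.

Lemma Phi_one_8 m : 0 < m -> m = 0 %[mod 8] -> m <> 64 -> Phi 1 m 3 2 1 = (7 * m) %/ 32.
Proof.
move=> Hm H8 N64.
have H := one_row_attains_8 (Z.of_nat (m %/ 8)) ltac:(lia).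
have E : (8 * Z.of_nat (m %/ 8))%coqZ = Z.of_nat m by lia.
rewrite E in H; have {H} := attains_Phi (n := 1) isT Hm H.
have := Phi_upper1 Hm ltac:(lia); have -> : 8 %| m by lia.
case: Z.eqb_spec => [E8|_]; first by exfalso; clear -E8 N64 E; lia.
move: (Phi _ _ _ _ _) => P /= U L; zlia.
Qed.

Lemma Phi_one_64 : Phi 1 64 3 2 1 = 13.
Proof.
have L : (13 <= Z.of_nat (Phi 1 64 3 2 1))%coqZ.
  exact: (attains_Phi (n := 1) (m := 64) isT isT (one_row_attains_8 8 ltac:(lia))).
by move: L Phi_upper_1_64; move: (Phi _ _ _ _ _) => P; lia.
Qed.

Lemma Phi_one_4 m : 0 < m -> m = 4 %[mod 8] -> Phi 1 m 3 2 1 = (7 * m + 4) %/ 32.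
Proof.
move=> Hm H8.
have H := one_row_attains_4 (Z.of_nat (m %/ 4)) ltac:(lia) ltac:(zlia).
have E : (4 * Z.of_nat (m %/ 4))%coqZ = Z.of_nat m by lia.
rewrite E in H; have {H} := attains_Phi (n := 1) isT Hm H.
have := Phi_upper1 Hm ltac:(lia); have -> : (8 %| m) = false by lia.
move: (Phi _ _ _ _ _) => P /= U L; zlia.
Qed.

Lemma Phi_two m : 4 < m -> m = 0 %[mod 4] -> 4 * Phi 2 m 3 2 1 = 3 * m.
Proof.
move=> Hm H4; have Hm0 : 0 < m by lia.
have := attains_Phi (n := 2) isT Hm0 (two_rows_attains (Z.of_nat m) ltac:(lia) ltac:(zlia)).
have := Phi_upper2 Hm0 ltac:(lia).
case: Z.eqb_spec => [E4|_]; first by exfalso; clear -E4 Hm; lia.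
move: (Phi _ _ _ _ _) => P /= U L; zlia.
Qed.

Lemma Phi_two_4 : Phi 2 4 3 2 1 = 2.
Proof.
have L : (2 <= Z.of_nat (Phi 2 4 3 2 1))%coqZ.
  exact: (attains_Phi (n := 2) (m := 4) isT isT (two_rows_attains 4 ltac:(lia) erefl)).
by move: L Phi_upper_2_4; move: (Phi _ _ _ _ _) => P; lia.
Qed.

Lemma Phi_three_4 : Phi 3 4 3 2 1 = 6.
Proof.
have L := attains_Phi (n := 3) (m := 4) isT isT three_rows_attains.
by move: L Phi_upper_3_4; move: (Phi _ _ _ _ _) => P; lia.
Qed.

Lemma Phi_triple_8 n m : 0 < n -> n = 0 %[mod 3] -> m = 8 %[mod 16] ->
  48 * Phi n m 3 2 1 + 8 * n = n * (8 * n * m + 3 * m).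
Proof.
move=> Hn H3 H16.
have Hm0 : 0 < m by lia.
pose s := Z.of_nat (n %/ 3); pose g := Z.of_nat (m %/ 16).
have Es : Z.of_nat n = (3 * s)%coqZ by lia.
have Em : Z.of_nat m = (8 * (2 * g + 1))%coqZ by lia.
have := three_attains_8 s (2 * g + 1)%coqZ g ltac:(lia) erefl ltac:(lia).
rewrite -Es -Em => /(attains_Phi Hn Hm0).
have := Phi_upper3_8 n Hm0 ltac:(lia).
move: (Phi _ _ _ _ _) Es Em; move: s g => s g P; clear; nia.
Qed.

Lemma Phi_triple_32 n m : 0 < n -> n = 0 %[mod 3] -> m = 32 %[mod 64] ->
  192 * Phi n m 3 2 1 + 32 * n = n * (32 * n * m + 11 * m).
Proof.
move=> Hn H3 H64.
have Hm0 : 0 < m by lia.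
pose s := Z.of_nat (n %/ 3); pose g := Z.of_nat (m %/ 64).
have Es : Z.of_nat n = (3 * s)%coqZ by lia.
have Em : Z.of_nat m = (32 * (2 * g + 1))%coqZ by lia.
have := three_attains_32 s (2 * g + 1)%coqZ g ltac:(lia) erefl ltac:(lia).
rewrite -Es -Em => /(attains_Phi Hn Hm0).
have := Phi_upper3_32 n Hm0 ltac:(lia).
move: (Phi _ _ _ _ _) Es Em; move: s g => s g P; clear; nia.
Qed.

Lemma Phi_triple_4 n m : 0 < n -> n = 0 %[mod 3] -> 4 < m ->
  m = 4 %[mod 48] \/ m = 20 %[mod 48] -> in_S (m %/ 4) ->
  48 * Phi n m 3 2 1 = n * (8 * n * m + 3 * m + 4).
Proof.
move=> Hn H3 Hm H48 HS.
have Hm0 : 0 < m by lia.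
(* Both residues modulo 48 make m / 4 equal to 1 modulo 4 and prime to 3; hence m / 4 = 4c + 1. *)
pose s := Z.of_nat (n %/ 3); pose c := Z.of_nat (m %/ 16).
have Es : Z.of_nat n = (3 * s)%coqZ by lia.
have Eu : Z.of_nat (m %/ 4) = (4 * c + 1)%coqZ by case: H48 => H48; lia.
have Em : Z.of_nat m = (4 * (4 * c + 1))%coqZ by case: H48 => H48; lia.
have [||||Y HY] := doubling_exists (Z.of_nat (m %/ 4)).
- by lia.
- by rewrite Eu; zlia.
- exact: in_S_even HS.
- by rewrite Eu; zlia.
have Hc : (1 <= c)%coqZ by lia.
have Hu3 : Z.modulo (4 * c + 1) 3 <> 0%coqZ by case: H48 => H48; zlia.
rewrite Eu in HY.
have := three_attains_4 s _ c Y ltac:(lia) erefl Hc Hu3 HY.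
rewrite -Es -Em => /(attains_Phi Hn Hm0).
have := Phi_upper3_4 n Hm0 ltac:(case: H48 => H48; lia).
move: (Phi _ _ _ _ _) Es Em; move: s c {Hc Hu3 HY Eu} => s c P; clear; nia.
Qed.

Theorem theorem1p2 (n m : nat) (n_gt0 : 0 < n) (m_gt0 : 0 < m) :
  (n = 1 -> m = 0 %[mod 8] -> m <> 64 ->
     Phi n m 3 2 1 = (7 * m) %/ 32) /\
  (n = 1 -> m = 4 %[mod 8] ->
     Phi n m 3 2 1 = (7 * m + 4) %/ 32) /\
  (n = 1 -> m = 64 -> Phi n m 3 2 1 = 13) /\
  (n = 2 -> m = 0 %[mod 4] -> 4 < m ->
     ((Phi n m 3 2 1)%:R = 3 * m%:R / 4 :> rat)%R) /\
  (n = 2 -> m = 4 -> Phi n m 3 2 1 = 2) /\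
  (n = 0 %[mod 3] -> n <> 6 -> n <> 9 -> m = 8 %[mod 16] ->
     ((Phi n m 3 2 1)%:R =
        n%:R * (8 * n%:R * m%:R + 3 * m%:R - 8) / 48 :> rat)%R) /\
  (n = 0 %[mod 3] -> n <> 6 -> n <> 9 -> m = 32 %[mod 64] ->
     ((Phi n m 3 2 1)%:R =
        n%:R * (32 * n%:R * m%:R + 11 * m%:R - 32) / 192 :> rat)%R) /\
  (n = 3 -> m = 4 -> Phi n m 3 2 1 = 6) /\
  (n = 0 %[mod 3] -> n <> 6 -> n <> 9 -> 4 < m ->
     m = 4 %[mod 48] \/ m = 20 %[mod 48] -> in_S (m %/ 4) ->
     ((Phi n m 3 2 1)%:R =
        n%:R * (8 * n%:R * m%:R + 3 * m%:R + 4) / 48 :> rat)%R).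
Proof.
(* The equalities over the natural numbers are free of division and subtraction; cast to the
   rationals, they become the stated quotients. *)
have nat_eq (x y : nat) : x = y -> (x%:R = y%:R :> rat)%R by move=> ->.
split; first by move=> -> ; exact: Phi_one_8.
split; first by move=> -> ; exact: Phi_one_4.
split; first by move=> -> ->; exact: Phi_one_64.
split.
  move=> -> H4 Hm; have /nat_eq := Phi_two Hm H4; rewrite !natrM; lra.
split; first by move=> -> ->; exact: Phi_two_4.
split.
  move=> H3 _ _ Hm; have /nat_eq := Phi_triple_8 n_gt0 H3 Hm; rewrite !(natrM, natrD); lra.
split.
  move=> H3 _ _ Hm; have /nat_eq := Phi_triple_32 n_gt0 H3 Hm; rewrite !(natrM, natrD); lra.
split; first by move=> -> ->; exact: Phi_three_4.
move=> H3 _ _ Hm H48 HS; have /nat_eq := Phi_triple_4 n_gt0 H3 Hm H48 HS; rewrite !(natrM, natrD); lra.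
Qed.
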